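(* Let $n \geq 2$, $N\ge 1$, $r,R\in(0,1)$, and suppose $f \colon \mathbb{A}_{n,r} \to \mathbb{A}_{N,R}$ is a proper holomorphic map. Then $k_f = N-1$ if and only if there exist $d \in \mathbb{N}$ ($d\ge 1$) and a unitary $U \in U(N)$ such that $N=\binom{n + d - 1}{d}$, $R=r^d$, and $f = U H_d$.
   Context: For $0<r<1$, $\mathbb{A}_{n,r} = \{ z \in \mathbb{C}^n : r < \|z\| < 1 \}$. For a map $f \colon U \subset \mathbb{C}^n \to \mathbb{C}^N$, the general hyperplane rank is $$k_f = \max\{ \dim \operatorname{aff}(f(H \cap U)) : H \subset \mathbb{C}^n \text{ an affine hyperplane}\},$$ where $\operatorname{aff}(X)$ is the smallest complex affine subspace of $\mathbb{C}^N$ containing $X$ and dimensions are complex. For an integer $d\ge 1$, $H_d \colon \mathbb{C}^n \to \mathbb{C}^{\binom{n+d-1}{d}}$ is the symmetrized homogeneous map of degree $d$ whose components are $\sqrt{\tfrac{d!}{\alpha!}}\, z^\alpha$ over all multi-indices $\alpha$ with $|\alpha|=d$, so that $\|H_d(z)\|^2=\|z\|^{2d}$. *)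

(* Defs.v *)
From HB Require Import structures.
From mathcomp Require Import all_boot all_order all_algebra.
From mathcomp Require Import all_classical all_reals all_analysis.
From mathcomp Require Import complex.
Set Implicit Arguments.
Unset Strict Implicit.
Unset Printing Implicit Defensive.
Import Order.TTheory GRing.Theory Num.Theory.
Import numFieldNormedType.Exports.
Local Open Scope classical_set_scope.
Local Open Scope complex_scope.
Local Open Scope ring_scope.

(* The field of complex numbers, packaged as a [numClosedFieldType] so that the
   topology and the normed module structure of numeric fields apply to it. *)
Definition Cx (K : realType) : numClosedFieldType := K[i].

(* The library norm on matrices is the sup norm; it only serves to define the
   topology of C^n.  The geometry below uses the Euclidean norm. *)
Definition enorm (K : realType) (n : nat) (z : 'cV[Cx K]_n) : K :=
  Num.sqrt (\sum_(j < n) ComplexField.Normc.normc (z j 0) ^+ 2).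

Definition annulus (K : realType) (n : nat) (r : K) : set 'cV[Cx K]_n :=
  [set z | r < enorm z < 1].
Arguments annulus {K} n r.

(* Maps defined on U are represented by total functions, of which only the
   restriction to U is used.  For U open, [differentiable f z] at z in U only
   depends on that restriction; the differential is linear over [Cx K], so this is
   complex differentiability. *)
Definition holomorphic_on (K : realType) (n N : nat) (U : set 'cV[Cx K]_n)
    (f : 'cV[Cx K]_n -> 'cV[Cx K]_N) : Prop :=
  forall z, U z -> differentiable f z.

Definition maps_to (K : realType) (n N : nat) (U : set 'cV[Cx K]_n)
    (V : set 'cV[Cx K]_N) (f : 'cV[Cx K]_n -> 'cV[Cx K]_N) : Prop :=
  forall z, U z -> V (f z).

Definition proper_map (K : realType) (n N : nat) (U : set 'cV[Cx K]_n)
    (V : set 'cV[Cx K]_N) (f : 'cV[Cx K]_n -> 'cV[Cx K]_N) : Prop :=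
  maps_to U V f /\
  forall A, A `<=` V -> compact A -> compact (U `&` f @^-1` A).

Definition affine_of_dim (K : realType) (n k : nat) (S : set 'cV[Cx K]_n) :
    Prop :=
  exists (p : 'cV[Cx K]_n) (V : {vspace 'cV[Cx K]_n}),
    \dim V = k /\ S = [set z | z - p \in V].

Definition affine_subspace (K : realType) (n : nat) (S : set 'cV[Cx K]_n) :
    Prop :=
  exists k, affine_of_dim k S.

Definition affine_hyperplane (K : realType) (n : nat) (H : set 'cV[Cx K]_n) :
    Prop :=
  exists k, k.+1 = n /\ affine_of_dim k H.

Definition aff (K : realType) (n : nat) (X : set 'cV[Cx K]_n) :
    set 'cV[Cx K]_n :=
  smallest (@affine_subspace K n) X.

(* All dimensions lie in {0, ..., N}, so the maximum over k < N.+1 is the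
   maximum over all dimensions that occur.  Hyperplanes that miss U contribute
   nothing, since the empty set has no dimension. *)
Definition hyperplane_rank (K : realType) (n N : nat) (U : set 'cV[Cx K]_n)
    (f : 'cV[Cx K]_n -> 'cV[Cx K]_N) : nat :=
  (\max_(k < N.+1 | `[< exists H, affine_hyperplane H /\
                          affine_of_dim k (aff (f @` (H `&` U))) >]) k)%N.

Definition multi_index (n d : nat) : {set n.-tuple 'I_d.+1} :=
  [set a : n.-tuple 'I_d.+1 | (\sum_(j <- a) j)%N == d].

Lemma card_multi_index (n d : nat) : #|multi_index n d| = 'C(n + d - 1, d).
Proof.
case: n => [|n]; last first.
  by rewrite card_ord_partitions addSn subn1 /= -[in RHS]bin_sub ?leq_addl ?addnK.
case: d => [|d].
  by rewrite bin0 (eqP (_ : #|_| == 1%N))//; apply/cards1P; exists [tuple];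
    apply/setP => a; rewrite finset.in_set1 (introT eqP (tuple0 a)) finset.in_set [a]tuple0 big_nil.
rewrite bin_small ?add0n ?subn1//; apply/eqP; rewrite cards_eq0.
by apply/eqP/setP => a; rewrite !inE [a]tuple0 big_nil.
Qed.

Definition monomial (K : realType) (n d : nat) (a : n.-tuple 'I_d.+1)
    (z : 'cV[Cx K]_n) : Cx K :=
  \prod_(j < n) z j 0 ^+ tnth a j.

Definition multi_fact (n d : nat) (a : n.-tuple 'I_d.+1) : nat :=
  (\prod_(j < n) (tnth a j)`!)%N.

(* The multi-indices of degree d are ordered by [enum_val]; any other order
   changes H_d by a permutation matrix only. *)
Definition Hmap (K : realType) (n d : nat) (z : 'cV[Cx K]_n) :
    'cV[Cx K]_('C(n + d - 1, d)) :=
  \col_i let a := enum_val (cast_ord (esym (card_multi_index n d)) i) in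
    (Num.sqrt (d`!%:R / (multi_fact a)%:R : K))%:C * monomial a z.

(* Main.v *)
Require Import Defs.
From mathcomp Require Import all_boot all_order all_algebra.
From mathcomp Require Import all_classical all_reals all_analysis.
From mathcomp Require Import complex ring lra spectral.
Set Implicit Arguments.
Unset Strict Implicit.
Unset Printing Implicit Defensive.
Import Order.TTheory GRing.Theory Num.Theory.
Import numFieldNormedType.Exports.
Local Open Scope classical_set_scope.
Local Open Scope complex_scope.
Local Open Scope ring_scope.

(** All analysis takes place in one complex variable: maps of several variables are used only along
    holomorphic curves, and continuation mostly runs along segments, which must avoid the centre of
    the punctured ball. The rank hypothesis provides [N] affinely independent values on some
    hyperplane, whereas solving for F w requires linearly independent values on a hyperplane <z, w>
    = r^2. On a hyperplane <z, p> = b with b > r^2, the first relation at w = (r^2 / b) p makes the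
    constant 1 a linear combination of the components of F, so affinely independent values are
    linearly independent there. A nonzero determinant of values survives, up to isolated parameters,
    when the hyperplane moves. Hence the hyperplane is moved first to a level above r^2, and then to
    the level r^2 itself, after a small rotation of p that avoids the isolated zeros. The
    alternative |Phi| = R is excluded last: it leads to d = 0, so that |F| = R along a line through
    0, whereas |f| > R. *)

(** Since [n >= 2], [f] extends, as in Hartogs' theorem, to a bounded map [F] of the punctured
ball, and properness together with the maximum principle gives |F| = R on the sphere |z| = r.
Polarizing this identity yields <F z, F w> = R^2 whenever <z, w> = r^2.

If k_f = N - 1, this relation contains [N] independent linear equations for [F w], for [w] in a
neighbourhood of a suitable unit vector [p]. Solving them extends [F] to a holomorphic map Phi
across the unit sphere near [p], where |Phi| is a constant [c], equal to [R] or 1, by properness.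
Polarizing |Phi|^2 = c^2 and comparing with the first relation gives
c^2 F (r^2 t p) = R^2 F (t p); comparing Taylor coefficients in [t], F (t p) = t^d v and
R = r^d. Together with the first relation this gives <F z, F w> = <z, w>^d = <H_d z, H_d w>
for the points [w] of an open set, so that F = A H_d. Testing the first relation on a grid of
points shows that [A] is an isometry, and counting dimensions that it is unitary.

Conversely, if f = U H_d, then [f] maps the hyperplane <z, u> = c into the affine hyperplane
<y, f u> = c^d, and its values on a grid of points with a given first coordinate are not
contained in any smaller affine subspace. *)

Ltac clear_nonlinear := repeat match goal with
  | H : forall _, _ |- _ => clear H
  | H : exists _, _ |- _ => clear H
  | H : @eq (matrix _ _ _) _ _ |- _ => clear H
  | H : @eq (Num.ClosedField.sort _) _ _ |- _ => clear H
  end.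
Ltac rlra := clear_nonlinear; lra.
Ltac rnra := clear_nonlinear; nra.

Local Notation Re := complex.Re.
Local Notation Im := complex.Im.

(** * Holomorphic functions of one variable *)

Section ComplexModulus.
Variable K : realType.
Local Notation C := (Cx K).

(** The norm of a numeric field takes its values in the field itself; [nm] is the same modulus with
    values in the ordered field [K]. *)
Definition nm (z : C) : K := ComplexField.Normc.normc z.

Lemma rC0 : (0 : K)%:C = 0 :> C. Proof. by []. Qed.
Lemma rC1 : (1 : K)%:C = 1 :> C. Proof. by []. Qed.
Lemma rCD (x y : K) : (x + y)%:C = x%:C + y%:C :> C.
Proof. exact: (rmorphD (real_complex K)). Qed.
Lemma rCN (x : K) : (- x)%:C = - x%:C :> C.
Proof. exact: (rmorphN (real_complex K)). Qed.
Lemma rCB (x y : K) : (x - y)%:C = x%:C - y%:C :> C.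
Proof. exact: (rmorphB (real_complex K)). Qed.
Lemma rCM (x y : K) : (x * y)%:C = x%:C * y%:C :> C.
Proof. exact: (rmorphM (real_complex K)). Qed.
Lemma rCV (x : K) : (x^-1)%:C = (x%:C)^-1 :> C.
Proof. exact: (fmorphV (real_complex K)). Qed.
Lemma rCX (x : K) n : (x ^+ n)%:C = x%:C ^+ n :> C.
Proof. exact: (rmorphXn (real_complex K)). Qed.
Lemma rC_nat n : (n%:R : K)%:C = n%:R :> C.
Proof. exact: (rmorph_nat (real_complex K)). Qed.
Lemma rC_sum (I : Type) (s : seq I) (P : pred I) (u : I -> K) :
  (\sum_(i <- s | P i) u i)%:C = \sum_(i <- s | P i) (u i)%:C :> C.
Proof. exact: (raddf_sum (real_complex K)). Qed.
Lemma rC_inj (x y : K) : x%:C = y%:C :> C -> x = y.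
Proof. by move=> []. Qed.
Lemma rC_eq0 (x : K) : (x%:C == 0 :> C) = (x == 0).
Proof. exact: (fmorph_eq0 (real_complex K)). Qed.

Lemma norm_nm (z : C) : `|z| = (nm z)%:C. Proof. by []. Qed.

Lemma nm_ge0 (z : C) : 0 <= nm z.
Proof. by case: z => a b; rewrite /nm /= sqrtr_ge0. Qed.

Lemma nm0 : nm 0 = 0. Proof. exact: ComplexField.Normc.normc0. Qed.
Lemma nm1 : nm 1 = 1. Proof. exact: ComplexField.Normc.normc1. Qed.
Lemma nmM (x y : C) : nm (x * y) = nm x * nm y.
Proof. exact: ComplexField.Normc.normcM. Qed.
Lemma nmV (x : C) : nm x^-1 = (nm x)^-1.
Proof. exact: ComplexField.Normc.normcV. Qed.
Lemma nmN (x : C) : nm (- x) = nm x.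
Proof. exact: normcN. Qed.
Lemma nmD (x y : C) : nm (x + y) <= nm x + nm y.
Proof. exact: le_normcD. Qed.
Lemma nmB (x y : C) : nm (x - y) <= nm x + nm y.
Proof. by rewrite -(nmN y); apply: nmD. Qed.
Lemma nm_dist (x y : C) : nm (x - y) = nm (y - x).
Proof. by rewrite -nmN opprB. Qed.
Lemma nmX (x : C) n : nm (x ^+ n) = nm x ^+ n.
Proof. by elim: n => [|n IH]; rewrite ?expr0 ?nm1// !exprS nmM IH. Qed.
Lemma nm_eq0 (x : C) : (nm x == 0) = (x == 0).
Proof.
apply/eqP/eqP => [|->]; last exact: nm0.
exact: ComplexField.Normc.eq0_normc.
Qed.
Lemma nm_gt0 (x : C) : (0 < nm x) = (x != 0).
Proof. by rewrite lt_neqAle nm_ge0 andbT eq_sym nm_eq0. Qed.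
Lemma nm_real (x : K) : nm x%:C = `|x|.
Proof. by rewrite /nm /= expr0n /= addr0 sqrtr_sqr. Qed.
Lemma mulcJ_nm (x : C) : (nm x ^+ 2)%:C = x * conjc x.
Proof.
case: x => a b; rewrite /nm /= sqr_sqrtr ?addr_ge0 ?sqr_ge0//.
by apply/eqP; rewrite eq_complex /=; apply/andP; split; apply/eqP; ring.
Qed.
Lemma conjE (x : C) : x^* = conjc x.
Proof. by []. Qed.
Lemma conj_rC (x : K) : (x%:C : C)^* = x%:C.
Proof. by rewrite conjE /= oppr0. Qed.
Lemma nmsqr (x : C) : (nm x ^+ 2)%:C = x * x^*.
Proof. by rewrite conjE mulcJ_nm. Qed.
Lemma nm_conj (x : C) : nm x^* = nm x.
Proof. by rewrite conjE; case: x => a b; rewrite /nm /= sqrrN. Qed.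
Lemma nm_Re (x : C) : `|Re x| <= nm x.
Proof.
by case: x => a b; rewrite /nm /= -sqrtr_sqr ler_wsqrtr// lerDl sqr_ge0.
Qed.
Lemma nm_Im (x : C) : `|Im x| <= nm x.
Proof.
by case: x => a b; rewrite /nm /= -sqrtr_sqr ler_wsqrtr// lerDr sqr_ge0.
Qed.
Lemma nm_i : nm 'i = 1.
Proof. by rewrite /nm /= expr0n expr1n add0r sqrtr1. Qed.
Lemma nm_le_ReIm (x : C) : nm x <= `|Re x| + `|Im x|.
Proof.
rewrite {1}[x]complexE; apply: (le_trans (nmD _ _)).
by rewrite nmM nm_i mul1r !nm_real.
Qed.
Lemma nmB_ge (x y : C) : nm x - nm y <= nm (x - y).
Proof. by rewrite lerBlDr -{1}(subrK y x) nmD. Qed.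

(** Balls have their radius in [Cx K]; positivity there forces a zero imaginary part, so real radii
    suffice. *)
Lemma nbhs_nm (z : C) (A : set C) :
  nbhs z A <-> exists2 e : K, 0 < e & forall w, nm (w - z) < e -> A w.
Proof.
split => [/nbhs_ballP [e /= e0 sub]|[e e0 sub]].
  exists (Re e) => [|w we]; first by move: e0; rewrite ltcE /= => /andP[].
  apply: sub; rewrite -ball_normE /= distrC norm_nm.
  move: e0; rewrite !ltcE /= => /andP[/eqP -> _].
  by rewrite eqxx.
apply/nbhs_ballP; exists (e%:C) => /=; first by rewrite ltcR.
move=> w; rewrite -ball_normE /= distrC norm_nm => we; apply: sub.
by rewrite -ltcR.
Qed.

Lemma cont_nm (g : C -> C) (z : C) :
  {for z, continuous g} <->
  (forall e : K, 0 < e -> exists2 d : K, 0 < d &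
     forall w, nm (w - z) < d -> nm (g w - g z) < e).
Proof.
split => [cg e e0|H A /nbhs_nm [e e0 eA]].
  have /cg : nbhs (g z) [set w | nm (w - g z) < e] by apply/nbhs_nm; exists e.
  by move=> /nbhs_nm [d d0 h]; exists d.
have [d d0 h] := H _ e0; apply/nbhs_nm; exists d => // w wd.
by apply: eA; apply: h.
Qed.

Lemma cont_nmK (g : K -> C) (z : K) :
  {for z, continuous g} <->
  (forall e : K, 0 < e -> exists2 d : K, 0 < d &
     forall w, `|w - z| < d -> nm (g w - g z) < e).
Proof.
split => [cg e e0|H A /nbhs_nm [e e0 eA]].
  have /cg : nbhs (g z) [set w | nm (w - g z) < e] by apply/nbhs_nm; exists e.
  move=> /nbhs_ballP [d /= d0 h]; exists d => // w wd.
  by apply: h; rewrite -ball_normE /= distrC.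
have [d d0 h] := H _ e0; apply/nbhs_ballP; exists d => //= w.
by rewrite -ball_normE /= distrC => wd; apply: eA; apply: h.
Qed.

Lemma cont_Re (T : topologicalType) (g : T -> C) (z : T) :
  {for z, continuous g} -> {for z, continuous (fun t => Re (g t))}.
Proof.
move=> cg A /nbhs_ballP [e /= e0 eA]; apply: (cg [set w | A (Re w)]).
apply/nbhs_nm; exists e => // w we; apply: eA; rewrite -ball_normE /= distrC.
by apply: le_lt_trans we; rewrite -raddfB nm_Re.
Qed.

Lemma cont_Im (T : topologicalType) (g : T -> C) (z : T) :
  {for z, continuous g} -> {for z, continuous (fun t => Im (g t))}.
Proof.
move=> cg A /nbhs_ballP [e /= e0 eA]; apply: (cg [set w | A (Im w)]).
apply/nbhs_nm; exists e => // w we; apply: eA; rewrite -ball_normE /= distrC.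
by apply: le_lt_trans we; rewrite -raddfB nm_Im.
Qed.

Lemma cont_complex (T : topologicalType) (g h : T -> K) (z : T) :
  {for z, continuous g} -> {for z, continuous h} ->
  {for z, continuous (fun t => g t +i* h t : C)}.
Proof.
move=> cg ch A /nbhs_nm [e e0 eA]; have e20 : 0 < e / 2 by rewrite divr_gt0.
have ng : nbhs z [set t | ball (g z) (e / 2) (g t)].
  by apply: cg; exact: (nbhsx_ballx (g z) (e / 2) e20).
have nh : nbhs z [set t | ball (h z) (e / 2) (h t)].
  by apply: ch; exact: (nbhsx_ballx (h z) (e / 2) e20).
change (nbhs z [set t | A (g t +i* h t)]).
near=> t; rewrite /=; apply: eA.
apply: le_lt_trans (nm_le_ReIm _) _.
rewrite -[Re _]/(g t - g z) -[Im _]/(h t - h z).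
rewrite [e]splitr /=; apply: ltrD; rewrite distrC.
  by near: t; move: ng; rewrite -ball_normE.
by near: t; move: nh; rewrite -ball_normE.
Unshelve. all: by end_near. Qed.

Lemma cont_conj (z : C) : {for z, continuous (fun w : C => w^* )}.
Proof.
apply/cont_nm => e e0; exists e => // w.
by rewrite -rmorphB /= nm_conj.
Qed.

Lemma cont_nmT (T : topologicalType) (g : T -> C) (z : T) :
  {for z, continuous g} -> {for z, continuous (fun t => nm (g t))}.
Proof.
move=> cg A /nbhs_ballP [e /= e0 eA]; apply: (cg [set w | A (nm w)]).
apply/nbhs_nm; exists e => // w we; apply: eA; rewrite -ball_normE /=.
apply: le_lt_trans we; rewrite ler_norml nm_dist nmB_ge andbT.
by rewrite lerNl opprB nm_dist nmB_ge.
Qed.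

End ComplexModulus.

Section Cont.
Variables (K : realType) (T : topologicalType).
Local Notation C := (Cx K).
Implicit Types (u v : T -> C) (x : T).

Lemma contC (c : C) x : {for x, continuous (fun _ : T => c)}.
Proof. exact: cvg_cst. Qed.
Lemma contD u v x : {for x, continuous u} -> {for x, continuous v} ->
  {for x, continuous (fun t => u t + v t)}.
Proof. exact: cvgD. Qed.
Lemma contN u x : {for x, continuous u} -> {for x, continuous (fun t => - u t)}.
Proof. exact: cvgN. Qed.
Lemma contB u v x : {for x, continuous u} -> {for x, continuous v} ->
  {for x, continuous (fun t => u t - v t)}.
Proof. exact: cvgB. Qed.
Lemma contM u v x : {for x, continuous u} -> {for x, continuous v} ->
  {for x, continuous (fun t => u t * v t)}.
Proof. exact: cvgM. Qed.
Lemma contV u x : {for x, continuous u} -> u x != 0 ->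
  {for x, continuous (fun t => (u t)^-1)}.
Proof. by move=> cu u0; apply: cvgV. Qed.
Lemma cont_near u v x : {for x, continuous u} -> (\forall t \near x, u t = v t) ->
  {for x, continuous v}.
Proof.
move=> cu uv; rewrite /prop_for /continuous_at -(nbhs_singleton uv).
apply: cvg_trans cu; apply: near_eq_cvg.
by apply: filterS uv => t ->.
Qed.
Lemma cont_neq0 u x :
  {for x, continuous u} -> u x != 0 -> \forall y \near x, u y != 0.
Proof.
move=> cu ux; apply: (cu [set w | w != 0]).
apply/nbhs_nm; exists (nm (u x)); first by rewrite nm_gt0.
by move=> w; apply: contraTneq => ->; rewrite sub0r nmN ltxx.
Qed.
End Cont.

Section Hol.
Variable K : realType.
Local Notation C := (Cx K).
Implicit Types (g h : C -> C) (z w : C).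

(* Caratheodory's form of complex differentiability. *)
Definition hol g z :=
  exists q : C -> C, {for z, continuous q} /\ forall w, g w - g z = q w * (w - z).

Lemma hol_cont g z : hol g z -> {for z, continuous g}.
Proof.
move=> [q [cq gq]]; have -> : g = (fun w => q w * (w - z) + g z).
  by apply/funext => w; rewrite -gq subrK.
apply: contD; last exact: contC.
apply: contM; first exact: cq.
apply: contB; [exact: cvg_id | exact: contC].
Qed.

Lemma hol_cst (c : C) z : hol (fun=> c) z.
Proof.
exists (fun=> 0); split => [|w]; first exact: contC.
by rewrite subrr mul0r.
Qed.

Lemma hol_id z : hol id z.
Proof.
exists (fun=> 1); split => [|w]; first exact: contC.
by rewrite mul1r.
Qed.

Lemma holD g h z : hol g z -> hol h z -> hol (fun w => g w + h w) z.
Proof.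
move=> [p [cp gp]] [q [cq hq]]; exists (fun w => p w + q w); split => [|w].
  exact: (contD cp cq).
by rewrite mulrDl -gp -hq opprD addrACA.
Qed.

Lemma holM g h z : hol g z -> hol h z -> hol (fun w => g w * h w) z.
Proof.
move=> Hg Hh; have ch := hol_cont Hh; move: Hg Hh => [p [cp gp]] [q [cq hq]].
exists (fun w => p w * h w + g z * q w); split => [|w].
  apply: contD; apply: contM; first exact: cp.
  - exact: ch.
  - exact: contC.
  - exact: cq.
rewrite mulrDl -mulrA (mulrC (h w)) mulrA -gp -mulrA -hq; ring.
Qed.

Lemma holN g z : hol g z -> hol (fun w => - g w) z.
Proof.
move=> Hg; have -> : (fun w => - g w) = (fun w => (-1) * g w).
  by apply/funext => w; rewrite mulN1r.
by apply: holM => //; exact: hol_cst.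
Qed.

Lemma holB g h z : hol g z -> hol h z -> hol (fun w => g w - h w) z.
Proof. by move=> Hg Hh; apply: holD => //; apply: holN. Qed.

Lemma hol_sum (I : Type) (s : seq I) (P : pred I) (u : I -> C -> C) z :
  (forall i, P i -> hol (u i) z) -> hol (fun w => \sum_(i <- s | P i) u i w) z.
Proof.
move=> H; elim: s => [|i s IH].
  have -> : (fun w => \sum_(i <- [::] | P i) u i w) = (fun=> 0).
    by apply/funext => w; rewrite big_nil.
  exact: hol_cst.
have -> : (fun w => \sum_(i <- i :: s | P i) u i w) =
   (fun w => (if P i then u i w else 0) + \sum_(i <- s | P i) u i w).
  by apply/funext => w; rewrite big_cons; case: ifP; rewrite ?add0r.
apply: holD; last exact: IH.
by case: (boolP (P i)) => [/H Hu|_]; [exact: Hu | exact: hol_cst].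
Qed.

Lemma hol_prod (I : Type) (s : seq I) (P : pred I) (u : I -> C -> C) z :
  (forall i, P i -> hol (u i) z) -> hol (fun w => \prod_(i <- s | P i) u i w) z.
Proof.
move=> H; elim: s => [|i s IH].
  have -> : (fun w => \prod_(i <- [::] | P i) u i w) = (fun=> 1).
    by apply/funext => w; rewrite big_nil.
  exact: hol_cst.
have -> : (fun w => \prod_(i <- i :: s | P i) u i w) =
   (fun w => (if P i then u i w else 1) * \prod_(i <- s | P i) u i w).
  by apply/funext => w; rewrite big_cons; case: ifP; rewrite ?mul1r.
apply: holM; last exact: IH.
by case: (boolP (P i)) => [/H Hu|_]; [exact: Hu | exact: hol_cst].
Qed.

Lemma holX g n z : hol g z -> hol (fun w => g w ^+ n) z.
Proof.
move=> Hg; elim: n => [|n IH].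
  have -> : (fun w => g w ^+ 0) = (fun=> 1) by apply/funext => w; rewrite expr0.
  exact: hol_cst.
have -> : (fun w => g w ^+ n.+1) = (fun w => g w * g w ^+ n).
  by apply/funext => w; rewrite exprS.
exact: holM.
Qed.

Lemma hol_comp g h z : hol g z -> hol h (g z) -> hol (fun w => h (g w)) z.
Proof.
move=> Hg; have cg := hol_cont Hg; move: Hg => [p [cp gp]] [q [cq hq]].
exists (fun w => q (g w) * p w); split => [|w].
  apply: contM; last exact: cp.
  exact: (continuous_comp cg cq).
by rewrite hq gp mulrA.
Qed.

(** The factorization in [hol] is global, so away from [z] the quotient is recomputed from [h]; near
    [z] it agrees with [q]. *)
Lemma hol_near g h z : hol g z -> (\forall w \near z, g w = h w) -> hol h z.
Proof.
move=> [q [cq gq]] gh; have gz : g z = h z := nbhs_singleton gh.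
exists (fun w => if w == z then q z else (h w - h z) / (w - z)); split => [|w].
  apply: (cont_near cq); near=> w; case: eqVneq => [->//|wz].
  have <- : g w = h w by near: w.
  by rewrite -gz gq mulfK ?subr_eq0.
case: eqVneq => [->|wz]; first by rewrite !subrr mulr0.
by rewrite divfK ?subr_eq0.
Unshelve. all: by end_near. Qed.

(** A quadratic error bound is a form of differentiability that can be integrated over a parameter,
    as in [hol_param]. *)
Lemma hol_quad g z (l : C) (e N : K) : 0 < e ->
  (forall w, nm (w - z) < e -> nm (g w - g z - l * (w - z)) <= N * nm (w - z) ^+ 2) ->
  hol g z.
Proof.
move=> e0 H.
exists (fun w => if w == z then l else (g w - g z) / (w - z)); split => [|w]; last first.
  case: eqVneq => [->|wz]; first by rewrite !subrr mulr0.
  by rewrite divfK ?subr_eq0.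
apply/cont_nm => e1 e10; rewrite eqxx.
have N0 : 0 < `|N| + 1 by rewrite ltr_wpDl.
exists (Num.min e (e1 / (`|N| + 1))); first by rewrite lt_min e0 divr_gt0.
move=> w; rewrite lt_min => /andP[we we1].
have [_|wz] := eqVneq w z; first by rewrite subrr nm0.
have wz' : w - z != 0 by rewrite subr_eq0.
have -> : (g w - g z) / (w - z) - l = (g w - g z - l * (w - z)) / (w - z).
  by rewrite [RHS]mulrBl mulfK.
rewrite nmM nmV ltr_pdivrMr ?nm_gt0//; apply: (le_lt_trans (H _ we)).
rewrite expr2 mulrA ltr_pM2r ?nm_gt0//.
apply: (@le_lt_trans _ _ (`|N| * nm (w - z))).
  by rewrite ler_wpM2r ?nm_ge0// ler_norm.
rewrite ltr_pdivlMr// in we1.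
apply: le_lt_trans we1; rewrite mulrC; apply: ler_wpM2l; rewrite ?nm_ge0//.
by rewrite lerDl.
Qed.

Lemma holV g z : hol g z -> g z != 0 -> hol (fun w => (g w)^-1) z.
Proof.
move=> Hg gz0; have cg := hol_cont Hg; have n0 := cont_neq0 cg gz0.
move: Hg => [q [cq gq]].
(* [hol] asks for a factorization at every [w]; the zeros of [g], which stay away from [z], are
   therefore replaced by the value [g z]. *)
pose g' w := if g w == 0 then g z else g w.
have g'0 w : g' w != 0 by rewrite /g'; case: (eqVneq (g w) 0).
suff Hg' : hol (fun w => (g' w)^-1) z.
  apply: (hol_near Hg').
  by near=> w; rewrite /g' ifN//; near: w; exact: n0.
exists (fun w => - (if g w == 0 then 0 else q w) / (g' w * g' z)); split => [|w].
  apply: contM.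
    apply: contN; apply: (cont_near cq); near=> w; rewrite ifN//; near: w.
    exact: n0.
  apply: contV; last by rewrite mulf_neq0.
  apply: contM; last exact: contC.
  apply: (cont_near cg); near=> w; rewrite /g' ifN//; near: w.
  exact: n0.
rewrite /g' (negbTE gz0); case: (eqVneq (g w) 0) => [_|gw0].
  by rewrite subrr oppr0 !mul0r.
have := gq w; move/eqP; rewrite subr_eq => /eqP E.
have -> : (g w)^-1 - (g z)^-1 = - (g w - g z) / (g w * g z).
  by field; rewrite gw0 gz0.
by rewrite gq; ring.
Unshelve. all: by end_near. Qed.

(** Conjugating the argument and the value leaves a complex linear difference quotient. This is how
    the conjugate-linear slot of [ip] is made holomorphic. *)
Lemma hol_conj g z : hol g (z^* ) -> hol (fun w => (g (w^* ))^* ) z.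
Proof.
move=> [q [cq gq]]; exists (fun w => (q (w^* ))^* ); split => [|w].
  apply: (@continuous_comp _ _ _ (fun w => q (w^* )) (fun w => w^* )).
    apply: (@continuous_comp _ _ _ (fun w => w^* ) q); last exact: cq.
    exact: cont_conj.
  exact: cont_conj.
by rewrite -rmorphB gq rmorphM rmorphB /= !conjCK.
Qed.

End Hol.

(** * The complex exponential *)

Section Cexp.
Variable K : realType.
Local Notation C := (Cx K).

Definition cexp (z : C) : C :=
  (expR (Re z) * cos (Im z)) +i* (expR (Re z) * sin (Im z)).

Lemma cexpD (x y : C) : cexp (x + y) = cexp x * cexp y.
Proof.
case: x => a b; case: y => c d; rewrite /cexp /= expRD cosD sinD.
apply/eqP; rewrite eq_complex /=; apply/andP; split; apply/eqP; ring.
Qed.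

Lemma nm_cexp (z : C) : nm (cexp z) = expR (Re z).
Proof.
rewrite /nm /= !exprMn -mulrDr cos2Dsin2 mulr1 sqrtr_sqr ger0_norm// expR_ge0.
Qed.

Lemma cexp_2pi (x : K) : cexp (x +i* (pi *+ 2)) = cexp (x +i* 0).
Proof. by rewrite /cexp /= cos2pi sin2pi cos0 sin0. Qed.

Lemma little_o0 (u : K -> K) (l : K) : is_derive (0 : K) 1 u l ->
  forall e : K, 0 < e -> exists2 d : K, 0 < d &
    forall x, `|x| < d -> `|u x - u 0 - l * x| <= e * `|x|.
Proof.
move=> [du dl] e e0; move/cvgrPdist_lt: du => /(_ e e0); rewrite -[lim _]/('D_1 u 0) dl.
move=> /nbhs_ballP [d /= d0 H]; exists d => // x xd.
have [->|x0] := eqVneq x 0; first by rewrite subrr mulr0 subr0 normr0 mulr0.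
have := H x; rewrite -ball_normE /= sub0r normrN => /(_ xd x0).
rewrite /GRing.scale /= mulr1 addr0 => h.
have -> : u x - u 0 - l * x = - ((l - x^-1 * (u x - u 0)) * x) by field.
by rewrite normrN normrM ler_wpM2r// ltW.
Qed.

(** Differentiability at 0, which [cexpD] transports to every point. The share [e / 12] leaves room
    for the bound 2 on [expR x] and for four error terms. *)
Lemma cexp_o0 (e : K) : 0 < e -> exists2 d : K, 0 < d &
  forall z : C, nm z < d -> nm (cexp z - 1 - z) <= e * nm z.
Proof.
move=> e0; have e50 : 0 < e / 12 by rewrite divr_gt0.
have [d1 d10 H1] := little_o0 (is_derive_expR (0 : K)) e50.
have [d2 d20 H2] := little_o0 (is_derive_cos (0 : K)) e50.
have [d3 d30 H3] := little_o0 (is_derive_sin (0 : K)) e50.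
rewrite expR0 in H1; rewrite sin0 cos0 in H2; rewrite sin0 cos0 in H3.
have e120 : 0 < Num.min 1 (e / 12) by rewrite lt_min ltr01.
have [d4 d40 H4] := little_o0 (is_derive_expR (0 : K)) (ltr01 : 0 < (1 : K)).
rewrite expR0 in H4.
exists (Num.min (Num.min (Num.min d1 d2) (Num.min d3 d4)) (Num.min (1/4) (e / 12))).
  by rewrite !lt_min d10 d20 d30 d40 e50 divr_gt0.
case=> x y; rewrite !lt_min => /and3P[/andP[/andP[h1 h2] /andP[h3 h4]] h5 h6].
set N := nm _ in h1 h2 h3 h4 h5 h6 *.
have N0 : 0 <= N by apply: nm_ge0.
have xN : `|x| <= N by apply: (nm_Re (x +i* y)).
have yN : `|y| <= N by apply: (nm_Im (x +i* y)).
have A1 := H1 x (le_lt_trans xN h1); have A2 := H2 y (le_lt_trans yN h2).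
have A3 := H3 y (le_lt_trans yN h3); have A4 := H4 x (le_lt_trans xN h4).
rewrite !mul1r oppr0 mul0r ?subr0 ?addr0 in A1 A2 A3 A4.
apply: le_trans (nm_le_ReIm _) _.
rewrite -[Re _]/(expR x * cos y - 1 - x) -[Im _]/(expR x * sin y - 0 - y) subr0.
have ex : expR x <= 2.
  move: A4; rewrite ler_norml => /andP[_ A4]; have := ler_norm x; rlra.
have ex0 := expR_ge0 x.
have -> : expR x * cos y - 1 - x = expR x * (cos y - 1) + (expR x - 1 - x) by ring.
have -> : expR x * sin y - y = expR x * (sin y - y) + (expR x - 1) * y by ring.
have B1 : `|expR x * (cos y - 1)| <= 2 * (e / 12 * N).
  rewrite normrM (ger0_norm ex0); apply: ler_pM => //.
  by apply: (le_trans A2); apply: ler_wpM2l => //; exact: ltW.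
have B2 : `|expR x * (sin y - y)| <= 2 * (e / 12 * N).
  rewrite normrM (ger0_norm ex0); apply: ler_pM => //.
  by apply: (le_trans A3); apply: ler_wpM2l => //; exact: ltW.
have B3 : `|(expR x - 1) * y| <= (2 * (e / 12)) * N.
  rewrite normrM; apply: ler_pM => //.
  have -> : expR x - 1 = (expR x - 1 - x) + x by ring.
  apply: (le_trans (ler_normD _ _)); rlra.
have B4 : `|expR x - 1 - x| <= e / 12 * N.
  by apply: (le_trans A1); apply: ler_wpM2l => //; exact: ltW.
have C1 := ler_normD (expR x * (cos y - 1)) (expR x - 1 - x).
have C2 := ler_normD (expR x * (sin y - y)) ((expR x - 1) * y).
have : 0 <= e / 12 * N by rewrite mulr_ge0// ltW.
rlra.
Qed.

Lemma hol_cexp (z : C) : hol cexp z.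
Proof.
exists (fun w => if w == z then cexp z else (cexp w - cexp z) / (w - z)).
split => [|w]; last first.
  case: eqVneq => [->|wz]; first by rewrite !subrr mulr0.
  by rewrite divfK ?subr_eq0.
apply/cont_nm => e e0; rewrite eqxx.
have E0 : 0 < expR (Re z) by apply: expR_gt0.
have [|d d0 H] := @cexp_o0 (e / (2 * expR (Re z))).
  by rewrite divr_gt0// mulr_gt0.
exists d => // w wd; have [_|wz] := eqVneq w z; first by rewrite subrr nm0.
have wz' : w - z != 0 by rewrite subr_eq0.
have -> : (cexp w - cexp z) / (w - z) - cexp z =
  cexp z * (cexp (w - z) - 1 - (w - z)) / (w - z).
  rewrite -{1}(subrK z w) cexpD; field; exact: wz'.
rewrite !nmM nmV ltr_pdivrMr ?nm_gt0// nm_cexp.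
apply: (@le_lt_trans _ _ (expR (Re z) * (e / (2 * expR (Re z)) * nm (w - z)))).
  by rewrite ler_wpM2l ?expR_ge0// H.
have -> : expR (Re z) * (e / (2 * expR (Re z)) * nm (w - z)) = e * nm (w - z) / 2.
  by field; rewrite gt_eqF.
have : 0 < e * nm (w - z) by rewrite mulr_gt0// nm_gt0.
rlra.
Qed.

End Cexp.

(** * Integrals of complex functions over an interval *)

Section Cint.
Variable K : realType.
Local Notation C := (Cx K).
Local Notation mu := (@lebesgue_measure K).
Implicit Types (a b m : K) (u v : K -> C).

Definition cint a b u : C :=
  (Rintegral mu `[a, b] (fun t => Re (u t))) +i*
  (Rintegral mu `[a, b] (fun t => Im (u t))).

Definition ccont a b u := forall t, a <= t <= b -> {for t, continuous u}.

Lemma ccont_sub a b a' b' u : a <= a' -> b' <= b -> ccont a b u -> ccont a' b' u.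
Proof.
move=> aa bb H t /andP[h1 h2]; apply: H.
by rewrite (le_trans aa h1) (le_trans h2 bb).
Qed.

Lemma ccontN a b u : ccont a b u -> ccont a b (fun t => - u t).
Proof. by move=> H t tab; exact: (contN (H t tab)). Qed.
Lemma ccontD a b u v : ccont a b u -> ccont a b v -> ccont a b (fun t => u t + v t).
Proof. by move=> H H' t tab; exact: (contD (H t tab) (H' t tab)). Qed.
Lemma ccontB a b u v : ccont a b u -> ccont a b v -> ccont a b (fun t => u t - v t).
Proof. by move=> H H'; exact: (ccontD H (ccontN H')). Qed.
Lemma ccontM a b u v : ccont a b u -> ccont a b v -> ccont a b (fun t => u t * v t).
Proof. by move=> H H' t tab; exact: (contM (H t tab) (H' t tab)). Qed.
Lemma ccontC a b (c : C) : ccont a b (fun=> c).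
Proof. by move=> t _; exact: (@contC _ _ c t). Qed.

Lemma ccontE a b u : (forall t, {for t, continuous u}) -> ccont a b u.
Proof. by move=> H t _; exact: (H t). Qed.

Lemma integrable_cont a b (u : K -> K) :
  (forall t, a <= t <= b -> {for t, continuous u}) ->
  mu.-integrable `[a, b] (EFin \o u).
Proof.
move=> H; apply: continuous_compact_integrable; first exact: segment_compact.
apply: continuous_in_subspaceT => t; rewrite inE /= in_itv /=; exact: H.
Qed.

Lemma integrable_Re a b u : ccont a b u ->
  mu.-integrable `[a, b] (EFin \o (fun t => Re (u t))).
Proof. by move=> H; apply: integrable_cont => t tab; exact: (cont_Re (H t tab)). Qed.

Lemma integrable_Im a b u : ccont a b u ->
  mu.-integrable `[a, b] (EFin \o (fun t => Im (u t))).
Proof. by move=> H; apply: integrable_cont => t tab; exact: (cont_Im (H t tab)). Qed.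

Opaque ccont.

Lemma cxP (x y : C) : Re x = Re y -> Im x = Im y -> x = y.
Proof. by case: x; case: y => /= a b c d -> ->. Qed.

Lemma eq_cint a b u v : (forall t, a <= t <= b -> u t = v t) ->
  cint a b u = cint a b v.
Proof.
move=> uv; congr (_ +i* _); apply: eq_Rintegral => t;
  by rewrite inE /= in_itv /= => /uv ->.
Qed.

Lemma cintD a b u v : ccont a b u -> ccont a b v ->
  cint a b (fun t => u t + v t) = cint a b u + cint a b v.
Proof.
move=> cu cv; have := (integrable_Re cu, integrable_Im cu).
have := (integrable_Re cv, integrable_Im cv) => -[r1 i1] [r2 i2].
apply: cxP.
  apply: etrans (RintegralD _ r2 r1) => //; apply: eq_Rintegral => t _.
  by rewrite /=; case: (u t); case: (v t).
apply: etrans (RintegralD _ i2 i1) => //; apply: eq_Rintegral => t _.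
by rewrite /=; case: (u t); case: (v t).
Qed.

Lemma cintZ a b (c : C) u : ccont a b u ->
  cint a b (fun t => c * u t) = c * cint a b u.
Proof.
move=> cu; have := (integrable_Re cu, integrable_Im cu) => -[r1 i1].
case: c => x y.
have mI : measurable (`[a, b] : set (measurableTypeR K)) by exact: measurable_itv.
have rZ (k : K) (h : K -> K) : mu.-integrable `[a, b] (EFin \o h) ->
   mu.-integrable `[a, b] (EFin \o (fun t => k * h t)).
  move=> ih; have -> : EFin \o (fun t => k * h t) = (fun t => (k%:E * (EFin \o h) t)%E).
    by [].
  exact: integrableZl.
apply: cxP.
  have -> : Re ((x +i* y : C) * cint a b u) =
    x * Rintegral mu `[a, b] (fun t => Re (u t)) -
    y * Rintegral mu `[a, b] (fun t => Im (u t)) by [].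
  rewrite -!RintegralZl// -RintegralB ?rZ//.
  by apply: eq_Rintegral => t _; rewrite /=; case: (u t).
have -> : Im ((x +i* y : C) * cint a b u) =
  x * Rintegral mu `[a, b] (fun t => Im (u t)) +
  y * Rintegral mu `[a, b] (fun t => Re (u t)) by [].
rewrite -!RintegralZl// -RintegralD ?rZ//.
by apply: eq_Rintegral => t _; rewrite /=; case: (u t).
Qed.

Lemma cintN a b u : ccont a b u -> cint a b (fun t => - u t) = - cint a b u.
Proof.
move=> cu; rewrite -mulN1r -cintZ//; apply: eq_cint => t _; by rewrite mulN1r.
Qed.

Lemma cintB a b u v : ccont a b u -> ccont a b v ->
  cint a b (fun t => u t - v t) = cint a b u - cint a b v.
Proof. by move=> cu cv; rewrite (cintD cu (ccontN cv)) cintN. Qed.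

Lemma cint_cst a b (c : C) : a <= b -> cint a b (fun=> c) = (b - a)%:C * c.
Proof.
move=> ab; rewrite /cint !Rintegral_cst//= lebesgue_measure_itv/= lte_fin.
case: c => x y; case: ltgtP ab => //= [ab _|-> _]; last first.
  by rewrite !mulr0 subrr mul0r.
apply/eqP; rewrite eq_complex /=; apply/andP; split; apply/eqP; ring.
Qed.

Lemma cint_split a m b u : a <= m -> m <= b -> ccont a b u ->
  cint a b u = cint a m u + cint m b u.
Proof.
move=> am mb cu.
have E (h : K -> K) : mu.-integrable `[a, b] (EFin \o h) ->
   Rintegral mu `[a, b] h = Rintegral mu `[a, m] h + Rintegral mu `[m, b] h.
  move=> ih; have := @Rintegral_itvB K h (BLeft a) (BRight b) m ih.
  rewrite !bnd_simp => /(_ am mb) E.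
  rewrite -[LHS](subrK (\int[mu]_(t in `[a, m]) h t)) E addrC; congr (_ + _).
  apply: Rintegral_itv_obnd_cbnd.
  by apply: integrableS ih => //; apply: subset_itv; rewrite bnd_simp.
rewrite /cint (E _ (integrable_Re cu)) (E _ (integrable_Im cu)).
by [].
Qed.

(** The factor 2 comes from bounding the real and imaginary parts separately. It does no harm: later
    it is absorbed in a limit or removed by passing to powers. *)
Lemma cint_bound a b u (M : K) : a <= b -> ccont a b u ->
  (forall t, a <= t <= b -> nm (u t) <= M) ->
  nm (cint a b u) <= 2 * M * (b - a).
Proof.
move=> ab cu uM.
have E (h : K -> K) : mu.-integrable `[a, b] (EFin \o h) ->
  (forall t, a <= t <= b -> `|h t| <= M) ->
  `|Rintegral mu `[a, b] h| <= M * (b - a).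
  move=> ih hM; apply: (le_trans (le_normr_Rintegral _ ih)) => //.
  have -> : M * (b - a) = Rintegral mu `[a, b] (fun=> M).
    rewrite Rintegral_cst//= lebesgue_measure_itv/= lte_fin.
    by case: ltgtP ab => // -> _; rewrite subrr.
  apply: le_Rintegral.
  - exact: measurable_itv.
  - by have := integrable_norm ih.
  - by apply: integrable_cont => t _; exact: cvg_cst.
  - by move=> t; rewrite /= in_itv /=; exact: hM.
apply: (le_trans (nm_le_ReIm _)); rewrite -mulrA mulrDl mul1r.
apply: lerD.
  apply: E; first exact: integrable_Re.
  by move=> t /uM; apply: le_trans; exact: nm_Re.
apply: E; first exact: integrable_Im.
by move=> t /uM; apply: le_trans; exact: nm_Im.
Qed.

Lemma cint_near a b u (c : C) (M : K) : a <= b -> ccont a b u ->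
  (forall t, a <= t <= b -> nm (u t - c) <= M) ->
  nm (cint a b u - (b - a)%:C * c) <= 2 * M * (b - a).
Proof.
move=> ab cu H; rewrite -cint_cst// -(cintB cu (@ccontC a b c)).
exact: (cint_bound ab (ccontB cu (@ccontC a b c)) H).
Qed.

End Cint.

Opaque nm.

(** * Goursat's theorem on rectangles *)

Section Goursat.
Variable K : realType.
Local Notation C := (Cx K).
Implicit Types (a b c d : K) (G : C -> C).

Lemma halves_small (t d : K) : 0 < d -> exists n : nat, t / 2 ^+ n < d.
Proof.
move=> d0; have [n nt] : exists n : nat, `|t| / d < n%:R.
  by exists (Num.bound (`|t| / d)); apply: archi_boundP; rewrite divr_ge0// ltW.
exists n; rewrite ltr_pdivrMr ?exprn_gt0//; apply: le_lt_trans (ler_norm t) _.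
move: nt; rewrite ltr_pdivrMr// => nt; apply: (lt_le_trans nt).
rewrite mulrC; apply: ler_wpM2l; first exact: ltW.
by rewrite -natrX ler_nat ltnW// ltn_expl.
Qed.

(** Nested intervals with left ends [u n]; their common point is the supremum of the left ends. *)
Lemma nested (u : nat -> K) (L : K) :
  (forall n, u n <= u n.+1 /\ u n.+1 + L / 2 ^+ n.+1 <= u n + L / 2 ^+ n) ->
  0 <= L -> exists x, forall n, u n <= x <= u n + L / 2 ^+ n.
Proof.
move=> H L0.
have inc m n : u m <= u (m + n)%N.
  elim: n => [|n IH]; first by rewrite addn0.
  by rewrite addnS; apply: (le_trans IH); case: (H (m + n)%N).
have dec m n : u (m + n)%N + L / 2 ^+ (m + n) <= u m + L / 2 ^+ m.
  elim: n => [|n IH]; first by rewrite addn0.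
  by rewrite addnS; apply: le_trans IH; case: (H (m + n)%N).
have pos n : 0 <= L / 2 ^+ n by rewrite divr_ge0// exprn_ge0.
have ub m n : u m <= u n + L / 2 ^+ n.
  have [mn|nm] := leqP m n.
    apply: (@le_trans _ _ (u n)); last by rewrite lerDl.
    by rewrite -(subnKC mn); exact: inc.
  rewrite -(subnKC (ltnW nm)); apply: le_trans (dec n (m - n)%N).
  by rewrite lerDl.
pose A := range u.
have A0 : A !=set0 by exists (u 0%N); exists 0%N.
exists (sup A) => n; apply/andP; split.
  apply: ub_le_sup; last by exists n.
  by exists (u 0%N + L / 2 ^+ 0) => _ [m _ <-].
by apply: ge_sup => // _ [m _ <-].
Qed.

(** The contour integral of [G] over the boundary of [a, b] x [c, d], counterclockwise. *)
Definition bdint G a b c d : C :=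
  'i * cint c d (fun t => G (b +i* t) - G (a +i* t))
  - cint a b (fun t => G (t +i* d) - G (t +i* c)).

Definition rect_cont G a b c d :=
  forall x y, a <= x <= b -> c <= y <= d -> {for (x +i* y), continuous G}.

Lemma cont_vert (x y : K) : {for y, continuous (fun t : K => x +i* t : C)}.
Proof. by apply: cont_complex; [exact: cvg_cst|exact: cvg_id]. Qed.

Lemma cont_horiz (x y : K) : {for x, continuous (fun t : K => t +i* y : C)}.
Proof. by apply: cont_complex; [exact: cvg_id|exact: cvg_cst]. Qed.

Lemma ccont_vert G a b c d x : rect_cont G a b c d -> a <= x <= b ->
  ccont c d (fun t => G (x +i* t)).
Proof.
move=> H xab t tcd.
exact: (continuous_comp (@cont_vert x t) (H x t xab tcd)).
Qed.

Lemma ccont_horiz G a b c d y : rect_cont G a b c d -> c <= y <= d ->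
  ccont a b (fun t => G (t +i* y)).
Proof.
move=> H ycd t tab.
exact: (continuous_comp (@cont_horiz t y) (H t y tab ycd)).
Qed.

Lemma rect_cont_sub G a b c d a' b' c' d' : rect_cont G a b c d ->
  a <= a' -> b' <= b -> c <= c' -> d' <= d -> rect_cont G a' b' c' d'.
Proof.
move=> H h1 h2 h3 h4 x y /andP[x1 x2] /andP[y1 y2]; apply: H; apply/andP; split.
- exact: le_trans x1.
- exact: le_trans h2.
- exact: le_trans y1.
- exact: le_trans h4.
Qed.

Opaque rect_cont.

Lemma bdint_splitx G a m b c d : a <= m -> m <= b -> c <= d ->
  rect_cont G a b c d ->
  bdint G a b c d = bdint G a m c d + bdint G m b c d.
Proof.
move=> am mb cd H.
have ab := le_trans am mb.
have va := ccont_vert H (_ : a <= a <= b).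
have vm := ccont_vert H (_ : a <= m <= b).
have vb := ccont_vert H (_ : a <= b <= b).
have hc := ccont_horiz H (_ : c <= c <= d).
have hd := ccont_horiz H (_ : c <= d <= d).
rewrite !lexx ?ab ?am ?mb ?cd in va vm vb hc hd.
have {}hd := hd isT; have {}hc := hc isT.
have {}va := va isT; have {}vm := vm isT; have {}vb := vb isT.
rewrite /bdint (cintB vb va) (cintB vm va) (cintB vb vm).
rewrite (cintB hd hc) (cint_split am mb hd) (cint_split am mb hc).
have s1 := ccont_sub (lexx a) mb; have s2 := ccont_sub am (lexx b).
rewrite (cintB (s1 _ hd) (s1 _ hc)) (cintB (s2 _ hd) (s2 _ hc)).
ring.
Qed.

Lemma bdint_splity G a b c m d : c <= m -> m <= d -> a <= b ->
  rect_cont G a b c d ->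
  bdint G a b c d = bdint G a b c m + bdint G a b m d.
Proof.
move=> cm md ab H.
have cd := le_trans cm md.
have va := ccont_vert H (_ : a <= a <= b).
have vb := ccont_vert H (_ : a <= b <= b).
have hc := ccont_horiz H (_ : c <= c <= d).
have hm := ccont_horiz H (_ : c <= m <= d).
have hd := ccont_horiz H (_ : c <= d <= d).
rewrite !lexx ?ab ?cm ?md ?cd in va vb hc hm hd.
have {}hd := hd isT; have {}hc := hc isT; have {}hm := hm isT.
have {}va := va isT; have {}vb := vb isT.
rewrite /bdint (cintB hd hc) (cintB hm hc) (cintB hd hm).
rewrite (cintB vb va) (cint_split cm md va) (cint_split cm md vb).
have s1 := ccont_sub (lexx c) md; have s2 := ccont_sub cm (lexx d).
rewrite (cintB (s1 _ vb) (s1 _ va)) (cintB (s2 _ vb) (s2 _ va)).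
ring.
Qed.

(** On the n-th rectangle of the subdivision [G] differs from its first-order expansion at the limit
    point by o(2^-n), so the boundary integral is o(4^-n); this beats the factor 4^n lost in n
    quarterings. *)
Lemma goursat G a b c d : a <= b -> c <= d ->
  (forall x y, a <= x <= b -> c <= y <= d -> hol G (x +i* y)) ->
  bdint G a b c d = 0.
Proof.
move=> ab cd H.
have Hc : rect_cont G a b c d by move=> x y xab ycd; exact: (hol_cont (H x y xab ycd)).
set L1 := b - a; set L2 := d - c.
have L10 : 0 <= L1 by rewrite subr_ge0.
have L20 : 0 <= L2 by rewrite subr_ge0.
pose B n (p : K * K) := bdint G p.1 (p.1 + L1 / 2 ^+ n) p.2 (p.2 + L2 / 2 ^+ n).
pose inside n (p : K * K) :=
  [/\ a <= p.1, p.1 + L1 / 2 ^+ n <= b, c <= p.2 & p.2 + L2 / 2 ^+ n <= d].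
pose sub n (p p' : K * K) :=
  [/\ p.1 <= p'.1, p'.1 + L1 / 2 ^+ n.+1 <= p.1 + L1 / 2 ^+ n, p.2 <= p'.2
    & p'.2 + L2 / 2 ^+ n.+1 <= p.2 + L2 / 2 ^+ n].
(* One quarter carries at least a fourth of the integral. The implication stands under the
   quantifier so that choice gives a total function [nxt]. *)
have step n p : exists p', inside n p ->
    sub n p p' /\ nm (B n p) <= 4 * nm (B n.+1 p').
  have [[i1 i2 i3 i4]|?] := pselect (inside n p); last by exists p.
  case: p i1 i2 i3 i4 => x y /= i1 i2 i3 i4.
  set l1 := L1 / 2 ^+ n.+1; set l2 := L2 / 2 ^+ n.+1.
  have E1 : L1 / 2 ^+ n = l1 + l1 by rewrite /l1 exprS; field; rewrite expf_neq0.
  have E2 : L2 / 2 ^+ n = l2 + l2 by rewrite /l2 exprS; field; rewrite expf_neq0.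
  have l10 : 0 <= l1 by rewrite divr_ge0// exprn_ge0.
  have l20 : 0 <= l2 by rewrite divr_ge0// exprn_ge0.
  have Hxy := rect_cont_sub Hc i1 i2 i3 i4.
  have S1 : B n (x, y) = bdint G x (x + l1) y (y + l2) +
     bdint G x (x + l1) (y + l2) (y + l2 + l2) +
     (bdint G (x + l1) (x + l1 + l1) y (y + l2) +
     bdint G (x + l1) (x + l1 + l1) (y + l2) (y + l2 + l2)).
    have xl : x <= x + l1 by rewrite lerDl.
    have xll : x + l1 <= x + l1 + l1 by rewrite lerDl.
    have yl : y <= y + l2 by rewrite lerDl.
    have yll : y + l2 <= y + l2 + l2 by rewrite lerDl.
    have {}Hxy : rect_cont G x (x + l1 + l1) y (y + l2 + l2).
      by move: Hxy; rewrite /= E1 E2 !addrA.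
    have -> : B n (x, y) = bdint G x (x + l1 + l1) y (y + l2 + l2).
      by rewrite /B /= E1 E2 !addrA.
    rewrite (bdint_splitx xl xll (le_trans yl yll) Hxy); congr (_ + _).
      by rewrite (bdint_splity yl yll xl (rect_cont_sub Hxy (lexx _) xll (lexx _) (lexx _))).
    by rewrite (bdint_splity yl yll xll (rect_cont_sub Hxy xl (lexx _) (lexx _) (lexx _))).
  have T : nm (B n (x, y)) <= nm (B n.+1 (x, y)) + nm (B n.+1 (x, y + l2)) +
    (nm (B n.+1 (x + l1, y)) + nm (B n.+1 (x + l1, y + l2))).
    rewrite S1; apply: (le_trans (nmD _ _)); apply: lerD; exact: nmD.
  have sb (s t : bool) : sub n (x, y) (if s then x + l1 else x, if t then y + l2 else y).
    rewrite /sub /= -/l1 -/l2 E1 E2 !addrA.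
    by case: s; case: t; split; rewrite ?lexx ?lerDl.
  have [h1|h1] := lerP (nm (B n (x, y))) (4 * nm (B n.+1 (x, y))).
    by exists (x, y) => _; split => //; exact: (sb false false).
  have [h2|h2] := lerP (nm (B n (x, y))) (4 * nm (B n.+1 (x, y + l2))).
    by exists (x, y + l2) => _; split => //; exact: (sb false true).
  have [h3|h3] := lerP (nm (B n (x, y))) (4 * nm (B n.+1 (x + l1, y))).
    by exists (x + l1, y) => _; split => //; exact: (sb true false).
  exists (x + l1, y + l2) => _; apply: conj; first exact: (sb true true).
  move: T h1 h2 h3; move: (nm (B n (x, y))) (nm (B n.+1 (x, y)))
    (nm (B n.+1 (x, y + l2))) (nm (B n.+1 (x + l1, y)))
    (nm (B n.+1 (x + l1, y + l2))) => t0 t1 t2 t3 t4; clear => T h1 h2 h3; rlra.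
have [nxt Hn] : exists nxt : nat -> K * K -> K * K, forall n p, inside n p ->
    sub n p (nxt n p) /\ nm (B n p) <= 4 * nm (B n.+1 (nxt n p)).
  have /choice [g Hg] : forall np : nat * (K * K), exists p', inside np.1 np.2 ->
    sub np.1 np.2 p' /\ nm (B np.1 np.2) <= 4 * nm (B np.1.+1 p').
    by move=> [n p]; exact: step.
  by exists (fun n p => g (n, p)) => n p; exact: (Hg (n, p)).
pose s := fix s n := if n is m.+1 then nxt m (s m) else (a, c).
have ins n : inside n (s n).
  elim: n => [|n IH].
    by rewrite /inside -[s 0%N]/(a, c) /= expr0 !divr1 /L1 /L2 !subrKC.
  have [[h1 h2 h3 h4] _] := Hn _ _ IH; case: IH => [i1 i2 i3 i4].
  rewrite /inside /=; split; [exact: le_trans h1|exact: le_trans i2|exact: le_trans h3|].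
  exact: le_trans i4.
have sn n := (Hn n _ (ins n)).1.
have Bn n : nm (bdint G a b c d) <= 4 ^+ n * nm (B n (s n)).
  elim: n => [|n IH].
    by rewrite expr0 mul1r /B -[s 0%N]/(a, c) /= expr0 !divr1 /L1 /L2 !subrKC.
  apply: (le_trans IH); rewrite exprSr -mulrA; apply: ler_wpM2l; rewrite ?exprn_ge0//.
  exact: (Hn n _ (ins n)).2.
have [x Hx] := @nested (fun n => (s n).1) L1 (fun n =>
   conj (let: And4 h _ _ _ := sn n in h) (let: And4 _ h _ _ := sn n in h)) L10.
have [y Hy] := @nested (fun n => (s n).2) L2 (fun n =>
   conj (let: And4 _ _ h _ := sn n in h) (let: And4 _ _ _ h := sn n in h)) L20.
have xab : a <= x <= b.
  by have := Hx 0%N; rewrite /= expr0 divr1 /L1 => /andP[-> /=]; rewrite addrC subrK.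
have ycd : c <= y <= d.
  by have := Hy 0%N; rewrite /= expr0 divr1 /L2 => /andP[-> /=]; rewrite addrC subrK.
have [q [/cont_nm cq Gq]] := H x y xab ycd.
pose L := L1 + L2.
have L0 : 0 <= L by rewrite addr_ge0.
have key (e : K) : 0 < e -> nm (bdint G a b c d) <= 4 * e * L ^+ 2.
  move=> e0; have [de de0 Hde] := cq e e0.
  have [n nd] := halves_small L de0.
  apply: (le_trans (Bn n)).
  have [i1 i2 i3 i4] := ins n; have := Hx n; have := Hy n.
  move: (s n) i1 i2 i3 i4 => [u v] /= i1 i2 i3 i4 /andP[y1 y2] /andP[x1 x2].
  set l1 := L1 / 2 ^+ n in i2 x2 *; set l2 := L2 / 2 ^+ n in i4 y2 *.
  have El : l1 + l2 = L / 2 ^+ n by rewrite /l1 /l2 -mulrDl.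
  rewrite -El in nd.
  have l10 : 0 <= l1 by rewrite divr_ge0// exprn_ge0.
  have l20 : 0 <= l2 by rewrite divr_ge0// exprn_ge0.
  set z0 := x +i* y in cq Hde Gq.
  have near0 x' y' : u <= x' <= u + l1 -> v <= y' <= v + l2 ->
      nm (G (x' +i* y') - G z0 - q z0 * ((x' +i* y') - z0)) <= e * (l1 + l2).
    move=> /andP[p1 p2] /andP[p3 p4].
    have D : nm ((x' +i* y') - z0) <= l1 + l2.
      apply: (le_trans (nm_le_ReIm _)).
      rewrite -[Re _]/(x' - x) -[Im _]/(y' - y).
      by apply: lerD; rewrite ler_norml; apply/andP; split; rlra.
    rewrite Gq -mulrBl nmM; apply: ler_pM; rewrite ?nm_ge0//.
    by apply/ltW/Hde; apply: le_lt_trans nd.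
  have Hs := rect_cont_sub Hc i1 i2 i3 i4.
  have uu : u <= u + l1 by rewrite lerDl.
  have vv : v <= v + l2 by rewrite lerDl.
  have C1 : ccont v (v + l2) (fun t => G ((u + l1) +i* t) - G (u +i* t)).
    by apply: ccontB; apply: (ccont_vert Hs); rewrite ?lexx ?uu.
  have C2 : ccont u (u + l1) (fun t => G (t +i* (v + l2)) - G (t +i* v)).
    by apply: ccontB; apply: (ccont_horiz Hs); rewrite ?lexx ?vv.
  (* Differences over opposite sides are compared with their first-order terms, whose contributions
     to the boundary integral cancel: i l2 (q l1) - l1 (q i l2) = 0. *)
  have N1 := @cint_near K v (v + l2) _ (q z0 * l1%:C) (2 * (e * (l1 + l2))) vv C1.
  have N2 := @cint_near K u (u + l1) _ (q z0 * ('i * l2%:C)) (2 * (e * (l1 + l2))) uu C2.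
  have {}N1 : nm (cint v (v + l2) (fun t => G ((u + l1) +i* t) - G (u +i* t))
     - l2%:C * (q z0 * l1%:C)) <= 2 * (2 * (e * (l1 + l2))) * l2.
    have El2 : v + l2 - v = l2 by rewrite addrAC subrr add0r.
    rewrite El2 in N1; apply: N1 => t tv.
    have h1 := near0 (u + l1) t; have h2 := near0 u t.
    rewrite !lexx uu tv in h1 h2; have {}h1 := h1 isT isT; have {}h2 := h2 isT isT.
    have -> : G ((u + l1) +i* t) - G (u +i* t) - q z0 * l1%:C =
      (G ((u + l1) +i* t) - G z0 - q z0 * (((u + l1) +i* t) - z0)) -
      (G (u +i* t) - G z0 - q z0 * ((u +i* t) - z0)).
      have -> : l1%:C = ((u + l1) +i* t) - (u +i* t) :> C.
        by apply: cxP => /=; ring.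
      ring.
    by apply: (le_trans (nmB _ _)); rlra.
  have {}N2 : nm (cint u (u + l1) (fun t => G (t +i* (v + l2)) - G (t +i* v))
     - l1%:C * (q z0 * ('i * l2%:C))) <= 2 * (2 * (e * (l1 + l2))) * l1.
    have El1 : u + l1 - u = l1 by rewrite addrAC subrr add0r.
    rewrite El1 in N2; apply: N2 => t tu.
    have h1 := near0 t (v + l2); have h2 := near0 t v.
    rewrite !lexx vv tu in h1 h2; have {}h1 := h1 isT isT; have {}h2 := h2 isT isT.
    have -> : G (t +i* (v + l2)) - G (t +i* v) - q z0 * ('i * l2%:C) =
      (G (t +i* (v + l2)) - G z0 - q z0 * ((t +i* (v + l2)) - z0)) -
      (G (t +i* v) - G z0 - q z0 * ((t +i* v) - z0)).
      have -> : 'i * l2%:C = (t +i* (v + l2)) - (t +i* v) :> C.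
        by apply: cxP => /=; ring.
      ring.
    by apply: (le_trans (nmB _ _)); rlra.
  have BB : nm (B n (u, v)) <= 4 * e * (l1 + l2) ^+ 2.
    rewrite /B /bdint /= -/l1 -/l2.
    move: N1 N2; set A1 := cint _ _ _; set A2 := cint _ _ _ => N1 N2.
    have -> : 'i * A1 - A2 = 'i * (A1 - l2%:C * (q z0 * l1%:C)) -
       (A2 - l1%:C * (q z0 * ('i * l2%:C))) by ring.
    apply: (le_trans (nmB _ _)); rewrite nmM nm_i mul1r.
    have -> : 4 * e * (l1 + l2) ^+ 2 = 2 * (2 * (e * (l1 + l2))) * l2 +
       2 * (2 * (e * (l1 + l2))) * l1 by ring.
    exact: lerD.
  have -> : 4 * e * L ^+ 2 = 4 ^+ n * (4 * e * (l1 + l2) ^+ 2).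
    have E4 : (4 : K) ^+ n = (2 ^+ n) ^+ 2.
      by rewrite -exprM mulnC exprM; congr (_ ^+ n); rewrite expr2 -natrM.
    have p0 : (2 : K) ^+ n != 0 by rewrite expf_neq0.
    by rewrite El E4; move: (2 ^+ n) p0 => p p0; field.
  by apply: ler_wpM2l => //; rewrite exprn_ge0.
apply/eqP; rewrite -nm_eq0; apply/eqP/le_anti; rewrite nm_ge0 andbT.
apply/ler_addgt0Pl => e e0; rewrite addr0.
have M0 : 0 < 4 * (L ^+ 2 + 1) by rewrite mulr_gt0// ltr_wpDl// sqr_ge0.
apply: (le_trans (key (e / (4 * (L ^+ 2 + 1))) _)); first by rewrite divr_gt0.
have -> : 4 * (e / (4 * (L ^+ 2 + 1))) * L ^+ 2 = e * (L ^+ 2 / (L ^+ 2 + 1)).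
  by field; rewrite gt_eqF// ltr_wpDl// sqr_ge0.
rewrite ger_pMr// ler_pdivrMr ?mul1r ?lerDl// ltr_wpDl// sqr_ge0.
by [].
Qed.

End Goursat.

(** * Means over circles *)

Section CircleMean.
Variable K : realType.
Local Notation C := (Cx K).
Local Notation tau := (pi *+ 2 : K).
Implicit Types (k h g : C -> C) (rho : K).

Definition circ rho (t : K) : C := rho%:C * cexp (0 +i* t).

Lemma tau_gt0 : 0 < tau. Proof. by rewrite mulrn_wgt0// pi_gt0. Qed.

Lemma nm_circ rho t : 0 <= rho -> nm (circ rho t) = rho.
Proof. by move=> r0; rewrite nmM nm_cexp expR0 mulr1 nm_real ger0_norm. Qed.

Lemma cont_circ rho t : {for t, continuous (circ rho)}.
Proof.
apply: (contM (@contC _ _ _ _)).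
exact: (continuous_comp (@cont_vert K 0 t) (hol_cont (hol_cexp _))).
Qed.

(** Equivalently, the contour integral of k(w) / w over |w| = rho, divided by 2 pi i. *)
Definition cmean rho k : C :=
  (tau^-1)%:C * cint 0 tau (fun t => k (circ rho t)).

Definition circ_cont rho k := ccont 0 tau (fun t => k (circ rho t)).

Lemma circ_cont_at rho k : 0 <= rho ->
  (forall w, nm w = rho -> {for w, continuous k}) -> circ_cont rho k.
Proof.
move=> r0 H; apply: ccontE => t.
exact: (continuous_comp (@cont_circ rho t) (H _ (nm_circ t r0))).
Qed.

Lemma circ_cont_hol rho k : 0 <= rho ->
  (forall w, nm w = rho -> hol k w) -> circ_cont rho k.
Proof.
by move=> r0 H; apply: circ_cont_at => // w wr; exact: (hol_cont (H w wr)).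
Qed.

Lemma circ_contM rho k h : circ_cont rho k -> circ_cont rho h ->
  circ_cont rho (fun w => k w * h w).
Proof. by move=> ck ch; exact: (ccontM ck ch). Qed.
Lemma circ_contD rho k h : circ_cont rho k -> circ_cont rho h ->
  circ_cont rho (fun w => k w + h w).
Proof. by move=> ck ch; exact: (ccontD ck ch). Qed.
Lemma circ_contB rho k h : circ_cont rho k -> circ_cont rho h ->
  circ_cont rho (fun w => k w - h w).
Proof. by move=> ck ch; exact: (ccontB ck ch). Qed.
Lemma circ_contC rho (c : C) : circ_cont rho (fun=> c).
Proof. exact: (@ccontC K 0 tau c). Qed.

Lemma eq_cmean rho k h : 0 <= rho -> (forall w, nm w = rho -> k w = h w) ->
  cmean rho k = cmean rho h.
Proof.
by move=> r0 H; congr (_ * _); apply: eq_cint => t _; apply: H; exact: nm_circ.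
Qed.

Lemma cmeanD rho k h : circ_cont rho k -> circ_cont rho h ->
  cmean rho (fun w => k w + h w) = cmean rho k + cmean rho h.
Proof. by move=> ck ch; rewrite /cmean (cintD ck ch) mulrDr. Qed.

Lemma cmeanB rho k h : circ_cont rho k -> circ_cont rho h ->
  cmean rho (fun w => k w - h w) = cmean rho k - cmean rho h.
Proof. by move=> ck ch; rewrite /cmean (cintB ck ch) mulrBr. Qed.

Lemma cmeanZ rho (c : C) k : circ_cont rho k ->
  cmean rho (fun w => c * k w) = c * cmean rho k.
Proof. by move=> ck; rewrite /cmean (cintZ c ck) mulrCA. Qed.

Lemma cmean_cst rho (c : C) : cmean rho (fun=> c) = c.
Proof.
rewrite /cmean cint_cst ?subr0; last exact: (ltW tau_gt0).
by rewrite mulrA -rCM mulVf ?mul1r// gt_eqF// tau_gt0.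
Qed.

Lemma cmean_sum rho (I : Type) (s : seq I) (u : I -> C -> C) :
  (forall i, circ_cont rho (u i)) ->
  circ_cont rho (fun w => \sum_(i <- s) u i w) /\
  cmean rho (fun w => \sum_(i <- s) u i w) = \sum_(i <- s) cmean rho (u i).
Proof.
move=> H; elim: s => [|i s [IH1 IH2]].
  have -> : (fun w => \sum_(i <- [::]) u i w) = (fun=> 0).
    by apply/funext => w; rewrite big_nil.
  by rewrite big_nil cmean_cst; split; first exact: circ_contC.
have -> : (fun w => \sum_(i <- i :: s) u i w) =
    (fun w => u i w + \sum_(i <- s) u i w).
  by apply/funext => w; rewrite big_cons.
by rewrite big_cons (cmeanD (H i) IH1) IH2; split; first exact: (circ_contD (H i) IH1).
Qed.

Lemma cmean_bound rho k (M : K) : 0 <= rho -> circ_cont rho k ->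
  (forall w, nm w = rho -> nm (k w) <= M) -> nm (cmean rho k) <= 2 * M.
Proof.
move=> r0 ck H; have t0 := tau_gt0.
have := cint_bound (ltW t0) ck (fun t _ => H _ (nm_circ t r0)).
rewrite subr0 nmM nm_real => b.
rewrite ger0_norm ?invr_ge0 ?(ltW t0)// mulrC ler_pdivrMr//.
Qed.

Lemma cexp_circ rho t : 0 < rho -> cexp (ln rho +i* t) = circ rho t.
Proof.
move=> r0; have e0 := lnK (r0 : rho \is Num.pos).
by apply: cxP; rewrite /circ /cexp /= e0 expR0; ring.
Qed.

(* Goursat's theorem for [z |-> h (exp z)] on a rectangle of height [2 pi]. *)
Lemma cmean_const_hol rho1 rho2 h : 0 < rho1 -> rho1 <= rho2 ->
  (forall w, rho1 <= nm w <= rho2 -> hol h w) -> cmean rho1 h = cmean rho2 h.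
Proof.
move=> r10 r12 H; have r20 := lt_le_trans r10 r12.
have l12 : ln rho1 <= ln rho2 by rewrite ler_ln.
have HG x y : ln rho1 <= x <= ln rho2 -> 0 <= y <= tau ->
    hol (fun z => h (cexp z)) (x +i* y).
  move=> /andP[x1 x2] _; apply: (hol_comp (hol_cexp _)); apply: H.
  rewrite nm_cexp /= -(lnK r10) -(lnK r20) !ler_expR.
  by rewrite x1 x2.
have := goursat l12 (ltW tau_gt0) HG; rewrite /bdint.
have -> : cint (ln rho1) (ln rho2) (fun t => h (cexp (t +i* tau)) - h (cexp (t +i* 0)))
   = 0.
  rewrite (@eq_cint _ _ _ _ (fun=> 0)); last by move=> t _; rewrite cexp_2pi subrr.
  by rewrite cint_cst// mulr0.
rewrite subr0 => /eqP; rewrite mulf_eq0 => /orP[/eqP/(congr1 (@nm K))|/eqP E].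
  by rewrite nm_i nm0 => /eqP; rewrite oner_eq0.
apply/eqP; rewrite eq_sym -subr_eq0 /cmean -mulrBr.
have c1 : circ_cont rho1 h.
  by apply: circ_cont_hol; [exact: ltW|move=> w wr; apply: H; rewrite wr lexx].
have c2 : circ_cont rho2 h.
  by apply: circ_cont_hol; [exact: ltW|move=> w wr; apply: H; rewrite wr lexx r12].
rewrite -(cintB c2 c1) -[X in _ * X == _](_ : 0 = _) ?mulr0// -[LHS]E.
by apply: eq_cint => t _; rewrite !cexp_circ.
Qed.

(** Uniformity in the angle [t] comes from the compactness of [0, tau]. *)
Lemma circ_unif (s : K) h (e : K) : 0 < s -> 0 < e ->
  (forall w, nm w = s -> {for w, continuous h}) ->
  exists2 d, 0 < d & forall rho t, 0 <= t <= tau -> `|rho - s| < d ->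
    nm (h (circ rho t) - h (circ s t)) < e.
Proof.
move=> s0 e0 H.
have := @segment_compact K 0 tau => /compact_near_coveringP.
move=> /(_ K (nbhs s) (fun rho t => nm (h (circ rho t) - h (circ s t)) < e) _).
case=> [t _|d /= d0 Hd]; last first.
  exists d => // rho t tt rs; apply: (Hd rho) => //=.
  by rewrite distrC.
have e20 : 0 < e / 2 by rewrite divr_gt0.
have [d1 d10 H1] := (cont_nm _ _).1 (H _ (nm_circ t (ltW s0))) _ e20.
have d20 : 0 < d1 / 2 / 2 by rewrite !divr_gt0.
have [d2 d20' H2] := (cont_nmK _ _).1 (@cont_circ 1 t) _ (divr_gt0 d10 (mulr_gt0 (ltr0n _ 2) s0) : 0 < d1 / (2 * s)).
have sd t' : `|t' - t| < d2 -> forall rho, `|rho - s| < d1 / 2 ->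
    nm (circ rho t' - circ s t) < d1.
  move=> /H2 ht rho hr.
  have -> : circ rho t' - circ s t = (rho - s)%:C * circ 1 t' +
     s%:C * (circ 1 t' - circ 1 t) by rewrite /circ rCB; ring.
  apply: (le_lt_trans (nmD _ _)); rewrite (nmM _ (circ 1 t')) (nmM s%:C) nm_circ// !nm_real mulr1 (gtr0_norm s0).
  rewrite [d1]splitr; apply: ltrD => //.
  rewrite mulrC -ltr_pdivlMr//.
  by have -> : d1 / 2 / s = d1 / (2 * s) by field; rewrite gt_eqF.
exists (ball t d2, ball s (d1 / 2)).
  by split; apply: nbhsx_ballx; rewrite ?divr_gt0.
move=> [t' rho] [] /=; rewrite -!ball_normE /= distrC => bt; rewrite distrC => br.
have h1 := H1 _ (sd _ bt _ br).
have h2 : nm (h (circ s t') - h (circ s t)) < e / 2.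
  by apply: H1; apply: sd => //; rewrite subrr normr0 divr_gt0.
have -> : h (circ rho t') - h (circ s t') = (h (circ rho t') - h (circ s t)) -
   (h (circ s t') - h (circ s t)) by ring.
by apply: (le_lt_trans (nmB _ _)); rewrite [e]splitr ltrD.
Qed.

(** The circle of radius [s] is allowed to carry points of mere continuity, as the difference
    quotient of [cauchy_annulus] has at [z]. The mean is constant on either side of [s] and
    continuous at [s]. *)
Lemma cmean_const rho1 rho2 h (s : K) : 0 < rho1 -> rho1 < s -> s < rho2 ->
  (forall w, rho1 <= nm w <= rho2 -> nm w != s -> hol h w) ->
  (forall w, nm w = s -> {for w, continuous h}) -> cmean rho1 h = cmean rho2 h.
Proof.
move=> r10 r1s sr2 H Hs; have s0 := lt_trans r10 r1s.
have cs : circ_cont s h by apply: circ_cont_at => //; exact: ltW.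
have cr rho : rho1 <= rho <= rho2 -> circ_cont rho h.
  move=> /andP[h1 h2]; apply: circ_cont_at => [|w wr]; first exact: (le_trans (ltW r10) h1).
  have [ws|ws] := eqVneq (nm w) s; first exact: Hs.
  by apply: hol_cont; apply: H => //; rewrite wr h1.
have lim rho : rho1 <= rho <= rho2 -> rho != s -> cmean rho h = cmean s h.
  move=> rr rs; apply/eqP; rewrite -subr_eq0 -nm_eq0; apply/eqP/le_anti.
  rewrite nm_ge0 andbT; apply/ler_addgt0Pl => e e0; rewrite addr0.
  have e20 : 0 < e / 2 by rewrite divr_gt0.
  have [d d0 Hd] := circ_unif s0 e20 Hs.
  have [r' r'd r'e] : exists2 r', cmean rho h = cmean r' h &
      `|r' - s| < d /\ rho1 <= r' <= rho2.
    case/andP: rr => h1 h2; move: rs; rewrite neq_lt => /orP[rs|rs].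
      (* A radius on the same side of [s] as [rho], hence with the same mean, at distance less than
         [d] from [s]. *)
      exists (Num.max rho (s - d / 2)); last first.
        split; last first.
          by rewrite le_max h1 ge_max h2 /= (le_trans _ (ltW sr2))// gerBl ltW// divr_gt0.
        have d20 : 0 < d / 2 by rewrite divr_gt0.
        rewrite ltr_norml; apply/andP; split; last first.
          rewrite ltrBlDr gt_max; apply/andP; split; last by clear -d0 d20; rlra.
          by apply: (lt_trans rs); rewrite ltrDr.
        rewrite ltrBrDr lt_max; apply/orP; right; clear -d0 d20; rlra.
      apply: cmean_const_hol; first exact: lt_le_trans h1.
        by rewrite le_max lexx.
      move=> w /andP[w1 w2]; have ws : nm w < s.
        apply: (le_lt_trans w2); rewrite gt_max rs /=.
        by rewrite gtrBl divr_gt0.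
      apply: H; rewrite ?(lt_eqF ws)// (le_trans h1 w1) (le_trans (ltW ws) (ltW sr2)).
      by [].
    exists (Num.min rho (s + d / 2)); last first.
      split; last first.
        by rewrite ge_min h2 le_min h1 /= (le_trans (ltW r1s))// lerDl ltW// divr_gt0.
      have d20 : 0 < d / 2 by rewrite divr_gt0.
      rewrite ltr_norml; apply/andP; split.
        rewrite ltrBrDr lt_min; apply/andP; split; last by clear -d0 d20; rlra.
        by apply: lt_trans rs; rewrite addrC gtrBl.
      rewrite ltrBlDr gt_min; apply/orP; right; clear -d0 d20; rlra.
    apply/esym; apply: cmean_const_hol.
    - by rewrite lt_min (lt_le_trans r10 h1) addr_gt0// divr_gt0.
    - by rewrite ge_min lexx.
    move=> w /andP[w1 w2]; have ws : s < nm w.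
      by apply: lt_le_trans w1; rewrite lt_min rs /= ltrDl divr_gt0.
    apply: H; rewrite ?(gt_eqF ws)// (le_trans w2 h2) (le_trans (ltW r1s) (ltW ws)).
    by [].
  case: r'e => r'e rr'; rewrite r'd /cmean -mulrBr -(cintB (cr _ rr') cs).
  rewrite nmM nm_real ger0_norm ?invr_ge0 ?(ltW tau_gt0)// mulrC.
  rewrite ler_pdivrMr ?tau_gt0//.
  apply: (le_trans (cint_bound (ltW tau_gt0) (ccontB (cr _ rr') cs) (fun t tt => ltW (Hd r' t tt r'e)))).
  by rewrite subr0 mulrCA divff// mulr1.
have r12 := lt_trans r1s sr2.
rewrite (lim rho1) ?lexx ?(ltW r12) ?(lt_eqF r1s)//.
by rewrite (lim rho2) ?lexx ?(ltW r12) ?(gt_eqF sr2).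
Qed.

End CircleMean.

(* Cauchy's formula and Taylor expansion *)
Opaque cmean.

Section Cauchy.
Variable K : realType.
Local Notation C := (Cx K).
Implicit Types (k h g : C -> C) (rho : K) (z w : C).

(** The Cauchy kernel relative to the measure dw / (2 pi i w) of [cmean]. *)
Definition kern (z w : C) : C := w / (w - z).

Lemma hol_kern z w : w != z -> hol (kern z) w.
Proof.
move=> wz; apply: holM; first exact: hol_id.
by apply: holV; [apply: holB; [exact: hol_id|exact: hol_cst]|rewrite subr_eq0].
Qed.

Lemma nm_neq z w : nm w != nm z -> w != z.
Proof. by apply: contra => /eqP ->. Qed.

Lemma circ_cont_kern rho z : 0 <= rho -> rho != nm z -> circ_cont rho (kern z).
Proof.
move=> r0 rz; apply: circ_cont_hol => // w wr; apply: hol_kern.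
by apply: nm_neq; rewrite wr.
Qed.

Lemma nm_small (x : C) : (forall e : K, 0 < e -> nm x <= e) -> x = 0.
Proof.
move=> H; apply/eqP; rewrite -nm_eq0; apply/eqP/le_anti; rewrite nm_ge0 andbT.
by apply/ler_addgt0Pl => e e0; rewrite addr0; exact: H.
Qed.

Lemma nm_kern_bound rho z w (e : K) : nm w = rho -> 0 < e -> e <= `|rho - nm z| ->
  nm (kern z w) <= rho / e.
Proof.
move=> wr e0 er; rewrite /kern nmM wr nmV.
have h : e <= nm (w - z).
  apply: (le_trans er); rewrite ler_norml -wr nmB_ge andbT lerNl opprB nm_dist.
  exact: nmB_ge.
have wz0 := lt_le_trans e0 h.
by apply: ler_wpM2l; rewrite -?wr ?nm_ge0// lef_pV2.
Qed.

(** The circle shrinks to 0 within |w| < |z|, where the kernel is holomorphic and tends to 0 with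
    [w]. *)
Lemma cmean_kern_out rho z : 0 < rho -> rho < nm z -> cmean rho (kern z) = 0.
Proof.
move=> r0 rz; apply: nm_small => e e0.
have z0 := lt_trans r0 rz.
pose r1 := Num.min rho (Num.min (nm z / 2) (e * nm z / 4)).
have r10 : 0 < r1 by rewrite !lt_min r0 !divr_gt0// mulr_gt0.
have r1r : r1 <= rho by rewrite ge_min lexx.
have r1z : r1 <= nm z / 2 by rewrite !ge_min lexx orbT.
have r1e : r1 <= e * nm z / 4 by rewrite !ge_min lexx !orbT.
have r1z' : r1 < nm z by apply: le_lt_trans rz.
rewrite -(@cmean_const_hol _ r1 rho (kern z) r10 r1r); last first.
  move=> w /andP[_ wr]; apply: hol_kern; apply: nm_neq.
  by rewrite lt_eqF// (le_lt_trans wr).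
apply: (@le_trans _ _ (2 * (r1 / (nm z / 2)))).
  apply: cmean_bound; first exact: ltW.
    by apply: circ_cont_kern; [exact: ltW|rewrite lt_eqF].
  move=> w wr; apply: nm_kern_bound => //; first by rewrite divr_gt0.
  rewrite ler0_norm ?subr_le0 ?(ltW r1z')//; rlra.
have -> : 2 * (r1 / (nm z / 2)) = 4 * r1 / nm z by field; rewrite gt_eqF.
rewrite ler_pdivrMr//; rlra.
Qed.

(** The circle expands to infinity, where the kernel tends to 1. *)
Lemma cmean_kern_in rho z : nm z < rho -> cmean rho (kern z) = 1.
Proof.
move=> zr; apply/eqP; rewrite -subr_eq0; apply/eqP/nm_small => e e0.
have r0 := le_lt_trans (nm_ge0 z) zr.
pose r1 := Num.max rho (nm z + 2 * nm z / e).
have rr1 : rho <= r1 by rewrite le_max lexx.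
have r10 := lt_le_trans r0 rr1; have zr1 := lt_le_trans zr rr1.
rewrite (@cmean_const_hol _ rho r1 (kern z) r0 rr1); last first.
  move=> w /andP[wr _]; apply: hol_kern; apply: nm_neq.
  by rewrite gt_eqF// (lt_le_trans zr).
have ck1 : circ_cont r1 (kern z).
  by apply: circ_cont_kern; [exact: ltW|rewrite gt_eqF].
rewrite -(@cmean_cst _ r1 1) -(cmeanB ck1 (@circ_contC _ r1 1)).
have d0 : 0 < r1 - nm z by rewrite subr_gt0.
apply: (@le_trans _ _ (2 * (nm z / (r1 - nm z)))).
  apply: cmean_bound; first exact: ltW.
    exact: (circ_contB ck1 (@circ_contC _ r1 1)).
  move=> w wr; have wz : w - z != 0.
    by rewrite subr_eq0; apply: nm_neq; rewrite wr gt_eqF.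
  have -> : kern z w - 1 = z / (w - z) by rewrite /kern; field.
  rewrite nmM nmV; apply: ler_wpM2l; first exact: nm_ge0.
  by rewrite lef_pV2 ?posrE ?nm_gt0// -wr nmB_ge.
rewrite mulrA ler_pdivrMr//.
have : nm z + 2 * nm z / e <= r1 by rewrite le_max lexx orbT.
by rewrite -lerBrDl ler_pdivrMr// [X in _ <= X -> _]mulrC.
Qed.

(** The difference quotient of [g] at [z], times [w], has the same mean over both circles; expanding
    it gives the formula, since the mean of [kern z] is 0 inside |z| and 1 outside. *)
Lemma cauchy_annulus rho1 rho2 g z : 0 < rho1 -> rho1 < nm z -> nm z < rho2 ->
  (forall w, rho1 <= nm w <= rho2 -> hol g w) ->
  g z = cmean rho2 (fun w => g w * kern z w) - cmean rho1 (fun w => g w * kern z w).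
Proof.
move=> r10 r1z zr2 H; have z0 := lt_trans r10 r1z.
have r12 := lt_trans r1z zr2.
have [q [cq gq]] : hol g z by apply: H; rewrite !ltW.
pose h w := q w * w.
have hE w : w != z -> h w = g w * kern z w - g z * kern z w.
  by move=> wz; rewrite -mulrBl gq /h /kern; field; rewrite subr_eq0.
have holh w : rho1 <= nm w <= rho2 -> w != z -> hol h w.
  move=> wr wz.
  have : hol (fun w => g w * kern z w - g z * kern z w) w.
    apply: holB; apply: holM.
    - exact: H.
    - exact: hol_kern.
    - exact: hol_cst.
    - exact: hol_kern.
  move/hol_near; apply.
  have := @cont_neq0 K _ (fun w => w - z) w (hol_cont (holB (@hol_id K w) (@hol_cst K z w))).
  rewrite subr_eq0 => /(_ wz); apply: filterS => w'; rewrite subr_eq0 => /hE.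
  exact: esym.
have E : cmean rho1 h = cmean rho2 h.
  apply: (cmean_const r10 r1z zr2) => w.
    by move=> wr wz; apply: holh => //; exact: nm_neq.
  move=> wz; have [->|wz'] := eqVneq w z.
    exact: (contM cq (hol_cont (@hol_id K z))).
  by apply: hol_cont; apply: holh; rewrite ?wz ?(ltW r1z) ?(ltW zr2).
have cg rho : rho1 <= rho <= rho2 -> rho != nm z ->
    cmean rho h = cmean rho (fun w => g w * kern z w) - g z * cmean rho (kern z).
  move=> /andP[h1 h2] rz; have r0 := lt_le_trans r10 h1.
  have ck : circ_cont rho (kern z) by apply: circ_cont_kern => //; exact: ltW.
  have cgk : circ_cont rho g.
    by apply: circ_cont_hol; [exact: ltW|move=> w wr; apply: H; rewrite wr h1].
  rewrite -(cmeanZ (g z) ck) -cmeanB; last 2 first.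
  - exact: (circ_contM cgk ck).
  - exact: (circ_contM (@circ_contC _ rho (g z)) ck).
  apply: eq_cmean; first exact: ltW.
  by move=> w wr; apply: hE; apply: nm_neq; rewrite wr.
have e1 := cg rho1; have e2 := cg rho2; rewrite !lexx (ltW r12) /= in e1 e2.
move: E; rewrite (e1 isT (negbT (lt_eqF r1z))) (e2 isT (negbT (gt_eqF zr2))).
rewrite (cmean_kern_out r10 r1z) (cmean_kern_in zr2) mulr0 mulr1 subr0 => ->.
by rewrite opprB addrCA subrr addr0.
Qed.

(** The inner circle of [cauchy_annulus] shrinks to 0, and the bound on [g] makes its contribution
    vanish: an isolated bounded singularity at 0 is harmless. *)
Lemma cauchy_disc rho g z (M e : K) : 0 < nm z -> nm z < rho -> 0 < e ->
  (forall w, 0 < nm w <= rho -> hol g w) ->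
  (forall w, 0 < nm w < e -> nm (g w) <= M) ->
  g z = cmean rho (fun w => g w * kern z w).
Proof.
move=> z0 zr e0 H B; apply/eqP; rewrite -subr_eq0; apply/eqP/nm_small => e1 e10.
have M1 : 0 < `|M| + 1 by rewrite ltr_wpDl.
pose r1 := Num.min (Num.min (e / 2) (nm z / 2)) (e1 * nm z / (4 * (`|M| + 1))).
have r10 : 0 < r1.
  by rewrite !lt_min !divr_gt0 ?mulr_gt0.
have h1 : r1 <= e / 2 by rewrite !ge_min lexx.
have h2 : r1 <= nm z / 2 by rewrite !ge_min lexx !orbT.
have h3 : r1 <= e1 * nm z / (4 * (`|M| + 1)) by rewrite !ge_min lexx !orbT.
have r1z : r1 < nm z by apply: (le_lt_trans h2); rewrite gtr_pMr// invf_lt1// ltr1n.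
have r1e : r1 < e by apply: (le_lt_trans h1); rewrite gtr_pMr// invf_lt1// ltr1n.
rewrite (@cauchy_annulus r1 rho g z)//; last first.
  by move=> w /andP[w1 w2]; apply: H; rewrite (lt_le_trans r10 w1).
rewrite addrAC subrr add0r nmN.
apply: (@le_trans _ _ (2 * ((`|M| + 1) * (r1 / (nm z / 2))))).
  apply: cmean_bound; first exact: ltW.
    apply: circ_contM; last by apply: circ_cont_kern; [exact: ltW|rewrite lt_eqF].
    apply: circ_cont_hol; first exact: ltW.
    by move=> w wr; apply: H; rewrite wr r10 (ltW (lt_trans r1z zr)).
  move=> w wr; rewrite nmM; apply: ler_pM; rewrite ?nm_ge0//.
    apply: (@le_trans _ _ M); first by apply: B; rewrite wr r10.
    by apply: (le_trans (ler_norm M)); rewrite lerDl.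
  apply: nm_kern_bound => //; first by rewrite divr_gt0.
  rewrite ler0_norm ?subr_le0 ?(ltW r1z)//; clear -h2; rlra.
move: h3; rewrite ler_pdivlMr ?mulr_gt0// => h3.
have -> : 2 * ((`|M| + 1) * (r1 / (nm z / 2))) = r1 * (4 * (`|M| + 1)) / nm z.
  by field; rewrite gt_eqF.
by rewrite ler_pdivrMr.
Qed.

Lemma hol_bounded_near g z : hol g z ->
  exists M e : K, 0 < e /\ forall w, nm (w - z) < e -> nm (g w) <= M.
Proof.
move=> /hol_cont /cont_nm /(_ 1 ltr01) [e e0 H].
exists (nm (g z) + 1), e; split => // w /H h.
have := nmD (g w - g z) (g z); rewrite subrK => h'.
by apply: (le_trans h'); rewrite addrC lerD2l ltW.
Qed.

Lemma cauchy_disc_full rho g z : nm z < rho ->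
  (forall w, nm w <= rho -> hol g w) ->
  g z = cmean rho (fun w => g w * kern z w).
Proof.
move=> zr H; have r0 := le_lt_trans (nm_ge0 z) zr.
have H0 : hol g 0 by apply: H; rewrite nm0 ltW.
have [M [e [e0 HM]]] := hol_bounded_near H0.
have HM' w : 0 < nm w < e -> nm (g w) <= M.
  by move=> /andP[_ we]; apply: HM; rewrite subr0.
have H' w : 0 < nm w <= rho -> hol g w by move=> /andP[_]; exact: H.
(* [cauchy_disc] concerns points other than the centre; at the centre the formula is the mean value
   property, obtained by shrinking the circle. *)
have [z0|z0] := eqVneq z 0; last first.
  by apply: (cauchy_disc _ zr e0 H' HM'); rewrite nm_gt0.
rewrite z0; apply/eqP; rewrite -subr_eq0; apply/eqP/nm_small => e1 e10.
have cg : circ_cont rho g.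
  by apply: circ_cont_hol; [exact: ltW|move=> w wr; apply: H; rewrite wr].
have [e2 e20 He2] := (cont_nm _ _).1 (hol_cont H0) (e1 / 2) (divr_gt0 e10 (ltr0n _ 2)).
pose r1 := Num.min rho (e2 / 2).
have r10 : 0 < r1 by rewrite lt_min r0 divr_gt0.
have r1r : r1 <= rho by rewrite ge_min lexx.
have r1e : r1 < e2.
  by rewrite gt_min; apply/orP; right; rewrite gtr_pMr// invf_lt1// ltr1n.
have -> : cmean rho (fun w => g w * kern 0 w) = cmean r1 g.
  rewrite (@cmean_const_hol _ r1 rho g r10 r1r); last first.
    by move=> w /andP[_]; exact: H.
  apply: eq_cmean; first exact: ltW.
  move=> w wr; rewrite /kern subr0 divff ?mulr1// -nm_gt0 wr//.
have cg1 : circ_cont r1 g.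
  by apply: circ_cont_hol; [exact: ltW|move=> w wr; apply: H; rewrite wr].
have cg0 := @circ_contC _ r1 (g 0).
rewrite nm_dist -(@cmean_cst _ r1 (g 0)) -(cmeanB cg1 cg0).
have -> : e1 = 2 * (e1 / 2) by field.
apply: cmean_bound; first exact: ltW.
  exact: (circ_contB cg1 cg0).
by move=> w wr; apply/ltW/He2; rewrite subr0 wr.
Qed.

Definition tcoef rho k j : C := cmean rho (fun w => k w * w ^- j).

Lemma circ_cont_Vexp rho j : 0 < rho -> circ_cont rho (fun w => w ^- j).
Proof.
move=> r0; apply: circ_cont_hol; first exact: ltW.
move=> w wr; apply: holV; first by apply: holX; exact: hol_id.
by rewrite expf_neq0// -nm_gt0 wr.
Qed.

(** The kernel is a geometric series in z / w, whose tail from order [m] on is exactly (z / w)^m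
    times the kernel. *)
Lemma taylor_rem rho k (M : K) z m : circ_cont rho k ->
  (forall w, nm w = rho -> nm (k w) <= M) -> nm z < rho ->
  nm (cmean rho (fun w => k w * kern z w) - \sum_(j < m) tcoef rho k j * z ^+ j)
    <= 2 * (M * ((nm z / rho) ^+ m * (rho / (rho - nm z)))).
Proof.
move=> ck kM zr; have r0 := le_lt_trans (nm_ge0 z) zr.
have ckV j := circ_contM ck (@circ_cont_Vexp rho j r0).
have cs j : circ_cont rho (fun w => z ^+ j * (k w * w ^- j)).
  exact: (circ_contM (@circ_contC _ rho (z ^+ j)) (ckV j)).
have [cS ES] := cmean_sum (enum 'I_m) (fun j : 'I_m => cs j).
have cK : circ_cont rho (kern z) by apply: circ_cont_kern; [exact: ltW|rewrite gt_eqF].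
have -> : \sum_(j < m) tcoef rho k j * z ^+ j =
    cmean rho (fun w => \sum_(j <- enum 'I_m) z ^+ j * (k w * w ^- j)).
  rewrite ES big_enum /=; apply: eq_bigr => j _.
  by rewrite (cmeanZ _ (ckV j)) mulrC.
have ckK := circ_contM ck cK.
rewrite -(cmeanB ckK cS).
apply: cmean_bound; first exact: ltW.
  exact: (circ_contB ckK cS).
move=> w wr; have w0 : w != 0 by rewrite -nm_gt0 wr.
have wz : w - z != 0 by rewrite subr_eq0; apply: nm_neq; rewrite wr gt_eqF.
have -> : k w * kern z w - \sum_(j <- enum 'I_m) z ^+ j * (k w * w ^- j) =
   k w * ((z / w) ^+ m * kern z w).
  rewrite big_enum /= -[LHS]/(_ - _).
  have -> : \sum_(i < m) z ^+ i * (k w * w ^- i) = k w * \sum_(i < m) (z / w) ^+ i.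
    by rewrite mulr_sumr; apply: eq_bigr => i _; rewrite mulrCA expr_div_n.
  rewrite -mulrBr; congr (_ * _).
  have zw : 1 - z / w != 0.
    by rewrite -(divff w0) -mulrBl mulf_neq0// invr_neq0.
  have -> : \sum_(i < m) (z / w) ^+ i = (1 - (z / w) ^+ m) / (1 - z / w).
    apply: (mulIf zw); rewrite divfK//.
    by rewrite -[RHS]opprB subrX1 -[RHS]mulNr opprB [RHS]mulrC.
  rewrite /kern; move: ((z / w) ^+ m) => p; field.
  by rewrite w0 wz.
rewrite (nmM (k w)) (nmM ((z / w) ^+ m)).
apply: ler_pM; rewrite ?mulr_ge0 ?nm_ge0 ?kM//.
apply: ler_pM; rewrite ?nm_ge0//.
  by rewrite nmX nmM nmV wr.
rewrite /kern nmM nmV wr; apply: ler_wpM2l; first exact: ltW.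
by rewrite lef_pV2 ?posrE ?nm_gt0 ?subr_gt0// -wr nmB_ge.
Qed.

End Cauchy.

Transparent ccont.
Lemma ccontP (K : realType) (a b : K) (u : K -> Cx K) :
  ccont a b u <-> forall t, a <= t <= b -> {for t, continuous u}.
Proof. by []. Qed.
Opaque ccont.

(** * Consequences of Cauchy's formula *)

Section CauchyCor.
Variable K : realType.
Local Notation C := (Cx K).
Implicit Types (k h g : C -> C) (rho : K) (z w : C).

(** The coefficients vanish one after the other: once those below [j] are 0, divide the estimate of
    order j + 1 by z^j and let [z] tend to 0 within [Z]. *)
Lemma coef_zero (c : nat -> C) (Z : C -> Prop) :
  (forall e : K, 0 < e -> exists z, [/\ Z z, 0 < nm z & nm z < e]) ->
  (forall m, exists A e : K, 0 < e /\ forall z, Z z -> nm z < e ->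
     nm (\sum_(j < m) c j * z ^+ j) <= A * nm z ^+ m) ->
  forall j, c j = 0.
Proof.
move=> HZ H; elim/ltn_ind => j IH; apply: nm_small => e e0.
have [A [d [d0 HA]]] := H j.+1.
have A1 : 0 < `|A| + 1 by rewrite ltr_wpDl.
have d1 : 0 < Num.min d (e / (`|A| + 1)) by rewrite lt_min d0 divr_gt0.
have [z [Zz z0]] := HZ _ d1; rewrite lt_min => /andP[zd ze].
have := HA z Zz zd; rewrite big_ord_recr /= big1 ?add0r; last first.
  by move=> i _; rewrite IH ?mul0r.
rewrite nmM nmX exprS mulrA ler_pM2r ?exprn_gt0// => h.
apply: (le_trans h); apply: (@le_trans _ _ ((`|A| + 1) * nm z)).
  apply: ler_wpM2r; first exact: ltW.
  by apply: (le_trans (ler_norm A)); rewrite lerDl.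
by rewrite mulrC -ler_pdivlMr// ltW.
Qed.

(** Beyond order [d] the Taylor polynomial no longer changes, so the remainder is constant in the
    order; it also decays geometrically. *)
Lemma tcoef_monomial rho k z (M : K) d : circ_cont rho k ->
  (forall w, nm w = rho -> nm (k w) <= M) -> nm z < rho ->
  (forall j, j != d -> tcoef rho k j = 0) ->
  cmean rho (fun w => k w * kern z w) = tcoef rho k d * z ^+ d.
Proof.
move=> ck kM zr H; have r0 := le_lt_trans (nm_ge0 z) zr.
apply/eqP; rewrite -subr_eq0; apply/eqP; apply: nm_small => e e0.
have T m := taylor_rem (d.+1 + m) ck kM zr.
have S0 m : \sum_(j < d.+1 + m) tcoef rho k j * z ^+ j = tcoef rho k d * z ^+ d.
  have dm : (d < d.+1 + m)%N by rewrite addSn ltnS leq_addr.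
  rewrite (bigD1 (Ordinal dm))//= big1 ?addr0// => j jd.
  by rewrite H ?mul0r//; apply: contraNneq jd => jd; apply/eqP/val_inj.
set B := 2 * (M * (rho / (rho - nm z))).
set q := nm z / rho.
have q0 : 0 <= q by rewrite divr_ge0 ?nm_ge0// ltW.
have q1 : q < 1 by rewrite ltr_pdivrMr// mul1r.
have Tm m : nm (cmean rho (fun w => k w * kern z w) - tcoef rho k d * z ^+ d) <= `|B| * q ^+ m.
  have := T m; rewrite S0 => h; apply: (le_trans h).
  apply: (@le_trans _ _ (`|B| * q ^+ (d.+1 + m))).
    apply: (@le_trans _ _ (B * q ^+ (d.+1 + m))).
      by rewrite le_eqVlt; apply/orP; left; apply/eqP; rewrite /B -/q; ring.
    by apply: ler_wpM2r; [exact: exprn_ge0|exact: ler_norm].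
  apply: ler_wpM2l => //; rewrite exprD ler_piMl ?exprn_ge0//.
  by rewrite exprn_ile1// ltW.
have := @cvg_geometric K `|B| q; rewrite ger0_norm// => /(_ q1).
move/cvgrPdist_lt => /(_ e e0) [m _ Hm].
have := Hm m (leqnn m); rewrite sub0r normrN /geometric /= => hm.
apply: (le_trans (Tm m)); apply/ltW; apply: le_lt_trans hm.
exact: ler_norm.
Qed.

Lemma tcoef_eq0 rho k z (M : K) : circ_cont rho k ->
  (forall w, nm w = rho -> nm (k w) <= M) -> nm z < rho ->
  (forall j, tcoef rho k j = 0) -> cmean rho (fun w => k w * kern z w) = 0.
Proof.
by move=> ck kM zr H; rewrite (tcoef_monomial (d := 0) ck kM zr) ?H ?mul0r.
Qed.

Lemma compact_box (B : K) : compact [set z : C | `|Re z| <= B /\ `|Im z| <= B].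
Proof.
have seg := @segment_compact K (- B) B.
have c2 := compact_setX seg seg.
pose f (p : K * K) : C := p.1 +i* p.2.
have cf : continuous f.
  move=> p; apply: (@cont_complex K _ (fun p : K * K => p.1) (fun p : K * K => p.2)).
    exact: cvg_fst.
  exact: cvg_snd.
have -> : [set z : C | `|Re z| <= B /\ `|Im z| <= B] = f @` (`[- B, B] `*` `[- B, B]).
  apply/seteqP; split => [[x y] /= [hx hy]|_ [[x y] [/= hx hy] <-] /=].
    by exists (x, y) => //=; rewrite !in_itv /= -!ler_norml.
  by move: hx hy; rewrite !in_itv /= -!ler_norml.
apply: continuous_compact c2.
by apply: continuous_subspaceT.
Qed.

Lemma closed_nm (r : K) : closed [set z : C | nm z = r].
Proof.
have -> : [set z : C | nm z = r] = (fun z => nm z) @^-1` [set r] by [].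
apply: preimage_closed; last exact: closed_eq.
by move=> z _; apply: cont_nmT; exact: cvg_id.
Qed.

Lemma compact_circ (r : K) : compact [set z : C | nm z = r].
Proof.
apply: (subclosed_compact (@closed_nm r) (@compact_box r)) => z /= <-.
by split; [exact: nm_Re|exact: nm_Im].
Qed.

Lemma circ_bounded rho k : (forall w, nm w = rho -> {for w, continuous k}) ->
  exists M : K, forall w, nm w = rho -> nm (k w) <= M.
Proof.
move=> H.
have cA : compact ((fun w => nm (k w)) @` [set z : C | nm z = rho]).
  apply: continuous_compact (@compact_circ rho).
  apply: continuous_in_subspaceT => w; rewrite inE /= => wr.
  exact: (cont_nmT (H w wr)).
have [M [_ HM]] := compact_bounded cA.
exists (M + 1) => w wr; apply: le_trans (ler_norm _) _; apply: (HM (M + 1)).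
  by rewrite ltrDl.
by exists w.
Qed.

Lemma hol_shift g (c : C) z : hol g (c + z) -> hol (fun w => g (c + w)) z.
Proof.
move=> H; apply: (@hol_comp _ (fun w => c + w) g) => //.
by apply: holD; [exact: hol_cst|exact: hol_id].
Qed.

(** At the zeros of [g] the Taylor polynomials are as small as the remainders, so zeros accumulating
    at [c] annihilate all coefficients by [coef_zero]. *)
Lemma identity_disc rho g (c : C) :
  (forall w, nm (w - c) <= rho -> hol g w) ->
  (forall e : K, 0 < e -> exists w, [/\ g w = 0, 0 < nm (w - c) & nm (w - c) < e]) ->
  forall w, nm (w - c) < rho -> g w = 0.
Proof.
move=> H HZ w wr; have r0 := le_lt_trans (nm_ge0 _) wr.
pose g' u := g (c + u).
have H' u : nm u <= rho -> hol g' u.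
  by move=> ur; apply: hol_shift; apply: H; rewrite addrAC subrr add0r.
have Hr u : nm u = rho -> {for u, continuous g'}.
  by move=> ur; apply: hol_cont; apply: H'; rewrite ur.
have [M HM] := circ_bounded Hr.
have cg := circ_cont_at (ltW r0) Hr.
have -> : g w = g' (w - c) by rewrite /g' addrC subrK.
rewrite (cauchy_disc_full wr H'); apply: (tcoef_eq0 cg HM wr).
apply: (@coef_zero _ (fun z => g' z = 0)) => [e e0|m].
  have [u [gu u0 ue]] := HZ e e0; exists (u - c); split => //.
  by rewrite /g' addrC subrK.
have r20 : 0 < rho / 2 by rewrite divr_gt0.
exists (2 * (`|M| * 2) / rho ^+ m), (rho / 2); split => // z g'z zr.
have zr' : nm z < rho by apply: (lt_trans zr); rewrite gtr_pMr// invf_lt1// ltr1n.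
have := taylor_rem m cg HM zr'; rewrite -(cauchy_disc_full zr' H') g'z sub0r nmN => h.
apply: (le_trans h).
have -> : 2 * (`|M| * 2) / rho ^+ m * nm z ^+ m = 2 * (`|M| * ((nm z / rho) ^+ m * 2)).
  by rewrite expr_div_n; field; rewrite expf_neq0 // gt_eqF.
apply: ler_wpM2l => //; apply: ler_pM.
- by apply: le_trans (nm_ge0 _) (HM rho%:C _); rewrite nm_real gtr0_norm.
- rewrite mulr_ge0 ?exprn_ge0 ?divr_ge0 ?nm_ge0 ?(ltW r0)//.
  by rewrite subr_ge0 ltW.
- exact: ler_norm.
apply: ler_wpM2l; first by rewrite exprn_ge0// divr_ge0 ?nm_ge0// ltW.
rewrite ler_pdivrMr ?subr_gt0//; rlra.
Qed.

(** The tool for analytic continuation: zeros accumulating at 0 propagate along [0, 1]. The zeros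
    below the supremum of the parameters reached accumulate there, and [identity_disc] leads beyond
    it. *)
Lemma identity_segment g :
  (forall t : K, 0 <= t <= 1 -> exists2 e : K, 0 < e &
     forall w, nm (w - t%:C) < e -> hol g w) ->
  (forall e : K, 0 < e -> exists w, [/\ g w = 0, 0 < nm w & nm w < e]) ->
  forall t : K, 0 <= t <= 1 -> g t%:C = 0.
Proof.
move=> H HZ.
have loc (t : K) : 0 <= t <= 1 -> (forall e : K, 0 < e -> exists w, [/\ g w = 0, 0 < nm (w - t%:C) & nm (w - t%:C) < e]) ->
    exists2 e : K, 0 < e & forall w, nm (w - t%:C) < e -> g w = 0.
  move=> /H [e e0 He] Hz; exists (e / 2); first by rewrite divr_gt0.
  apply: identity_disc Hz => w we; apply: He; apply: (le_lt_trans we).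
  by rewrite gtr_pMr// invf_lt1// ltr1n.
pose A := [set t : K | 0 <= t <= 1 /\ forall s, 0 <= s <= t -> g s%:C = 0].
have [e0 e00 He0] : exists2 e : K, 0 < e & forall w, nm (w - 0%:C) < e -> g w = 0.
  apply: loc; first by rewrite lexx ler01.
  by move=> e /HZ [w Hw]; exists w; rewrite subr0.
have A0 : A 0.
  split; first by rewrite lexx ler01.
  move=> s s0; apply: He0; have -> : s = 0 by apply/le_anti; rewrite andbC.
  by rewrite subrr nm0.
have hA : has_sup A.
  by split; [exists 0|exists 1 => t [/andP[]]].
pose T := sup A.
have T0 : 0 <= T by apply: ub_le_sup; [exact: hA.2|].
have T1 : T <= 1 by apply: ge_sup; [exists 0|move=> t [/andP[]]].
have T01 : 0 <= T <= 1 by rewrite T0.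
have below (s : K) : 0 <= s -> s < T -> g s%:C = 0.
  move=> s0 sT; have Ts : 0 < T - s by rewrite subr_gt0.
  have [t [_ Ht]] := sup_adherent Ts hA; rewrite -/T subKr => st.
  by apply: Ht; rewrite s0 ltW.
have Tpos : 0 < T.
  apply: (@lt_le_trans _ _ (Num.min 1 (e0 / 2))).
    by rewrite lt_min ltr01 divr_gt0.
  apply: ub_le_sup; first exact: hA.2.
  split; first by rewrite ge_min lexx le_min ler01 divr_ge0// ltW.
  move=> s /andP[s0]; rewrite le_min => /andP[_ se]; apply: He0.
  rewrite subr0 nm_real ger0_norm//; apply: (le_lt_trans se).
  by rewrite gtr_pMr// invf_lt1// ltr1n.
have [e e10 He] : exists2 e : K, 0 < e & forall w, nm (w - T%:C) < e -> g w = 0.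
  apply: loc => // e e1.
  pose s := Num.max 0 (T - e / 2).
  have sT : s < T by rewrite gt_max Tpos gtrBl divr_gt0.
  exists s%:C; rewrite -rCB nm_real distrC gtr0_norm ?subr_gt0//; split => //.
    by apply: below => //; rewrite le_max lexx.
  rewrite ltrBlDr -ltrBlDl lt_max; apply/orP; right.
  by rewrite ltrD2l ltrN2 gtr_pMr// invf_lt1// ltr1n.
have [T1'|T1'] := ltP T 1.
  pose s := Num.min 1 (T + e / 2).
  have Ts : T < s by rewrite lt_min T1' ltrDl divr_gt0.
  have : A s.
    split; first by rewrite ge_min lexx andbT (le_trans T0)// ltW.
    move=> u /andP[u0 us]; have [uT|Tu] := ltP u T; first exact: below.
    apply: He; rewrite -rCB nm_real ger0_norm ?subr_ge0// ltrBlDl.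
    apply: (le_lt_trans us); rewrite gt_min; apply/orP; right.
    by rewrite ltrD2l gtr_pMr// invf_lt1// ltr1n.
  by move=> /(ub_le_sup hA.2); rewrite -/T leNgt Ts.
move=> t /andP[t0 t1]; have [tT|Tt] := ltP t T; first exact: below.
apply: He; have -> : t = T by apply/le_anti; rewrite Tt (le_trans t1).
by rewrite subrr nm0.
Qed.

(** As [g] decays at infinity, its means over large circles already determine the value at 0. *)
Lemma liouville0 g : (forall w, hol g w) ->
  (forall e : K, 0 < e -> exists B : K, forall w, B <= nm w -> nm (g w) <= e) ->
  g 0 = 0.
Proof.
move=> H HB; apply: nm_small => e e0.
have [B HBe] := HB (e / 2) (divr_gt0 e0 (ltr0n _ 2)).
pose rho := Num.max 1 B.
have r0 : 0 < rho by rewrite lt_max ltr01.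
have h0 : nm (0 : C) < rho by rewrite nm0.
rewrite (cauchy_disc_full h0 (fun w _ => H w)).
have -> : e = 2 * (e / 2) by field.
apply: cmean_bound; first exact: ltW.
  apply: circ_contM; first by apply: circ_cont_hol => //; exact: ltW.
  by apply: circ_cont_kern; [exact: ltW|rewrite nm0 gt_eqF].
move=> w wr; have w0 : w != 0 by rewrite -nm_gt0 wr.
rewrite /kern subr0 divff// mulr1; apply: HBe.
by rewrite wr le_max lexx orbT.
Qed.

(** Cauchy's formula for the powers of [g] gives |g z|^m <= A M^m with [A] independent of m, and A
    disappears as m grows. The bound [N] admits a singularity at 0. *)
Lemma max_principle rho g z (M N e : K) : 0 < nm z -> nm z < rho -> 0 < e ->
  (forall w, 0 < nm w <= rho -> hol g w) ->
  (forall w, 0 < nm w < e -> nm (g w) <= N) ->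
  (forall w, nm w = rho -> nm (g w) <= M) -> nm (g z) <= M.
Proof.
move=> z0 zr e0 H B HM; have r0 := lt_trans z0 zr.
have M0 : 0 <= M by apply: le_trans (nm_ge0 _) (HM rho%:C _); rewrite nm_real gtr0_norm.
have d0 : 0 < rho - nm z by rewrite subr_gt0.
set A := 2 * (rho / (rho - nm z)).
have A0 : 0 < A by rewrite mulr_gt0// divr_gt0.
have P m : nm (g z) ^+ m <= A * M ^+ m.
  have H' w : 0 < nm w <= rho -> hol (fun w => g w ^+ m) w.
    by move=> wr; apply: holX; exact: H.
  have B' w : 0 < nm w < e -> nm (g w ^+ m) <= N ^+ m.
    by move=> we; rewrite nmX lerXn2r ?nnegrE ?nm_ge0 ?B// (le_trans (nm_ge0 _) (B _ we)).
  rewrite -nmX (cauchy_disc z0 zr e0 H' B') /A -mulrA.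
  apply: cmean_bound; first exact: ltW.
    apply: circ_contM; last by apply: circ_cont_kern; [exact: ltW|rewrite gt_eqF].
    apply: circ_cont_hol; first exact: ltW.
    by move=> w wr; apply: H'; rewrite wr r0 lexx.
  move=> w wr; rewrite nmM mulrC; apply: ler_pM; rewrite ?nm_ge0//.
    apply: nm_kern_bound => //; exact: ler_norm.
  by rewrite nmX lerXn2r ?nnegrE ?nm_ge0 ?HM.
rewrite leNgt; apply/negP => Mz.
have z1 : 0 < nm (g z) by apply: le_lt_trans Mz.
pose q := M / nm (g z).
have q0 : 0 <= q by rewrite divr_ge0// ltW.
have q1 : q < 1 by rewrite ltr_pdivrMr// mul1r.
have := @cvg_geometric K A q; rewrite ger0_norm// => /(_ q1).
move/cvgrPdist_lt => /(_ 1 ltr01) [m _ Hm].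
have := Hm m (leqnn m); rewrite sub0r normrN /geometric /=.
have Aq : 0 <= A * q ^+ m by apply: mulr_ge0; [exact: ltW|exact: exprn_ge0].
rewrite (ger0_norm Aq).
have -> : A * q ^+ m = A * M ^+ m / nm (g z) ^+ m by rewrite /q expr_div_n mulrA.
rewrite ltr_pdivrMr ?exprn_gt0// mul1r => h.
by have := le_lt_trans (P m) h; rewrite ltxx.
Qed.

(** Removing from the Cauchy kernel its first-order expansion in [u] leaves u^2 / (w (w - u)), which
    is at most 2 |u|^2 / d^2 on |w| = d. *)
Lemma quad_estimate (d M : K) g (c : C) : 0 < d ->
  (forall w, nm (w - c) <= d -> hol g w) ->
  (forall w, nm (w - c) <= d -> nm (g w) <= M) ->
  forall u, nm u <= d / 2 ->
  nm (g (c + u) - g c - u * cmean d (fun w => g (c + w) / w))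
    <= 4 * M / d ^+ 2 * nm u ^+ 2.
Proof.
move=> d0 H HM u ud.
have ud' : nm u < d by apply: (le_lt_trans ud); rewrite gtr_pMr// invf_lt1// ltr1n.
pose g' w := g (c + w).
have H' w : nm w <= d -> hol g' w.
  by move=> wd; apply: hol_shift; apply: H; rewrite addrAC subrr add0r.
have HM' w : nm w <= d -> nm (g' w) <= M.
  by move=> wd; apply: HM; rewrite addrAC subrr add0r.
have z0 : nm (0 : C) < d by rewrite nm0.
have cg : circ_cont d g'.
  by apply: circ_cont_hol; [exact: ltW|move=> w wr; apply: H'; rewrite wr].
have cu : circ_cont d (kern u) by apply: circ_cont_kern; [exact: ltW|rewrite gt_eqF].
have c0 : circ_cont d (kern 0) by apply: circ_cont_kern; [exact: ltW|rewrite nm0 gt_eqF].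
have cV : circ_cont d (fun w => g' w / w).
  exact: (circ_contM cg (@circ_cont_Vexp _ d 1 d0)).
rewrite -[g (c + u)]/(g' u) -{1}[c]addr0 -[g (c + 0)]/(g' 0).
rewrite (cauchy_disc_full ud' H') (cauchy_disc_full z0 H').
have cgu := circ_contM cg cu; have cg0 := circ_contM cg c0.
have cuV := circ_contM (@circ_contC _ d u) cV.
rewrite -(cmeanZ u cV) -(cmeanB cgu cg0) -(cmeanB (circ_contB cgu cg0) cuV).
have -> : 4 * M / d ^+ 2 * nm u ^+ 2 = 2 * (M * (nm u ^+ 2 / (d * (d / 2)))).
  by field; rewrite gt_eqF.
apply: cmean_bound; first exact: ltW.
  exact: (circ_contB (circ_contB cgu cg0) cuV).
move=> w wd; have w0 : w != 0 by rewrite -nm_gt0 wd.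
have wu : w - u != 0 by rewrite subr_eq0; apply: nm_neq; rewrite wd gt_eqF.
have -> : g' w * kern u w - g' w * kern 0 w - u * (g' w / w) =
   g' w * (u ^+ 2 / (w * (w - u))).
  by rewrite /kern subr0; field; rewrite wu w0.
rewrite (nmM (g' w)); apply: ler_pM; rewrite ?nm_ge0 ?HM' ?wd//.
rewrite (nmM (u ^+ 2)) nmX nmV; apply: ler_wpM2l; first by rewrite exprn_ge0 ?nm_ge0.
rewrite (nmM w) wd lef_pV2 ?posrE ?mulr_gt0 ?divr_gt0 ?nm_gt0//.
apply: ler_wpM2l; first exact: ltW.
apply: (@le_trans _ _ (d - nm u)); first by clear -ud; rlra.
by rewrite -wd nmB_ge.
Qed.

(** The expansion of [quad_estimate] is uniform in [w], so its mean over the circle is an expansion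
    of the mean, to which [hol_quad] applies. *)
Lemma hol_param (rho d M : K) (k : C -> C -> C) (c : C) : 0 < rho -> 0 < d ->
  (forall w, nm w = rho -> forall z, nm (z - c) <= d -> hol (k w) z) ->
  (forall w, nm w = rho -> forall z, nm (z - c) <= d -> nm (k w z) <= M) ->
  (forall z, nm (z - c) <= d -> circ_cont rho (k^~ z)) ->
  hol (fun z => cmean rho (k^~ z)) c.
Proof.
move=> r0 d0 H HM Hc.
pose D w := cmean d (fun v => k w (c + v) / v).
have Q w : nm w = rho -> forall u, nm u <= d / 2 ->
   nm (k w (c + u) - k w c - u * D w) <= 4 * M / d ^+ 2 * nm u ^+ 2.
  by move=> wr u ud; exact: (quad_estimate d0 (H w wr) (HM w wr) ud).
have M0 : 0 <= M.
  apply: le_trans (nm_ge0 _) (HM rho%:C _ c _); first by rewrite nm_real gtr0_norm.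
  by rewrite subrr nm0 ltW.
have d20 : 0 < d / 2 by rewrite divr_gt0.
set B := 4 * M / d ^+ 2 in Q.
have B0 : 0 <= B.
  by rewrite /B; apply: divr_ge0; [exact: mulr_ge0|exact/exprn_ge0/ltW].
have cin u : nm u <= d / 2 -> nm (c + u - c) <= d.
  move=> ud; rewrite addrAC subrr add0r; apply: (le_trans ud).
  by rewrite ler_pdivrMr// ler_peMr ?ler1n// ltW.
have c00 : nm (c - c) <= d by rewrite subrr nm0 ltW.
(* The derivative [D] is a uniform limit on the circle of the continuous difference quotients [Qt],
   so its mean can be taken. *)
have cD : circ_cont rho D.
  apply/ccontP => t0 t0i; apply/cont_nmK => e e0.
  have B1 : 0 < B + 1 by rewrite ltr_wpDl.
  pose eta := Num.min (d / 2) (e / 3 / (B + 1)).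
  have eta0 : 0 < eta by rewrite lt_min d20 !divr_gt0.
  have etad : eta <= d / 2 by rewrite ge_min lexx.
  have etae : B * eta < e / 3.
    apply: (@lt_le_trans _ _ ((B + 1) * eta)); first by rewrite ltr_pM2r// ltrDl.
    by rewrite mulrC -ler_pdivlMr// ge_min lexx orbT.
  pose u : C := eta%:C.
  have nu : nm u = eta by rewrite nm_real gtr0_norm.
  have u0 : u != 0 by rewrite -nm_gt0 nu.
  pose Qt w := (k w (c + u) - k w c) / u.
  have QD t : nm (Qt (circ rho t) - D (circ rho t)) < e / 3.
    have := Q _ (nm_circ t (ltW r0)) u; rewrite nu => /(_ etad) h.
    have -> : Qt (circ rho t) - D (circ rho t) = (k (circ rho t) (c + u)
       - k (circ rho t) c - u * D (circ rho t)) / u by rewrite /Qt; field.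
    rewrite nmM nmV nu ltr_pdivrMr//; apply: (le_lt_trans h).
    by rewrite expr2 mulrA ltr_pM2r.
  have cQ : circ_cont rho Qt.
    have h1 := Hc (c + u) (cin u _); rewrite nu in h1.
    exact: (circ_contM (circ_contB (h1 etad) (Hc c c00)) (@circ_contC _ rho u^-1)).
  have [d3 d30 Hd3] := (cont_nmK _ _).1 ((ccontP _ _ _).1 cQ t0 t0i) (e / 3) (divr_gt0 e0 (ltr0n _ 3)).
  exists d3 => // t td.
  have -> : D (circ rho t) - D (circ rho t0) = (Qt (circ rho t) - Qt (circ rho t0))
     - (Qt (circ rho t) - D (circ rho t)) + (Qt (circ rho t0) - D (circ rho t0)) by ring.
  have := QD t; have := QD t0; have := Hd3 t td => h3 h4 h5.
  apply: (le_lt_trans (nmD _ _)).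
  apply: (@le_lt_trans _ _ (nm (Qt (circ rho t) - Qt (circ rho t0)) +
     nm (Qt (circ rho t) - D (circ rho t)) + nm (Qt (circ rho t0) - D (circ rho t0)))).
    by rewrite lerD2r; exact: nmB.
  have -> : e = e / 3 + e / 3 + e / 3 by field.
  by apply: ltrD => //; exact: ltrD.
apply: (@hol_quad _ _ _ (cmean rho D) (d / 2) (2 * B) d20) => w wd.
pose u := w - c.
have Ew : w = c + u by rewrite /u addrC subrK.
have cw := Hc w; rewrite Ew in cw; have {}cw := cw (cin u (ltW wd)).
have cc := Hc c c00.
have cuD := circ_contM (@circ_contC _ rho u) cD.
rewrite -/u mulrC -(cmeanZ u cD) Ew -(cmeanB cw cc) -(cmeanB (circ_contB cw cc) cuD) -mulrA.
apply: cmean_bound; first exact: ltW.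
  exact: (circ_contB (circ_contB cw cc) cuD).
by move=> v vr; apply: Q => //; exact: ltW.
Qed.

End CauchyCor.

(** * Extension to the punctured ball *)

Section Hermitian.
Variables (K : realType) (n : nat).
Local Notation C := (Cx K).
Local Notation V := 'cV[C]_n.
Implicit Types (z w a b : V) (c : C).

Definition ip z w : C := \sum_(j < n) z j 0 * (w j 0)^*.

Lemma ipDl z1 z2 w : ip (z1 + z2) w = ip z1 w + ip z2 w.
Proof. by rewrite -big_split; apply: eq_bigr => j _; rewrite mxE mulrDl. Qed.
Lemma ipZl c z w : ip (c *: z) w = c * ip z w.
Proof. by rewrite mulr_sumr; apply: eq_bigr => j _; rewrite mxE mulrA. Qed.
Lemma ip_conj z w : (ip z w)^* = ip w z.
Proof.
by rewrite rmorph_sum; apply: eq_bigr => j _; rewrite rmorphM /= conjCK mulrC.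
Qed.
Lemma ipDr z w1 w2 : ip z (w1 + w2) = ip z w1 + ip z w2.
Proof. by rewrite -ip_conj ipDl rmorphD /= !ip_conj. Qed.
Lemma ipZr c z w : ip z (c *: w) = c^* * ip z w.
Proof. by rewrite -ip_conj ipZl rmorphM /= ip_conj. Qed.
Lemma ipNl z w : ip (- z) w = - ip z w.
Proof. by rewrite -scaleN1r ipZl mulN1r. Qed.
Lemma ipNr z w : ip z (- w) = - ip z w.
Proof. by rewrite -scaleN1r ipZr rmorphN rmorph1 mulN1r. Qed.
Lemma ipBl z1 z2 w : ip (z1 - z2) w = ip z1 w - ip z2 w.
Proof. by rewrite ipDl ipNl. Qed.
Lemma ipBr z w1 w2 : ip z (w1 - w2) = ip z w1 - ip z w2.
Proof. by rewrite ipDr ipNr. Qed.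
Lemma ip0l w : ip 0 w = 0.
Proof. by rewrite -(scale0r w) ipZl mul0r. Qed.
Lemma ip0r w : ip w 0 = 0.
Proof. by rewrite -ip_conj ip0l rmorph0. Qed.

Lemma enorm_ge0 z : 0 <= enorm z.
Proof. exact: sqrtr_ge0. Qed.

Lemma enorm_sqrK z : enorm z ^+ 2 = \sum_(j < n) nm (z j 0) ^+ 2.
Proof. by rewrite sqr_sqrtr// sumr_ge0// => j _; exact: sqr_ge0. Qed.

Lemma enorm_sqr z : (enorm z ^+ 2)%:C = ip z z.
Proof. by rewrite enorm_sqrK rC_sum; apply: eq_bigr => j _; exact: nmsqr. Qed.

Lemma enorm_ip z (x : K) : 0 <= x -> ip z z = (x ^+ 2)%:C -> enorm z = x.
Proof.
move=> x0; rewrite -enorm_sqr => /rC_inj /eqP.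
by rewrite eqrXn2 ?enorm_ge0// => /eqP.
Qed.

Lemma enorm0 : enorm (0 : V) = 0.
Proof. by apply: enorm_ip => //; rewrite ip0l expr0n. Qed.

Lemma enorm_eq0 z : (enorm z == 0) = (z == 0).
Proof.
apply/eqP/eqP => [z0|->]; last exact: enorm0.
apply/colP => j; rewrite mxE; apply/eqP; rewrite -nm_eq0 -sqrf_eq0.
have := enorm_sqrK z; rewrite z0 expr0n /= => /esym/eqP.
rewrite psumr_eq0; last by move=> i _; exact: sqr_ge0.
by move=> /allP /(_ j); rewrite mem_index_enum => /(_ isT).
Qed.

Lemma enorm_gt0 z : (0 < enorm z) = (z != 0).
Proof. by rewrite lt_neqAle enorm_ge0 andbT eq_sym enorm_eq0. Qed.

Lemma enormZ c z : enorm (c *: z) = nm c * enorm z.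
Proof.
apply: enorm_ip; first by rewrite mulr_ge0 ?nm_ge0 ?enorm_ge0.
by rewrite ipZl ipZr -enorm_sqr mulrA -nmsqr -rCM exprMn.
Qed.

Lemma enormN z : enorm (- z) = enorm z.
Proof. by rewrite -scaleN1r enormZ nmN nm1 mul1r. Qed.

Lemma cauchy_schwarz z w : nm (ip z w) <= enorm z * enorm w.
Proof.
have [->|w0] := eqVneq w 0; first by rewrite ip0r nm0 enorm0 mulr0.
have ew : 0 < enorm w by rewrite enorm_gt0.
have ew2 : ((enorm w ^+ 2)%:C : C) != 0 by rewrite rC_eq0 expf_neq0// gt_eqF.
have := sqr_ge0 (enorm (z - (ip z w * ((enorm w ^+ 2)^-1)%:C) *: w)).
have -> : enorm (z - (ip z w * ((enorm w ^+ 2)^-1)%:C) *: w) ^+ 2 =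
   enorm z ^+ 2 - nm (ip z w) ^+ 2 / enorm w ^+ 2.
  have cE (x : C) (y : K) : (x * y%:C)^* = x^* * y%:C by rewrite rmorphM /= conj_rC.
  apply: rC_inj; rewrite enorm_sqr ipBl !ipBr !ipZr !ipZl -!enorm_sqr cE.
  rewrite -[ip w z]ip_conj rCB rCM nmsqr rCV.
  by move: ((enorm w ^+ 2)%:C : C) ew2 ((enorm z ^+ 2)%:C : C) => y y0 x; field.
rewrite subr_ge0 ler_pdivrMr ?exprn_gt0// -exprMn => h.
rewrite -(@ler_pXn2r _ 2)// ?nnegrE ?nm_ge0//.
by rewrite mulr_ge0// ?enorm_ge0.
Qed.

Lemma enormD z w : enorm (z + w) <= enorm z + enorm w.
Proof.
rewrite -(@ler_pXn2r _ 2)// ?nnegrE ?addr_ge0 ?enorm_ge0//.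
have -> : enorm (z + w) ^+ 2 = enorm z ^+ 2 + enorm w ^+ 2 + 2 * Re (ip z w).
  apply: rC_inj; rewrite enorm_sqr ipDl !ipDr -!enorm_sqr -[ip w z]ip_conj.
  case: (ip z w) => x y; rewrite conjE /=.
  by apply: cxP => /=; ring.
have : Re (ip z w) <= enorm z * enorm w.
  apply: le_trans (cauchy_schwarz z w); apply: le_trans (nm_Re _).
  exact: ler_norm.
rewrite sqrrD mulr2n; move: (Re _) (_ * _) (_ ^+ 2) (_ ^+ 2) => x y u v h; clear -h; rlra.
Qed.

Lemma enormB_ge z w : enorm z - enorm w <= enorm (z - w).
Proof. by rewrite lerBlDr -{1}(subrK w z) enormD. Qed.

Lemma enorm_pyth z w : ip z w = 0 -> enorm (z + w) ^+ 2 = enorm z ^+ 2 + enorm w ^+ 2.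
Proof.
move=> zw; apply: rC_inj; rewrite enorm_sqr ipDl !ipDr -!enorm_sqr.
by rewrite -[ip w z]ip_conj zw rmorph0 addr0 add0r rCD.
Qed.

Lemma nm_coord z j : nm (z j 0) <= enorm z.
Proof.
rewrite -(@ler_pXn2r _ 2)// ?nnegrE ?nm_ge0 ?enorm_ge0// enorm_sqrK.
by rewrite (bigD1 j)//= lerDl sumr_ge0// => i _; exact: sqr_ge0.
Qed.

Lemma enorm_le_sum z : enorm z <= \sum_(j < n) nm (z j 0).
Proof.
rewrite -(@ler_pXn2r _ 2)// ?nnegrE ?enorm_ge0 ?sumr_ge0//; last first.
  by move=> j _; exact: nm_ge0.
rewrite enorm_sqrK expr2 mulr_suml; apply: ler_sum => j _.
rewrite expr2; apply: ler_wpM2l; first exact: nm_ge0.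
by rewrite (bigD1 j)//= lerDl sumr_ge0// => i _; exact: nm_ge0.
Qed.

(** The Euclidean norm lies between the sup norm and [n] times the sup norm, so both define the same
    neighbourhoods. *)
Lemma nbhs_cv z (A : set V) :
  nbhs z A <-> exists2 e : K, 0 < e & forall w, enorm (w - z) < e -> A w.
Proof.
split => [/nbhs_ballP [e /= e0 sub]|[e e0 sub]].
  have [eE e0'] : e = (Re e)%:C /\ 0 < Re e.
    move: e0; rewrite ltcE /= => /andP[/eqP h1 h2]; split => //.
    by apply: cxP.
  exists (Re e) => // w we; apply: sub; split => // i j; rewrite ord1.
  rewrite -ball_normE /= distrC norm_nm eE ltcR.
  by apply: le_lt_trans we; have := nm_coord (w - z) i; rewrite !mxE.
have n1 : 0 < (n%:R + 1 : K) by rewrite ltr_wpDl.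
apply/nbhs_ballP; exists ((e / (n%:R + 1))%:C) => /=; first by rewrite ltcR divr_gt0.
move=> w [_ zw]; apply: sub; apply: (le_lt_trans (enorm_le_sum _)).
apply: (@le_lt_trans _ _ (\sum_(j < n) (e / (n%:R + 1)))).
  apply: ler_sum => j _; have := zw j 0; rewrite -ball_normE /= distrC norm_nm ltcR.
  by rewrite !mxE => /ltW.
have E : (e / (n%:R + 1)) *+ n = n%:R * e / (n%:R + 1) :> K by rewrite -mulrA mulr_natl.
rewrite sumr_const card_ord E ltr_pdivrMr// mulrC ltr_pM2l//.
by rewrite ltrDl.
Qed.

Lemma norm_mx_coord m (M : 'cV[C]_m) j : `|M j 0| <= `|M|.
Proof.
rewrite [leRHS]/Num.norm /= mx_normE -[leLHS]nngE num_le.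
exact: (le_bigmax _ (fun i : 'I_m * 'I_1 => `|M i.1 i.2|%:nng) (j, 0)).
Qed.

Lemma norm_mx_le z : `|z| <= (enorm z)%:C.
Proof.
have [z0|z0] := eqVneq (mx_norm z) 0.
  by rewrite [leLHS]/Num.norm /= z0 lecR enorm_ge0.
have [[i k] /= E] := @mx_norm_neq0 _ _ _ _ z0.
rewrite [leLHS]/Num.norm /= E norm_nm lecR ord1.
exact: nm_coord.
Qed.

End Hermitian.

(** * Holomorphy along curves *)

Section CurveHol.
Variables (K : realType).
Local Notation C := (Cx K).

(* Holomorphy along the holomorphic curves contained in a plane replaces joint
   holomorphy in [n] variables. *)
Definition chol n (u : 'cV[C]_n -> C) (z : 'cV[C]_n) :=
  forall (a b : 'cV[C]_n) (P Q : C -> C) (t : C),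
    (\forall s \near t, hol P s) -> (\forall s \near t, hol Q s) ->
    P t *: a + Q t *: b = z -> hol (fun s => u (P s *: a + Q s *: b)) t.

Lemma hol_o (g : C -> C) (z : C) :
  (forall e : K, 0 < e -> exists2 d : K, 0 < d &
    forall w, nm (w - z) < d -> nm (g w - g z) <= e * nm (w - z)) -> hol g z.
Proof.
move=> H; exists (fun w => if w == z then 0 else (g w - g z) / (w - z)).
split => [|w]; last first.
  case: eqVneq => [->|wz]; first by rewrite !subrr mulr0.
  by rewrite divfK ?subr_eq0.
apply/cont_nm => e e0; rewrite eqxx.
have [d d0 Hd] := H (e / 2) (divr_gt0 e0 (ltr0n _ 2)).
exists d => // w wd; have [_|wz] := eqVneq w z; first by rewrite subrr nm0.
have wz' : w - z != 0 by rewrite subr_eq0.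
rewrite subr0 nmM nmV ltr_pdivrMr ?nm_gt0//; apply: (le_lt_trans (Hd w wd)).
by rewrite ltr_pM2r ?nm_gt0// gtr_pMr// invf_lt1// ltr1n.
Qed.

Lemma hol_lip (g : C -> C) (z : C) : hol g z -> exists M d : K, [/\ 0 < M, 0 < d &
  forall w, nm (w - z) < d -> nm (g w - g z) <= M * nm (w - z)].
Proof.
move=> [q [/cont_nm cq gq]]; have [d d0 Hd] := cq 1 ltr01.
exists (nm (q z) + 1), d; split => //; first by rewrite ltr_wpDl ?nm_ge0.
move=> w wd; rewrite gq nmM; apply: ler_wpM2r; first exact: nm_ge0.
have := nmD (q w - q z) (q z); rewrite subrK => h; apply: (le_trans h).
by rewrite addrC lerD2l ltW// Hd.
Qed.

Lemma curve_lip n (a b : 'cV[C]_n) (P Q : C -> C) (t : C) :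
  hol P t -> hol Q t -> exists A d : K, [/\ 0 < A, 0 < d & forall s, nm (s - t) < d ->
    enorm ((P s *: a + Q s *: b) - (P t *: a + Q t *: b)) <= A * nm (s - t)].
Proof.
move=> hP hQ.
have [M1 [d1 [M10 d10 H1]]] := hol_lip hP.
have [M2 [d2 [M20 d20 H2]]] := hol_lip hQ.
exists (M1 * enorm a + M2 * enorm b + 1), (Num.min d1 d2); split.
- by rewrite ltr_wpDl// addr_ge0// mulr_ge0 ?enorm_ge0// ltW.
- by rewrite lt_min d10.
move=> s; rewrite lt_min => /andP[sd1 sd2].
have -> : (P s *: a + Q s *: b) - (P t *: a + Q t *: b) =
  (P s - P t) *: a + (Q s - Q t) *: b by rewrite opprD addrACA !scalerBl.
apply: (le_trans (enormD _ _)); rewrite !enormZ.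
apply: (@le_trans _ _ ((M1 * nm (s - t)) * enorm a + (M2 * nm (s - t)) * enorm b)).
  by apply: lerD; apply: ler_wpM2r; rewrite ?enorm_ge0 ?H1 ?H2.
rewrite !mulrDl mul1r -!mulrA ![nm _ * enorm _]mulrC lerDl.
exact: nm_ge0.
Qed.

Lemma curve_near n (a b : 'cV[C]_n) (P Q : C -> C) (t : C) (e : K) :
  hol P t -> hol Q t -> 0 < e -> exists2 d : K, 0 < d & forall s, nm (s - t) < d ->
    enorm ((P s *: a + Q s *: b) - (P t *: a + Q t *: b)) < e.
Proof.
move=> hP hQ e0; have [A [d [A0 d0 H]]] := curve_lip a b hP hQ.
exists (Num.min d (e / A)); first by rewrite lt_min d0 divr_gt0.
move=> s; rewrite lt_min => /andP[sd se]; apply: (le_lt_trans (H s sd)).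
by rewrite mulrC -ltr_pdivlMr.
Qed.

(** The chain rule: the remainder of the differential stays negligible along the curve by
    [curve_lip]. *)
Lemma diff_chol n N (f : 'cV[C]_n -> 'cV[C]_N) z (j : 'I_N) :
  differentiable f z -> chol (fun x => f x j 0) z.
Proof.
move=> df a b P Q t /nbhs_singleton hP /nbhs_singleton hQ Ez.
have := diff_locally df; set L := 'd f z => /eqaddoP Hd.
pose gam s := P s *: a + Q s *: b.
pose R s := f (gam s) j 0 - f z j 0 - L (gam s - z) j 0.
have LE s : L (gam s - z) j 0 = (P s - P t) * L a j 0 + (Q s - Q t) * L b j 0.
  have -> : gam s - z = (P s - P t) *: a + (Q s - Q t) *: b.
    by rewrite -Ez /gam opprD addrACA !scalerBl.
  by rewrite linearD !linearZ /= !mxE.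
have -> : (fun s => f (gam s) j 0) = fun s => f z j 0 +
    ((P s - P t) * L a j 0 + (Q s - Q t) * L b j 0) + R s.
  by apply/funext => s; rewrite -LE /R; ring.
apply: holD.
  apply: holD; first exact: hol_cst.
  by apply: holD; apply: holM; [apply: holB|exact: hol_cst|apply: holB|exact: hol_cst];
    rewrite //; exact: hol_cst.
apply: hol_o => e e0.
have Rt : R t = 0 by rewrite /R /gam Ez !subrr linear0 mxE subrr.
have [A [d [A0 d0 gamd]]] := curve_lip a b hP hQ.
rewrite Ez in gamd.
have e1 : 0 < (e / A)%:C :> C by rewrite ltcR divr_gt0.
have /nbhs_cv [d3 d30 H3] := Hd _ e1.
have d30' : 0 < d3 / A by rewrite divr_gt0.
exists (Num.min d (d3 / A)); first by rewrite !lt_min d0.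
move=> s; rewrite lt_min => /andP[sd sd3].
have gs := gamd s sd; rewrite -/(gam s) in gs; set h := gam s - z in gs.
have hd3 : enorm h < d3 by apply: (le_lt_trans gs); rewrite mulrC -ltr_pdivlMr.
have := H3 h; rewrite subr0 => /(_ hd3) /=.
rewrite -[(_ - _) h]/(f (h + z) - (f z + L h)) => hh.
rewrite Rt subr0 -lecR -norm_nm.
have -> : R s = (f (h + z) - (f z + L h)) j 0.
  by rewrite /R /h subrK !mxE opprD addrA.
apply: (le_trans (norm_mx_coord _ _)); apply: (le_trans hh).
have -> : (e * nm (s - t))%:C = (e / A)%:C * (A * nm (s - t))%:C :> C.
  by rewrite -rCM; congr (_%:C); field; rewrite gt_eqF.
apply: ler_wpM2l; first by rewrite lecR divr_ge0 ?ltW.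
apply: (@le_trans _ _ (enorm h)%:C); last by rewrite lecR.
exact: norm_mx_le.
Qed.

End CurveHol.

Lemma hol_nearC (K : realType) (c t : Cx K) : \forall s \near t, hol (fun=> c) s.
Proof. by near=> s; exact: hol_cst. Unshelve. all: by end_near. Qed.

Lemma hol_near_id (K : realType) (t : Cx K) : \forall s \near t, hol (@id (Cx K)) s.
Proof. by near=> s; exact: hol_id. Unshelve. all: by end_near. Qed.

(** A radius [rho] whose circle in the complex line of a point of norm [x] lies in the annulus keeps
    this property for points of norm [y] near [x]. *)
Lemma near_adm (K : realType) (x y D r rho : K) : 0 < rho ->
  x - y <= D -> y - x <= D -> D < x - r / rho -> D < rho^-1 - x ->
  r < rho * y /\ rho * y < 1.
Proof.
move=> rho0 h1 h2 h3 h4.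
have a : r / rho < y by rlra.
have b : y < rho^-1 by rlra.
by rewrite mulrC -ltr_pdivrMr// a -ltr_pdivlMr// div1r.
Qed.

Lemma enorm_dist (K : realType) n (y z : 'cV[Cx K]_n) :
  enorm z - enorm y <= enorm (y - z) /\ enorm y - enorm z <= enorm (y - z).
Proof.
by split; [rewrite -(enormN (y - z)) opprB; exact: enormB_ge | exact: enormB_ge].
Qed.

Lemma dist_box (K : realType) (x y D : K) :
  x - y <= D -> y - x <= D -> D < x -> D < 1 - x -> 0 < y /\ y < 1.
Proof. by move=> h1 h2 h3 h4; split; rlra. Qed.

(** * Hartogs extension by Cauchy integrals over slices *)

Section Hartogs.
Variables (K : realType) (n : nat) (r M : K) (u : 'cV[Cx K]_n -> Cx K).
Local Notation C := (Cx K).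
Local Notation V := 'cV[C]_n.
Hypotheses (n2 : (2 <= n)%N) (r01 : 0 < r < 1).
Hypothesis u_hol : forall z, annulus n r z -> chol u z.
Hypothesis u_bd : forall z, annulus n r z -> nm (u z) <= M.

Let r0 : 0 < r. Proof. by case/andP: r01. Qed.
Let r1 : r < 1. Proof. by case/andP: r01. Qed.

(** Two coordinates suffice. The extension depends on the dimension being at least 2 through this
    vector. *)
Lemma exists_orth (z : V) : exists b : V, b != 0 /\ ip b z = 0.
Proof.
case: n n2 z => [|[|m]] // _ z.
pose i0 : 'I_m.+2 := ord0; pose i1 : 'I_m.+2 := lift ord0 ord0.
have i01 : i1 != i0 by [].
have ipd (c : C) i : ip (c *: delta_mx i 0) z = c * (z i 0)^*.
  rewrite /ip (bigD1 i)//= big1 ?addr0 => [|j ji]; rewrite !mxE ?eqxx ?mulr1//.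
  by rewrite (negbTE ji) mulr0 mul0r.
have d0 i : delta_mx i 0 != 0 :> 'cV[C]_m.+2.
  apply/negP => /eqP/matrixP/(_ i 0); rewrite !mxE !eqxx /= => /eqP.
  by rewrite oner_eq0.
have [z0|z0] := eqVneq (z i0 0) 0.
  exists (delta_mx i0 0); split => //.
  by rewrite -[delta_mx _ _]scale1r ipd z0 rmorph0 mulr0.
exists ((z i1 0)^* *: delta_mx i0 0 - (z i0 0)^* *: delta_mx i1 0); split.
  apply/negP => /eqP/matrixP/(_ i1 0); rewrite !mxE !eqxx (negbTE i01) /= => /eqP.
  by rewrite mulr0 add0r mulr1 oppr_eq0 conjC_eq0 (negbTE z0).
by rewrite ipBl !ipd mulrC subrr.
Qed.

Lemma hol_ray (z : V) (w : C) : annulus n r (w *: z) -> hol (fun s => u (s *: z)) w.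
Proof.
move=> wz; have := @u_hol _ wz z 0 id (fun=> 0) w (hol_near_id w) (hol_nearC 0 w).
rewrite scaler0 addr0 => /(_ erefl).
by congr (hol _ w); apply/funext => s; rewrite addr0.
Qed.

(** The Cauchy integral, at the point w = 1, of the slice w |-> u (w z). *)
Definition kint rho (z : V) : C := cmean rho (fun w => u (w *: z) * kern 1 w).

Lemma annZ (z : V) (w : C) : r < nm w * enorm z -> nm w * enorm z < 1 ->
  annulus n r (w *: z).
Proof. by rewrite /annulus /= enormZ => -> ->. Qed.

Lemma circ_cont_kint rho (z : V) : 0 < rho -> rho != 1 ->
  r < rho * enorm z -> rho * enorm z < 1 ->
  circ_cont rho (fun w => u (w *: z) * kern 1 w).
Proof.
move=> rho0 rho1 h1 h2; apply: circ_contM.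
  apply: circ_cont_hol; first exact: ltW.
  by move=> w wr; apply: hol_ray; apply: annZ; rewrite wr.
by apply: circ_cont_kern; [exact: ltW|rewrite nm1].
Qed.

Lemma kint_bound rho (z : V) : 0 < rho -> rho != 1 ->
  r < rho * enorm z -> rho * enorm z < 1 ->
  nm (kint rho z) <= 2 * (M * (rho / `|rho - 1|)).
Proof.
move=> rho0 rho1 h1 h2; apply: cmean_bound; first exact: ltW.
  exact: circ_cont_kint.
move=> w wr; rewrite nmM; apply: ler_pM; rewrite ?nm_ge0//.
  by apply: u_bd; apply: annZ; rewrite wr.
by apply: nm_kern_bound; rewrite ?nm1// normr_gt0 subr_eq0.
Qed.

(** The pole of the kernel is at w = 1; for two radii on the same side of 1 the integrand is
    holomorphic between the circles. *)
Lemma kint_indep rho1 rho2 (z : V) : 0 < rho1 -> 0 < rho2 ->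
  (rho1 < 1) = (rho2 < 1) -> rho1 != 1 -> rho2 != 1 ->
  r < rho1 * enorm z -> rho1 * enorm z < 1 ->
  r < rho2 * enorm z -> rho2 * enorm z < 1 -> kint rho1 z = kint rho2 z.
Proof.
wlog r12 : rho1 rho2 / rho1 <= rho2 => [W|].
  have [h|/ltW h] := leP rho1 rho2; first exact: W.
  by move=> h1 h2 h3 h4 h5 h6 h7 h8 h9; apply/esym/W.
move=> h1 h2 h3 h4 h5 h6 h7 h8 h9.
apply: cmean_const_hol => // w /andP[w1 w2].
have ez : 0 < enorm z.
  by rewrite lt_neqAle enorm_ge0 andbT eq_sym; apply: contraTneq h6 => ->;
    rewrite mulr0 -leNgt ltW.
apply: holM.
  apply: hol_ray; apply: annZ.
    by apply: (lt_le_trans h6); rewrite ler_pM2r.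
  by apply: le_lt_trans h9; rewrite ler_pM2r.
apply: hol_kern; apply: nm_neq; rewrite nm1.
have [g1|g1] := ltP rho2 1; first by rewrite lt_eqF// (le_lt_trans w2).
rewrite gt_eqF//; apply: lt_le_trans w1; move: h3; rewrite [rho2 < 1]ltNge g1 /= => /negbT.
by rewrite -leNgt le_eqVlt eq_sym (negbTE h4).
Qed.

Lemma kint_hol rho (a b : V) (P Q : C -> C) (t : C) : 0 < rho -> rho != 1 ->
  (\forall s \near t, hol P s) -> (\forall s \near t, hol Q s) ->
  r < rho * enorm (P t *: a + Q t *: b) -> rho * enorm (P t *: a + Q t *: b) < 1 ->
  hol (fun s => kint rho (P s *: a + Q s *: b)) t.
Proof.
move=> rho0 rho1 nP nQ h1 h2.
set z := P t *: a + Q t *: b in h1 h2.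
pose e := Num.min (enorm z - r / rho) (rho^-1 - enorm z).
have e0 : 0 < e.
  rewrite lt_min !subr_gt0 ltr_pdivrMr// mulrC h1 /=.
  by rewrite -[rho^-1]mul1r ltr_pdivlMr// mulrC.
have [d1 d10 Hd1] := curve_near a b (nbhs_singleton nP) (nbhs_singleton nQ) e0.
have /nbhs_nm [d2 d20 Hd2] : \forall s \near t, hol P s /\ hol Q s.
  by apply: filterI.
pose d := Num.min d1 d2 / 2.
have d0 : 0 < d by rewrite divr_gt0// lt_min d10.
have dd : d < Num.min d1 d2 by rewrite gtr_pMr ?invf_lt1 ?ltr1n// lt_min d10.
have dn s : nm (s - t) <= d -> nm (s - t) < d1 /\ nm (s - t) < d2.
  by move=> sd; have := le_lt_trans sd dd; rewrite lt_min => /andP[].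
have adm s : nm (s - t) <= d -> r < rho * enorm (P s *: a + Q s *: b) < 1.
  move=> /dn [/Hd1 + _]; rewrite -/z lt_min => /andP[g1 g2].
  have [y1 y2] := enorm_dist (P s *: a + Q s *: b) z.
  by have [-> ->] := near_adm rho0 y1 y2 g1 g2.
pose k (w s : C) : C := u (w *: (P s *: a + Q s *: b)) * kern 1 w.
apply: (@hol_param _ rho d (M * (rho / `|rho - 1|)) k t rho0 d0).
- move=> w wr s sd; have /andP[s1 s2] := adm s sd.
  apply: holM; last exact: hol_cst.
  have sd2 : nm (s - t) < d2 by case: (dn s sd).
  have nn : \forall s' \near s, hol P s' /\ hol Q s'.
    apply/nbhs_nm; exists (d2 - nm (s - t)); first by rewrite subr_gt0.
    move=> s' hs; apply: Hd2; have := nmD (s' - s) (s - t).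
    rewrite addrA subrK => h; apply: (le_lt_trans h); by rewrite -ltrBrDr.
  have wP : \forall s' \near s, hol (fun s => w * P s) s'.
    by apply: filterS nn => s' [hP _]; apply: holM => //; exact: hol_cst.
  have wQ : \forall s' \near s, hol (fun s => w * Q s) s'.
    by apply: filterS nn => s' [_ hQ]; apply: holM => //; exact: hol_cst.
  have az : annulus n r (w *: (P s *: a + Q s *: b)) by apply: annZ; rewrite wr.
  have Es s' : (w * P s') *: a + (w * Q s') *: b = w *: (P s' *: a + Q s' *: b).
    by rewrite -!scalerA -scalerDr.
  have := @u_hol _ az a b _ _ s wP wQ (Es s).
  by congr (hol _ s); apply/funext => s'; rewrite Es.
- move=> w wr s sd; have /andP[s1 s2] := adm s sd.
  rewrite /k nmM; apply: ler_pM; rewrite ?nm_ge0//.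
    by apply: u_bd; apply: annZ; rewrite wr.
  by apply: nm_kern_bound; rewrite ?nm1// normr_gt0 subr_eq0.
- move=> s sd; have /andP[s1 s2] := adm s sd.
  exact: circ_cont_kint.
Qed.

(* Along a line [z + C b] with [b] orthogonal to [z] the inner part is entire
   and tends to 0, so it vanishes by Liouville's theorem. *)
Lemma kint_inner0 rho (z : V) : 0 < rho -> rho < 1 -> r < rho * enorm z ->
  rho * enorm z < 1 -> kint rho z = 0.
Proof.
move=> rho0 rho1 h1 h2.
have [b [b0 bz]] := exists_orth z.
have eb : 0 < enorm b by rewrite enorm_gt0.
have ez : 0 < enorm z.
  rewrite lt_neqAle enorm_ge0 andbT eq_sym; apply: contraTneq h1 => ->.
  by rewrite mulr0 -leNgt ltW.
have rz : r < enorm z by apply: (lt_le_trans h1); rewrite ger_pMl// ltW.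
(* [neg y] is a radius below 1 whose circle in the line of [y] lies in the annulus. It exists
   whenever r < |y|, even if |y| >= 1; therefore the inner part is defined on the whole line z + C
   b. *)
have [neg negP] : exists neg : V -> K, forall y, r < enorm y ->
    [/\ 0 < neg y, neg y < 1, r < neg y * enorm y & neg y * enorm y < 1].
  exists (fun y => (r / enorm y + Num.min 1 (enorm y)^-1) / 2) => y.
  set negy := (X in [/\ 0 < X, _, _ & _]) => ry; have y0 := lt_trans r0 ry.
  have A : r / enorm y < Num.min 1 (enorm y)^-1.
    by rewrite lt_min !ltr_pdivrMr// mul1r ry mulVf ?gt_eqF.
  have m1 : Num.min 1 (enorm y)^-1 <= 1 by rewrite ge_min lexx.
  have m2 : Num.min 1 (enorm y)^-1 <= (enorm y)^-1 by rewrite ge_min lexx orbT.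
  have A0 : 0 < r / enorm y by rewrite divr_gt0.
  have [N1 N2] : r / enorm y < negy /\ negy < Num.min 1 (enorm y)^-1.
    by have [? ?] := midf_lt A.
  split; first exact: lt_trans N1.
  - exact: lt_le_trans m1.
  - by rewrite -ltr_pdivrMr.
  - by rewrite -ltr_pdivlMr// div1r (lt_le_trans N2).
pose g (s : C) := kint (neg (z + s *: b)) (z + s *: b).
have eg s : enorm (z + s *: b) ^+ 2 = enorm z ^+ 2 + (nm s * enorm b) ^+ 2.
  by rewrite enorm_pyth ?enormZ// ipZr -[ip z b]ip_conj bz rmorph0 mulr0.
have rg s : r < enorm (z + s *: b).
  apply: (lt_le_trans rz); rewrite -(@ler_pXn2r _ 2)// ?nnegrE ?enorm_ge0//.
  by rewrite eg lerDl sqr_ge0.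
have holg t : hol g t.
  have [rhot [n1 n2' n3 n4]] : exists rhot, [/\ 0 < rhot, rhot < 1,
      r < rhot * enorm (z + t *: b) & rhot * enorm (z + t *: b) < 1].
    by exists (neg (z + t *: b)); exact: (negP _ (rg t)).
  have E s : z + s *: b = (1 : C) *: z + s *: b by rewrite scale1r.
  have H : hol (fun s : C => kint rhot ((1 : C) *: z + s *: b)) t.
    apply: kint_hol => //; first by rewrite lt_eqF.
    - exact: hol_nearC.
    - exact: hol_near_id.
    - by rewrite -E.
    - by rewrite -E.
  apply: (hol_near H).
  have e0 : 0 < Num.min (enorm (z + t *: b) - r / rhot) (rhot^-1 - enorm (z + t *: b)).
    rewrite lt_min !subr_gt0 ltr_pdivrMr// mulrC n3 /=.
    by rewrite -[rhot^-1]mul1r ltr_pdivlMr// mulrC.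
  have [d d0 Hd] := @curve_near K n z b (fun=> 1) id t _ (@hol_cst K 1 t) (@hol_id K t) e0.
  apply/nbhs_nm; exists d; first exact: d0.
  move=> s sd; have := Hd s sd; rewrite /= -(E s) -(E t) lt_min => /andP[g1 g2].
  have [y1 y2] := enorm_dist (z + s *: b) (z + t *: b).
  have [a1 a2] := near_adm n1 y1 y2 g1 g2.
  have [m1 m2 m3 m4] := negP _ (rg s).
  rewrite /g.
  have q1 : rhot != 1 by rewrite (lt_eqF n2').
  have q2 : neg (z + s *: b) != 1 by rewrite (lt_eqF m2).
  have q3 : (rhot < 1) = (neg (z + s *: b) < 1) by rewrite n2' m2.
  exact: (kint_indep n1 m1 q3 q1 q2 a1 a2 m3 m4).
have g0 : g 0 = 0.
  apply: liouville0 => // e e0.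
  (* Since neg y < 1 / |y|, the kernel on the circle is at most 1 / (|y| - 1); the constant makes 2
     |M| times this bound at most [e]. *)
  exists ((2 + 2 * `|M| / e) / enorm b) => s sB.
  set y := z + s *: b.
  have yB : 2 + 2 * `|M| / e <= enorm y.
    rewrite ler_pdivrMr// in sB; apply: (le_trans sB).
    rewrite -(@ler_pXn2r _ 2)// ?nnegrE ?enorm_ge0 ?mulr_ge0 ?nm_ge0 ?enorm_ge0//.
    by rewrite eg lerDr sqr_ge0.
  have M0 : 0 <= 2 * `|M| / e by rewrite divr_ge0 ?mulr_ge0// ltW.
  have y2 : 2 <= enorm y by apply: le_trans yB; rewrite lerDl.
  have y0 : 0 < enorm y by apply: lt_le_trans y2.
  have [m1 m2 m3 m4] := negP _ (rg s); rewrite -/y in m1 m2 m3 m4.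
  rewrite /g -/y; apply: (le_trans (kint_bound m1 _ m3 m4)); first by rewrite lt_eqF.
  rewrite ltr0_norm ?subr_lt0// opprB.
  have B1 : neg y / (1 - neg y) <= (enorm y - 1)^-1.
    rewrite ler_pdivrMr ?subr_gt0// mulrC ler_pdivlMr ?subr_gt0 ?(lt_le_trans _ y2) ?ltr1n//.
    by rewrite mulrBr mulr1 lerD2r ltW.
  have B2 : (enorm y - 1)^-1 <= (1 + 2 * `|M| / e)^-1.
    rewrite lef_pV2 ?posrE ?subr_gt0 ?(lt_le_trans _ y2) ?ltr1n ?ltr_wpDr//.
    by rewrite lerBrDr addrAC.
  have D0 : 0 < 1 + 2 * `|M| / e by rewrite ltr_wpDr.
  apply: (@le_trans _ _ (2 * (`|M| * (1 + 2 * `|M| / e)^-1))).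
    apply: ler_wpM2l => //; apply: (@le_trans _ _ (`|M| * (neg y / (1 - neg y)))).
      apply: ler_wpM2r; last exact: ler_norm.
      by rewrite divr_ge0 ?subr_ge0 ?ltW.
    by apply: ler_wpM2l => //; exact: le_trans B2.
  rewrite mulrA ler_pdivrMr// mulrDr mulr1 mulrCA divff ?gt_eqF// mulr1.
  by rewrite lerDr ltW.
have [m1 m2 m3 m4] := negP _ rz.
have q1 : rho != 1 by rewrite (lt_eqF rho1).
have q2 : neg z != 1 by rewrite (lt_eqF m2).
have q3 : (rho < 1) = (neg z < 1) by rewrite rho1 m2.
rewrite (kint_indep rho0 m1 q3 q1 q2 h1 h2 m3 m4).
by move: g0; rewrite /g scale0r addr0.
Qed.

Definition rad (z : V) : K := (Num.max 1 (r / enorm z) + (enorm z)^-1) / 2.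

(* The Cauchy integral over the slice [w |-> u (w *: z)]; [rad z] is one of the radii
   for which the circle of integration lies in the annulus, and the value does not
   depend on it. *)
Definition ext (z : V) : C := kint (rad z) z.

Lemma radP (z : V) : 0 < enorm z < 1 ->
  [/\ 1 < rad z, r < rad z * enorm z & rad z * enorm z < 1].
Proof.
move=> /andP[z0 z1].
have A : Num.max 1 (r / enorm z) < (enorm z)^-1.
  by rewrite gt_max invf_gt1// z1 /= ltr_pdivrMr// mulVf ?gt_eqF.
have m1 : 1 <= Num.max 1 (r / enorm z) by rewrite le_max lexx.
have m2 : r / enorm z <= Num.max 1 (r / enorm z) by rewrite le_max lexx orbT.
have [N1 N2] : Num.max 1 (r / enorm z) < rad z /\ rad z < (enorm z)^-1.
  by have [? ?] := midf_lt A.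
split; first exact: le_lt_trans N1.
- by rewrite -ltr_pdivrMr// (le_lt_trans m2).
- by rewrite -ltr_pdivlMr// div1r.
Qed.

Lemma ext_kint rho (z : V) : 0 < enorm z < 1 -> 1 < rho -> r < rho * enorm z ->
  rho * enorm z < 1 -> ext z = kint rho z.
Proof.
move=> z01 h1 h2 h3; have [m1 m2 m3] := radP z01.
have q1 : rad z != 1 by rewrite (gt_eqF m1).
have q2 : rho != 1 by rewrite (gt_eqF h1).
have q3 : (rad z < 1) = (rho < 1) by rewrite !ltNge (ltW m1) (ltW h1).
exact: (kint_indep (lt_trans ltr01 m1) (lt_trans ltr01 h1) q3 q1 q2 m2 m3 h2 h3).
Qed.

(** In Cauchy's formula on an annulus around w = 1 the inner circle contributes nothing, by
    [kint_inner0]. *)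
Lemma ext_annulus (z : V) : annulus n r z -> ext z = u z.
Proof.
move=> /andP[z0 z1]; have zp := lt_trans r0 z0.
have [|m1 m2 m3] := @radP z; first by rewrite zp.
pose rho1 : K := (r / enorm z + 1) / 2.
have rz1 : r / enorm z < 1 by rewrite ltr_pdivrMr// mul1r.
have rz0 : 0 < r / enorm z by rewrite divr_gt0.
have [h1 h2] : r / enorm z < rho1 /\ rho1 < 1 by have [? ?] := midf_lt rz1.
have h0 := lt_trans rz0 h1.
have h3 : r < rho1 * enorm z by rewrite -ltr_pdivrMr.
have h4 : rho1 * enorm z < 1.
  by apply: lt_trans z1; rewrite -[X in _ < X]mul1r ltr_pM2r.
have := @cauchy_annulus K rho1 (rad z) (fun w => u (w *: z)) 1 h0.
rewrite nm1 scale1r => /(_ h2 m1) ->; last first.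
  move=> w /andP[w1 w2]; apply: hol_ray; apply: annZ.
    by apply: (lt_le_trans h3); rewrite ler_pM2r.
  by apply: le_lt_trans m3; rewrite ler_pM2r.
by have := kint_inner0 h0 h2 h3 h4; rewrite /kint => ->; rewrite subr0.
Qed.

Lemma ext_hol (z : V) : 0 < enorm z < 1 -> chol ext z.
Proof.
move=> z01 a b P Q t nP nQ Ez; have [m1 m2 m3] := radP z01.
have m0 := lt_trans ltr01 m1.
have H : hol (fun s => kint (rad z) (P s *: a + Q s *: b)) t.
  by apply: kint_hol => //; rewrite ?Ez// gt_eqF.
apply: (hol_near H); case/andP: z01 => z0 z1.
have e0 : 0 < Num.min (Num.min (enorm z) (1 - enorm z))
    (Num.min (enorm z - r / rad z) ((rad z)^-1 - enorm z)).
  rewrite !lt_min !subr_gt0 z0 z1 ltr_pdivrMr// mulrC m2 /=.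
  by rewrite -[(rad z)^-1]mul1r ltr_pdivlMr// mulrC.
have [d d0 Hd] := curve_near a b (nbhs_singleton nP) (nbhs_singleton nQ) e0.
apply/nbhs_nm; exists d; first exact: d0.
move=> s sd; have := Hd s sd; rewrite Ez !lt_min => /andP[/andP[g1 g2] /andP[g3 g4]].
have [y1 y2] := enorm_dist (P s *: a + Q s *: b) z.
have [b1 b2] := dist_box y1 y2 g1 g2.
have [a1 a2] := near_adm m0 y1 y2 g3 g4.
have yb : 0 < enorm (P s *: a + Q s *: b) < 1 by rewrite b1.
exact: (esym (ext_kint yb m1 a1 a2)).
Qed.

(** With the radius p / |z| the integration runs over points of the fixed norm [p], and the kernel
    is at most p / (p - |z|), uniformly as [z] tends to 0. *)
Lemma ext_bounded (t0 : K) : t0 < 1 -> exists B : K, forall z : V,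
  0 < enorm z -> enorm z <= t0 -> nm (ext z) <= B.
Proof.
move=> t01; pose t1 := Num.max t0 r.
have t11 : t1 < 1 by rewrite gt_max t01.
have r_t1 : r <= t1 by rewrite le_max lexx orbT.
have t10 : 0 < t1 by apply: lt_le_trans r_t1.
pose p := (t1 + 1) / 2.
have [p1 p2] : t1 < p /\ p < 1 by have [? ?] := midf_lt t11.
have p0 := lt_trans t10 p1.
exists (2 * (`|M| * (p / (p - t1)))) => z z0 zt.
have zt1 : enorm z <= t1 by apply: (le_trans zt); rewrite le_max lexx.
have z1 : enorm z < 1 by apply: le_lt_trans t11.
have zp : enorm z < p by apply: le_lt_trans p1.
have q1 : 1 < p / enorm z by rewrite ltr_pdivlMr// mul1r.
have qE : p / enorm z * enorm z = p by rewrite divfK// gt_eqF.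
have q0 := lt_trans ltr01 q1.
have qr : r < p / enorm z * enorm z by rewrite qE (le_lt_trans r_t1).
have qs : p / enorm z * enorm z < 1 by rewrite qE.
have z01 : 0 < enorm z < 1 by rewrite z0.
have qn : p / enorm z != 1 by rewrite (gt_eqF q1).
rewrite (ext_kint z01 q1 qr qs).
apply: (le_trans (kint_bound q0 qn qr qs)).
rewrite gtr0_norm ?subr_gt0//.
have -> : p / enorm z / (p / enorm z - 1) = p / (p - enorm z).
  by field; rewrite !gt_eqF// subr_gt0.
apply: ler_wpM2l => //; apply: ler_pM => //.
- have az : annulus n r ((p / enorm z)%:C *: z).
    by apply: annZ; rewrite nm_real (gtr0_norm q0).
  exact: le_trans (nm_ge0 _) (u_bd az).
- by rewrite divr_ge0 ?subr_ge0// ltW.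
- exact: ler_norm.
apply: ler_wpM2l; first exact: ltW.
by rewrite lef_pV2 ?posrE ?subr_gt0// lerD2l lerN2.
Qed.

End Hartogs.

(** * Polarization *)

Section Polarization.
Variable K : realType.
Local Notation C := (Cx K).

Definition vchol n N (G : 'cV[C]_n -> 'cV[C]_N) (z : 'cV[C]_n) :=
  forall j, chol (fun x => G x j 0) z.

(** A Moebius map with value a^2 at 1, value b^2 at -1, and constant modulus a b on the imaginary
    axis. *)
Definition moeb (a b : K) (t : C) : C :=
  (a * b)%:C * (((a + b)%:C + (a - b)%:C * t) / ((a + b)%:C - (a - b)%:C * t)).

Section Moeb.
Variables (a b s d : K).
Hypotheses (a0 : 0 < a) (b0 : 0 < b) (s0 : 0 < s) (ds : d <= s / 8)
  (ha : `|a ^+ 2 - s| <= d) (hb : `|b ^+ 2 - s| <= d).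

(** This combines |a - b| (a + b) = |a^2 - b^2| <= 2 d with s <= (a + b)^2. *)
Lemma moeb_diff : `|a - b| * s <= 2 * d * (a + b).
Proof.
have [ds' s0'] := (ds, s0).
move: ha hb; rewrite !ler_norml => /andP[h1 h2] /andP[h3 h4].
have ab : 0 < a + b by rewrite addr_gt0.
have H : `|a - b| * (a + b) <= 2 * d.
  rewrite -(gtr0_norm ab) -normrM -subr_sqr ler_norml; apply/andP; split; rlra.
have sq : s <= (a + b) ^+ 2.
  rewrite sqrrD; have : 0 < a * b by rewrite mulr_gt0.
  rewrite mulr2n; rlra.
apply: (@le_trans _ _ (`|a - b| * (a + b) ^+ 2)); first by rewrite ler_wpM2l.
by rewrite expr2 mulrA ler_pM2r.
Qed.

Lemma moeb_den t : nm t <= 2 -> (a + b) / 2 <= nm ((a + b)%:C - (a - b)%:C * t).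
Proof.
have [ds' s0'] := (ds, s0).
move=> t2; have ab : 0 < a + b by rewrite addr_gt0.
have h : nm ((a - b)%:C * t) <= (a + b) / 2.
  rewrite nmM nm_real; apply: (@le_trans _ _ (`|a - b| * 2)); first by rewrite ler_wpM2l.
  rewrite -(ler_pM2r s0); apply: (@le_trans _ _ (2 * d * (a + b) * 2)).
    by rewrite mulrAC ler_pM2r// moeb_diff.
  have -> : 2 * d * (a + b) * 2 = 4 * d * (a + b) by ring.
  have -> : (a + b) / 2 * s = s / 2 * (a + b) by ring.
  by rewrite ler_pM2r//; move: ds; rlra.
have := nmB_ge (a + b)%:C ((a - b)%:C * t).
rewrite nm_real gtr0_norm// => h'.
by apply: le_trans h'; move: h; rlra.
Qed.

Lemma moeb_den0 t : nm t <= 2 -> (a + b)%:C - (a - b)%:C * t != 0.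
Proof.
by move=> /moeb_den h; rewrite -nm_gt0 (lt_le_trans _ h)// divr_gt0// addr_gt0.
Qed.

Lemma moeb_hol t : nm t <= 2 -> hol (moeb a b) t.
Proof.
move=> /moeb_den0 t0; apply: holM; first exact: hol_cst.
apply: holM.
  apply: holD; first exact: hol_cst.
  by apply: holM; [exact: hol_cst|exact: hol_id].
apply: holV => //; apply: holB; first exact: hol_cst.
by apply: holM; [exact: hol_cst|exact: hol_id].
Qed.

(** The constant is 1 + 32: a b is within [d] of [s], and as a b <= 2 s the other term is at most 16
    s |a - b| / (a + b), hence at most 32 d by [moeb_diff]. *)
Lemma moeb_near t : nm t <= 2 -> nm (moeb a b t - s%:C) <= 33 * d.
Proof.
have [ds' s0'] := (ds, s0).
move=> t2; have den := moeb_den t2; have den0 := moeb_den0 t2.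
have ab : 0 < a + b by rewrite addr_gt0.
move: ha hb; rewrite !ler_norml => /andP[h1 h2] /andP[h3 h4].
have d0 : 0 <= d by move: h1 h2; rlra.
have abs : `|a * b - s| <= d.
  have ab0 := mulr_gt0 a0 b0.
  have lo : (s - d) <= a * b.
    have [sd|sd] := leP (s - d) 0; first by rewrite (le_trans sd)// ltW.
    rewrite -(@ler_pXn2r _ 2)// ?nnegrE ?(ltW sd) ?(ltW ab0)// exprMn expr2.
    by apply: ler_pM; rewrite ?(ltW sd)//; [move: h1|move: h3]; rlra.
  have hi : a * b <= s + d.
    rewrite -(@ler_pXn2r _ 2)// ?nnegrE ?addr_ge0 ?(ltW ab0) ?(ltW s0)//.
    rewrite exprMn [leRHS]expr2.
    by apply: ler_pM; rewrite ?sqr_ge0//; [move: h2|move: h4]; rlra.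
  by rewrite ler_norml; apply/andP; split; [move: lo|move: hi]; rlra.
have -> : moeb a b t - s%:C = (a * b - s)%:C +
   (a * b)%:C * (2 * ((a - b)%:C * t) / ((a + b)%:C - (a - b)%:C * t)).
  rewrite /moeb (rCB (a * b)).
  move: ((a * b)%:C : C) (s%:C : C) ((a + b)%:C : C) ((a - b)%:C * t : C) den0 => p q x y xy.
  by field.
apply: (le_trans (nmD _ _)); rewrite nm_real.
have -> : 33 * d = d + 32 * d by ring.
apply: lerD => //; rewrite nmM nm_real gtr0_norm ?mulr_gt0//.
rewrite nmM nmV; apply: (@le_trans _ _ (a * b * (4 * `|a - b| / ((a + b) / 2)))).
  apply: ler_wpM2l; first by rewrite ltW// mulr_gt0.
  apply: ler_pM; rewrite ?nm_ge0 ?invr_ge0 ?nm_ge0//.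
    rewrite !nmM nm_real -rC_nat nm_real ger0_norm//.
    have -> : 4 * `|a - b| = 2 * (`|a - b| * 2) by ring.
    by rewrite ler_wpM2l// ler_wpM2l.
  by rewrite lef_pV2 ?posrE ?nm_gt0 ?divr_gt0.
have -> : a * b * (4 * `|a - b| / ((a + b) / 2)) = 8 * (a * b) * `|a - b| / (a + b).
  by field; rewrite gt_eqF.
rewrite ler_pdivrMr//.
have a2s : a * b <= 2 * s by move: abs ds; rewrite ler_norml => /andP[]; rlra.
apply: (@le_trans _ _ (8 * (2 * s) * `|a - b|)).
  by rewrite ler_wpM2r// ler_wpM2l.
have := moeb_diff; rlra.
Qed.

Lemma moeb1 : moeb a b 1 = (a ^+ 2)%:C.
Proof.
have a0' : (a%:C : C) != 0 by rewrite rC_eq0 gt_eqF.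
have b0' : (b%:C : C) != 0 by rewrite rC_eq0 gt_eqF.
rewrite /moeb !mulr1 -rCD -rCB -rCV -!rCM; congr (_%:C).
by field; rewrite !gt_eqF// (_ : a + b - (a - b) = 2 * b) ?mulr_gt0//; ring.
Qed.

Lemma moebN1 : moeb a b (-1) = (b ^+ 2)%:C.
Proof.
rewrite /moeb !mulrN1 opprK -rCD -rCB -rCV -!rCM; congr (_%:C).
by field; rewrite !gt_eqF// (_ : a + b + (a - b) = 2 * a) ?mulr_gt0//; ring.
Qed.

Lemma moeb_im (y : K) : nm (moeb a b (0 +i* y)) = a * b.
Proof.
rewrite /moeb nmM nm_real gtr0_norm ?mulr_gt0//.
have ab : 0 < a + b by rewrite addr_gt0.
have -> : (a + b)%:C + (a - b)%:C * (0 +i* y) = (a + b) +i* ((a - b) * y) :> C.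
  by apply: cxP => /=; ring.
have -> : (a + b)%:C - (a - b)%:C * (0 +i* y) = ((a + b) +i* ((a - b) * y))^* :> C.
  by rewrite conjE /=; apply: cxP => /=; ring.
rewrite nmM nmV nm_conj divff ?mulr1// nm_eq0.
by rewrite eq_complex /= gt_eqF.
Qed.

End Moeb.

Lemma scale_halves n (x y : 'cV[C]_n) (p q : C) :
  p *: (2^-1 *: (x + y)) + q *: (2^-1 *: (x - y)) =
  ((p + q) / 2) *: x + ((p - q) / 2) *: y.
Proof.
rewrite !scalerA !scalerDr scalerN addrACA -scalerDl -scalerBl.
by rewrite -mulrDl -mulrBl.
Qed.

Lemma half_sum (x y : C) : (x + y + (x - y)) / 2 = x.
Proof. by field. Qed.
Lemma half_diff (x y : C) : (x + y - (x - y)) / 2 = y.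
Proof. by field. Qed.
Lemma half_double (x : C) : (x + x) / 2 = x.
Proof. by field. Qed.

(* The two points are the values at [t = 1] and [t = -1] of a holomorphic curve [z(t)]
   which lies on the sphere of radius [s] for imaginary [t]; the function
   [ip (G (z(t))) (G (z(- t^* )))] is holomorphic and equal to [c] on the imaginary axis. *)
Lemma polarization n N (G : 'cV[C]_n -> 'cV[C]_N) (om : 'cV[C]_n) (s e0 : K) (c : C) :
  0 < s -> 0 < e0 -> enorm om = 1 ->
  (forall z, enorm (z - s%:C *: om) < e0 -> vchol G z) ->
  (forall z, enorm (z - s%:C *: om) < e0 -> enorm z = s -> ip (G z) (G z) = c) ->
  exists2 e1 : K, 0 < e1 & forall (b eta : K) (e : 'cV[C]_n),
    `|b - s| < e1 -> 0 <= eta < e1 -> enorm e = 1 -> ip e om = 0 ->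
    ip (G ((s ^+ 2 / b)%:C *: om + eta%:C *: e)) (G (b%:C *: om)) = c.
Proof.
move=> s0 e00 om1 HG Hs.
(* The estimates for [moeb] require s / 8; since the curve stays within 2 * 33 d of its base point,
   67 d <= e0 keeps it in the given ball. *)
pose d := Num.min (s / 8) (e0 / 67).
have d0 : 0 < d by rewrite lt_min !divr_gt0.
have ds : d <= s / 8 by rewrite ge_min lexx.
have de : 67 * d <= e0.
  by rewrite mulrC -ler_pdivlMr// ge_min lexx orbT.
exists (d / 3); first by rewrite divr_gt0.
move=> b eta e hb /andP[eta0 eta1] e1 eom.
have [a aE] : exists a, a = s ^+ 2 / b by exists (s ^+ 2 / b).
rewrite -aE.
move: (hb); rewrite ltr_norml => /andP[hb1 hb2].
have b0 : 0 < b by move: hb1 ds; rlra.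
have has : `|a - s| <= 2 * (d / 3).
  have -> : a - s = s * (s - b) / b by rewrite aE; field; rewrite gt_eqF.
  rewrite normrM normfV (gtr0_norm b0) ler_pdivrMr// normrM (gtr0_norm s0) distrC.
  apply: (@le_trans _ _ (s * (d / 3))).
    by rewrite ler_wpM2l// ltW.
  have -> : 2 * (d / 3) * b = 2 * b * (d / 3) by ring.
  by rewrite ler_pM2r ?divr_gt0//; move: hb1 ds; rlra.
move: (has); rewrite ler_norml => /andP[has1 has2].
have Z10 : 0 < a + eta by move: has1 ds eta0; rlra.
have Z20 : 0 < a - eta by move: has1 ds eta1; rlra.
have sq (x : K) : 0 < x -> exists2 y, 0 < y & y ^+ 2 = x.
  by move=> x0; exists (Num.sqrt x); rewrite ?sqrtr_gt0// sqr_sqrtr// ltW.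
have [u1 u10 u1E] := sq _ Z10; have [u2 u20 u2E] := sq _ Z20.
have [v v0 vE] := sq _ b0.
have h1 : `|u1 ^+ 2 - s| <= d by rewrite u1E ler_norml; apply/andP; split; rlra.
have h2 : `|u2 ^+ 2 - s| <= d by rewrite u2E ler_norml; apply/andP; split; rlra.
have h3 : `|v ^+ 2 - s| <= d by rewrite vE ler_norml; apply/andP; split; rlra.
have half0 : (2%:R : C) != 0 by rewrite pnatr_eq0.
(* The vectors p1 and p2 are orthogonal of squared norm 1/2. With u1^2 = a + eta, u2^2 = a - eta and
   v^2 = b, this gives gam 1 = a om + eta e and gam (-1) = b om, and for imaginary t the squared
   norm ((a + eta) b + (a - eta) b) / 2 = a b = s^2. *)
have [p1 p1E] : exists p1, p1 = (2^-1 : C) *: (om + e) by eexists.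
have [p2 p2E] : exists p2, p2 = (2^-1 : C) *: (om - e) by eexists.
pose gam t := moeb u1 v t *: p1 + moeb u2 v t *: p2.
have omom : ip om om = 1 by rewrite -enorm_sqr om1 expr1n.
have ee : ip e e = 1 by rewrite -enorm_sqr e1 expr1n.
have ome : ip om e = 0 by rewrite -ip_conj eom rmorph0.
have conj2 : (2^-1 : C)^* = 2^-1 by rewrite fmorphV rmorph_nat.
have p11 : ip p1 p1 = 2^-1.
  by rewrite ?p1E ?p2E ipZl ipZr conj2 ipDl !ipDr omom ee eom ome; field.
have p22 : ip p2 p2 = 2^-1.
  by rewrite ?p1E ?p2E ipZl ipZr conj2 ipBl !ipBr omom ee eom ome; field.
have p12 : ip p1 p2 = 0.
  by rewrite ?p1E ?p2E ipZl ipZr conj2 ipDl !ipBr omom ee eom ome; field.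
have p21 : ip p2 p1 = 0 by rewrite -ip_conj p12 rmorph0.
have gamn t : ip (gam t) (gam t) =
   ((nm (moeb u1 v t) ^+ 2 + nm (moeb u2 v t) ^+ 2) / 2)%:C.
  rewrite ipDl !ipDr !ipZl !ipZr p11 p22 p12 p21 rCM rCV rCD !nmsqr rC_nat.
  by field.
have gamE t : gam t - s%:C *: om =
   (moeb u1 v t - s%:C) *: p1 + (moeb u2 v t - s%:C) *: p2.
  rewrite !scalerBl /gam addrACA -opprD -scalerDr; congr (_ - _ *: _).
  by rewrite p1E p2E; apply/colP => i; rewrite !mxE; field.
have np1 : enorm p1 <= 1.
  rewrite -(@ler_pXn2r _ 2)// ?nnegrE ?enorm_ge0// expr1n -lecR enorm_sqr p11.
  by rewrite -rC_nat -rCV lecR; rlra.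
have np2 : enorm p2 <= 1.
  rewrite -(@ler_pXn2r _ 2)// ?nnegrE ?enorm_ge0// expr1n -lecR enorm_sqr p22.
  by rewrite -rC_nat -rCV lecR; rlra.
have gam_in t : nm t <= 2 -> enorm (gam t - s%:C *: om) < e0.
  move=> t2; rewrite gamE; apply: (@le_lt_trans _ _ (66 * d)).
    apply: (le_trans (enormD _ _)); rewrite !enormZ.
    have m1 := moeb_near u10 v0 s0 ds h1 h3 t2.
    have m2 := moeb_near u20 v0 s0 ds h2 h3 t2.
    have -> : 66 * d = 33 * d * 1 + 33 * d * 1 by ring.
    by apply: lerD; apply: ler_pM; rewrite ?nm_ge0 ?enorm_ge0.
  by apply: lt_le_trans de; rewrite ltr_pM2r// ltr_nat.
(* The reflection in the second slot fixes the imaginary axis pointwise and exchanges 1 and -1. *)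
pose h t : C := ip (G (gam t)) (G (gam (- t^* ))) - c.
have near2 (t : C) : nm t < 2 -> \forall t' \near t, nm t' <= 2.
  move=> t2; apply/nbhs_nm; exists (2 - nm t); first by rewrite subr_gt0.
  move=> t' tt; have := nmD (t' - t) t; rewrite subrK => hh.
  by apply: (le_trans hh); rewrite -lerBrDr ltW.
have hol_gam j t : nm t < 2 -> hol (fun t => G (gam t) j 0) t.
  move=> t2; have /nbhs_nm [dd dd0 Hdd] := near2 t t2.
  have nu1 : \forall s \near t, hol (moeb u1 v) s.
    apply/nbhs_nm; exists dd; first exact: dd0.
    by move=> t' /Hdd t2'; exact: (moeb_hol u10 v0 s0 ds h1 h3 t2').
  have nu2 : \forall s \near t, hol (moeb u2 v) s.
    apply/nbhs_nm; exists dd; first exact: dd0.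
    by move=> t' /Hdd t2'; exact: (moeb_hol u20 v0 s0 ds h2 h3 t2').
  exact: (@HG (gam t) (gam_in _ (ltW t2)) j p1 p2 (moeb u1 v) (moeb u2 v) t nu1 nu2 erefl).
have hol_h t : nm t <= 3 / 2 -> hol h t.
  move=> t32; have t2 : nm t < 2 by move: t32; rlra.
  apply: holB; last exact: hol_cst.
  apply: hol_sum => j _; apply: holM; first exact: hol_gam.
  apply: (@hol_conj K (fun t => G (gam (- t)) j 0)).
  apply: (@hol_comp K (fun t => - t) (fun t => G (gam t) j 0)).
    by apply: holN; exact: hol_id.
  by apply: hol_gam; rewrite nmN nm_conj.
have zer (y : K) : `|y| <= 2 -> h (0 +i* y) = 0.
  move=> y2; have ty : nm (0 +i* y : C) <= 2.
    by apply: (le_trans (nm_le_ReIm _)); rewrite /= normr0 add0r.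
  rewrite /h; have -> : - (0 +i* y : C)^* = 0 +i* y by rewrite conjE; apply: cxP => /=; rewrite ?oppr0 ?opprK.
  rewrite Hs ?subrr//; first exact: gam_in.
  apply: enorm_ip; first exact: ltW.
  rewrite gamn (moeb_im u10 v0) (moeb_im u20 v0) !exprMn u1E u2E vE.
  by congr (_%:C); rewrite aE; field; rewrite gt_eqF.
have H1 : h 1 = 0.
  apply: (@identity_disc K (3 / 2) h 0).
  - by move=> w; rewrite subr0; exact: hol_h.
  - move=> e2 e20; pose y := Num.min 1 (e2 / 2).
    have y0 : 0 < y by rewrite lt_min ltr01 divr_gt0.
    exists (0 +i* y); rewrite subr0.
    have ny : nm (0 +i* y : C) = y.
      have -> : 0 +i* y = 'i * y%:C :> C by apply: cxP => /=; ring.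
      by rewrite nmM nm_i mul1r nm_real gtr0_norm.
    rewrite ny; split => //.
      by apply: zer; rewrite gtr0_norm// ge_min; apply/orP; left; rlra.
    by rewrite gt_min; apply/orP; right; rlra.
  by rewrite subr0 nm1; rlra.
have c1 : - (1 : C)^* = -1 by rewrite conjC1.
move: H1; rewrite /h c1 => /eqP; rewrite subr_eq0 => /eqP <-.
congr (ip (G _) (G _)).
  rewrite /gam (moeb1 u10 v0) (moeb1 u20 v0) u1E u2E p1E p2E scale_halves rCD rCB.
  by rewrite half_sum half_diff.
rewrite /gam (moebN1 _ u10) (moebN1 _ u20) vE p1E p2E scale_halves.
by rewrite subrr mul0r scale0r addr0 half_double.
Qed.

End Polarization.

Lemma near_forall_ord (T : topologicalType) N (P : 'I_N -> T -> Prop) (t : T) :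
  (forall j, \forall s \near t, P j s) -> \forall s \near t, forall j, P j s.
Proof. exact: (@filter_forall T 'I_N P (nbhs t) _). Qed.

Section OpenDomain.
Variables (K : realType) (n N : nat).
Local Notation C := (Cx K).
Local Notation V := 'cV[C]_n.
Implicit Types (D : set V) (G : V -> 'cV[C]_N).

Definition eopen D := forall z, D z -> exists2 e : K, 0 < e &
  forall y, enorm (y - z) < e -> D y.

Lemma near_near (P : C -> Prop) (t : C) : (\forall s \near t, P s) ->
  \forall s \near t, \forall s' \near s, P s'.
Proof.
move=> /nbhs_nm [e e0 H]; apply/nbhs_nm; exists e => // s se.
apply/nbhs_nm; exists (e - nm (s - t)); first by rewrite subr_gt0.
move=> s' ss; apply: H; have := nmD (s' - s) (s - t); rewrite addrA subrK => h.
by apply: (le_lt_trans h); rewrite -ltrBrDr.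
Qed.

Lemma curve_open D (a b : V) (P Q : C -> C) (t : C) : eopen D ->
  (\forall s \near t, hol P s) -> (\forall s \near t, hol Q s) ->
  D (P t *: a + Q t *: b) -> \forall s \near t, D (P s *: a + Q s *: b).
Proof.
move=> oD nP nQ Dt; have [e e0 He] := oD _ Dt.
have [d d0 Hd] := curve_near a b (nbhs_singleton nP) (nbhs_singleton nQ) e0.
by apply/nbhs_nm; exists d => // s sd; apply: He; exact: Hd.
Qed.

Lemma vchol_near D G (a b : V) (P Q : C -> C) (t : C) j : eopen D ->
  (forall z, D z -> vchol G z) ->
  (\forall s \near t, hol P s) -> (\forall s \near t, hol Q s) ->
  D (P t *: a + Q t *: b) ->
  \forall s \near t, hol (fun s => G (P s *: a + Q s *: b) j 0) s.
Proof.
move=> oD HG nP nQ Dt.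
have h1 := curve_open oD nP nQ Dt; have h2 := near_near nP; have h3 := near_near nQ.
have : \forall s \near t, [/\ D (P s *: a + Q s *: b),
   (\forall s' \near s, hol P s') & (\forall s' \near s, hol Q s')].
  by apply: filterS3 h1 h2 h3.
by apply: filterS => s [Ds Ps Qs]; exact: (@HG _ Ds j a b P Q s Ps Qs erefl).
Qed.

Lemma near_conj (P : C -> Prop) (t : C) : (\forall s \near t^*, P s) ->
  \forall s \near t, P (s^* ).
Proof.
move=> /nbhs_nm [e e0 H]; apply/nbhs_nm; exists e => // s se; apply: H.
by rewrite -rmorphB nm_conj.
Qed.

(** The curve in the second slot runs through the conjugate parameter, which compensates the
    conjugation in [ip]. *)
Lemma pair_hol D G (a1 b1 a2 b2 : V) (P1 Q1 P2 Q2 : C -> C) (t : C) : eopen D ->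
  (forall z, D z -> vchol G z) ->
  (\forall s \near t, hol P1 s) -> (\forall s \near t, hol Q1 s) ->
  (\forall s \near t^*, hol P2 s) -> (\forall s \near t^*, hol Q2 s) ->
  D (P1 t *: a1 + Q1 t *: b1) -> D (P2 (t^* ) *: a2 + Q2 (t^* ) *: b2) ->
  \forall s \near t, hol (fun s => ip (G (P1 s *: a1 + Q1 s *: b1))
     (G (P2 (s^* ) *: a2 + Q2 (s^* ) *: b2))) s.
Proof.
move=> oD HG nP1 nQ1 nP2 nQ2 D1 D2.
have h1 : \forall s \near t, forall j, hol (fun s => G (P1 s *: a1 + Q1 s *: b1) j 0) s.
  by apply: near_forall_ord => j; exact: (vchol_near j oD HG nP1 nQ1 D1).
have h2 : \forall s \near t, forall j,
    hol (fun s => G (P2 s *: a2 + Q2 s *: b2) j 0) (s^* ).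
  suff : \forall s \near t^*, forall j,
      hol (fun s => G (P2 s *: a2 + Q2 s *: b2) j 0) s by exact: near_conj.
  by apply: near_forall_ord => j; exact: (vchol_near j oD HG nP2 nQ2 D2).
have : \forall s \near t, (forall j, hol (fun s => G (P1 s *: a1 + Q1 s *: b1) j 0) s) /\
    forall j, hol (fun s => G (P2 s *: a2 + Q2 s *: b2) j 0) (s^* ).
  exact: filterI.
apply: filterS => s [k1 k2]; apply: hol_sum => j _; apply: holM; first exact: k1.
exact: (hol_conj (k2 j)).
Qed.

Lemma vcurve_cont G (a b : V) (P Q : C -> C) (t : C) (e : K) :
  vchol G (P t *: a + Q t *: b) ->
  (\forall s \near t, hol P s) -> (\forall s \near t, hol Q s) -> 0 < e ->
  exists2 d : K, 0 < d & forall s, nm (s - t) < d ->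
    enorm (G (P s *: a + Q s *: b) - G (P t *: a + Q t *: b)) < e.
Proof.
move=> HG nP nQ e0; have N1 : 0 < (N%:R + 1 : K) by rewrite ltr_wpDl.
have : \forall s \near t, forall j, nm (G (P s *: a + Q s *: b) j 0 -
    G (P t *: a + Q t *: b) j 0) < e / (N%:R + 1).
  apply: near_forall_ord => j; apply/nbhs_nm.
  have := hol_cont (@HG j a b P Q t nP nQ erefl) => /cont_nm; apply.
  by rewrite divr_gt0.
move=> /nbhs_nm [d d0 Hd]; exists d => // s sd; apply: (le_lt_trans (enorm_le_sum _)).
apply: (@le_lt_trans _ _ (\sum_(j < N) (e / (N%:R + 1)))).
  by apply: ler_sum => j _; rewrite !mxE ltW// Hd.
have E : (e / (N%:R + 1)) *+ N = N%:R * e / (N%:R + 1) :> K by rewrite -mulrA mulr_natl.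
by rewrite sumr_const card_ord E ltr_pdivrMr// mulrC ltr_pM2l// ltrDl.
Qed.

Lemma compact_cv_box (B : K) :
  compact [set v : 'cV[C]_N | forall i, `|Re (v i 0)| <= B /\ `|Im (v i 0)| <= B].
Proof.
have := @rV_compact C N (fun=> [set z : C | `|Re z| <= B /\ `|Im z| <= B])
  (fun=> @compact_box K B).
set A := mkset _ => cA.
have -> : [set v : 'cV[C]_N | forall i, `|Re (v i 0)| <= B /\ `|Im (v i 0)| <= B] =
   (fun v : 'rV[C]_N => v^T) @` A.
  apply/seteqP; split => [v /= H|_ [v /= H <-] i].
    by exists (v^T); rewrite ?trmxK// => i; rewrite mxE.
  by rewrite mxE; exact: H.
apply: continuous_compact cA; apply: continuous_subspaceT => v U.
rewrite /= /nbhs /= => -[P HP sub]; exists (fun i j => P j i) => [i j|w wP] /=.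
  by have := HP j i; rewrite mxE.
by apply: sub => i j; rewrite mxE; exact: wP.
Qed.

Lemma cont_enorm (v : V) : {for v, continuous (@enorm K n)}.
Proof.
move=> A /nbhs_ballP [e /= e0 sub]; apply/nbhs_cv; exists e => // w we.
apply: sub; rewrite -ball_normE /= distrC; apply: le_lt_trans we.
rewrite ler_norml enormB_ge andbT lerNl opprB -(enormN (w - v)) opprB.
exact: enormB_ge.
Qed.

End OpenDomain.

Lemma compact_shell (K : realType) N (x y : K) :
  compact [set v : 'cV[Cx K]_N | x <= enorm v <= y].
Proof.
have cl : closed [set v : 'cV[Cx K]_N | x <= enorm v <= y].
  have -> : [set v : 'cV[Cx K]_N | x <= enorm v <= y] = @enorm K N @^-1` `[x, y].
    by apply/seteqP; split => v /=; rewrite in_itv.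
  apply: preimage_closed; last exact: interval_closed.
  by move=> v _; exact: cont_enorm.
apply: (subclosed_compact cl (@compact_cv_box K N y)) => v /= /andP[_ vy] i.
by split; apply: le_trans vy; apply: le_trans (nm_coord v i); [exact: nm_Re|exact: nm_Im].
Qed.

Definition punct (K : realType) n : set 'cV[Cx K]_n := [set z | 0 < enorm z < 1].
Arguments punct {K n}.

Lemma punct_open (K : realType) n : eopen (@punct K n).
Proof.
move=> z /= /andP[z0 z1]; exists (Num.min (enorm z) (1 - enorm z)).
  by rewrite lt_min z0 subr_gt0.
move=> y; rewrite lt_min => /andP[g1 g2].
have [y1 y2] := enorm_dist y z.
have [b1 b2] := dist_box y1 y2 g1 g2.
by rewrite /punct /= b1.
Qed.

Lemma line_hol (K : realType) n N (F : 'cV[Cx K]_n -> 'cV[Cx K]_N) (om : 'cV[Cx K]_n)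
  (s : Cx K) j : vchol F (s *: om) -> hol (fun s => F (s *: om) j 0) s.
Proof.
move=> HF; have E : s *: om + 0 *: om = s *: om by rewrite scale0r addr0.
have := @HF j om om id (fun=> 0) s (hol_near_id s) (hol_nearC _ _) E.
have -> // : (fun s : Cx K => F (id s *: om + 0 *: om) j 0) = fun s => F (s *: om) j 0.
by apply/funext => t; rewrite scale0r addr0.
Qed.

Lemma line_ip_hol (K : realType) n N (F : 'cV[Cx K]_n -> 'cV[Cx K]_N) (om : 'cV[Cx K]_n)
  (s : Cx K) v : vchol F (s *: om) -> hol (fun s => ip (F (s *: om)) v) s.
Proof.
move=> HF; apply: hol_sum => j _; apply: holM; first exact: line_hol.
exact: hol_cst.
Qed.

Lemma vline_cont (K : realType) n N (F : 'cV[Cx K]_n -> 'cV[Cx K]_N) (om : 'cV[Cx K]_n)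
  (s : Cx K) (e : K) : vchol F (s *: om) -> 0 < e ->
  exists2 d : K, 0 < d & forall t, nm (t - s) < d ->
    enorm (F (t *: om) - F (s *: om)) < e.
Proof.
move=> HF e0; have E (t : Cx K) : t *: om + 0 *: om = t *: om by rewrite scale0r addr0.
have HF' : vchol F (id s *: om + (fun=> 0 : Cx K) s *: om) by rewrite E.
have [d d0 Hd] := vcurve_cont HF' (hol_near_id s) (hol_nearC _ _) e0.
by exists d => // t td; have := Hd t td; rewrite /= !E.
Qed.

Lemma circ_max (K : realType) (rho : K) (k : Cx K -> Cx K) : 0 <= rho ->
  (forall w, nm w = rho -> {for w, continuous k}) ->
  exists2 c, nm c = rho & forall w, nm w = rho -> nm (k w) <= nm (k c).
Proof.
move=> rho0 H.
have ne : [set z : Cx K | nm z = rho] !=set0.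
  by exists (rho%:C); rewrite /= nm_real ger0_norm.
have cc : {within [set z : Cx K | nm z = rho], continuous (fun w => nm (k w))}.
  apply: continuous_in_subspaceT => w; rewrite inE /= => wr.
  exact: (cont_nmT (H w wr)).
have [c cA Hc] := compact_EVT_max ne (@compact_circ K rho) cc.
exists c; first by move: cA; rewrite inE.
by move=> w wr; apply: Hc; rewrite inE.
Qed.

(** The doubled tolerance adds the error of approaching a boundary point to that of the boundary
    behaviour. *)
Lemma two_values (K : realType) (R v : K) :
  (forall e : K, 0 < e -> `|v - R| < e + e \/ `|v - 1| < e + e) -> v = R \/ v = 1.
Proof.
move=> H; have [h|h] := eqVneq v R; first by left.
have [h'|h'] := eqVneq v 1; first by right.
have a1 : 0 < `|v - R| by rewrite normr_gt0 subr_eq0.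
have a2 : 0 < `|v - 1| by rewrite normr_gt0 subr_eq0.
have m0 : 0 < Num.min `|v - R| `|v - 1| by rewrite lt_min a1.
have hm : 0 < Num.min `|v - R| `|v - 1| / 2 by rlra.
have m1 : Num.min `|v - R| `|v - 1| <= `|v - R| by rewrite ge_min lexx.
have m2 : Num.min `|v - R| `|v - 1| <= `|v - 1| by rewrite ge_min lexx orbT.
exfalso; case: (H _ hm); rlra.
Qed.

(** * The extended map and its norm on the inner sphere *)

Section Extension.
Variables (K : realType) (n N : nat) (r R : K) (f : 'cV[Cx K]_n -> 'cV[Cx K]_N).
Hypotheses (n2 : (2 <= n)%N) (r01 : 0 < r < 1) (R01 : 0 < R < 1).
Hypothesis f_hol : holomorphic_on (annulus n r) f.
Hypothesis f_proper : proper_map (annulus n r) (annulus N R) f.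
Local Notation C := (Cx K).
Local Notation V := 'cV[C]_n.

(** The preimage of the compact shell R + eps <= |v| <= 1 - eps is compact, so the norms of its
    points form a closed set; this set misses [r] and 1, which are not norms of points of the
    annulus. *)
Lemma boundary_behaviour (s eps : K) : s = r \/ s = 1 -> 0 < eps ->
  exists2 d : K, 0 < d & forall z, annulus n r z -> `|enorm z - s| < d ->
    enorm (f z) < R + eps \/ 1 - eps < enorm (f z).
Proof.
move=> Hs e0; have [_ Hp] := f_proper.
pose A := [set v : 'cV[C]_N | R + eps <= enorm v <= 1 - eps].
have cA : compact A by exact: compact_shell.
have sA : A `<=` annulus N R.
  move=> v /= /andP[h1 h2]; apply/andP; split; first by apply: lt_le_trans h1; rewrite ltrDl.
  by apply: le_lt_trans h2 _; rewrite gtrBl.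
have := Hp A sA cA; set P := _ `&` _ => cP.
have cI : compact (@enorm K n @` P).
  apply: continuous_compact cP; apply: continuous_subspaceT => v.
  exact: cont_enorm.
have oI := closed_openC (compact_closed (@norm_hausdorff _ _) cI).
have nI : (~` (@enorm K n @` P)) s.
  move=> [z [/= /andP[h1 h2] _] E]; move: h1 h2; rewrite E.
  by case: Hs => ->; rewrite ltxx.
have /nbhs_ballP [d /= d0 sub] : nbhs s (~` (@enorm K n @` P)) by exact: open_nbhs_nbhs.
exists d => // z az zd.
have nz : ~ (@enorm K n @` P) (enorm z).
  by apply: sub; rewrite -ball_normE /= distrC.
have [h|h] := ltP (enorm (f z)) (R + eps); first by left.
right; rewrite ltNge; apply/negP => h'; apply: nz; exists z => //; split => //.
by apply/andP; split.
Qed.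

Lemma f_chol z : annulus n r z -> vchol f z.
Proof. by move=> az j; apply: diff_chol; exact: f_hol. Qed.

Lemma f_coord_bd j z : annulus n r z -> nm (f z j 0) <= 1.
Proof.
move=> az; apply: le_trans (nm_coord _ _) _.
by have /andP[_ /ltW] := f_proper.1 z az.
Qed.

Definition Fext (z : V) : 'cV[C]_N := \col_j ext r (fun x => f x j 0) z.

Lemma Fext_annulus z : annulus n r z -> Fext z = f z.
Proof.
move=> az; apply/colP => j; rewrite mxE.
apply: (@ext_annulus _ _ _ 1) => // y ay; [exact: f_chol|exact: f_coord_bd].
Qed.

Lemma Fext_hol z : punct z -> vchol Fext z.
Proof.
move=> pz j; have -> : (fun x => Fext x j 0) = ext r (fun x => f x j 0).
  by apply/funext => x; rewrite mxE.
by apply: (@ext_hol _ _ _ 1) => // y ay; [exact: f_chol|exact: f_coord_bd].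
Qed.

Lemma Fext_bounded : exists B : K, forall z, 0 < enorm z -> enorm z <= 1 / 2 ->
  enorm (Fext z) <= B.
Proof.
have h2 : 1 / 2 < 1 :> K by rlra.
have H j : exists B : K, forall z : V, 0 < enorm z -> enorm z <= 1 / 2 ->
    nm (Fext z j 0) <= B.
  have [B HB] := @ext_bounded K n r 1 (fun x => f x j 0) r01
     (fun z az => f_chol az j) (@f_coord_bd j) _ h2.
  by exists B => z z0 zt; rewrite mxE; exact: HB.
have [B HB] := choice H.
exists (\sum_j B j) => z z0 zt; apply: le_trans (enorm_le_sum _) _.
by apply: ler_sum => j _; exact: HB.
Qed.

Opaque Fext.

(** [z] is approached along its ray from outside, where [Fext] is [f] and the norm of [f] is close
    to [R] or to 1. *)
Lemma Fext_inner_cases z : enorm z = r -> enorm (Fext z) = R \/ enorm (Fext z) = 1.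
Proof.
case/andP: r01 => r0 r1; case/andP: R01 => R0 R1 zr.
have pz : punct z by rewrite /punct /= zr r0.
have pz1 : vchol Fext (1 *: z) by rewrite scale1r; exact: Fext_hol.
have H (eps : K) : 0 < eps -> `|enorm (Fext z) - R| < eps + eps \/ `|enorm (Fext z) - 1| < eps + eps.
  move=> e0; have [d d0 Hd] := vline_cont pz1 e0.
  have [d2 d20 Hd2] := boundary_behaviour (or_introl erefl) e0.
  have m0 : 0 < Num.min (Num.min d d2) (1 - r).
    by rewrite !lt_min d0 d20 subr_gt0.
  have [m mE] : exists m, m = Num.min (Num.min d d2) (1 - r) by eexists.
  rewrite -mE in m0; have m1 : m <= d by rewrite mE !ge_min lexx.
  have m2 : m <= d2 by rewrite mE !ge_min lexx orbT.
  have m3 : m <= 1 - r by rewrite mE !ge_min lexx orbT.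
  have h0 : 0 < m / 2 by rlra.
  pose t : C := (1 + m / 2)%:C.
  have td : nm (t - 1) < d.
    have -> : t - 1 = (m / 2)%:C by apply: cxP => /=; ring.
    by rewrite nm_real gtr0_norm//; rlra.
  have tz : enorm (t *: z) = r + m / 2 * r.
    by rewrite enormZ nm_real zr gtr0_norm; [ring|rlra].
  have mr : 0 < m / 2 * r /\ m / 2 * r < m / 2.
    by split; [exact: mulr_gt0|rewrite gtr_pMr].
  have at_ : annulus n r (t *: z).
    by case: mr => mr1 mr2; rewrite /annulus /= tz; apply/andP; split; rlra.
  have := Hd t td; rewrite scale1r (Fext_annulus at_) => ft.
  have q1 := enormB_ge (f (t *: z)) (Fext z).
  have q2 := enormB_ge (Fext z) (f (t *: z)).
  have q3 := enormN (Fext z - f (t *: z)); rewrite opprB in q3.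
  have /andP[f1 f2] := f_proper.1 _ at_.
  have ab : `|enorm (t *: z) - r| < d2.
    case: mr => mr1 mr2; rewrite tz [r + _]addrC addrK gtr0_norm//; rlra.
  by case: (Hd2 _ at_ ab) => h; [left|right]; rewrite ltr_norml; apply/andP;
    (split; [clear -q1 q2 q3 ft f1 f2 h e0|clear -q1 q2 q3 ft f1 f2 h e0]); rlra.
exact: two_values.
Qed.

(** If |F z| = 1, then s |-> <F (s z), F z> has modulus 1 at s = 1 but modulus below 1 on a circle
    |s| = rho > 1 with [s z] in the annulus, against the maximum principle. *)
Lemma Fext_inner z : enorm z = r -> enorm (Fext z) = R.
Proof.
case/andP: r01 => r0 r1 zr; case: (Fext_inner_cases zr) => // F1; exfalso.
have cs v : nm (ip v (Fext z)) <= enorm v.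
  by have := cauchy_schwarz v (Fext z); rewrite F1 mulr1.
have [g gE] : exists g : C -> C, forall s, g s = ip (Fext (s *: z)) (Fext z) by eexists.
have gF : g = fun s => ip (Fext (s *: z)) (Fext z) by apply/funext.
have [rho rhoE] : exists rho : K, rho = (1 + r^-1) / 2 by eexists.
have ri : 1 < r^-1 by rewrite invf_gt1.
have rho1 : 1 < rho by rlra.
have rho2 : rho < r^-1 by rlra.
have rr : rho * r < 1 by rewrite -ltr_pdivlMr ?div1r.
have pw (w : C) : 0 < nm w <= rho -> punct (w *: z).
  move=> /andP[w0 wr]; rewrite /punct /= enormZ zr mulr_gt0//=.
  by apply: le_lt_trans rr; rewrite ler_pM2r.
have gh (w : C) : 0 < nm w <= rho -> hol g w.
  by move=> wp; rewrite gF; exact: (line_ip_hol _ (Fext_hol (pw w wp))).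
have rho0 : 0 < rho by rlra.
have [c cr Hc] : exists2 c, nm c = rho & forall w, nm w = rho -> nm (g w) <= nm (g c).
  apply: circ_max; first exact: ltW.
  move=> w wr; have wp : 0 < nm w <= rho by rewrite wr rho0 lexx.
  exact: (hol_cont (gh w wp)).
have ac : annulus n r (c *: z).
  by rewrite /annulus /= enormZ zr cr rr andbT ltr_pMl.
have gc1 : nm (g c) < 1.
  have /andP[_ fc] := f_proper.1 _ ac.
  rewrite gE; apply: (le_lt_trans (cs _)).
  by move: fc; rewrite -(Fext_annulus ac).
have [B HB] := Fext_bounded.
have g1 : nm (g 1) <= nm (g c).
  have e0 : 0 < 1 / 2 / r by rewrite divr_gt0.
  apply: (@max_principle K rho g 1 (nm (g c)) B (1 / 2 / r)) => //.
  - by rewrite nm1.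
  - by rewrite nm1.
  move=> w /andP[w0 we]; rewrite gE; apply: (le_trans (cs _)).
  apply: HB; rewrite enormZ zr; first exact: mulr_gt0.
  by rewrite -ler_pdivlMr// ltW.
have : nm (g 1) = 1.
  by rewrite gE scale1r -enorm_sqr F1 expr1n nm1.
by move=> E; rewrite E in g1; have := le_lt_trans g1 gc1; rewrite ltxx.
Qed.

End Extension.

(* What is used of the extension of [f] to the punctured ball. *)
Record inner_ext (K : realType) n N (r R : K) (F : 'cV[Cx K]_n -> 'cV[Cx K]_N) := InnerExt {
  ix_n : (2 <= n)%N;
  ix_r : 0 < r < 1;
  ix_R : 0 < R < 1;
  ix_hol : forall z, punct z -> vchol F z;
  ix_bd : exists B : K, forall z, 0 < enorm z -> enorm z <= 1 / 2 -> enorm (F z) <= B;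
  ix_inner : forall z, enorm z = r -> enorm (F z) = R;
  ix_outer : forall eps : K, 0 < eps -> exists2 d : K, 0 < d &
    forall z, 1 - d < enorm z < 1 -> R < enorm (F z) < R + eps \/ 1 - eps < enorm (F z) < 1 }.

Lemma inner_extP (K : realType) n N (r R : K) (f : 'cV[Cx K]_n -> 'cV[Cx K]_N) :
  (2 <= n)%N -> 0 < r < 1 -> 0 < R < 1 -> holomorphic_on (annulus n r) f ->
  proper_map (annulus n r) (annulus N R) f ->
  inner_ext r R (Fext r f).
Proof.
move=> n2 r01 R01 f_hol f_proper; split => //.
- exact: (Fext_hol r01 f_hol f_proper).
- exact: (Fext_bounded r01 f_hol f_proper).
- exact: (Fext_inner n2 r01 R01 f_hol f_proper).
move=> eps e0; have [d d0 Hd] := boundary_behaviour f_proper (or_intror erefl) e0.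
case/andP: r01 => r0 r1.
have m0 : 0 < Num.min d (1 - r) by rewrite lt_min d0 subr_gt0.
exists (Num.min d (1 - r)) => // z /andP[z1 z2].
have m1 : Num.min d (1 - r) <= d by rewrite ge_min lexx.
have m2 : Num.min d (1 - r) <= 1 - r by rewrite ge_min lexx orbT.
have az : annulus n r z by rewrite /annulus /= z2 andbT; rlra.
have r01 : 0 < r < 1 by rewrite r0.
rewrite (Fext_annulus n2 r01 f_hol f_proper az).
have zd : `|enorm z - 1| < d by rewrite ltr_norml; apply/andP; split; rlra.
have /andP[f0 f1] := f_proper.1 z az.
by case: (Hd z az zd) => h; [left; rewrite f0|right; rewrite h].
Qed.

Lemma near_all (K : realType) (P : Cx K -> Prop) (t : Cx K) : (forall s, P s) -> \forall s \near t, P s.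
Proof. by move=> H; apply/nbhs_nm; exists 1. Qed.

Lemma hol_affine (K : realType) (a b s : Cx K) : hol (fun s => a + s * b) s.
Proof. by apply: holD; [exact: hol_cst|apply: holM; [exact: hol_id|exact: hol_cst]]. Qed.

Lemma near_hol_affine (K : realType) (a b t : Cx K) : \forall s \near t, hol (fun s => a + s * b) s.
Proof. by apply: near_all => s; exact: hol_affine. Qed.

Lemma near_hol_inv (K : realType) (c a b t : Cx K) : a + t * b != 0 ->
  \forall s \near t, hol (fun s => c / (a + s * b)) s.
Proof.
move=> t0; have n0 := cont_neq0 (hol_cont (hol_affine a b t)) t0.
apply: filterS n0 => s s0; apply: holM; first exact: hol_cst.
by apply: holV => //; exact: hol_affine.
Qed.

Lemma enorm_orth (K : realType) n (om e : 'cV[Cx K]_n) (a b : Cx K) : enorm om = 1 -> enorm e = 1 ->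
  ip e om = 0 -> enorm (a *: om + b *: e) ^+ 2 = nm a ^+ 2 + nm b ^+ 2.
Proof.
move=> om1 e1 eo; rewrite enorm_pyth ?enormZ ?om1 ?e1 ?mulr1//.
by rewrite ipZl ipZr -ip_conj eo rmorph0 !mulr0.
Qed.

Lemma punct_orth (K : realType) n (om e : 'cV[Cx K]_n) (a b : Cx K) : enorm om = 1 -> enorm e = 1 ->
  ip e om = 0 -> 0 < nm a -> nm a ^+ 2 + nm b ^+ 2 < 1 -> punct (a *: om + b *: e).
Proof.
move=> om1 e1 eo a0 ab; have E := enorm_orth a b om1 e1 eo.
have x0 := enorm_ge0 (a *: om + b *: e).
apply/andP; split.
  rewrite lt_neqAle x0 andbT; apply/negP => /eqP h; move: E; rewrite -h expr0n /=.
  have := exprn_gt0 2 a0; have := sqr_ge0 (nm b) => h1 h2 h3; rlra.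
by rewrite -(@ltr_pXn2r _ 2)// ?nnegrE ?E ?expr1n.
Qed.

(** For z = 0 any unit vector orthogonal to [om] will do; one exists because n >= 2. *)
Lemma orth_unit (K : realType) n (om z : 'cV[Cx K]_n) : (2 <= n)%N -> ip z om = 0 ->
  exists (eta : K) (e : 'cV[Cx K]_n), [/\ 0 <= eta, enorm e = 1, ip e om = 0 & z = eta%:C *: e].
Proof.
move=> n2 zo.
have H (b : 'cV[Cx K]_n) : b != 0 -> ip b om = 0 ->
    enorm (((enorm b)^-1)%:C *: b) = 1 /\ ip (((enorm b)^-1)%:C *: b) om = 0.
  rewrite -enorm_gt0 => b0 bo; split; last by rewrite ipZl bo mulr0.
  by rewrite enormZ nm_real ger0_norm ?invr_ge0 ?ltW// mulVf// gt_eqF.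
have [z0|z0] := eqVneq z 0.
  have [b [b0 bo]] := exists_orth n2 om.
  have [h1 h2] := H b b0 bo.
  by exists 0, (((enorm b)^-1)%:C *: b); split => //; rewrite rC0 scale0r.
have [h1 h2] := H z z0 zo.
exists (enorm z), (((enorm z)^-1)%:C *: z); split => //; first exact: enorm_ge0.
by rewrite scalerA -rCM mulfV ?rC1 ?scale1r// enorm_eq0.
Qed.

(** * The polarized relation on the whole punctured ball *)

Section Polarized.
Variables (K : realType) (n N : nat) (r R : K).
Local Notation C := (Cx K).
Local Notation V := 'cV[C]_n.
Variable F : V -> 'cV[C]_N.
Hypothesis HF : inner_ext r R F.

Lemma inner_polar_local (om : V) : enorm om = 1 -> exists2 e1 : K, 0 < e1 &
  forall (b eta : K) (e : V), `|b - r| < e1 -> 0 <= eta < e1 -> enorm e = 1 -> ip e om = 0 ->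
    ip (F ((r ^+ 2 / b)%:C *: om + eta%:C *: e)) (F (b%:C *: om)) = (R ^+ 2)%:C.
Proof.
move=> om1; have /andP[r0 r1] := ix_r HF.
have pr : punct (r%:C *: om) by rewrite /punct /= enormZ om1 mulr1 nm_real gtr0_norm// r0.
have [e0 e00 He0] := punct_open pr.
apply: (@polarization K n N F om r e0) => //.
- by move=> z ze; apply: (ix_hol HF); exact: He0.
by move=> z ze zr; rewrite -enorm_sqr (ix_inner HF zr).
Qed.

Lemma polar_pair (om e : V) (P1 Q1 L : C -> C) (t : K) : enorm om = 1 -> enorm e = 1 -> ip e om = 0 ->
  (\forall s \near (t%:C : C), hol P1 s) -> (\forall s \near (t%:C : C), hol Q1 s) ->
  (\forall s \near (t%:C : C), hol L s) -> 0 < nm (P1 t%:C) ->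
  nm (P1 t%:C) ^+ 2 + nm (Q1 t%:C) ^+ 2 < 1 -> 0 < nm (L t%:C) < 1 ->
  \forall s \near (t%:C : C), hol (fun s => ip (F (P1 s *: om + Q1 s *: e)) (F (L (s^* ) *: om))) s.
Proof.
move=> om1 e1 eo nP nQ nL P0 PQ Lt.
have tc : (t%:C : C)^* = t%:C by rewrite conj_rC.
have D2 : punct (L (t%:C^* ) *: om + (fun=> 0 : C) (t%:C^* ) *: om).
  by rewrite tc /= scale0r addr0 /punct /= enormZ om1 mulr1.
have nL' : \forall s \near (t%:C : C)^*, hol L s by rewrite tc.
have := pair_hol (@punct_open K n) (ix_hol HF) nP nQ nL' (hol_nearC 0 _)
  (punct_orth om1 e1 eo P0 PQ) D2.
have -> // : (fun s : C => ip (F (P1 s *: om + Q1 s *: e)) (F (L s^* *: om + 0 *: om))) =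
  fun s => ip (F (P1 s *: om + Q1 s *: e)) (F (L s^* *: om)).
by apply/funext => s; rewrite scale0r addr0.
Qed.

(** Continuation in the norm of the second point, from [r] to [lam], while the orthogonal part of
    the first stays small and fixed. *)
Lemma inner_polar_lam (om e : V) (lam : K) : enorm om = 1 -> enorm e = 1 -> ip e om = 0 ->
  r ^+ 2 < lam < 1 -> exists2 d : K, 0 < d & forall eta : K, 0 <= eta < d ->
    ip (F ((r ^+ 2 / lam)%:C *: om + eta%:C *: e)) (F (lam%:C *: om)) = (R ^+ 2)%:C.
Proof.
move=> om1 e1 eo /andP[lr l1]; have /andP[r0 r1] := ix_r HF.
have r20 : 0 < r ^+ 2 by exact: exprn_gt0.
have r2r : r ^+ 2 < r by rewrite expr2 gtr_pMr.
have [d d0 Hd] := inner_polar_local om1.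
have l0 : 0 < lam by rlra.
(* On the path from [r] to [lam] the norm is at least [m], so the component r^2 / L is at most q <
   1, and eta < 1 - q keeps the first point in the ball. *)
have [m mE] : exists m : K, m = Num.min lam r by eexists.
have m1 : m <= lam by rewrite mE ge_min lexx.
have m2 : m <= r by rewrite mE ge_min lexx orbT.
have m0 : r ^+ 2 < m by rewrite mE lt_min lr.
have mp : 0 < m by rlra.
have [q qE] : exists q : K, q = r ^+ 2 / m by eexists.
have q1 : q < 1 by rewrite qE ltr_pdivrMr// mul1r.
have q0 : 0 < q by rewrite qE divr_gt0.
exists (Num.min d (1 - q)) => [|eta]; first by rewrite lt_min d0 subr_gt0.
rewrite lt_min => /and3P[eta0 etad etaq].
pose L (s : C) : C := r%:C + s * (lam - r)%:C.
have LE (t : K) : L t%:C = (r + t * (lam - r))%:C by rewrite /L (rCD r) (rCM t).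
have Lb (t : K) : 0 <= t <= 1 -> m <= r + t * (lam - r) < 1.
  case/andP => t0 t1; have -> : r + t * (lam - r) = (1 - t) * r + t * lam by ring.
  apply/andP; split; last first.
    have [->|t10] := eqVneq t 1; first by rlra.
    have : (1 - t) * r < (1 - t) * 1 by rewrite ltr_pM2l//; rlra.
    have : t * lam <= t * 1 by rewrite ler_wpM2l//; rlra.
    rlra.
  have : (1 - t) * m <= (1 - t) * r by rewrite ler_wpM2l//; rlra.
  have : t * m <= t * lam by rewrite ler_wpM2l.
  rlra.
pose g (s : C) := ip (F (((r ^+ 2)%:C / L s) *: om + eta%:C *: e)) (F (L (s^* ) *: om)) - (R ^+ 2)%:C.
have gt_ (t : K) : g t%:C = ip (F ((r ^+ 2 / (r + t * (lam - r)))%:C *: om + eta%:C *: e))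
    (F ((r + t * (lam - r))%:C *: om)) - (R ^+ 2)%:C.
  by rewrite /g conj_rC LE -rCV -rCM.
have g1 : g 1%:C = 0.
  apply: (identity_segment (g := g)); last by rewrite ler01 lexx.
    move=> t t01; have /andP[b1 b2] := Lb t t01.
    have Lp : 0 < r + t * (lam - r) by rlra.
    have Ln : r%:C + t%:C * (lam - r)%:C != 0 :> C by rewrite -[_ + _]/(L t%:C) LE rC_eq0 gt_eqF.
    have : \forall s \near (t%:C : C), hol (fun s => ip (F (((r ^+ 2)%:C / L s) *: om + eta%:C *: e)) (F (L (s^* ) *: om))) s.
      apply: (@polar_pair om e (fun s => (r ^+ 2)%:C / L s) (fun=> eta%:C) L t) => //.
      - exact: near_hol_inv.
      - exact: hol_nearC.
      - exact: near_hol_affine.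
      - by rewrite LE -rCV -rCM nm_real normr_gt0 mulf_neq0 ?invr_neq0// gt_eqF.
      - rewrite LE -rCV -rCM !nm_real ger0_norm ?divr_ge0 ?ltW// ger0_norm//.
        have b3 : r ^+ 2 / (r + t * (lam - r)) <= q.
          by rewrite qE ler_pM2l// lef_pV2 ?posrE.
        have b4 : 0 < r ^+ 2 / (r + t * (lam - r)) by rewrite divr_gt0.
        move: (_ / _) b3 b4 => x x1 x2; rnra.
      by rewrite LE nm_real gtr0_norm// Lp.
    move=> /nbhs_nm [e' e'0 He']; exists e' => // w we; rewrite /g.
    by apply: holB; [exact: He'|exact: hol_cst].
  move=> e' e'0.
  have [x xE] : exists x : K, x = Num.min (Num.min (e' / 2) d) 1 / 2 by eexists.
  have x0 : 0 < x by rewrite xE divr_gt0// !lt_min d0 divr_gt0// ltr01.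
  have [x1 x2 x3] : [/\ x < e', x < d & x < 1].
    have y1 : Num.min (Num.min (e' / 2) d) 1 <= e' / 2 by rewrite !ge_min lexx.
    have y2 : Num.min (Num.min (e' / 2) d) 1 <= d by rewrite !ge_min lexx orbT.
    have y3 : Num.min (Num.min (e' / 2) d) 1 <= 1 by rewrite !ge_min lexx orbT.
    by rewrite xE; split; rlra.
  exists (x%:C); rewrite nm_real gtr0_norm//; split => //.
  rewrite gt_; apply/eqP; rewrite subr_eq0; apply/eqP; apply: Hd => //; last by rewrite eta0.
  rewrite addrAC subrr add0r normrM gtr0_norm//.
  have : `|lam - r| < 1 by rewrite ltr_norml; apply/andP; split; rlra.
  move=> h; apply: lt_trans x2; rewrite -{2}[x]mulr1 ltr_pM2l//.
have E1 : r + 1 * (lam - r) = lam by ring.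
move: g1; rewrite gt_ E1 => /eqP.
by rewrite subr_eq0 => /eqP.
Qed.

(** Continuation in the orthogonal part, from the small values covered by [inner_polar_lam]. *)
Lemma inner_polar_coord (om e : V) (lam eta : K) : enorm om = 1 -> enorm e = 1 -> ip e om = 0 ->
  0 < lam < 1 -> 0 <= eta -> (r ^+ 2 / lam) ^+ 2 + eta ^+ 2 < 1 ->
  ip (F ((r ^+ 2 / lam)%:C *: om + eta%:C *: e)) (F (lam%:C *: om)) = (R ^+ 2)%:C.
Proof.
move=> om1 e1 eo /andP[l0 l1] eta0 le; have /andP[r0 r1] := ix_r HF.
have r20 : 0 < r ^+ 2 by exact: exprn_gt0.
have [q qE] : exists q : K, q = r ^+ 2 / lam by eexists.
have q0 : 0 < q by rewrite qE divr_gt0.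
rewrite -qE in le.
have q1 : q < 1.
  by rewrite -(@ltr_pXn2r _ 2)// ?nnegrE ?ltW// expr1n; have := sqr_ge0 eta; rlra.
have lb : r ^+ 2 < lam < 1 by rewrite l1 andbT; move: q1; rewrite qE ltr_pdivrMr// mul1r.
have [d d0 Hd] := inner_polar_lam om1 e1 eo lb.
rewrite -qE in Hd *.
pose g (s : C) := ip (F (q%:C *: om + (s * eta%:C) *: e)) (F (lam%:C *: om)) - (R ^+ 2)%:C.
have g1 : g 1%:C = 0.
  apply: (identity_segment (g := g)); last by rewrite ler01 lexx.
    move=> t /andP[t0 t1].
    have : \forall s \near (t%:C : C), hol (fun s => ip (F (q%:C *: om + (s * eta%:C) *: e)) (F (lam%:C *: om))) s.
      apply: (@polar_pair om e (fun=> q%:C) (fun s => s * eta%:C) (fun=> lam%:C) t) => //.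
      - exact: hol_nearC.
      - by apply: near_all => s; apply: holM; [exact: hol_id|exact: hol_cst].
      - exact: hol_nearC.
      - by rewrite nm_real normr_gt0 gt_eqF.
      - rewrite -rCM !nm_real gtr0_norm// ger0_norm ?mulr_ge0//.
        have : (t * eta) ^+ 2 <= eta ^+ 2.
          by rewrite ler_pXn2r ?nnegrE ?mulr_ge0// ler_piMl.
        rlra.
      by rewrite nm_real gtr0_norm// l0.
    move=> /nbhs_nm [e' e'0 He']; exists e' => // w we; rewrite /g.
    by apply: holB; [exact: He'|exact: hol_cst].
  move=> e' e'0; have eta1 : 0 < eta + 1 by rlra.
  have [x xE] : exists x : K, x = Num.min e' (d / (eta + 1)) / 2 by eexists.
  have md : 0 < d / (eta + 1) by rewrite divr_gt0.
  have x0 : 0 < x by rewrite xE divr_gt0// !lt_min e'0.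
  have [x1 x2] : x < e' /\ x < d / (eta + 1).
    have y1 : Num.min e' (d / (eta + 1)) <= e' by rewrite !ge_min lexx.
    have y2 : Num.min e' (d / (eta + 1)) <= d / (eta + 1) by rewrite !ge_min lexx orbT.
    by rewrite xE; split; rlra.
  exists (x%:C); rewrite nm_real gtr0_norm//; split => //.
  rewrite /g -rCM; apply/eqP; rewrite subr_eq0; apply/eqP; apply: Hd.
  rewrite (mulr_ge0 (ltW x0) eta0) /=; move: x2; rewrite ltr_pdivlMr// mulrDr mulr1 => x2.
  rlra.
move: g1; rewrite /g mul1r => /eqP.
by rewrite subr_eq0 => /eqP.
Qed.

(** In coordinates adapted to [w] one has w = lam om, and the condition on <z, w> leaves z = (r^2 /
    lam) om + eta e with [e] orthogonal to [om]. *)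
Lemma inner_polar z w : punct z -> punct w -> ip z w = (r ^+ 2)%:C ->
  ip (F z) (F w) = (R ^+ 2)%:C.
Proof.
move=> /andP[z0 z1] /andP[w0 w1] zw; have /andP[r0 r1] := ix_r HF.
have [lam lamE] : exists l : K, l = enorm w by eexists.
rewrite -lamE in w0 w1; have ln : (lam%:C : C) != 0 by rewrite rC_eq0 gt_eqF.
have [om omE] : exists om : V, om = (lam^-1)%:C *: w by eexists.
have wE : w = lam%:C *: om by rewrite omE scalerA -rCM mulfV ?rC1 ?scale1r// gt_eqF.
have om1 : enorm om = 1.
  by rewrite omE enormZ nm_real ger0_norm ?invr_ge0 ?ltW// -lamE mulVf// gt_eqF.
have zo : ip z om = (r ^+ 2 / lam)%:C.
  by rewrite omE ipZr zw conj_rC -rCM mulrC.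
have [z' z'E] : exists z' : V, z' = z - (r ^+ 2 / lam)%:C *: om by eexists.
have zE : z = (r ^+ 2 / lam)%:C *: om + z' by rewrite z'E addrC subrK.
have z'o : ip z' om = 0.
  by rewrite z'E ipBl zo ipZl -enorm_sqr om1 expr1n rC1 mulr1 subrr.
have [eta [e [eta0 e1 eo z'e]]] := orth_unit (ix_n HF) z'o.
rewrite zE wE z'e; apply: inner_polar_coord => //; first by rewrite w0.
have := enorm_orth (r ^+ 2 / lam)%:C eta%:C om1 e1 eo.
rewrite -z'e -zE !nm_real ger0_norm ?divr_ge0 ?exprn_ge0 ?ltW// ger0_norm// => <-.
by rewrite expr_lt1// enorm_ge0.
Qed.

End Polarized.

(** * Independent values on a hyperplane *)

Lemma det_hol (K : realType) N (M : Cx K -> 'M[Cx K]_N) (t : Cx K) :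
  (forall i j, hol (fun s => M s i j) t) -> hol (fun s => \det (M s)) t.
Proof.
move=> H; apply: hol_sum => s _; apply: holM; first exact: hol_cst.
by apply: hol_prod => i _; exact: H.
Qed.

Lemma nonzero_near0 (K : realType) (g : Cx K -> Cx K) :
  (forall t : K, 0 <= t <= 1 -> \forall s \near (t%:C : Cx K), hol g s) -> g 1 != 0 ->
  exists2 e : K, 0 < e & forall w, 0 < nm w < e -> g w != 0.
Proof.
move=> H g1; apply: contrapT => h.
have : g 1%:C = 0; last by move=> E; rewrite rC1 in E; rewrite E eqxx in g1.
apply: identity_segment; last by rewrite ler01 lexx.
  by move=> t /H /nbhs_nm.
move=> e e0; apply: contrapT => h2; apply: h; exists e => // w /andP[w0 we].
by apply/negP => /eqP gw; apply: h2; exists w.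
Qed.

Lemma enorm_conv (K : realType) n (x y : 'cV[Cx K]_n) (t : K) : 0 <= t <= 1 ->
  enorm x < 1 -> enorm y < 1 -> enorm ((1 - t)%:C *: x + t%:C *: y) < 1.
Proof.
move=> /andP[t0 t1] x1 y1; apply: le_lt_trans (enormD _ _) _.
rewrite !enormZ !nm_real !ger0_norm ?subr_ge0//.
have [->|tn] := eqVneq t 1; first by rewrite subrr mul0r add0r mul1r.
have : (1 - t) * enorm x < (1 - t) * 1 by rewrite ltr_pM2l//; rlra.
have : t * enorm y <= t * 1 by rewrite ler_wpM2l// ltW.
rlra.
Qed.

Lemma ip_neq0 (K : realType) n (x y : 'cV[Cx K]_n) : ip x y != 0 -> 0 < enorm x.
Proof. by rewrite enorm_gt0; apply: contraNN => /eqP ->; rewrite ip0l. Qed.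

(** The number is v / v^* for v = 1 + i y with [y] small. *)
Lemma unimod_near1 (K : realType) (e : K) : 0 < e ->
  exists u : Cx K, [/\ nm u = 1, u != 1 & nm (u - 1) < e].
Proof.
move=> e0; pose y := e / 4; have y0 : 0 < y by rewrite divr_gt0.
pose v : Cx K := 1 +i* y; have vc : v^* = 1 -i* y by rewrite conjE.
have v1 : 1 <= nm v by apply: le_trans (nm_Re v); rewrite /= normr1.
have vn : v != 0 by rewrite -nm_gt0; exact: lt_le_trans v1.
have vcn : v^* != 0 by rewrite conjC_eq0.
have E : v / v^* - 1 = (0 +i* (y *+ 2)) / v^*.
  rewrite -{1}[1](divff vcn) -mulrBl; congr (_ / _).
  by rewrite vc; apply: cxP => /=; ring.
exists (v / v^* ); split.
- by rewrite nmM nmV nm_conj divff// gt_eqF// (lt_le_trans ltr01 v1).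
- rewrite -subr_eq0 E mulf_neq0 ?invr_neq0//.
  by apply/negP => /eqP [/eqP]; rewrite mulrn_eq0 /= gt_eqF.
have vp := lt_le_trans ltr01 v1.
rewrite E nmM nmV nm_conj ltr_pdivrMr//.
have h : nm (0 +i* (y *+ 2) : Cx K) <= e / 2.
  apply: le_trans (nm_le_ReIm _) _; rewrite /= normr0 add0r gtr0_norm ?mulrn_wgt0//.
  by rewrite /y; rlra.
by apply: (le_lt_trans h); have := ler_wpM2l (ltW e0) v1; rlra.
Qed.

Section Rank.
Variables (K : realType) (n N : nat) (r R : K).
Local Notation C := (Cx K).
Local Notation V := 'cV[C]_n.
Variable F : V -> 'cV[C]_N.
Hypothesis HF : inner_ext r R F.
Hypothesis N0 : (0 < N)%N.

Definition Fm (zs : 'I_N -> V) : 'M[C]_N := \matrix_(i, j) F (zs i) j 0.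

(** The rows are the images of the [F (zs i)] under the affine map y |-> t0 + y T; a nonzero
    determinant for some [t0] and [T] expresses that these values are affinely independent. *)
Definition Ym (t0 : 'I_N -> C) (T : 'M[C]_N) (zs : 'I_N -> V) : 'M[C]_N :=
  \matrix_(i, j) (t0 j + \sum_k F (zs i) k 0 * T k j).

Lemma rows_hol (a b : 'I_N -> V) (P Q : 'I_N -> C -> C) (t : C) :
  (forall i, \forall s \near t, hol (P i) s) -> (forall i, \forall s \near t, hol (Q i) s) ->
  (forall i, punct (P i t *: a i + Q i t *: b i)) ->
  \forall s \near t, forall i k, hol (fun s => F (P i s *: a i + Q i s *: b i) k 0) s.
Proof.
move=> nP nQ Pt; apply: near_forall_ord => i; apply: near_forall_ord => k.
exact: (vchol_near k (@punct_open K n) (ix_hol HF) (nP i) (nQ i) (Pt i)).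
Qed.

Lemma Fm_hol (a b : 'I_N -> V) (P Q : 'I_N -> C -> C) (t : C) :
  (forall i, \forall s \near t, hol (P i) s) -> (forall i, \forall s \near t, hol (Q i) s) ->
  (forall i, punct (P i t *: a i + Q i t *: b i)) ->
  \forall s \near t, hol (fun s => \det (Fm (fun i => P i s *: a i + Q i s *: b i))) s.
Proof.
move=> nP nQ Pt; have := rows_hol nP nQ Pt; apply: filterS => s H.
apply: det_hol => i j.
have -> // : (fun s => Fm (fun i => P i s *: a i + Q i s *: b i) i j) =
  fun s => F (P i s *: a i + Q i s *: b i) j 0 by apply/funext => u; rewrite mxE.
Qed.

Lemma Ym_hol t0 T (a b : 'I_N -> V) (P Q : 'I_N -> C -> C) (t : C) :
  (forall i, \forall s \near t, hol (P i) s) -> (forall i, \forall s \near t, hol (Q i) s) ->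
  (forall i, punct (P i t *: a i + Q i t *: b i)) ->
  \forall s \near t, hol (fun s => \det (Ym t0 T (fun i => P i s *: a i + Q i s *: b i))) s.
Proof.
move=> nP nQ Pt; have := rows_hol nP nQ Pt; apply: filterS => s H.
apply: det_hol => i j.
have -> : (fun s => Ym t0 T (fun i => P i s *: a i + Q i s *: b i) i j) =
  fun s => t0 j + \sum_k F (P i s *: a i + Q i s *: b i) k 0 * T k j.
  by apply/funext => u; rewrite mxE.
apply: holD; first exact: hol_cst.
by apply: hol_sum => k _; apply: holM; [exact: H|exact: hol_cst].
Qed.

(* By [inner_polar], the constant column of [Y] is a combination of the columns of [F]. *)
Lemma Ym_Fm t0 T zs (p : V) (c : K) : enorm p = 1 -> r ^+ 2 < c ->
  (forall i, punct (zs i)) -> (forall i, ip (zs i) p = c%:C) ->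
  \det (Ym t0 T zs) != 0 -> \det (Fm zs) != 0.
Proof.
move=> p1 rc zp zc; have /andP[r0 r1] := ix_r HF; have /andP[R0 R1] := ix_R HF.
have r20 : 0 < r ^+ 2 by exact: exprn_gt0.
have c0 : 0 < c by rlra.
have [w wE] : exists w : V, w = (r ^+ 2 / c)%:C *: p by eexists.
have wp : punct w.
  rewrite /punct /= wE enormZ p1 mulr1 nm_real gtr0_norm ?divr_gt0//=.
  by rewrite ltr_pdivrMr// mul1r.
have Fw i : ip (F (zs i)) (F w) = (R ^+ 2)%:C.
  apply: (inner_polar HF) => //; rewrite wE ipZr conj_rC zc -rCM.
  by rewrite divfK// gt_eqF.
have -> : Ym t0 T zs = Fm zs *m
   (\matrix_(k, j) ((R ^+ 2)^-1%:C * (F w k 0)^* * t0 j + T k j)).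
  apply/matrixP => i j; rewrite !mxE.
  under [in RHS]eq_bigr => k _ do rewrite !mxE mulrDr.
  rewrite big_split /=; congr (_ + _).
  have -> : \sum_k F (zs i) k 0 * ((R ^+ 2)^-1%:C * (F w k 0)^* * t0 j) =
     ip (F (zs i)) (F w) * ((R ^+ 2)^-1%:C * t0 j).
    by rewrite mulr_suml; apply: eq_bigr => k _; ring.
  by rewrite Fw mulrA -rCM mulfV ?rC1 ?mul1r// expf_neq0// gt_eqF.
by rewrite det_mulmx mulf_eq0 negb_or => /andP[].
Qed.

(* The points of a hyperplane [ip z w = kap] meeting the ball determine a vector through
   its products with the [F z]. *)
Definition good (w : V) := exists (kap : K) (zs : 'I_N -> V),
  [/\ r ^+ 2 * enorm w < kap, forall i, punct (zs i),
      forall i, ip (zs i) w = kap%:C & \det (Fm zs) != 0].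

(** Contraction towards c p moves the hyperplane from level c0 to levels near [c]. The determinant
    is holomorphic in the contraction parameter and nonzero at the start, so its zeros cannot
    accumulate at the end. *)
Lemma segment_points t0 T zs (p : V) (c0 c : K) : enorm p = 1 -> 0 <= c0 -> 0 < c < 1 ->
  (forall i, punct (zs i)) -> (forall i, ip (zs i) p = c0%:C) ->
  \det (Ym t0 T zs) != 0 ->
  exists2 e : K, 0 < e & forall x : K, 0 < x < e -> exists zs' : 'I_N -> V,
    [/\ forall i, punct (zs' i), forall i, ip (zs' i) p = (x * c0 + (1 - x) * c)%:C
      & \det (Ym t0 T zs') != 0].
Proof.
move=> p1 c00 /andP[c3 c2] zp zc Y0.
have cp1 : enorm (c%:C *: p) < 1 by rewrite enormZ p1 mulr1 nm_real gtr0_norm.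
pose ga (s : C) i : V := s *: zs i + (1 - s) *: (c%:C *: p).
have gip (t : K) i : ip (ga t%:C i) p = (t * c0 + (1 - t) * c)%:C.
  rewrite /ga ipDl !ipZl zc -enorm_sqr p1 expr1n rC1 mulr1 rCD.
  by rewrite (rCM t) (rCM (1 - t)) rCB rC1.
have gp (t : K) i : 0 <= t <= 1 -> punct (ga t%:C i).
  move=> t01; case/andP: (t01) => t0' t1'.
  apply/andP; split.
    have [t1|t1] := eqVneq t 1.
      by rewrite /ga t1 rC1 scale1r subrr scale0r addr0; case/andP: (zp i).
    apply: (@ip_neq0 _ _ _ p); rewrite gip rC_eq0 gt_eqF//.
    have : 0 <= t * c0 by exact: mulr_ge0.
    have : 0 < (1 - t) * c by apply: mulr_gt0 => //; rlra.
    rlra.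
  have -> : ga t%:C i = (1 - (1 - t))%:C *: zs i + (1 - t)%:C *: (c%:C *: p).
    have -> : 1 - (1 - t) = t by ring.
    by rewrite /ga rCB rC1.
  apply: enorm_conv => //; first by apply/andP; split; rlra.
  by case/andP: (zp i).
have [e e0 He] : exists2 e : K, 0 < e & forall w, 0 < nm w < e -> \det (Ym t0 T (ga w)) != 0.
  apply: (nonzero_near0 (g := fun s => \det (Ym t0 T (ga s)))).
    move=> t t01.
    apply: (@Ym_hol t0 T zs (fun=> c%:C *: p) (fun=> id) (fun _ s => 1 - s)).
    - by move=> i; exact: hol_near_id.
    - by move=> i; apply: near_all => s; apply: holB; [exact: hol_cst|exact: hol_id].
    by move=> i; exact: gp.
  have -> // : ga 1 = zs.
  by apply/funext => i; rewrite /ga scale1r subrr scale0r addr0.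
exists (Num.min e 1) => [|x]; first by rewrite lt_min e0 ltr01.
rewrite lt_min => /and3P[x0 xe x1].
have x01 : 0 <= x <= 1 by rewrite !ltW.
exists (ga x%:C); split.
- by move=> i; exact: gp.
- by move=> i; exact: gip.
by apply: He; rewrite nm_real gtr0_norm// x0.
Qed.

(** The level c0 may be at most r^2, where [Ym_Fm] does not apply; the points are first moved to a
    level close to (1 + r^2) / 2. *)
Lemma good_start t0 T zs (p : V) (c0 : K) : enorm p = 1 -> 0 <= c0 ->
  (forall i, punct (zs i)) -> (forall i, ip (zs i) p = c0%:C) ->
  \det (Ym t0 T zs) != 0 -> good p.
Proof.
move=> p1 c00 zp zc Y0; have /andP[r0 r1] := ix_r HF.
have r20 : 0 < r ^+ 2 by exact: exprn_gt0.
have r21 : r ^+ 2 < 1 by rewrite expr_lt1// ltW.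
have [c cE] : exists c : K, c = (1 + r ^+ 2) / 2 by eexists.
have [c1 c2 c3] : [/\ r ^+ 2 < c, c < 1 & 0 < c] by rewrite cE; split; rlra.
have c01 : 0 < c < 1 by rewrite c3.
have [e e0 He] := segment_points p1 c00 c01 zp zc Y0.
have cc : 0 < c - r ^+ 2 by rlra.
have [m mE] : exists m : K, m = Num.min (Num.min e 1) (c - r ^+ 2) by eexists.
have m0 : 0 < m by rewrite mE !lt_min e0 cc ltr01.
have m1 : m <= e by rewrite mE !ge_min lexx.
have m2 : m <= 1 by rewrite mE !ge_min lexx orbT.
have m3 : m <= c - r ^+ 2 by rewrite mE !ge_min lexx orbT.
have [x xE] : exists x : K, x = m / 2 by eexists.
have x0 : 0 < x by rlra.
have c4 : r ^+ 2 < x * c0 + (1 - x) * c.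
  have : 0 <= x * c0 by rewrite mulr_ge0// ltW.
  have : x * c < x * 1 by rewrite ltr_pM2l.
  rlra.
have xe : 0 < x < e by rewrite x0; rlra.
have [zs' [h1 h2 h3]] := He x xe.
exists (x * c0 + (1 - x) * c), zs'; split; [by rewrite p1 mulr1|exact: h1|exact: h2|].
exact: (Ym_Fm p1 c4 h1 h2 h3).
Qed.

Lemma Ym01 zs : Ym (fun=> 0) 1%:M zs = Fm zs.
Proof.
apply/matrixP => i j; rewrite !mxE add0r (bigD1 j)//= !mxE eqxx mulr1.
rewrite big1 ?addr0// => k kj; rewrite mxE (negbTE kj).
exact: mulr0.
Qed.

Lemma good_neq0 w : good w -> 0 < enorm w.
Proof.
move=> [kap [zs [k1 _ zw _]]]; have := zw (Ordinal N0).
rewrite enorm_gt0; apply: contra_eqN => /eqP w0.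
rewrite w0 ip0r eq_sym rC_eq0; rewrite w0 enorm0 mulr0 in k1.
by rewrite gt_eqF.
Qed.

Lemma good_scale w (t : K) : 0 < t -> good w -> good (t%:C *: w).
Proof.
move=> t0 [kap [zs [k1 zp zw d0]]]; exists (t * kap), zs; split => //.
  by rewrite enormZ nm_real gtr0_norm// mulrCA ltr_pM2l.
by move=> i; rewrite ipZr conj_rC zw -rCM.
Qed.

(** The points are corrected by multiples of [p] so that their products with the moving vector
    remain [kap]; the correction is holomorphic in the parameter and vanishes at 0. *)
Lemma good_radial (p q : V) : good p -> exists2 e : K, 0 < e & forall t : K, 0 <= t < e ->
  good (p + t%:C *: q).
Proof.
move=> gp; have p0 := good_neq0 gp; case: gp => [kap [zs [k1 zp zw d0]]].
have pp : (enorm p ^+ 2)%:C != 0 :> C by rewrite rC_eq0 expf_neq0// gt_eqF.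
pose k (i : 'I_N) (s : C) : C := (- ip (zs i) q * s) / ((enorm p ^+ 2)%:C + s * ip p q).
pose ga (s : C) (i : 'I_N) : V := 1 *: zs i + k i s *: p.
have k0 i : k i 0 = 0 by rewrite /k mulr0 mul0r.
have ga0 : ga 0 = zs by apply/funext => i; rewrite /ga k0 scale0r addr0 scale1r.
have q0 : (enorm p ^+ 2)%:C + 0 * ip p q != 0 by rewrite mul0r addr0.
have khol i : \forall s \near (0 : C), hol (k i) s.
  have := near_hol_inv (- ip (zs i) q) q0; apply: filterS => s hs.
  have -> : k i = fun s => s * (- ip (zs i) q / ((enorm p ^+ 2)%:C + s * ip p q)).
    by apply/funext => u; rewrite /k mulrAC mulrC.
  by apply: holM => //; exact: hol_id.
have gap i : punct (1 *: zs i + k i 0 *: p) by rewrite k0 scale0r addr0 scale1r.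
have nh : \forall s \near (0 : C), hol (fun s => \det (Fm (ga s))) s.
  exact: (@Fm_hol zs (fun=> p) (fun _ _ => 1) k 0 (fun=> hol_nearC _ _) khol gap).
have nd : \forall s \near (0 : C), \det (Fm (ga s)) != 0.
  apply: (cont_neq0 (u := fun s => \det (Fm (ga s)))).
    exact: hol_cont (nbhs_singleton nh).
  by rewrite ga0.
have np : \forall s \near (0 : C), forall i, punct (ga s i).
  apply: near_forall_ord => i.
  exact: (curve_open (@punct_open K n) (hol_nearC 1 0) (khol i) (gap i)).
have nq := cont_neq0 (hol_cont (hol_affine (enorm p ^+ 2)%:C (ip p q) 0)) q0.
have : \forall s \near (0 : C), \det (Fm (ga s)) != 0 /\ ((forall i, punct (ga s i)) /\
    (enorm p ^+ 2)%:C + s * ip p q != 0).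
  by apply: filterI nd _; exact: filterI np nq.
move=> /nbhs_nm [e e0 He].
have k2 : 0 < kap - r ^+ 2 * enorm p by rewrite subr_gt0.
have rq0 : 0 <= r ^+ 2 * enorm q by rewrite mulr_ge0 ?enorm_ge0// sqr_ge0.
have rq : 0 < r ^+ 2 * enorm q + 1 by rlra.
exists (Num.min e ((kap - r ^+ 2 * enorm p) / (r ^+ 2 * enorm q + 1))).
  by rewrite lt_min e0 divr_gt0.
move=> t; rewrite lt_min => /and3P[t0 te]; rewrite ltr_pdivlMr// => tk.
have te' : nm (t%:C - 0) < e by rewrite subr0 nm_real ger0_norm.
have [h1 [h2 h3]] := He _ te'.
exists kap, (ga t%:C); split => //.
  have : enorm (p + t%:C *: q) <= enorm p + t * enorm q.
    by apply: le_trans (enormD _ _) _; rewrite enormZ nm_real ger0_norm.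
  have r2 : 0 <= r ^+ 2 by exact: sqr_ge0.
  move=> /(ler_wpM2l r2); rnra.
move=> i; rewrite /ga scale1r ipDl ipZl !ipDr !ipZr conj_rC zw.
rewrite -(enorm_sqr p) /k.
by move: h3; move: (enorm p ^+ 2)%:C (kap%:C : C) (t%:C : C) (ip (zs i) q) (ip p q) => x y u a b h3; field.
Qed.

(* The determinant may vanish on [ip z p = r^2] itself, but not on all the rotated
   hyperplanes near it, by the identity theorem. *)
Lemma good_rotate p : enorm p = 1 -> good p -> exists (u : C) (zs : 'I_N -> V),
  [/\ nm u = 1, forall i, punct (zs i), forall i, ip (zs i) (u *: p) = (r ^+ 2)%:C
    & \det (Fm zs) != 0].
Proof.
move=> p1 [kap [zs [k1 zp zw d0]]]; have /andP[r0 r1] := ix_r HF.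
have r20 : 0 < r ^+ 2 by exact: exprn_gt0.
rewrite p1 mulr1 in k1.
(* Translation along [p]: the level is r^2 at s = 0, and at s = 1 the points are the given ones, at
   level kap. *)
pose ga (s : C) (i : 'I_N) : V := 1 *: zs i + ((r ^+ 2 - kap)%:C + s * (kap - r ^+ 2)%:C) *: p.
have gip (s : C) i : ip (ga s i) p = (r ^+ 2)%:C + s * (kap - r ^+ 2)%:C.
  rewrite /ga ipDl !ipZl zw -enorm_sqr p1 expr1n rC1 mulr1 mul1r addrA -rCD.
  by have -> : kap + (r ^+ 2 - kap) = r ^+ 2 by ring.
have gp (t : K) i : 0 <= t <= 1 -> punct (ga t%:C i).
  move=> /andP[t0' t1']; have tk : 0 <= t * (kap - r ^+ 2) by rewrite mulr_ge0//; rlra.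
  apply/andP; split.
    apply: (@ip_neq0 _ _ _ p); rewrite gip -rCM -rCD rC_eq0 gt_eqF//; rlra.
  have Eo (x : C) : ip (zs i - kap%:C *: p) (x *: p) = 0.
    by rewrite ipZr ipBl ipZl zw -enorm_sqr p1 expr1n rC1 mulr1 subrr mulr0.
  have E (x : K) : enorm (zs i - kap%:C *: p + x%:C *: p) ^+ 2 = enorm (zs i - kap%:C *: p) ^+ 2 + x ^+ 2.
    by rewrite enorm_pyth// enormZ p1 mulr1 nm_real real_normK ?num_real.
  rewrite -(@ltr_pXn2r _ 2)// ?nnegrE ?enorm_ge0//.
  have -> : ga t%:C i = zs i - kap%:C *: p + (r ^+ 2 + t * (kap - r ^+ 2))%:C *: p.
    rewrite /ga scale1r -[RHS]addrA -(scaleNr kap%:C p) -(scalerDl p).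
    congr (_ + _ *: _); rewrite -rCM -rCN -!rCD.
    by congr (_%:C); ring.
  have /andP[_ z1] := zp i; have := E kap; rewrite subrK E => E2.
  have : enorm (zs i) ^+ 2 < 1 ^+ 2 by rewrite ltr_pXn2r ?nnegrE ?enorm_ge0.
  have tk2 : t * (kap - r ^+ 2) <= 1 * (kap - r ^+ 2) by rewrite ler_wpM2r//; rlra.
  have : (r ^+ 2 + t * (kap - r ^+ 2)) ^+ 2 <= kap ^+ 2.
    have h1 : 0 <= r ^+ 2 + t * (kap - r ^+ 2) by rewrite addr_ge0// ltW.
    have h2 : r ^+ 2 + t * (kap - r ^+ 2) <= kap by rewrite mul1r in tk2; rlra.
    by rewrite ler_pXn2r ?nnegrE// (le_trans h1 h2).
  rewrite expr1n.
  rlra.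
have [e e0 He] : exists2 e : K, 0 < e & forall w, 0 < nm w < e -> \det (Fm (ga w)) != 0.
  apply: (nonzero_near0 (g := fun s => \det (Fm (ga s)))).
    move=> t t01.
    apply: (@Fm_hol zs (fun=> p) (fun _ _ => 1) (fun _ s => (r ^+ 2 - kap)%:C + s * (kap - r ^+ 2)%:C)).
    - by move=> i; exact: hol_nearC.
    - by move=> i; exact: near_hol_affine.
    by move=> i; exact: gp.
  have -> // : ga 1 = zs.
  apply/funext => i; rewrite /ga scale1r mul1r -rCD.
  have -> : r ^+ 2 - kap + (kap - r ^+ 2) = 0 by ring.
  by rewrite rC0 scale0r addr0.
have z01 : 0 <= (0 : K) <= 1 by rewrite lexx ler01.
have np : \forall s \near (0 : C), forall i, punct (ga s i).
  apply: near_forall_ord => i.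
  exact: (curve_open (@punct_open K n) (hol_nearC 1 0) (near_hol_affine _ _ _) (gp 0 i z01)).
have /nbhs_nm [e2 e20 He2] := np.
have [dl dlE] : exists dl : K, dl = kap - r ^+ 2 by eexists.
have dl0 : 0 < dl by rlra.
have m0 : 0 < Num.min e e2 * dl / r ^+ 2.
  by apply: divr_gt0 => //; apply: mulr_gt0 => //; rewrite lt_min e0.
have [u [u1 un1 ue]] := unimod_near1 m0.
(* With this [s] the level r^2 + s dl equals r^2 u, so the products with u p are r^2. *)
have [s sE] : exists s : C, s = (r ^+ 2)%:C * (u - 1) / dl%:C by eexists.
have r2n : (r ^+ 2)%:C != 0 :> C by rewrite rC_eq0 gt_eqF.
have dln : dl%:C != 0 :> C by rewrite rC_eq0 gt_eqF.
have s0 : 0 < nm s.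
  by rewrite nm_gt0 sE !mulf_neq0 ?invr_neq0// subr_eq0.
have sm : nm s < Num.min e e2.
  rewrite sE nmM nmM nmV !nm_real !gtr0_norm// ltr_pdivrMr//.
  by move: ue; rewrite ltr_pdivlMr// mulrC.
move: sm; rewrite lt_min => /andP[se se2].
exists u, (ga s); split; first exact: u1.
- by apply: He2; rewrite subr0.
- move=> i; rewrite ipZr gip -dlE sE divfK// mulrBr mulr1 addrC subrK mulrCA.
  by rewrite [_^* * _]mulrC -nmsqr u1 expr1n rC1 mulr1.
by apply: He; rewrite s0.
Qed.

End Rank.

(** * Reflection across the unit sphere *)

Lemma near2 (T : topologicalType) (P Q S : T -> Prop) (t : T) :
  (forall s, P s -> Q s -> S s) -> (\forall s \near t, P s) -> (\forall s \near t, Q s) ->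
  \forall s \near t, S s.
Proof. by move=> H; apply: filterS2 => s; exact: H. Qed.

Lemma near3 (T : topologicalType) (P Q U S : T -> Prop) (t : T) :
  (forall s, P s -> Q s -> U s -> S s) -> (\forall s \near t, P s) ->
  (\forall s \near t, Q s) -> (\forall s \near t, U s) -> \forall s \near t, S s.
Proof. by move=> H; apply: filterS3 => s; exact: H. Qed.

Lemma enormC (K : realType) n (x y : 'cV[Cx K]_n) : enorm (x - y) = enorm (y - x).
Proof. by rewrite -(enormN (x - y)) opprB. Qed.

Lemma two_values_close (K : realType) (R x y z : K) : R < 1 -> x = R \/ x = 1 ->
  y = R \/ y = 1 -> z < (1 - R) / 2 -> x - y <= z -> y - x <= z -> x = y.
Proof. by move=> R1 [->|->] [->|->] // h1 h2 h3; rlra. Qed.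

Section VectorContinuity.
Variables (K : realType) (n : nat).
Local Notation C := (Cx K).
Local Notation V := 'cV[C]_n.
Implicit Types (u v : V -> C) (x : V).

Definition vcont u x := forall e : K, 0 < e -> exists2 d : K, 0 < d &
  forall y, enorm (y - x) < d -> nm (u y - u x) < e.

Lemma vcontP u x : {for x, continuous u} <-> vcont u x.
Proof.
split => [cu e e0|H A /nbhs_nm [e e0 eA]].
  apply/nbhs_cv; apply: (cu [set w | nm (w - u x) < e]).
  by apply/nbhs_nm; exists e.
have [d d0 Hd] := H _ e0; apply/nbhs_cv; exists d => // y yd.
by apply: eA; exact: Hd.
Qed.

Lemma vcont_cst (c : C) x : vcont (fun=> c) x.
Proof. by apply/vcontP; exact: (@contC K V c x). Qed.
Lemma vcontD u v x : vcont u x -> vcont v x -> vcont (fun y => u y + v y) x.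
Proof. by move=> /vcontP cu /vcontP cv; apply/vcontP; exact: (contD cu cv). Qed.
Lemma vcontM u v x : vcont u x -> vcont v x -> vcont (fun y => u y * v y) x.
Proof. by move=> /vcontP cu /vcontP cv; apply/vcontP; exact: (contM cu cv). Qed.
Lemma vcontN u x : vcont u x -> vcont (fun y => - u y) x.
Proof. by move=> /vcontP cu; apply/vcontP; exact: (contN cu). Qed.
Lemma vcontV u x : vcont u x -> u x != 0 -> vcont (fun y => (u y)^-1) x.
Proof. by move=> /vcontP cu u0; apply/vcontP; exact: (contV cu u0). Qed.
Lemma vcont_sum (I : Type) (s : seq I) (u : I -> V -> C) x :
  (forall i, vcont (u i) x) -> vcont (fun y => \sum_(i <- s) u i y) x.
Proof.
move=> H; elim: s => [|i s IH].
  have -> : (fun y => \sum_(i <- [::]) u i y) = fun=> 0 by apply/funext => y; rewrite big_nil.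
  exact: vcont_cst.
have -> : (fun y => \sum_(j <- i :: s) u j y) = fun y => u i y + \sum_(j <- s) u j y.
  by apply/funext => y; rewrite big_cons.
exact: vcontD.
Qed.
Lemma vcont_prod (I : Type) (s : seq I) (u : I -> V -> C) x :
  (forall i, vcont (u i) x) -> vcont (fun y => \prod_(i <- s) u i y) x.
Proof.
move=> H; elim: s => [|i s IH].
  have -> : (fun y => \prod_(i <- [::]) u i y) = fun=> 1 by apply/funext => y; rewrite big_nil.
  exact: vcont_cst.
have -> : (fun y => \prod_(j <- i :: s) u j y) = fun y => u i y * \prod_(j <- s) u j y.
  by apply/funext => y; rewrite big_cons.
exact: vcontM.
Qed.
Lemma vcont_det N (M : V -> 'M[C]_N) x : (forall i j, vcont (fun y => M y i j) x) ->
  vcont (fun y => \det (M y)) x.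
Proof.
move=> H; apply: vcont_sum => s; apply: vcontM; first exact: vcont_cst.
by apply: vcont_prod => i; exact: H.
Qed.
Lemma vcont_ip a x : vcont (ip a) x.
Proof.
move=> e e0; exists (e / (enorm a + 1)); first by rewrite divr_gt0// ltr_wpDl ?enorm_ge0.
have a1 : 0 < enorm a + 1 by rewrite ltr_wpDl ?enorm_ge0.
move=> y; rewrite ltr_pdivlMr// -ipBr => h; apply: le_lt_trans (cauchy_schwarz _ _) _.
apply: le_lt_trans h; rewrite mulrDr mulr1 mulrC lerDl.
exact: enorm_ge0.
Qed.
Lemma vcont_conj u x : vcont u x -> vcont (fun y => (u y)^* ) x.
Proof.
move=> H e e0; have [d d0 Hd] := H _ e0; exists d => // y yd.
by rewrite -rmorphB nm_conj; exact: Hd.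
Qed.
Lemma vcont_hol u (g : C -> C) x : vcont u x -> hol g (u x) -> vcont (fun y => g (u y)) x.
Proof.
move=> H /hol_cont /cont_nm cg e e0; have [d d0 Hd] := cg _ e0.
have [d2 d20 Hd2] := H _ d0; exists d2 => // y yd.
by apply: Hd; exact: Hd2.
Qed.
Lemma vcont_nbhs u (P : C -> Prop) x : vcont u x -> (\forall s \near u x, P s) ->
  \forall y \near x, P (u y).
Proof.
move=> H /nbhs_nm [e e0 He]; have [d d0 Hd] := H _ e0.
by apply/nbhs_cv; exists d => // y yd; apply: He; exact: Hd.
Qed.
Lemma vcont_neq0 u x : vcont u x -> u x != 0 -> \forall y \near x, u y != 0.
Proof. by move=> /vcontP cu; exact: cont_neq0. Qed.
Lemma vcont_enorm N (G : V -> 'cV[C]_N) x (e : K) : (forall j, vcont (fun y => G y j 0) x) -> 0 < e ->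
  \forall y \near x, enorm (G y - G x) < e.
Proof.
move=> H e0; have N1 : 0 < (N%:R + 1 : K) by rewrite ltr_wpDl.
have : \forall y \near x, forall j, nm (G y j 0 - G x j 0) < e / (N%:R + 1).
  apply: near_forall_ord => j; have [d d0 Hd] := H j _ (divr_gt0 e0 N1).
  by apply/nbhs_cv; exists d.
apply: filterS => y Hy; apply: (le_lt_trans (enorm_le_sum _)).
apply: (@le_lt_trans _ _ (\sum_(j < N) (e / (N%:R + 1)))).
  by apply: ler_sum => j _; rewrite !mxE ltW// Hy.
have E : (e / (N%:R + 1)) *+ N = N%:R * e / (N%:R + 1) :> K by rewrite -mulrA mulr_natl.
by rewrite sumr_const card_ord E ltr_pdivrMr// mulrC ltr_pM2l// ltrDl.
Qed.

End VectorContinuity.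

Lemma adj_hol (K : realType) N (M : Cx K -> 'M[Cx K]_N) (t : Cx K) i j :
  (forall i j, hol (fun s => M s i j) t) -> hol (fun s => (\adj (M s)) i j) t.
Proof.
move=> H; have -> : (fun s => (\adj (M s)) i j) = fun s => cofactor (M s) j i.
  by apply/funext => s; rewrite mxE.
apply: holM; first exact: hol_cst.
apply: det_hol => a b.
have -> : (fun s => row' j (col' i (M s)) a b) = fun s => M s (lift j a) (lift i b).
  by apply/funext => s; rewrite !mxE.
exact: H.
Qed.

Lemma adj_vcont (K : realType) n N (M : 'cV[Cx K]_n -> 'M[Cx K]_N) x i j :
  (forall i j, vcont (fun s => M s i j) x) -> vcont (fun s => (\adj (M s)) i j) x.
Proof.
move=> H; have -> : (fun s => (\adj (M s)) i j) = fun s => cofactor (M s) j i.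
  by apply/funext => s; rewrite mxE.
apply: vcontM; first exact: vcont_cst.
apply: vcont_det => a b.
have -> : (fun s => row' j (col' i (M s)) a b) = fun s => M s (lift j a) (lift i b).
  by apply/funext => s; rewrite !mxE.
exact: H.
Qed.

Section Reflection.
Variables (K : realType) (n N : nat) (r R : K).
Local Notation C := (Cx K).
Local Notation V := 'cV[C]_n.
Variable F : V -> 'cV[C]_N.
Hypothesis HF : inner_ext r R F.
Variables (p : V) (zs : 'I_N -> V).
Hypotheses (p1 : enorm p = 1) (zp : forall i, punct (zs i))
  (zr : forall i, ip (zs i) p = (r ^+ 2)%:C) (z_det : \det (Fm F zs) != 0).

(** The component orthogonal to [p], by [zr]. It is kept, and the component along [p] is adjusted by
    [hcoef] to reach the hyperplane of [w]; at w = p the points are the [zs]. *)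
Definition vperp i : V := zs i - (r ^+ 2)%:C *: p.
Definition hcoef i w : C := ((r ^+ 2)%:C - ip (vperp i) w) / ip p w.
Definition hpt w i : V := 1 *: vperp i + hcoef i w *: p.
(* [Phi w] solves [ip (F z) (Phi w) = R^2] for [z] running over the points [hpt w i],
   which satisfy [ip z w = r^2]; it therefore extends [F] across the sphere. *)
Definition Phi w : 'cV[C]_N := \col_j ((R ^+ 2)%:C *
  ((\det (Fm F (hpt w)))^-1 * \sum_i (\adj (Fm F (hpt w))) j i)^* ).

Definition Pdom w := [/\ ip p w != 0, forall i, punct (hpt w i) & \det (Fm F (hpt w)) != 0].

Lemma ip_pp : ip p p = 1.
Proof. by rewrite -enorm_sqr p1 expr1n rC1. Qed.

Lemma hcoef_p i : hcoef i p = (r ^+ 2)%:C.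
Proof. by rewrite /hcoef ipBl zr ipZl ip_pp mulr1 subrr subr0 divr1. Qed.

Lemma hpt_p : hpt p = zs.
Proof. by apply/funext => i; rewrite /hpt hcoef_p scale1r subrK. Qed.

Lemma ip_hpt w i : ip p w != 0 -> ip (hpt w i) w = (r ^+ 2)%:C.
Proof. by move=> w0; rewrite /hpt ipDl scale1r ipZl /hcoef divfK// addrC subrK. Qed.

(** Cramer's rule for the linear system that [inner_polar] gives for the conjugate of [F w]. *)
Lemma Phi_F w : Pdom w -> punct w -> Phi w = F w.
Proof.
have cM (x y : C) : (x * y)^* = x^* * y^* by rewrite rmorphM.
move=> [w0 hp hd] wp; have E : Fm F (hpt w) *m (map_mx (fun x : C => x^* ) (F w)) = const_mx (R ^+ 2)%:C.
  apply/colP => i; rewrite !mxE -[RHS](inner_polar HF (hp i) wp (ip_hpt i w0)).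
  by apply: eq_bigr => j _; rewrite !mxE.
have E2 : \det (Fm F (hpt w)) *: map_mx (fun x : C => x^* ) (F w) = \adj (Fm F (hpt w)) *m const_mx (R ^+ 2)%:C.
  by rewrite -E mulmxA mul_adj_mx mul_scalar_mx.
apply/colP => j; rewrite mxE.
have := congr1 (fun v : 'cV[C]_N => v j 0) E2; rewrite !mxE => E3.
have -> : \sum_i (\adj (Fm F (hpt w))) j i =
    \det (Fm F (hpt w)) * (F w j 0)^* / (R ^+ 2)%:C.
  rewrite E3 mulr_suml; apply: eq_bigr => i _; rewrite [const_mx _ _ _]mxE mulfK//.
  by have /andP[R0 _] := ix_R HF; rewrite rC_eq0 expf_neq0// gt_eqF.
rewrite !mulrA mulVf// mul1r -rCV cM conjCK conj_rC mulrC rCV divfK//.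
by have /andP[R0 _] := ix_R HF; rewrite rC_eq0 expf_neq0// gt_eqF.
Qed.

(** [hpt w] is antiholomorphic in [w], and the conjugation in [Phi] restores holomorphy; therefore
    the curve is conjugated first and [hol_conj] applied. *)
Lemma Phi_hol w : Pdom w -> vchol Phi w.
Proof.
move=> [w0 hp hd] j a b P Q t nP nQ Ew.
pose X (s : C) : V := P (s^* ) *: a + Q (s^* ) *: b.
have XE : X (t^* ) = w by rewrite /X conjCK.
pose g (s : C) : C := (\det (Fm F (hpt (X s))))^-1 * \sum_i (\adj (Fm F (hpt (X s)))) j i.
have -> : (fun s => Phi (P s *: a + Q s *: b) j 0) = fun s => (R ^+ 2)%:C * (g (s^* ))^*.
  by apply/funext => s; rewrite mxE /g /X conjCK.
apply: holM; first exact: hol_cst.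
apply: hol_conj.
have nc (f : C -> C) (c : C) : (\forall s \near t, hol f s) ->
    \forall s \near t^*, hol (fun s => (f (s^* ))^* * c) s.
  move=> H; have H' : \forall s \near (t^* )^*, hol f s by rewrite conjCK.
  have := near_conj H'; apply: filterS => s hs.
  by apply: holM; [exact: hol_conj|exact: hol_cst].
have ipX y s : ip y (X s) = (P (s^* ))^* * ip y a + (Q (s^* ))^* * ip y b.
  by rewrite /X ipDr !ipZr.
have nip y : \forall s \near t^*, hol (fun s => ip y (X s)) s.
  have -> : (fun s => ip y (X s)) = fun s => (P (s^* ))^* * ip y a + (Q (s^* ))^* * ip y b.
    by apply/funext => s.
  by apply: near2 (nc P (ip y a) nP) (nc Q (ip y b) nQ) => s; exact: holD.
have X0 : ip p (X t^*) != 0 by rewrite XE.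
have nX := cont_neq0 (hol_cont (nbhs_singleton (nip p))) X0.
have nk i : \forall s \near t^*, hol (fun s => hcoef i (X s)) s.
  apply: near3 nX (nip p) (nip (vperp i)) => s h0 h1 h2; apply: holM; last exact: holV.
  by apply: holB; [exact: hol_cst|].
have Pt i : punct (1 *: vperp i + hcoef i (X t^*) *: p) by rewrite XE; exact: hp.
have nh := rows_hol HF (a := vperp) (b := fun=> p) (P := fun _ _ => 1) (Q := fun i s => hcoef i (X s))
   (fun=> hol_nearC 1 _) nk Pt.
have hM i k : hol (fun s => Fm F (hpt (X s)) i k) t^*.
  have -> : (fun s => Fm F (hpt (X s)) i k) = fun s => F (1 *: vperp i + hcoef i (X s) *: p) k 0.
    by apply/funext => s; rewrite mxE.
  exact: (nbhs_singleton nh).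
apply: holM.
  by apply: holV; [exact: det_hol|rewrite XE].
by apply: hol_sum => i _; exact: adj_hol.
Qed.

Lemma hcoef_vcont i : vcont (hcoef i) p.
Proof.
apply: vcontM; last by apply: vcontV; [exact: vcont_ip|rewrite ip_pp oner_neq0].
by apply: vcontD; [exact: vcont_cst|apply: vcontN; exact: vcont_ip].
Qed.

Lemma Fm_vcont i k : vcont (fun w => Fm F (hpt w) i k) p.
Proof.
have -> : (fun w => Fm F (hpt w) i k) = fun w => (fun s : C => F (1 *: vperp i + s *: p) k 0) (hcoef i w).
  by apply/funext => w; rewrite mxE.
apply: (vcont_hol (g := fun s : C => F (1 *: vperp i + s *: p) k 0) (@hcoef_vcont i)).
have zpi : punct (1 *: vperp i + hcoef i p *: p).
  by rewrite -[_ + _]/(hpt p i) hpt_p.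
exact: (@ix_hol _ _ _ _ _ _ HF _ zpi k (vperp i) p (fun=> 1) id _ (hol_nearC 1 _) (hol_near_id _) erefl).
Qed.

Lemma Pdom_near : \forall w \near p, Pdom w.
Proof.
have d1 := vcont_det Fm_vcont.
have d2 : \det (Fm F (hpt p)) != 0 by rewrite hpt_p.
have n1 := vcont_neq0 d1 d2.
have q2 : ip p p != 0 by rewrite ip_pp oner_neq0.
have n2 := vcont_neq0 (vcont_ip p p) q2.
have n3 : \forall w \near p, forall i, punct (hpt w i).
  apply: near_forall_ord => i.
  have zpi : punct (1 *: vperp i + (hcoef i p) *: p).
    by rewrite -[_ + _]/(hpt p i) hpt_p.
  have := curve_open (@punct_open K n) (hol_nearC 1 _) (hol_near_id _) zpi.
  exact: (vcont_nbhs (hcoef_vcont i)).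
by apply: near3 n1 n2 n3 => w h1 h2 h3.
Qed.

Lemma Phi_vcont j : vcont (fun w => Phi w j 0) p.
Proof.
have -> : (fun w => Phi w j 0) = fun w => (R ^+ 2)%:C *
  ((\det (Fm F (hpt w)))^-1 * \sum_i (\adj (Fm F (hpt w))) j i)^*.
  by apply/funext => w; rewrite mxE.
apply: vcontM; first exact: vcont_cst.
apply: vcont_conj; apply: vcontM.
  by apply: vcontV; [exact: (vcont_det Fm_vcont)|rewrite hpt_p].
by apply: vcont_sum => i; exact: (adj_vcont _ _ Fm_vcont).
Qed.

Opaque Phi.

(** At a unit vector near [p] the norm of [Phi] is a limit of norms of [F] along the ray, hence [R]
    or 1. Continuity of [Phi] at [p] excludes a jump of size 1 - R. *)
Lemma Phi_ball : exists (e : K) (cv : K), [/\ 0 < e, cv = R \/ cv = 1,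
   forall w, enorm (w - p) < e -> Pdom w &
   forall w, enorm (w - p) < e -> enorm w = 1 -> enorm (Phi w) = cv].
Proof.
have /andP[R0 R1] := ix_R HF.
have [e1 e10 H1] := (@nbhs_cv K n p _).1 Pdom_near.
have h0 : 0 < (1 - R) / 2 by rewrite divr_gt0// subr_gt0.
have [e2 e20 H2] := (@nbhs_cv K n p _).1 (vcont_enorm Phi_vcont h0).
have two w : enorm (w - p) < e1 -> enorm w = 1 -> enorm (Phi w) = R \/ enorm (Phi w) = 1.
  move=> we w1; apply: two_values => eps eps0.
  have Pw := H1 w we.
  have Pw1 : vchol Phi (1 *: w) by rewrite scale1r; exact: Phi_hol.
  have [d d0 Hd] := vline_cont Pw1 eps0.
  have [d2 d20 Hd2] := ix_outer HF eps0.
  have q0 : 0 < e1 - enorm (w - p) by rewrite subr_gt0.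
  have [m mE] : exists m : K, m = Num.min (Num.min d d2) (Num.min (e1 - enorm (w - p)) 1) by eexists.
  have m0 : 0 < m by rewrite mE !lt_min d0 d20 q0 ltr01.
  have m1 : m <= d by rewrite mE !ge_min lexx.
  have m2 : m <= d2 by rewrite mE !ge_min lexx orbT.
  have m3 : m <= e1 - enorm (w - p) by rewrite mE !ge_min lexx !orbT.
  have m4 : m <= 1 by rewrite mE !ge_min lexx !orbT.
  have [x xE] : exists x : K, x = m / 2 by eexists.
  have x0 : 0 < x by rewrite xE divr_gt0.
  have [x1 x2 x3 x4] : [/\ x < d, x < d2, x < e1 - enorm (w - p) & x < 1] by split; rlra.
  have [t tE] : exists t : C, t = (1 - x)%:C by eexists.
  have td : nm (t - 1) < d.
    have -> : t - 1 = - x%:C by rewrite tE rCB rC1 addrAC subrr sub0r.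
    by rewrite nmN nm_real gtr0_norm.
  have tw : enorm (t *: w) = 1 - x.
    by rewrite enormZ w1 mulr1 tE nm_real gtr0_norm// subr_gt0.
  have tp : punct (t *: w) by rewrite /punct /= tw; apply/andP; split; rlra.
  have tP : Pdom (t *: w).
    apply: H1; have -> : t *: w - p = (w - p) - x%:C *: w.
      by rewrite tE rCB rC1 scalerBl scale1r addrAC.
    apply: le_lt_trans (enormD _ _) _; rewrite enormN enormZ w1 nm_real mulr1 gtr0_norm//.
    rlra.
  have := Hd t td; rewrite scale1r (Phi_F tP tp) => ft.
  have tw2 : 1 - d2 < enorm (t *: w) < 1 by rewrite tw; apply/andP; split; rlra.
  have q1 := enormB_ge (F (t *: w)) (Phi w).
  have q2 := enormB_ge (Phi w) (F (t *: w)).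
  have q3 := enormC (Phi w) (F (t *: w)).
  case: (Hd2 _ tw2) => /andP[f1 f2]; [left|right]; rewrite ltr_norml; apply/andP;
    (split; [clear -q1 q2 q3 ft f1 f2 eps0|clear -q1 q2 q3 ft f1 f2 eps0]); rlra.
have pp0 : enorm (p - p) < e1 by rewrite subrr enorm0.
exists (Num.min e1 e2), (enorm (Phi p)); split.
- by rewrite lt_min e10.
- exact: (two p pp0 p1).
- by move=> w; rewrite lt_min => /andP[w1 _]; exact: H1.
move=> w; rewrite lt_min => /andP[we1 we2] w1.
have h2 := H2 w we2.
have q1 := enormB_ge (Phi w) (Phi p).
have q2 := enormB_ge (Phi p) (Phi w).
have q3 := enormC (Phi w) (Phi p).
rewrite -q3 in q2.
exact: (two_values_close R1 (two w we1 w1) (two p pp0 p1) h2 q1 q2).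
Qed.

End Reflection.

Lemma curve_ip_hol (K : realType) n N (F : 'cV[Cx K]_n -> 'cV[Cx K]_N) (a b : 'cV[Cx K]_n)
  (P Q : Cx K -> Cx K) (t : Cx K) v :
  (forall z, punct z -> vchol F z) -> (\forall s \near t, hol P s) ->
  (\forall s \near t, hol Q s) -> punct (P t *: a + Q t *: b) ->
  \forall s \near t, hol (fun s => ip (F (P s *: a + Q s *: b)) v) s.
Proof.
move=> HF nP nQ Pt.
have : \forall s \near t, forall j, hol (fun s => F (P s *: a + Q s *: b) j 0) s.
  by apply: near_forall_ord => j; exact: (vchol_near j (@punct_open K n) HF nP nQ Pt).
apply: filterS => s H; apply: hol_sum => j _; apply: holM; [exact: H|exact: hol_cst].
Qed.

Lemma line_hol_near (K : realType) n N (D : set 'cV[Cx K]_n) (G : 'cV[Cx K]_n -> 'cV[Cx K]_N)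
  (om : 'cV[Cx K]_n) (P : Cx K -> Cx K) (t : Cx K) j : eopen D -> (forall z, D z -> vchol G z) ->
  (\forall s \near t, hol P s) -> D (P t *: om) ->
  \forall s \near t, hol (fun s => G (P s *: om) j 0) s.
Proof.
move=> oD HG nP Dt; have E (s : Cx K) : P s *: om + 0 *: om = P s *: om.
  by rewrite scale0r addr0.
rewrite -E in Dt; have := vchol_near j oD HG nP (hol_nearC 0 t) Dt.
have -> // : (fun s => G (P s *: om + 0 *: om) j 0) = fun s => G (P s *: om) j 0.
by apply/funext => s; rewrite E.
Qed.

Lemma ball_open (K : realType) n (p : 'cV[Cx K]_n) (e : K) : eopen [set w | enorm (w - p) < e].
Proof.
move=> z /= ze; exists (e - enorm (z - p)); first by rewrite subr_gt0.
move=> y yz; have := enormD (y - z) (z - p); rewrite addrA subrK => h.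
by apply: (le_lt_trans h); rewrite -ltrBrDr.
Qed.

Lemma coordB_scale (K : realType) N (a b : Cx K) (x y : 'cV[Cx K]_N) j :
  (a *: x - b *: y) j 0 = a * x j 0 - b * y j 0.
Proof. by rewrite !mxE. Qed.

Section Reflected.
Variables (K : realType) (n N : nat) (r R : K).
Local Notation C := (Cx K).
Local Notation V := 'cV[C]_n.
Variable F : V -> 'cV[C]_N.
Hypothesis HF : inner_ext r R F.

Lemma Fm_orth0 zs v : \det (Fm F zs) != 0 -> (forall i, ip (F (zs i)) v = 0) -> v = 0.
Proof.
move=> d0 H; have E : Fm F zs *m map_mx (fun x : C => x^* ) v = 0.
  apply/colP => i; rewrite !mxE -[RHS](H i).
  by apply: eq_bigr => j _; rewrite !mxE.
have U : Fm F zs \in unitmx by rewrite unitmxE unitfE.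
have := mulKmx U (map_mx (fun x : C => x^* ) v); rewrite E mulmx0 => v0.
apply/colP => j; have := congr1 (fun u : 'cV[C]_N => u j 0) v0.
by rewrite !mxE => /esym/eqP; rewrite conjC_eq0 => /eqP.
Qed.

Section Functional.
Variables (p : V) (zs : 'I_N -> V).
Hypotheses (p1 : enorm p = 1) (zp : forall i, punct (zs i))
  (zr : forall i, ip (zs i) p = (r ^+ 2)%:C) (z_det : \det (Fm F zs) != 0).
Local Notation Ph := (Phi r R F p zs).

(** Polarization of |Phi| = cv on the unit sphere. The partner [z] of b p has component 1 / b < 1
    along [p]; close to [p] it lies in the ball, where [Phi] is [F], and the identity theorem in the
    orthogonal part reaches every [z] of the hyperplane. *)
Lemma outer_pair : exists (e cv : K), [/\ 0 < e, cv = R \/ cv = 1,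
  forall w, enorm (w - p) < e -> Pdom r F p zs w &
  forall (b : K) z, 1 < b < 1 + e -> punct z -> ip z p = (b^-1)%:C ->
    ip (F z) (Ph (b%:C *: p)) = (cv ^+ 2)%:C].
Proof.
have [e [cv [e0 cvE eP ecv]]] := Phi_ball HF p1 zp zr z_det.
have rP := ip_pp p1.
have pE : 1%:C *: p = p by rewrite rC1 scale1r.
have H1 z : enorm (z - 1%:C *: p) < e -> vchol Ph z.
  by rewrite pE => ze; apply: (Phi_hol HF); exact: eP.
have H2 z : enorm (z - 1%:C *: p) < e -> enorm z = 1 -> ip (Ph z) (Ph z) = (cv ^+ 2)%:C.
  by rewrite pE => ze z1; rewrite -enorm_sqr (ecv z ze z1).
have [e1 e10 He1] := polarization ltr01 e0 p1 H1 H2.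
have m0 : 0 < Num.min e1 (e / 2) by rewrite lt_min e10 divr_gt0.
have [m mE] : exists m : K, m = Num.min e1 (e / 2) by eexists.
rewrite -mE in m0; have m1 : m <= e1 by rewrite mE ge_min lexx.
have m2 : m <= e / 2 by rewrite mE ge_min lexx orbT.
exists m, cv; split; [exact m0|exact cvE| |].
  by move=> w we; apply: eP; apply: lt_le_trans we _; rlra.
move=> b z /andP[b1 bm] zp' zb.
have b0 : 0 < b by rlra.
have bi : 0 < b^-1 by rewrite invr_gt0.
have bi1 : b^-1 < 1 by rewrite invf_lt1.
have bi2 : 1 - b^-1 <= b - 1.
  have E : b * b^-1 = 1 by rewrite mulfV// gt_eqF.
  have := mulr_ge0 (ltW bi) (sqr_ge0 (b - 1)).
  have -> : b^-1 * (b - 1) ^+ 2 = b - 2 * (b * b^-1) + b^-1 by rewrite expr2; field; rewrite gt_eqF.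
  rewrite E; rlra.
have zo : ip (z - (b^-1)%:C *: p) p = 0.
  by rewrite ipBl ipZl zb rP mulr1 subrr.
have [eta [q [eta0 q1 qo zq]]] := orth_unit (ix_n HF) zo.
have zE : z = (b^-1)%:C *: p + eta%:C *: q by rewrite -zq addrC subrK.
have zn : b^-1 ^+ 2 + eta ^+ 2 < 1.
  have /andP[_ z1] := zp'; have := enorm_orth (b^-1)%:C eta%:C p1 q1 qo.
  rewrite -zE !nm_real !ger0_norm ?(ltW bi)// => <-.
  by rewrite expr_lt1// enorm_ge0.
pose g (s : C) := ip (F ((b^-1)%:C *: p + (s * eta%:C) *: q)) (Ph (b%:C *: p)) - (cv ^+ 2)%:C.
have Dt (t : K) : 0 <= t <= 1 -> punct ((b^-1)%:C *: p + (t%:C * eta%:C) *: q).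
  move=> /andP[t0 t1]; apply: punct_orth => //; first by rewrite nm_real gtr0_norm.
  rewrite -rCM !nm_real gtr0_norm// ger0_norm ?mulr_ge0//.
  have : (t * eta) ^+ 2 <= eta ^+ 2.
    by rewrite ler_pXn2r ?nnegrE ?mulr_ge0// ler_piMl.
  rlra.
have g1 : g 1%:C = 0.
  apply: (identity_segment (g := g)); last by rewrite ler01 lexx.
    move=> t t01.
    have nQ : \forall s \near (t%:C : C), hol (fun s => s * eta%:C) s.
      by apply: near_all => s; apply: holM; [exact: hol_id|exact: hol_cst].
    have := curve_ip_hol (Ph (b%:C *: p)) (ix_hol HF) (hol_nearC (b^-1)%:C _) nQ (Dt t t01).
    move=> /nbhs_nm [e' e'0 He']; exists e' => // w we; rewrite /g.
    by apply: holB; [exact: He'|exact: hol_cst].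
  move=> e' e'0; have eta1 : 0 < eta + 1 by rlra.
  have md : 0 < m / (eta + 1) by rewrite divr_gt0.
  have [x xE] : exists x : K, x = Num.min (Num.min e' 1) (m / (eta + 1)) / 2 by eexists.
  have x0 : 0 < x by rewrite xE divr_gt0// !lt_min e'0 ltr01.
  have [x1 x2 x3] : [/\ x < e', x < m / (eta + 1) & x < 1].
    have y1 : Num.min (Num.min e' 1) (m / (eta + 1)) <= e' by rewrite !ge_min lexx.
    have y2 : Num.min (Num.min e' 1) (m / (eta + 1)) <= m / (eta + 1) by rewrite !ge_min lexx orbT.
    have y3 : Num.min (Num.min e' 1) (m / (eta + 1)) <= 1 by rewrite !ge_min lexx orbT.
    by rewrite xE; split; rlra.
  exists (x%:C); rewrite nm_real gtr0_norm//; split => //.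
  have x01 : 0 <= x <= 1 by rewrite !ltW.
  have xm : x * eta < m.
    by move: x2; rewrite ltr_pdivlMr// mulrDr mulr1 => x2; rlra.
  have xe0 := mulr_ge0 (ltW x0) eta0.
  have yP : punct ((b^-1)%:C *: p + (x * eta)%:C *: q) by rewrite rCM; exact: Dt.
  have yD : Pdom r F p zs ((b^-1)%:C *: p + (x * eta)%:C *: q).
    apply: eP.
    have -> : (b^-1)%:C *: p + (x * eta)%:C *: q - p = (b^-1 - 1)%:C *: p + (x * eta)%:C *: q.
      by rewrite rCB rC1 scalerBl scale1r addrAC.
    apply: le_lt_trans (enormD _ _) _; rewrite !enormZ p1 q1 !mulr1 !nm_real.
    rewrite (ger0_norm xe0) ler0_norm; rlra.
  rewrite /g -rCM -(Phi_F HF yD yP).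
  have -> : b^-1 = 1 ^+ 2 / b by rewrite expr1n mul1r.
  apply/eqP; rewrite subr_eq0; apply/eqP; apply: He1 => //.
    by rewrite gtr0_norm; rlra.
  by rewrite xe0; rlra.
by move: g1; rewrite /g mul1r -zE => /eqP; rewrite subr_eq0 => /eqP.
Qed.

(** For [b] slightly above 1 and <z, p> = 1 / b there are two relations, <F z, F (r^2 b p)> = R^2
    and <F z, Phi (b p)> = cv^2. As these F z span, cv^2 F (r^2 b p) = R^2 Phi (b p). Both sides
    continue to b = t < 1, where [Phi] is [F]. *)
Lemma functional_eq : exists (cv d : K), [/\ 0 < d, cv = R \/ cv = 1 &
  forall (t : K) j, 1 - d < t < 1 -> 0 < t ->
    (cv ^+ 2)%:C * F ((r ^+ 2 * t)%:C *: p) j 0 = (R ^+ 2)%:C * F (t%:C *: p) j 0].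
Proof.
have /andP[r0 r1] := ix_r HF; have /andP[R0 R1] := ix_R HF.
have r20 : 0 < r ^+ 2 by exact: exprn_gt0.
have r21 : r ^+ 2 < 1 by rewrite expr_lt1// ltW.
have [e [cv [e0 cvE eP epair]]] := outer_pair.
exists cv, e; split; [exact e0|exact cvE|].
move=> t j /andP[te t1] t0.
have [m mE] : exists m : K, m = Num.min e (1 - r ^+ 2) / 2 by eexists.
have m0 : 0 < m by rewrite mE divr_gt0// lt_min e0 subr_gt0.
have m1 : m < e.
  have : Num.min e (1 - r ^+ 2) <= e by rewrite ge_min lexx.
  rlra.
have m2 : m < 1 - r ^+ 2.
  have : Num.min e (1 - r ^+ 2) <= 1 - r ^+ 2 by rewrite ge_min lexx orbT.
  rlra.
(* The continuation starts at b0 > 1, close enough to 1 for r^2 b0 < r^2 (2 - r^2) < 1. *)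
have [b0 b0E] : exists b0 : K, b0 = 1 + m by eexists.
have b0r : r ^+ 2 * b0 < 1.
  have : r ^+ 2 * b0 < r ^+ 2 * (1 + (1 - r ^+ 2)) by rewrite ltr_pM2l//; rlra.
  have := exprn_gt0 2 (_ : 0 < 1 - r ^+ 2); rewrite subr_gt0 => /(_ r21); rnra.
have bp : 0 < b0 by rlra.
have tb : 0 < b0 - t by rlra.
pose L (s : C) : C := b0%:C + s * (t - b0)%:C.
have LE (s : K) : L s%:C = (b0 + s * (t - b0))%:C by rewrite /L (rCD b0) (rCM s).
pose h (l : C) : C := (cv ^+ 2)%:C * F (((r ^+ 2)%:C * l) *: p) j 0 - (R ^+ 2)%:C * Ph (l *: p) j 0.
have gh (s : K) : 0 <= s <= 1 -> \forall w \near (s%:C : C), hol (fun s => h (L s)) w.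
  move=> /andP[s0 s1].
  have q1 : s * (t - b0) <= 0 by rewrite mulr_ge0_le0// subr_le0; rlra.
  have q2 : s * (b0 - t) <= 1 * (b0 - t) by rewrite ler_wpM2r// ltW.
  have q3 : s * (b0 - t) = - (s * (t - b0)) by ring.
  have q4 : r ^+ 2 * (b0 + s * (t - b0)) <= r ^+ 2 * b0 by rewrite ler_pM2l//; rlra.
  have q5 : 0 < r ^+ 2 * (b0 + s * (t - b0)) by rewrite mulr_gt0//; rlra.
  have nL : \forall w \near (s%:C : C), hol (fun w => (r ^+ 2)%:C * L w) w.
    by apply: near_all => w; apply: holM; [exact: hol_cst|exact: hol_affine].
  have D1 : punct (((r ^+ 2)%:C * L s%:C) *: p).
    rewrite /punct /= LE -rCM enormZ p1 mulr1 nm_real gtr0_norm// q5 /=.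
    exact: le_lt_trans q4 b0r.
  have D2 : [set w | enorm (w - p) < e] (L s%:C *: p).
    rewrite /= LE; have -> : (b0 + s * (t - b0))%:C *: p - p = (b0 + s * (t - b0) - 1)%:C *: p.
      by rewrite (rCB _ 1) rC1 scalerBl scale1r.
    by rewrite enormZ p1 mulr1 nm_real ltr_norml; apply/andP; split; rlra.
  have PH w : [set w | enorm (w - p) < e] w -> vchol Ph w.
    by move=> we; apply: (Phi_hol HF); exact: eP.
  have N1 := line_hol_near j (@punct_open K n) (ix_hol HF) nL D1.
  have N2 := line_hol_near j (@ball_open K n p e) PH (near_hol_affine _ _ _) D2.
  apply: near2 N1 N2 => w h1 h2.
  by apply: holB; (apply: holM; first exact: hol_cst).
have key b : b0 < b -> b < 1 + e -> r ^+ 2 * b < 1 -> (exists zs' : 'I_N -> V, [/\ forall i, punct (zs' i),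
    forall i, ip (zs' i) p = (b^-1)%:C & \det (Fm F zs') != 0]) -> h b%:C = 0.
  move=> b1 b2 b3 [zs' [y1 y2 y3]]; have b1' : 1 < b < 1 + e by rewrite b2 andbT; rlra.
  have bb : 0 < b by rlra.
  have wp : punct ((r ^+ 2 * b)%:C *: p).
    by rewrite /punct /= enormZ p1 mulr1 nm_real gtr0_norm ?b3 ?andbT ?mulr_gt0.
  have E : (cv ^+ 2)%:C *: F ((r ^+ 2 * b)%:C *: p) - (R ^+ 2)%:C *: Ph (b%:C *: p) = 0.
    apply: (Fm_orth0 y3) => i; rewrite ipBr !ipZr !conj_rC (epair b _ b1' (y1 i) (y2 i)).
    rewrite (inner_polar HF (y1 i) wp); first by rewrite mulrC subrr.
    by rewrite ipZr conj_rC y2 -rCM; congr (_%:C); field; rewrite gt_eqF.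
  have := congr1 (fun u : 'cV[C]_N => u j 0) E; rewrite coordB_scale [RHS]mxE /h.
  by rewrite -(rCM (r ^+ 2) b).
have h1 : h (L 1%:C) = 0.
  apply: (identity_segment (g := fun s => h (L s))); last by rewrite ler01 lexx.
    by move=> s /gh /nbhs_nm.
  move=> e' e'0; have [Y1 Y2] : 0 < b0^-1 /\ b0^-1 < 1 by rewrite invr_gt0 invf_lt1//; split; rlra.
  have [e3 e30 He3] : exists2 e3 : K, 0 < e3 & forall x : K, 0 < x < e3 ->
      exists zs' : 'I_N -> V, [/\ forall i, punct (zs' i),
      forall i, ip (zs' i) p = (x * r ^+ 2 + (1 - x) * b0^-1)%:C & \det (Fm F zs') != 0].
    have b01 : 0 < b0^-1 < 1 by rewrite Y1.
    have d0 : \det (Ym F (fun=> 0) 1%:M zs) != 0 by rewrite Ym01.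
    have [e3 e30 H3] := segment_points HF p1 (ltW r20) b01 zp zr d0.
    exists e3; first exact e30.
    move=> x /H3 [zs' []]; rewrite Ym01 => h1 h2 h3; exists zs'.
    split; [exact h1|exact h2|exact h3].
  have [q qE] : exists q : K, q = 1 - r ^+ 2 * b0 by eexists.
  have q0 : 0 < q by rlra.
  have q1 : q < 1 by rewrite qE; have := mulr_gt0 r20 bp; rlra.
  have [u uE] : exists u : K, u = Num.min (Num.min e3 1) (Num.min (e' * (b0 - t)) (Num.min (e - m) (1 - r ^+ 2 * b0))) by eexists.
  have u0 : 0 < u by rewrite uE !lt_min e30 ltr01 mulr_gt0// subr_gt0 m1 subr_gt0 b0r.
  have u1 : u <= e3 by rewrite uE !ge_min lexx.
  have u2 : u <= 1 by rewrite uE !ge_min lexx !orbT.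
  have u3 : u <= e' * (b0 - t) by rewrite uE !ge_min lexx !orbT.
  have u4 : u <= e - m by rewrite uE !ge_min lexx !orbT.
  have u5 : u <= 1 - r ^+ 2 * b0 by rewrite uE !ge_min lexx !orbT.
  have bn : 0 < 2 * b0 + 1 by rlra.
  have [x xE] : exists x : K, x = u / (2 * b0 + 1) by eexists.
  have x0 : 0 < x by rewrite xE divr_gt0.
  have xu : x * (2 * b0) + x = u by rewrite xE; field; rewrite gt_eqF.
  have xb : 0 < x * b0 by exact: mulr_gt0.
  have x3 : x * 3 < u.
    have : x * 1 < x * b0 by rewrite ltr_pM2l//; rlra.
    rlra.
  have xq : 0 < x * q /\ x * q < x by split; [exact: mulr_gt0|rewrite gtr_pMr].
  have dn : 0 < 1 - x * q by rlra.
  (* Then 1 / b = x r^2 + (1 - x) / b0, the level of the points that [segment_points] provides; [b]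
     tends to b0 from above as [x] tends to 0. *)
  have [b bE] : exists b : K, b = b0 / (1 - x * q) by eexists.
  have bB : b - b0 = b0 * (x * q) / (1 - x * q) by rewrite bE; field; rewrite gt_eqF.
  have bb0 : 0 < b - b0 by rewrite bB divr_gt0// mulr_gt0// (xq.1).
  have bu : b - b0 < u.
    rewrite bB ltr_pdivrMr//; have : b0 * (x * q) < b0 * x by rewrite ltr_pM2l// (xq.2).
    have : u * (1 - x * q) >= u * (1 / 2) by rewrite ler_pM2l//; rlra.
    rlra.
  have x3' : 0 < x < e3 by rewrite x0; rlra.
  have hb : h b%:C = 0.
    apply: key; [rlra|rewrite b0E in bu; rlra| |].
      have : r ^+ 2 * (b - b0) < 1 * u by rewrite ltr_pM//; rewrite ?ltW.
      rlra.
    have [zs' [y1 y2 y3]] := He3 x x3'; exists zs'; split => // i; rewrite y2; congr (_%:C).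
    rewrite bE qE; field; rewrite -qE !gt_eqF//=.
  exists (((b0 - b) / (b0 - t))%:C); split.
  - rewrite LE -[RHS]hb; congr (h _%:C); field; rewrite gt_eqF//.
  - rewrite nm_real normr_gt0 mulf_neq0 ?invr_neq0 ?(gt_eqF tb)//.
    by rewrite subr_eq0 lt_eqF// -subr_gt0.
  rewrite nm_real normrM normfV (gtr0_norm tb) ltr_pdivrMr// distrC gtr0_norm//.
  exact: lt_le_trans bu u3.
have tp : punct (t%:C *: p) by rewrite /punct /= enormZ p1 mulr1 nm_real gtr0_norm// t0.
have tD : Pdom r F p zs (t%:C *: p).
  apply: eP; have -> : t%:C *: p - p = (t - 1)%:C *: p by rewrite rCB rC1 scalerBl scale1r.
  by rewrite enormZ p1 mulr1 nm_real ler0_norm; rlra.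
move: h1; rewrite LE; have -> : b0 + 1 * (t - b0) = t by ring.
rewrite /h (Phi_F HF tD tp) -rCM => /eqP.
by rewrite subr_eq0 => /eqP.
Qed.

End Functional.
End Reflected.

Lemma nm_scaled2 (K : realType) (a b : K) (x y : Cx K) : 0 <= a -> 0 <= b ->
  nm (a%:C * x - b%:C * y) <= a * nm x + b * nm y.
Proof.
by move=> a0 b0; apply: le_trans (nmB _ _) _; rewrite !nmM !nm_real !ger0_norm.
Qed.

(** * Homogeneity along lines *)

Section Power.
Variables (K : realType) (n N : nat) (r R : K).
Local Notation C := (Cx K).
Local Notation V := 'cV[C]_n.
Variable F : V -> 'cV[C]_N.
Hypothesis HF : inner_ext r R F.

Section Line.
Variable p : V.
Hypothesis p1 : enorm p = 1.
Let k j (l : C) := F (l *: p) j 0.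

Lemma punct_line (l : C) : 0 < nm l < 1 -> punct (l *: p).
Proof. by move=> h; rewrite /punct /= enormZ p1 mulr1. Qed.

Lemma line_hol_all j (l : C) : 0 < nm l < 1 -> hol (k j) l.
Proof. by move=> h; apply: line_hol; apply: (ix_hol HF); exact: punct_line. Qed.

Lemma line_affine_near j (c : C) (P : C -> C) (t : C) : 0 < nm (P t) < 1 ->
  (forall s, hol P s) -> \forall s \near t, hol (fun s => k j (P s)) s.
Proof.
move=> h hP; apply: (line_hol_near j (@punct_open K n) (ix_hol HF) (near_all _ hP)).
exact: punct_line.
Qed.

Lemma line_monomial (d : nat) (v : 'cV[C]_N) (e : K) : 0 < e ->
  (forall l, 0 < nm l < e -> F (l *: p) = l ^+ d *: v) ->
  forall l, 0 < nm l < 1 -> F (l *: p) = l ^+ d *: v.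
Proof.
move=> e0 H l /andP[l0 l1]; apply/colP => j; rewrite mxE.
have [x xE] : exists x : K, x = Num.min e 1 / 2 by eexists.
have x0 : 0 < x by rewrite xE divr_gt0// lt_min e0 ltr01.
have y1 : Num.min e 1 <= e by rewrite ge_min lexx.
have y2 : Num.min e 1 <= 1 by rewrite ge_min lexx orbT.
have x1 : x < e by rlra.
have x2 : x < 1 by rlra.
pose P (s : C) : C := x%:C * l + s * ((1 - x)%:C * l).
have hP s : hol P s by exact: hol_affine.
have PE (s : K) : nm (P s%:C) = `|x + s * (1 - x)| * nm l.
  by rewrite /P mulrA -mulrDl nmM -rCM -rCD nm_real.
pose g (s : C) := k j (P s) - P s ^+ d * v j 0.
have g1 : g 1%:C = 0.
  apply: (identity_segment (g := g)); last by rewrite ler01 lexx.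
    move=> t /andP[t0 t1].
    have tx : 0 <= t * (1 - x) by rewrite mulr_ge0//; rlra.
    have tx2 : t * (1 - x) <= 1 * (1 - x) by rewrite ler_wpM2r//; rlra.
    have Pt : 0 < nm (P t%:C) < 1.
      rewrite PE gtr0_norm; last by rlra.
      rewrite mulr_gt0//=; last by rlra.
      by apply: le_lt_trans l1; rewrite ler_piMl ?nm_ge0//; rlra.
    have := line_affine_near j 0 Pt hP; move=> /nbhs_nm [e' e'0 He'].
    exists e' => // w we; apply: holB; first exact: He'.
    by apply: holM; [apply: holX; exact: hP|exact: hol_cst].
  move=> e' e'0.
  have m0 : 0 < Num.min e' (e - x) by rewrite lt_min e'0 subr_gt0.
  have [y yE] : exists y : K, y = Num.min e' (e - x) / 2 by eexists.
  have y0 : 0 < y by rewrite yE divr_gt0.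
  have z1 : Num.min e' (e - x) <= e' by rewrite ge_min lexx.
  have z2 : Num.min e' (e - x) <= e - x by rewrite ge_min lexx orbT.
  exists y%:C; rewrite nm_real gtr0_norm//; split => //; last by rlra.
  rewrite /g /k H ?mxE ?subrr// PE gtr0_norm; last by rewrite addr_gt0// mulr_gt0// subr_gt0.
  rewrite mulr_gt0//=; last by rewrite addr_gt0// mulr_gt0// subr_gt0.
  have h1 : y * (1 - x) < y by rewrite gtr_pMr//; rlra.
  have h2 : (x + y * (1 - x)) * nm l <= x + y * (1 - x).
    by rewrite ler_piMr// ltW// addr_gt0// mulr_gt0// subr_gt0.
  rlra.
have PE1 : P 1%:C = l.
  by rewrite /P rC1 mul1r -mulrDl -rCD addrC subrK rC1 mul1r.
by move: g1; rewrite /g PE1 => /eqP; rewrite subr_eq0 => /eqP.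
Qed.

Variable zs : 'I_N -> V.
Hypotheses (zp : forall i, punct (zs i))
  (zr : forall i, ip (zs i) p = (r ^+ 2)%:C) (z_det : \det (Fm F zs) != 0).

Lemma functional_eq_all : exists2 cv : K, cv = R \/ cv = 1 &
  forall (t : K) j, 0 < t < 1 ->
    (cv ^+ 2)%:C * k j (r ^+ 2 * t)%:C = (R ^+ 2)%:C * k j t%:C.
Proof.
have /andP[r0 r1] := ix_r HF.
have r20 : 0 < r ^+ 2 by exact: exprn_gt0.
have r21 : r ^+ 2 < 1 by rewrite expr_lt1// ltW.
have [cv [d [d0 cvE H]]] := functional_eq HF p1 zp zr z_det.
exists cv; first exact cvE.
move=> t j /andP[t0 t1].
have [m mE] : exists m : K, m = Num.min d 1 / 2 by eexists.
have m0 : 0 < m by rewrite mE divr_gt0// lt_min d0 ltr01.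
have y1 : Num.min d 1 <= d by rewrite ge_min lexx.
have y2 : Num.min d 1 <= 1 by rewrite ge_min lexx orbT.
have [a aE] : exists a : K, a = 1 - m by eexists.
have a0 : 0 < a by rlra.
have a1 : a < 1 by rlra.
pose L (s : C) : C := a%:C + s * (t - a)%:C.
have LE (s : K) : L s%:C = (a + s * (t - a))%:C by rewrite /L (rCD a) (rCM s).
have Lb (s : K) : 0 <= s <= 1 -> 0 < a + s * (t - a) < 1.
  move=> /andP[s0 s1]; have -> : a + s * (t - a) = (1 - s) * a + s * t by ring.
  have [->|sn] := eqVneq s 1; first by rewrite subrr mul0r add0r mul1r t0.
  have s1' : 0 < 1 - s by rewrite subr_gt0 lt_neqAle sn.
  have h1 : 0 < (1 - s) * a by exact: mulr_gt0.
  have h2 : 0 <= s * t by rewrite mulr_ge0// ltW.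
  have h3 : (1 - s) * a < (1 - s) * 1 by rewrite ltr_pM2l.
  have h4 : s * t <= s * 1 by rewrite ler_wpM2l// ltW.
  by apply/andP; split; rlra.
pose g (s : C) := (cv ^+ 2)%:C * k j ((r ^+ 2)%:C * L s) - (R ^+ 2)%:C * k j (L s).
have g1 : g 1%:C = 0.
  apply: (identity_segment (g := g)); last by rewrite ler01 lexx.
    move=> s s01; have /andP[b1 b2] := Lb s s01.
    have h1 : 0 < nm (L s%:C) < 1 by rewrite LE nm_real gtr0_norm// b1.
    have h2 : 0 < nm ((r ^+ 2)%:C * L s%:C) < 1.
      rewrite nmM nm_real gtr0_norm// mulr_gt0//=; last by case/andP: h1.
      case/andP: h1 => h1 h1'.
      by have : r ^+ 2 * nm (L s%:C) < 1 * 1; [apply: ltr_pM; rewrite ?nm_ge0// ltW|rewrite mulr1].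
    have N1 := line_affine_near j 0 (P := L) h1 (fun s => hol_affine _ _ s).
    have N2 := line_affine_near j 0 (P := fun s => (r ^+ 2)%:C * L s) h2
      (fun s => holM (hol_cst _ _) (hol_affine _ _ s)).
    have : \forall s' \near (s%:C : C), hol g s'.
      by apply: near2 N1 N2 => s' q1 q2; apply: holB; (apply: holM; first exact: hol_cst).
    by move=> /nbhs_nm.
  move=> e' e'0.
  have q0 : 0 < Num.min e' m by rewrite lt_min e'0.
  have [x xE] : exists x : K, x = Num.min e' m / 2 by eexists.
  have x0 : 0 < x by rewrite xE divr_gt0.
  have z1 : Num.min e' m <= e' by rewrite ge_min lexx.
  have z2 : Num.min e' m <= m by rewrite ge_min lexx orbT.
  exists x%:C; rewrite nm_real gtr0_norm//; split => //; last by rlra.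
  rewrite /g LE -(rCM (r ^+ 2)).
  have x1 : 0 <= x <= 1 by apply/andP; split; rlra.
  have /andP[b1 b2] := Lb x x1.
  have xa : - x < x * (t - a).
    have : x * -1 < x * (t - a) by rewrite ltr_pM2l//; rlra.
    rlra.
  have xr : 1 - d < a + x * (t - a) < 1 by apply/andP; split; rlra.
  by have := H _ j xr b1; rewrite /k => ->; rewrite subrr.
move: g1; rewrite /g LE; have -> : a + 1 * (t - a) = t by ring.
by rewrite -(rCM (r ^+ 2)) => /eqP; rewrite subr_eq0 => /eqP.
Qed.

(** Taylor coefficients satisfy (cv^2 r^(2 m) - R^2) a_m = 0, and r^(2 m) is injective in m; so a
    single power survives, the same for all components. *)
Lemma line_power : exists (d : nat) (v : 'cV[C]_N), [/\ (1 <= d)%N, R = r ^+ d &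
  forall l, 0 < nm l < 1 -> F (l *: p) = l ^+ d *: v].
Proof.
have /andP[r0 r1] := ix_r HF; have /andP[R0 R1] := ix_R HF.
have r20 : 0 < r ^+ 2 by exact: exprn_gt0.
have r21 : r ^+ 2 < 1 by rewrite expr_lt1// ltW.
have [cv cvE Hcv] := functional_eq_all.
have cv0 : 0 < cv by case: cvE => ->.
have [B0 HB0] := ix_bd HF.
have [B BE] : exists B : K, B = `|B0| by eexists.
have B0' : 0 <= B by rewrite BE.
have kB j l : 0 < nm l -> nm l <= 1 / 2 -> nm (k j l) <= B.
  move=> l0 l1; apply: le_trans (nm_coord _ _) _.
  have := HB0 (l *: p); rewrite enormZ p1 mulr1 => /(_ l0 l1) h.
  by apply: (le_trans h); rewrite BE ler_norm.
have h12 : 1 / 2 < 1 :> K by rlra.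
have h0 : 0 < 1 / 2 :> K by rlra.
have kC j l : 0 < nm l < 1 / 2 -> k j l = cmean (1 / 2) (fun w => k j w * kern l w).
  move=> /andP[l0 l1]; apply: (@cauchy_disc K (1 / 2) (k j) l B (1 / 2)) => //.
    by move=> w /andP[w0 w1]; apply: line_hol_all; rewrite w0; rlra.
  by move=> w /andP[w0 w1]; apply: kB => //; exact: ltW.
have kc j : circ_cont (1 / 2) (k j).
  apply: circ_cont_hol; first exact: ltW.
  by move=> w w1; apply: line_hol_all; rewrite w1 h0.
have kM j w : nm w = 1 / 2 -> nm (k j w) <= B.
  by move=> w1; apply: kB; rewrite w1.
pose a j m := tcoef (1 / 2) (k j) m.
have rem j m l : 0 < nm l < 1 / 4 -> nm (k j l - \sum_(i < m) a j i * l ^+ i) <=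
    4 * B * 2 ^+ m * nm l ^+ m.
  move=> /andP[l0 l1]; have l2 : nm l < 1 / 2 by rlra.
  have l3 : 0 < nm l < 1 / 2 by rewrite l0.
  rewrite (kC j l l3); apply: le_trans (taylor_rem m (kc j) (@kM j) l2) _.
  have -> : nm l / (1 / 2) = 2 * nm l by field.
  rewrite exprMn.
  have q : 1 / 2 / (1 / 2 - nm l) <= 2 by rewrite ler_pdivrMr; rlra.
  have -> : 4 * B * 2 ^+ m * nm l ^+ m = 2 * (B * (2 ^+ m * nm l ^+ m * 2)) by ring.
  apply: ler_wpM2l => //; apply: ler_wpM2l => //; apply: ler_wpM2l => //.
  by rewrite mulr_ge0// exprn_ge0// nm_ge0.
have coef j m : ((cv ^+ 2 * (r ^+ 2) ^+ m - R ^+ 2)%:C : C) * a j m = 0.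
  apply: (@coef_zero K (fun m => (cv ^+ 2 * (r ^+ 2) ^+ m - R ^+ 2)%:C * a j m)
    (fun z => exists2 t : K, 0 < t < 1 & z = t%:C)).
    move=> e e0; have m0 : 0 < Num.min e 1 / 2 by rewrite divr_gt0// lt_min e0 ltr01.
    have y1 : Num.min e 1 <= e by rewrite ge_min lexx.
    have y2 : Num.min e 1 <= 1 by rewrite ge_min lexx orbT.
    exists ((Num.min e 1 / 2)%:C); rewrite nm_real gtr0_norm//; split => //; last by rlra.
    by exists (Num.min e 1 / 2) => //; apply/andP; split; rlra.
  move=> M; exists ((cv ^+ 2 + R ^+ 2) * (4 * B * 2 ^+ M)), (1 / 4); split; first by rlra.
  move=> _ [t /andP[t0 t1] ->]; rewrite nm_real (gtr0_norm t0) => t4.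
  have rt : 0 < r ^+ 2 * t by exact: mulr_gt0.
  have rt' : r ^+ 2 * t <= t by rewrite ler_piMl// ltW.
  have T1 := rem j M t%:C; rewrite nm_real (gtr0_norm t0) t0 in T1.
  have T2 := rem j M (r ^+ 2 * t)%:C; rewrite nm_real (gtr0_norm rt) rt in T2.
  have {}T1 := T1 t4; have {}T2 := T2 (le_lt_trans rt' t4).
  have t01 : 0 < t < 1 by rewrite t0.
  have E := Hcv t j t01.
  have -> : \sum_(i < M) (cv ^+ 2 * (r ^+ 2) ^+ i - R ^+ 2)%:C * a j i * t%:C ^+ i =
    (R ^+ 2)%:C * (k j t%:C - \sum_(i < M) a j i * t%:C ^+ i) -
    (cv ^+ 2)%:C * (k j (r ^+ 2 * t)%:C - \sum_(i < M) a j i * (r ^+ 2 * t)%:C ^+ i).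
    rewrite !mulrBr E opprB addrC addrA subrK !mulr_sumr -sumrB.
    apply: eq_bigr => i _; rewrite rCB (rCM (cv ^+ 2)) (rCX (r ^+ 2) i) (rCM (r ^+ 2) t) exprMn.
    by ring.
  apply: (le_trans (nm_scaled2 _ _ (sqr_ge0 R) (sqr_ge0 cv))).
  have A0 : 0 <= 4 * B * 2 ^+ M by rewrite !mulr_ge0// exprn_ge0.
  have U1 : R ^+ 2 * nm (k j t%:C - \sum_(i < M) a j i * t%:C ^+ i) <=
      R ^+ 2 * (4 * B * 2 ^+ M * t ^+ M) by exact (ler_wpM2l (sqr_ge0 R) T1).
  have U2 : cv ^+ 2 * nm (k j (r ^+ 2 * t)%:C - \sum_(i < M) a j i * (r ^+ 2 * t)%:C ^+ i) <=
      cv ^+ 2 * (4 * B * 2 ^+ M * t ^+ M).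
    apply: (le_trans (ler_wpM2l (sqr_ge0 cv) T2)); apply: (ler_wpM2l (sqr_ge0 cv)).
    apply: (ler_wpM2l A0); apply: lerXn2r; rewrite ?nnegrE; [exact: ltW|exact: ltW|exact: rt'].
  apply: (le_trans (lerD U1 U2)); rewrite -mulrDl addrC -!mulrA.
  exact: lexx.
have inj m m' j j' : a j m != 0 -> a j' m' != 0 -> m = m'.
  move=> a1 a2; have := coef j m; have := coef j' m' => /eqP.
  rewrite mulf_eq0 (negbTE a2) orbF rC_eq0 subr_eq0 => /eqP E1 /eqP.
  rewrite mulf_eq0 (negbTE a1) orbF rC_eq0 subr_eq0 => /eqP; rewrite -E1 => E2.
  have cv2 : cv ^+ 2 != 0 by rewrite expf_neq0// gt_eqF.
  have := mulfI cv2 E2; apply: ieexprIn => //.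
  by rewrite lt_eqF.
have [d Hd] : exists d : nat, forall j m, m != d -> a j m = 0.
  have [[j0 [d a0]]|h] := pselect (exists j d, a j d != 0).
    exists d => j m md; apply/eqP; apply: contraNT md => am.
    by apply/eqP; exact: inj am a0.
  exists 0 => j m _; apply/eqP; apply/negPn/negP => am; apply: h.
  by exists j, m.
have small l : 0 < nm l < 1 / 2 -> F (l *: p) = l ^+ d *: \col_j a j d.
  move=> l01; apply/colP => j; case/andP: (l01) => _ l1.
  have := tcoef_monomial (kc j) (@kM j) l1 (Hd j); rewrite -(kC j l l01) => E.
  by rewrite !mxE [RHS]mulrC; exact E.
have all := line_monomial h0 small.
have vn (t : K) : 0 < t < 1 -> enorm (F (t%:C *: p)) = t ^+ d * enorm (\col_j a j d).
  move=> /andP[t0 t1]; rewrite all ?nm_real ?gtr0_norm ?t0//.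
  by rewrite enormZ nmX nm_real gtr0_norm.
have rF : R = r ^+ d * enorm (\col_j a j d).
  have := @ix_inner _ _ _ _ _ _ HF (r%:C *: p); rewrite enormZ p1 mulr1 nm_real gtr0_norm//.
  by rewrite vn ?r0// => ->.
have [j0 aj] : exists j, a j d != 0.
  apply: contrapT => h; have v0 : \col_j a j d = 0 :> 'cV[C]_N.
    apply/colP => j; rewrite !mxE; apply/eqP; apply/negPn/negP => am; apply: h.
    by exists j.
  by move: rF; rewrite v0 enorm0 mulr0 => h'; move: R0; rewrite h' ltxx.
have E2 : cv ^+ 2 * (r ^+ 2) ^+ d = R ^+ 2.
  have /eqP := coef j0 d; rewrite mulf_eq0 (negbTE aj) orbF rC_eq0 subr_eq0.
  by move=> /eqP.
have rd0 : 0 <= r ^+ d by rewrite exprn_ge0// ltW.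
have E : cv * r ^+ d = R.
  apply/eqP; rewrite -(@eqrXn2 _ 2) ?mulr_ge0 ?(ltW R0) ?(ltW cv0)//.
  by rewrite exprMn -exprM mulnC exprM E2.
exists d, (\col_j a j d); case: cvE => cE; last first.
  rewrite cE mul1r in E; split => //.
  by rewrite lt0n; apply: contraTneq R1 => d0; rewrite -E d0 expr0 ltxx.
(* The case cv = R gives r^d = 1, so d = 0 and |F (t p)| = R for all [t], whereas [ix_outer] makes
   this norm exceed [R] near the unit sphere. *)
exfalso.
have rd1 : r ^+ d = 1 by apply: (mulfI (lt0r_neq0 R0)); rewrite mulr1 -{1}cE.
have d0 : d = 0%N.
  have : r ^+ d = r ^+ 0 by rewrite rd1 expr0.
  by apply: ieexprIn => //; rewrite lt_eqF.
have e0 : 0 < (1 - R) / 2 by rewrite divr_gt0// subr_gt0.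
have [dl dl0 Hdl] := ix_outer HF e0.
have m0 : 0 < Num.min dl 1 / 2 by rewrite divr_gt0// lt_min dl0 ltr01.
have y1 : Num.min dl 1 <= dl by rewrite ge_min lexx.
have y2 : Num.min dl 1 <= 1 by rewrite ge_min lexx orbT.
have [t tE] : exists t : K, t = 1 - Num.min dl 1 / 2 by eexists.
have t0 : 0 < t by rlra.
have t1 : t < 1 by rlra.
have t01 : 0 < t < 1 by rewrite t0.
have td : 1 - dl < enorm (t%:C *: p) < 1.
  by rewrite enormZ p1 mulr1 nm_real gtr0_norm// t1 andbT; rlra.
have EF : enorm (F (t%:C *: p)) = R.
  by rewrite vn// d0 expr0 mul1r rF d0 expr0 mul1r.
by case: (Hdl _ td); rewrite EF; rlra.
Qed.

End Line.

(** On the line of [w], spanned by the rotated unit vector u p, [F] is l^d v. The relation at the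
    point mu u p with <z, mu u p> = r^2 determines <F z, v>; the lower bound on <z, w> places this
    point in the ball. *)
Lemma good_pair (d : nat) w z : R = r ^+ d -> good r F w -> punct w -> punct z ->
  r ^+ 2 * enorm w < nm (ip z w) -> ip (F z) (F w) = ip z w ^+ d.
Proof.
move=> Rd gw wp zp zw; have /andP[r0 r1] := ix_r HF; have /andP[w0 w1] := wp.
have r20 : 0 < r ^+ 2 by exact: exprn_gt0.
have wi : 0 < (enorm w)^-1 by rewrite invr_gt0.
have gp := good_scale wi gw.
have [p pE] : exists p : V, p = ((enorm w)^-1)%:C *: w by eexists.
rewrite -pE in gp.
have p1 : enorm p = 1 by rewrite pE enormZ nm_real gtr0_norm// mulVf// gt_eqF.
have [u [zs [u1 zsp zsr zsd]]] := good_rotate HF p1 gp.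
have un : u != 0 by rewrite -nm_gt0 u1.
have q1 : enorm (u *: p) = 1 by rewrite enormZ u1 p1 mulr1.
have [d' [v [_ Rd' Hv]]] := line_power q1 zsp zsr zsd.
have dd : d' = d.
  have : r ^+ d' = r ^+ d by rewrite -Rd' -Rd.
  by apply: ieexprIn => //; rewrite lt_eqF.
rewrite {}dd {d' Rd'} in Hv.
have [l lE] : exists l : C, l = (enorm w)%:C * u^-1 by eexists.
have wE : w = l *: (u *: p).
  rewrite scalerA lE -mulrA mulVf// mulr1 pE scalerA -rCM mulfV ?rC1 ?scale1r//.
  by rewrite gt_eqF.
have ln : nm l = enorm w by rewrite lE nmM nmV u1 invr1 mulr1 nm_real gtr0_norm.
have [b bE] : exists b : C, b = ip z (u *: p) by eexists.
have zwE : ip z w = l^* * b by rewrite {1}wE ipZr bE.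
have bn : r ^+ 2 < nm b.
  by move: zw; rewrite zwE nmM nm_conj ln mulrC ltr_pM2l.
have b0 : 0 < nm b by exact: lt_trans bn.
have bn0 : b != 0 by rewrite -nm_gt0.
have [mu muE] : exists mu : C, mu = (r ^+ 2)%:C / b^* by eexists.
have mun : 0 < nm mu < 1.
  by rewrite muE nmM nmV nm_conj nm_real gtr0_norm// divr_gt0//= ltr_pdivrMr// mul1r.
have mup : punct (mu *: (u *: p)) by rewrite /punct /= enormZ q1 mulr1.
have cM (x y : C) : (x * y)^* = x^* * y^* by rewrite rmorphM.
have cX (x : C) : (x ^+ d)^* = x^* ^+ d by rewrite rmorphXn.
have cV (x : C) : (x^-1)^* = (x^* )^-1 by rewrite fmorphV.
have muc : mu^* * b = (r ^+ 2)%:C.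
  by rewrite muE cM conj_rC cV conjCK divfK.
have A : ip (F z) (F (mu *: (u *: p))) = (R ^+ 2)%:C.
  by apply: (inner_polar HF) => //; rewrite ipZr -bE muc.
have Fv : ip (F z) v = b ^+ d.
  have mc0 : mu^* ^+ d != 0.
    by rewrite expf_neq0// conjC_eq0 -nm_gt0; case/andP: mun.
  apply: (mulfI mc0); rewrite -exprMn muc -cX -ipZr -(Hv _ mun) A Rd.
  by rewrite -rCX -!exprM mulnC.
have l01 : 0 < nm l < 1 by rewrite ln w0.
rewrite {1}wE (Hv _ l01) ipZr Fv cX zwE exprMn.
by [].
Qed.

End Power.

Lemma orth_rows (K : realType) k n (X : 'I_k -> 'cV[Cx K]_n) : (k < n)%N ->
  exists2 u : 'cV[Cx K]_n, u != 0 & forall i, ip (X i) u = 0.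
Proof.
move=> kn; pose M : 'M[Cx K]_(k, n) := \matrix_(i, j) X i j 0.
have rX : (\rank M^T < n)%N by rewrite mxrank_tr; apply: leq_ltn_trans kn; exact: rank_leq_row.
have kn0 : kermx M^T != 0 by rewrite kermx_eq0 /row_free neq_ltn rX.
have [u uX u0] := rowV0Pn kn0.
have {}uX : u *m M^T = 0 by apply/sub_kermxP.
exists (\col_j (u 0 j)^* ).
  apply: contraNneq u0 => v0; apply/eqP/rowP => j.
  have := congr1 (fun v : 'cV[Cx K]_n => v j 0) v0.
  by rewrite !mxE => /eqP; rewrite conjC_eq0 => /eqP.
move=> i; have := congr1 (fun v : 'rV[Cx K]_k => v 0 i) uX; rewrite !mxE => h.
by rewrite -[RHS]h; apply: eq_bigr => j _; rewrite !mxE conjCK mulrC.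
Qed.

(** As long as fewer than [N] points are chosen, a nonzero [u] is orthogonal to all of them; by
    hypothesis [S] contains a point not orthogonal to [u], which is the next one. *)
Lemma indep_points (K : realType) N (S : set 'cV[Cx K]_N) :
  (forall v, (forall x, S x -> ip x v = 0) -> v = 0) ->
  forall k, (k <= N)%N -> exists xs : 'I_k -> 'cV[Cx K]_N,
    (forall i, S (xs i)) /\ row_free (\matrix_(i < k, j < N) xs i j 0).
Proof.
move=> HS; elim=> [_|k IH kN].
  exists (fun i => match ltn0 i in (_ = b) return (i < 0)%N = b -> _ with _ => fun=> 0 end (erefl _)).
  split; first by case.
  by rewrite /row_free -leqn0 rank_leq_row.
have [xs [Sxs fxs]] := IH (ltnW kN); have [u u0 ipu] := orth_rows xs kN.
have [x [Sx xu]] : exists x, S x /\ ip x u != 0.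
  apply: contrapT => h; move/eqP: u0; apply; apply: HS => x Sx.
  by apply/eqP/negPn/negP => xu; apply: h; exists x.
exists (fun i : 'I_k.+1 => if unlift ord0 i is Some j then xs j else x); split.
  by move=> i; case: (unlift ord0 i).
apply: inj_row_free => y yX.
have E j : y 0 ord0 * x j 0 + \sum_(i < k) y 0 (lift ord0 i) * xs i j 0 = 0.
  have := congr1 (fun v : 'rV[Cx K]_N => v 0 j) yX; rewrite !mxE big_ord_recl mxE unlift_none => h.
  rewrite -[RHS]h; congr (_ + _); apply: eq_bigr => i _.
  by rewrite mxE liftK.
have y0 : y 0 ord0 = 0.
  have : \sum_j (y 0 ord0 * x j 0 + \sum_(i < k) y 0 (lift ord0 i) * xs i j 0) * (u j 0)^* = 0.
    by apply: big1 => j _; rewrite E mul0r.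
  under eq_bigr => j _ do rewrite mulrDl mulr_suml -mulrA.
  rewrite big_split -mulr_sumr exchange_big /= [X in _ + X]big1 => [|i _].
    by rewrite addr0 => /eqP; rewrite mulf_eq0 (negbTE xu) orbF => /eqP.
  under eq_bigr => j _ do rewrite -mulrA.
  by rewrite -mulr_sumr -[\sum_j _]/(ip (xs i) u) ipu mulr0.
have yr : (\row_i y 0 (lift ord0 i)) *m (\matrix_(i < k, j < N) xs i j 0) = 0.
  apply/rowP => j; rewrite mxE [RHS]mxE -[RHS](E j) y0 mul0r add0r.
  by apply: eq_bigr => i _; rewrite !mxE.
have yr0 : \row_i y 0 (lift ord0 i) = 0 :> 'rV_k.
  by apply: (row_free_inj fxs); rewrite yr mul0mx.
apply/rowP => i; rewrite [RHS]mxE; case: (unliftP ord0 i) => [j ->|->//].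
by have := congr1 (fun v : 'rV[Cx K]_k => v 0 j) yr0; rewrite !mxE.
Qed.

(** * The power formula at all points of the punctured ball *)

Section Pairing.
Variables (K : realType) (n N : nat) (r R : K).
Local Notation C := (Cx K).
Local Notation V := 'cV[C]_n.
Variable F : V -> 'cV[C]_N.
Hypothesis HF : inner_ext r R F.

(** A segment between two points of the punctured ball can leave it only through 0. *)
Definition nseg (z0 z1 : V) := forall t : K, 0 <= t <= 1 -> (1 - t)%:C *: z0 + t%:C *: z1 != 0.

Lemma seg_punct (z0 z1 : V) (t : K) : punct z0 -> punct z1 -> nseg z0 z1 -> 0 <= t <= 1 ->
  punct ((1 - t)%:C *: z0 + t%:C *: z1).
Proof.
move=> /andP[_ h0] /andP[_ h1] ns t01; apply/andP; split.
  by rewrite enorm_gt0; exact: ns.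
exact: enorm_conv.
Qed.

Lemma seg_identity (z0 z1 : V) (v : 'cV[C]_N) (w : V) (d : nat) : punct z0 -> punct z1 -> nseg z0 z1 ->
  (exists2 e : K, 0 < e & forall t : K, 0 < t < e ->
    ip (F ((1 - t)%:C *: z0 + t%:C *: z1)) v = ip ((1 - t)%:C *: z0 + t%:C *: z1) w ^+ d) ->
  ip (F z1) v = ip z1 w ^+ d.
Proof.
move=> p0 p1 ns [e e0 He].
pose ga (s : C) : V := (1 - s) *: z0 + s *: z1.
have gaE (t : K) : ga t%:C = (1 - t)%:C *: z0 + t%:C *: z1 by rewrite /ga (rCB 1) rC1.
pose g (s : C) := ip (F (ga s)) v - ip (ga s) w ^+ d.
have hB (s : C) : hol (fun s : C => 1 - s) s by apply: holB; [exact: hol_cst|exact: hol_id].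
have g1 : g 1%:C = 0.
  apply: (identity_segment (g := g)); last by rewrite ler01 lexx.
    move=> t t01.
    have Pt : punct (ga t%:C) by rewrite gaE; exact: seg_punct.
    have := curve_ip_hol v (ix_hol HF) (near_all _ hB) (hol_near_id _) Pt.
    move=> /nbhs_nm [e' e'0 He']; exists e' => // s se; apply: holB; first exact: He'.
    apply: holX.
    have -> : (fun s => ip (ga s) w) = fun s => (1 - s) * ip z0 w + s * ip z1 w.
      by apply/funext => u; rewrite ipDl !ipZl.
    apply: holD; apply: holM; [exact: hB|exact: hol_cst|exact: hol_id|exact: hol_cst].
  move=> e' e'0.
  have [x xE] : exists x : K, x = Num.min e' e / 2 by eexists.
  have x0 : 0 < x by rewrite xE divr_gt0// lt_min e'0.
  have y1 : Num.min e' e <= e' by rewrite ge_min lexx.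
  have y2 : Num.min e' e <= e by rewrite ge_min lexx orbT.
  exists x%:C; rewrite nm_real gtr0_norm//; split => //; last by rlra.
  rewrite /g gaE He ?subrr// x0; rlra.
move: g1; rewrite /g gaE subrr rC0 scale0r add0r rC1 scale1r => /eqP.
by rewrite subr_eq0 => /eqP.
Qed.

(** Continuation along segments from c p. If the segment to [z] meets 0, then [z] is a multiple of
    [p], and the segment from e / 2 avoids 0; the first kind of segment has already reached a ball
    around e / 2. *)
Lemma pairing_ext (p e : V) (c : K) (v : 'cV[C]_N) (w : V) (d : nat) : enorm p = 1 -> enorm e = 1 ->
  ip e p = 0 -> 0 < c < 1 ->
  (exists2 dl : K, 0 < dl & forall z, enorm (z - c%:C *: p) < dl -> ip (F z) v = ip z w ^+ d) ->
  forall z, punct z -> ip (F z) v = ip z w ^+ d.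
Proof.
move=> p1 e1 ep /andP[c0 c1] [dl dl0 Hdl].
have cn : 0 < nm (c%:C : C) by rewrite nm_real normr_gt0 gt_eqF.
have pc : punct (c%:C *: p) by rewrite /punct /= enormZ p1 mulr1 nm_real gtr0_norm// c0.
have near_seg (z0 z : V) (e0 : K) : 0 < e0 -> (forall y, enorm (y - z0) < e0 -> ip (F y) v = ip y w ^+ d) ->
   exists2 e : K, 0 < e & forall t : K, 0 < t < e ->
    ip (F ((1 - t)%:C *: z0 + t%:C *: z)) v = ip ((1 - t)%:C *: z0 + t%:C *: z) w ^+ d.
  move=> e00 H; have E0 : 0 < enorm (z - z0) + 1 by rewrite ltr_wpDl ?enorm_ge0.
  exists (e0 / (enorm (z - z0) + 1)); first by rewrite divr_gt0.
  move=> t /andP[t0]; rewrite ltr_pdivlMr// => te; apply: H.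
  have -> : (1 - t)%:C *: z0 + t%:C *: z - z0 = t%:C *: (z - z0).
    by rewrite (rCB 1) rC1 scalerBl scale1r scalerBr addrAC [z0 - _]addrC addrK addrC.
  rewrite enormZ nm_real gtr0_norm//; move: te; rewrite mulrDr mulr1; rlra.
have step1 z : punct z -> nseg (c%:C *: p) z -> ip (F z) v = ip z w ^+ d.
  by move=> pz ns; apply: (seg_identity pc pz ns); exact: near_seg dl0 Hdl.
have h2 : 0 < 1 / 2 :> K by rlra.
have pe : punct ((1 / 2)%:C *: e).
  by rewrite /punct /= enormZ e1 mulr1 nm_real gtr0_norm//; apply/andP; split; rlra.
have step2 z : punct z -> nseg ((1 / 2)%:C *: e) z -> ip (F z) v = ip z w ^+ d.
  move=> pz ns; apply: (seg_identity pe pz ns); apply: (near_seg _ _ (1 / 4)); first by rlra.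
  move=> y ye.
  have y2 : enorm ((1 / 2)%:C *: e) = 1 / 2 by rewrite enormZ e1 mulr1 nm_real gtr0_norm.
  have q1 := enormB_ge y ((1 / 2)%:C *: e).
  have q2 := enormB_ge ((1 / 2)%:C *: e) y; rewrite enormC in q2.
  rewrite y2 in q1 q2.
  have py : punct y by apply/andP; split; rlra.
  apply: step1 => // t /andP[t0 t1]; rewrite -enorm_gt0.
  have [->|tn] := eqVneq t 0.
    by rewrite subr0 rC1 scale1r rC0 scale0r addr0; case/andP: pc.
  apply: (@ip_neq0 _ _ _ e); rewrite ipDl !ipZl -(ip_conj e p) ep rmorph0 !mulr0 add0r.
  rewrite mulf_neq0// ?rC_eq0//.
  have -> : y = (y - (1 / 2)%:C *: e) + (1 / 2)%:C *: e by rewrite subrK.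
  rewrite ipDl ipZl -enorm_sqr e1 expr1n rC1 mulr1.
  have := cauchy_schwarz (y - (1 / 2)%:C *: e) e; rewrite e1 mulr1 => cs.
  apply/negP => /eqP E; have E2 : ip (y - (1 / 2)%:C *: e) e = - (1 / 2)%:C by apply/eqP; rewrite -addr_eq0 E.
  by rewrite E2 nmN nm_real gtr0_norm// in cs; rlra.
move=> z pz; have [ns|] := pselect (nseg (c%:C *: p) z); first exact: step1.
move=> /existsNP [t /not_implyP [/andP[t0 t1] /negP]]; rewrite negbK => /eqP E.
have tn : t != 0.
  apply/negP => /eqP t0'; have := congr1 (@enorm K n) E.
  rewrite t0' subr0 rC1 scale1r rC0 scale0r addr0 enorm0 => h.
  by case/andP: pc; rewrite h ltxx.
have ze : ip z e = 0.
  have := congr1 (fun x => ip x e) E; rewrite ipDl !ipZl ip0l -(ip_conj e p) ep rmorph0 !mulr0 add0r.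
  by move=> /eqP; rewrite mulf_eq0 rC_eq0 (negbTE tn) => /eqP.
apply: step2 => // s /andP[s0 s1]; rewrite -enorm_gt0.
have [->|sn] := eqVneq s 1.
  by rewrite subrr rC0 scale0r add0r rC1 scale1r; case/andP: pz.
apply: (@ip_neq0 _ _ _ e); rewrite ipDl !ipZl ze mulr0 addr0 -enorm_sqr e1 expr1n rC1 mulr1.
by rewrite -rCM rC_eq0 mulf_neq0 ?gt_eqF// subr_gt0 lt_neqAle sn.
Qed.

(** By [good_radial] the initial part of the segment from p / 2 to each [zs i] consists of good
    points. There [F] is orthogonal to [v], hence also at [zs i], and the [F (zs i)] span. *)
Lemma good_span (p v : _) : enorm p = 1 -> good r F p ->
  (forall w, punct w -> good r F w -> r ^+ 2 * enorm w < nm (ip (((1 + r ^+ 2) / 2)%:C *: p) w) ->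
    ip (F w) v = 0) -> v = 0.
Proof.
move=> p1 gp H; have /andP[r0 r1] := ix_r HF.
have r20 : 0 < r ^+ 2 by exact: exprn_gt0.
have r21 : r ^+ 2 < 1 by rewrite expr_lt1// ltW.
have h0 : 0 < 1 / 2 :> K by rlra.
have gp2 := good_scale h0 gp.
case: (gp) => [kap [zs [k1 zp zk zd]]]; rewrite p1 mulr1 in k1.
apply: (Fm_orth0 zd) => i.
have ph : punct ((1 / 2)%:C *: p).
  by rewrite /punct /= enormZ p1 mulr1 nm_real gtr0_norm//; apply/andP; split; rlra.
have pip (t : K) : ip ((1 - t)%:C *: ((1 / 2)%:C *: p) + t%:C *: zs i) p = ((1 - t) / 2 + t * kap)%:C.
  rewrite ipDl !ipZl zk -enorm_sqr p1 expr1n rC1 mulr1 -!rCM -rCD; congr (_%:C).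
  by ring.
have pos (t : K) : 0 <= t <= 1 -> 0 < (1 - t) / 2 + t * kap.
  move=> /andP[t0 t1]; have [->|tn] := eqVneq t 0; first by rlra.
  have : 0 < t * kap by rewrite mulr_gt0 ?lt_neqAle ?t0 ?andbT 1?eq_sym//; rlra.
  rlra.
have ns : nseg ((1 / 2)%:C *: p) (zs i).
  move=> t t01; rewrite -enorm_gt0; apply: (@ip_neq0 _ _ _ p).
  by rewrite pip rC_eq0 gt_eqF// pos.
have [e e0 He] := good_radial HF (leq_ltn_trans (leq0n i) (ltn_ord i)) (zs i - (1 / 2)%:C *: p) gp2.
(* With w = 0 and d = 1 the right-hand side of [seg_identity] is 0, which makes it a vanishing
   statement. *)
have -> : 0 = ip (zs i) 0 ^+ 1 :> C by rewrite ip0r expr1.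
apply: (seg_identity ph (zp i) ns).
have m0 : 0 < Num.min e ((1 - r ^+ 2) / 8) by rewrite lt_min e0 divr_gt0// subr_gt0.
exists (Num.min e ((1 - r ^+ 2) / 8)) => // t /andP[t0]; rewrite lt_min => /andP[te t8].
have t01 : 0 <= t <= 1 by rewrite ltW//=; rlra.
rewrite ip0r expr1; apply: H.
- by apply: seg_punct.
- have -> : (1 - t)%:C *: ((1 / 2)%:C *: p) + t%:C *: zs i =
     (1 / 2)%:C *: p + t%:C *: (zs i - (1 / 2)%:C *: p).
    by rewrite (rCB 1) rC1 scalerBl scale1r scalerBr addrA addrAC.
  by apply: He; rewrite ltW.
rewrite ipZl nmM nm_real gtr0_norm; last by rlra.
rewrite -(ip_conj _ p) nm_conj pip nm_real gtr0_norm ?pos//.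
have : enorm ((1 - t)%:C *: ((1 / 2)%:C *: p) + t%:C *: zs i) <= (1 - t) / 2 + t.
  apply: le_trans (enormD _ _) _; rewrite !enormZ p1 mulr1 !nm_real (gtr0_norm t0) (gtr0_norm h0).
  have /andP[_ zi] := zp i; rewrite gtr0_norm; last by rlra.
  have : t * enorm (zs i) <= t * 1 by rewrite ler_wpM2l// ltW.
  rlra.
move=> /(ler_wpM2l (ltW r20)) h.
apply: (le_lt_trans h).
have tk : 0 <= t * kap by rewrite mulr_ge0 ?(ltW t0)//; rlra.
have : (1 + r ^+ 2) / 2 * ((1 - t) / 2) <= (1 + r ^+ 2) / 2 * ((1 - t) / 2 + t * kap).
  by rewrite ler_wpM2l//; rlra.
have := mulr_gt0 t0 r20; have : t * r ^+ 2 < t * 1 by rewrite ltr_pM2l.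
rlra.
Qed.

(** [good_span] yields [N] good points with independent values; [good_pair] applies to each of them
    for [z] near c p, and [pairing_ext] extends the formula. *)
Lemma pairing (p : V) (d : nat) : enorm p = 1 -> good r F p -> R = r ^+ d ->
  exists ws : 'I_N -> V, [/\ forall i, punct (ws i), \det (Fm F ws) != 0 &
    forall z i, punct z -> ip (F z) (F (ws i)) = ip z (ws i) ^+ d].
Proof.
move=> p1 gp Rd; have /andP[r0 r1] := ix_r HF.
have r20 : 0 < r ^+ 2 by exact: exprn_gt0.
have r21 : r ^+ 2 < 1 by rewrite expr_lt1// ltW.
have [c cE] : exists c : K, c = (1 + r ^+ 2) / 2 by eexists.
pose S := [set x | exists w, [/\ punct w, good r F w, r ^+ 2 * enorm w < nm (ip (c%:C *: p) w)
  & F w = x]].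
have HS v : (forall x, S x -> ip x v = 0) -> v = 0.
  move=> H; apply: (good_span p1 gp) => w pw gw; rewrite -cE => wc.
  by apply: H; exists w.
have [xs [Sxs fxs]] := indep_points HS (leqnn N).
have [ws Hws] := choice Sxs.
exists ws; split.
- by move=> i; case: (Hws i).
- move: fxs; rewrite row_free_unit unitmxE unitfE.
  have -> // : Fm F ws = \matrix_(i < N, j < N) xs i j 0.
  by apply/matrixP => i j; rewrite !mxE; case: (Hws i) => _ _ _ ->.
move=> z i pz; have [pw gw wc _] := Hws i.
have [b [b0 bp]] := exists_orth (ix_n HF) p.
have [eta [e [_ e1 ep _]]] := orth_unit (ix_n HF) bp.
apply: (pairing_ext p1 e1 ep (c := c)) => //; first by rewrite cE; apply/andP; split; rlra.
have cp : punct (c%:C *: p).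
  by rewrite /punct /= enormZ p1 mulr1 nm_real gtr0_norm cE; [apply/andP; split; rlra|rlra].
have [e1' e10 He1] := punct_open cp.
have /andP[w0 _] := pw.
have q0 : 0 < nm (ip (c%:C *: p) (ws i)) - r ^+ 2 * enorm (ws i) by rewrite subr_gt0.
exists (Num.min e1' ((nm (ip (c%:C *: p) (ws i)) - r ^+ 2 * enorm (ws i)) / enorm (ws i))).
  by rewrite lt_min e10 divr_gt0.
move=> y; rewrite lt_min => /andP[y1]; rewrite ltr_pdivlMr// => y2.
apply: (good_pair HF Rd gw pw); first exact: He1.
have := cauchy_schwarz (c%:C *: p - y) (ws i); rewrite enormC ipBl => cs.
have := nmB_ge (ip (c%:C *: p) (ws i)) (ip y (ws i)) => h.
rlra.
Qed.

End Pairing.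

(** * The homogeneous map *)

Section Multinomial.
Variable C : numFieldType.

Definition truncated_exp (d : nat) (x : C) : {poly C} :=
  \poly_(k < d.+1) (x ^+ k / k`!%:R).

(* The multinomial theorem is the comparison of coefficients in [exp (x + y) = exp x * exp y]. *)
Lemma coef_prod_truncated_exp (I : Type) (s : seq I) (x : I -> C) d m : (m <= d)%N ->
  (\prod_(j <- s) truncated_exp d (x j))`_m = (\sum_(j <- s) x j) ^+ m / m`!%:R.
Proof.
have f0 k : (k`!%:R : C) != 0 by rewrite pnatr_eq0 -lt0n fact_gt0.
elim: s m => [|i s IH] m md.
  by rewrite !big_nil coef1 expr0n; case: m md => [|m] _ //=; rewrite ?fact0 ?divr1 ?mul0r.
rewrite !big_cons coefMr exprDn mulr_suml; apply: eq_bigr => j _.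
have jm : (j <= m)%N by rewrite -ltnS.
rewrite IH ?(leq_trans jm)// coef_poly ltnS (leq_trans (leq_subr _ _) md).
have := congr1 (fun k => k%:R : C) (bin_fact jm); rewrite /= !natrM => E.
have b0 : 'C(m, j)%:R = m`!%:R / (j`!%:R * (m - j)`!%:R) :> C.
  by rewrite -E mulfK// mulf_neq0.
rewrite -[_ *+ 'C(m, j)]mulr_natr b0; move: (f0 m) (f0 j) (f0 (m - j)%N) => h1 h2 h3.
by field; rewrite h1 h2 h3.
Qed.

Lemma multinomial_ffun n d (x : 'I_n -> C) :
  (\sum_j x j) ^+ d = d`!%:R * \sum_(f : {ffun 'I_n -> 'I_d.+1} | (\sum_j f j == d)%N)
     \prod_j (x j ^+ f j / (f j)`!%:R).
Proof.
have f0 : (d`!%:R : C) != 0 by rewrite pnatr_eq0 -lt0n fact_gt0.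
apply: (mulIf (invr_neq0 f0)); rewrite -(coef_prod_truncated_exp _ _ (leqnn d)) mulrAC mulfV// mul1r.
under eq_bigr => j _ do rewrite /truncated_exp poly_def.
rewrite bigA_distr_bigA coef_sum [RHS]big_mkcond; apply: eq_bigr => f _.
rewrite scaler_prod -expr_sum coefZ coefXn eq_sym.
by case: ifP => _; rewrite ?mulr1 ?mulr0.
Qed.

End Multinomial.

Section Hspace.
Variables (K : realType) (n d : nat).
Local Notation C := (Cx K).
Local Notation V := 'cV[C]_n.
Local Notation D := ('C(n + d - 1, d)).

Definition multi_index_of (i : 'I_D) : n.-tuple 'I_d.+1 :=
  enum_val (cast_ord (esym (card_multi_index n d)) i).

Lemma multi_index_of_inj : injective multi_index_of.
Proof. by move=> i j /enum_val_inj /cast_ord_inj. Qed.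

Definition Hweight (i : 'I_D) : K := Num.sqrt (d`!%:R / (multi_fact (multi_index_of i))%:R).

Lemma HmapE (z : V) i : Hmap d z i 0 = (Hweight i)%:C * \prod_j z j 0 ^+ tnth (multi_index_of i) j.
Proof. by rewrite mxE. Qed.

Lemma multi_fact_gt0 (a : n.-tuple 'I_d.+1) : (0 < multi_fact a)%N.
Proof. by apply: prodn_gt0 => j; exact: fact_gt0. Qed.

Lemma Hweight_gt0 i : 0 < Hweight i.
Proof. by rewrite sqrtr_gt0 divr_gt0// ltr0n ?fact_gt0 ?multi_fact_gt0. Qed.

Lemma Hweight_sqr i : Hweight i ^+ 2 = d`!%:R / (multi_fact (multi_index_of i))%:R.
Proof. by rewrite sqr_sqrtr// divr_ge0. Qed.

Lemma sum_multi_index_of (G : n.-tuple 'I_d.+1 -> C) :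
  \sum_i G (multi_index_of i) = \sum_(f : {ffun 'I_n -> 'I_d.+1} | (\sum_j f j == d)%N) G [tuple f j | j < n].
Proof.
have -> : \sum_i G (multi_index_of i) = \sum_(a in multi_index n d) G a.
  rewrite [RHS]big_enum_val /= (reindex (cast_ord (esym (card_multi_index n d)))) //.
  by apply: onW_bij; exists (cast_ord (card_multi_index n d)) => k; exact: val_inj.
rewrite (reindex (fun f : {ffun 'I_n -> 'I_d.+1} => [tuple f j | j < n])) /=.
  apply: eq_bigl => f; rewrite inE big_tuple; congr (_ == _).
  by apply: eq_bigr => j _; rewrite tnth_mktuple.
apply: onW_bij; exists (fun a : n.-tuple 'I_d.+1 => [ffun j => tnth a j]).
  by move=> f; apply/ffunP => j; rewrite ffunE tnth_mktuple.
by move=> a; apply: eq_from_tnth => j; rewrite tnth_mktuple ffunE.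
Qed.

(** The squared weights are the multinomial coefficients, so this is the multinomial theorem for <z,
    w>^d. *)
Lemma ip_Hmap (z w : V) : ip (Hmap d z) (Hmap d w) = ip z w ^+ d.
Proof.
have cM (x y : C) : (x * y)^* = x^* * y^* by rewrite rmorphM.
have cX (x : C) m : (x ^+ m)^* = x^* ^+ m by rewrite rmorphXn.
rewrite {2}/ip multinomial_ffun.
pose G (a : n.-tuple 'I_d.+1) : C := d`!%:R * \prod_j ((z j 0 * (w j 0)^* ) ^+ tnth a j / (tnth a j)`!%:R).
have -> : ip (Hmap d z) (Hmap d w) = \sum_i G (multi_index_of i).
  apply: eq_bigr => i _; rewrite !HmapE cM conj_rC rmorph_prod.
  have -> : (Hweight i)%:C * \prod_j z j 0 ^+ tnth (multi_index_of i) j *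
     ((Hweight i)%:C * \prod_j (w j 0 ^+ tnth (multi_index_of i) j)^* ) =
     ((Hweight i) ^+ 2)%:C * \prod_j (z j 0 * (w j 0)^* ) ^+ tnth (multi_index_of i) j.
    under [in RHS]eq_bigr => j _ do rewrite exprMn -cX.
    by rewrite big_split /= rCX; ring.
  rewrite Hweight_sqr rCM rCV !rC_nat /G -mulrA; congr (_ * _).
  rewrite big_split /= mulrC; congr (_ * _).
  by rewrite prodfV -natr_prod.
rewrite sum_multi_index_of mulr_sumr; apply: eq_bigr => f _; rewrite /G; congr (_ * _).
by apply: eq_bigr => j _; rewrite tnth_mktuple.
Qed.

(** The inverse Vandermonde matrix gives combinations of values at the nodes dual to the powers 0,
    ..., d; their tensor product [c] extracts the coefficient of one multi-index. *)
Lemma nodes (t : 'I_d.+1 -> C) (y : 'I_D -> C) : injective t ->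
  (forall f : 'I_n -> 'I_d.+1, \sum_i y i * \prod_j t (f j) ^+ tnth (multi_index_of i) j = 0) ->
  forall i, y i = 0.
Proof.
move=> tI H i0.
pose W := Vandermonde d.+1 (\row_m t m).
have U : W \in unitmx.
  rewrite unitmxE unitfE det_Vandermonde; apply/prodf_neq0 => i _; apply/prodf_neq0 => j ij.
  by rewrite !mxE subr_eq0; apply: contraTneq ij => /tI ->; rewrite ltnn.
have LE (k l : 'I_d.+1) : \sum_m t m ^+ k * invmx W m l = (k == l)%:R.
  have := congr1 (fun A : 'M[C]_(d.+1) => A k l) (mulmxV U); rewrite !mxE => <-.
  by apply: eq_bigr => m _; rewrite !mxE.
pose c (f : {ffun 'I_n -> 'I_d.+1}) := \prod_j invmx W (f j) (tnth (multi_index_of i0) j).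
have : \sum_(f : {ffun 'I_n -> 'I_d.+1}) (\sum_i y i * \prod_j t (f j) ^+ tnth (multi_index_of i) j) * c f = 0.
  by apply: big1 => f _; rewrite H mul0r.
under eq_bigr => f _ do rewrite mulr_suml.
rewrite exchange_big /= (bigD1 i0)//= [X in _ + X]big1 => [|i ii0].
  under eq_bigr => f _ do rewrite -mulrA -big_split /=.
  rewrite -mulr_sumr -(bigA_distr_bigA (fun j m => t m ^+ tnth (multi_index_of i0) j * invmx W m (tnth (multi_index_of i0) j))).
  rewrite big1 ?mulr1 ?addr0// => j _.
  by rewrite LE eqxx.
under eq_bigr => f _ do rewrite -mulrA -big_split /=.
rewrite -mulr_sumr -(bigA_distr_bigA (fun j m => t m ^+ tnth (multi_index_of i) j * invmx W m (tnth (multi_index_of i0) j))).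
have [j ji] : exists j, tnth (multi_index_of i) j != tnth (multi_index_of i0) j.
  apply/existsP; apply: contraNT ii0; rewrite negb_exists => /forallP h.
  by apply/eqP/multi_index_of_inj/eq_from_tnth => j; have := h j; rewrite negbK => /eqP.
by rewrite (bigD1 j)//= LE (negbTE ji) mul0r mulr0.
Qed.

Lemma HmapZ (c : C) (z : V) : Hmap d (c *: z) = c ^+ d *: Hmap d z.
Proof.
apply/colP => i; rewrite [RHS]mxE !HmapE mulrCA; congr (_ * _).
under eq_bigr => j _ do rewrite mxE exprMn.
rewrite big_split /= -expr_sum; congr (_ ^+ _ * _).
have := enum_valP (cast_ord (esym (card_multi_index n d)) i).
by rewrite inE -/(multi_index_of i) big_tuple => /eqP.
Qed.

End Hspace.

Local Open Scope sesquilinear_scope.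

Section Adjoint.
Variables (K : realType).
Local Notation C := (Cx K).

Lemma ip_adj m k (A : 'M[C]_(m, k)) x y : ip (A *m x) y = ip x (A^t* *m y).
Proof.
have cM (a b : C) : (a * b)^* = a^* * b^* by rewrite rmorphM.
rewrite /ip; under eq_bigr => i _ do rewrite mxE mulr_suml.
rewrite exchange_big /=; apply: eq_bigr => j _; rewrite mxE rmorph_sum mulr_sumr /=.
by apply: eq_bigr => i _; rewrite !mxE cM conjCK mulrCA mulrA.
Qed.

(** Once the equation of dimensions is eliminated, [A] is square, and its left inverse is a right
    inverse. *)
Lemma castmx_unitary k m (e : k = m) (A : 'M[C]_(m, k)) : A^t* *m A = 1%:M ->
  exists2 U : 'M[C]_m, U \is unitarymx & forall h : 'cV[C]_k,
    A *m h = U *m castmx (e, erefl 1%N) h.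
Proof.
case: m / e A => A A1; exists A; last by move=> h; rewrite castmx_id.
by apply/unitarymxP; exact: mulmx1C.
Qed.

End Adjoint.

Section Grid.
Variables (K : realType) (n d : nat).
Local Notation C := (Cx K).
Local Notation D := ('C(n + d - 1, d)).

(* The nodes [1 + dl * m], [m <= d], in each coordinate, with scale [s j] in the [j]-th one. *)
Definition grid (s : 'I_n -> K) (dl : K) (f : 'I_n -> 'I_d.+1) : 'cV[C]_n :=
  \col_j (s j * (1 + dl * (f j)%:R))%:C.

Lemma grid_span s (dl : K) (y : 'I_D -> C) : 0 < dl -> (forall j, 0 < s j) ->
  (forall f, \sum_i y i * Hmap d (grid s dl f) i 0 = 0) -> forall i, y i = 0.
Proof.
move=> dl0 s0 H i.
have tI : injective (fun m : 'I_d.+1 => (1 + dl * m%:R)%:C : C).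
  move=> a b /rC_inj /addrI /(mulfI (lt0r_neq0 dl0)) /eqP.
  by rewrite eqr_nat => /eqP/val_inj.
pose c (i : 'I_D) := Hweight K i * \prod_j s j ^+ tnth (multi_index_of i) j.
have c0 : 0 < c i by rewrite mulr_gt0 ?Hweight_gt0// prodr_gt0// => j _; rewrite exprn_gt0.
have : y i * (c i)%:C = 0.
  apply: (@nodes K n d _ (fun i => y i * (c i)%:C) tI) => f.
  rewrite -[RHS](H f); apply: eq_bigr => k _.
  rewrite HmapE -!mulrA; congr (_ * _); rewrite /c rCM -mulrA; congr (_ * _).
  rewrite (rmorph_prod (real_complex K)) -big_split /=; apply: eq_bigr => j _.
  by rewrite mxE (rCM (s j)) exprMn (rCX (s j)).
by move=> /eqP; rewrite mulf_eq0 rC_eq0 (gt_eqF c0) orbF => /eqP.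
Qed.

Lemma ip_grid (dl : K) f g : 0 <= dl -> exists S : K, ip (grid (fun=> 1) dl f) (grid (fun=> 1) dl g) = S%:C /\ n%:R <= S.
Proof.
move=> dl0; exists (\sum_j (1 + dl * (f j)%:R) * (1 + dl * (g j)%:R)); split.
  by rewrite rC_sum; apply: eq_bigr => j _; rewrite !mxE conj_rC !mul1r (rCM (_ + _)).
have -> : n%:R = \sum_(j < n) 1 :> K by rewrite sumr_const card_ord.
apply: ler_sum => j _.
have a0 m : 0 <= dl * m%:R by rewrite mulr_ge0.
have := mulr_ge0 (a0 (f j)) (a0 (g j)); have := a0 (f j); have := a0 (g j).
move: (_ * _) (_ * _) => x y; rnra.
Qed.

Lemma enorm_grid (dl : K) f : 0 <= dl -> enorm (grid (fun=> 1) dl f) ^+ 2 <= n%:R * (1 + dl * d%:R) ^+ 2.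
Proof.
move=> dl0; rewrite enorm_sqrK.
have -> : n%:R * (1 + dl * d%:R) ^+ 2 = \sum_(j < n) (1 + dl * d%:R) ^+ 2.
  by rewrite sumr_const card_ord mulr_natl.
apply: ler_sum => j _; rewrite mxE nm_real mul1r.
have a0 m : 0 <= 1 + dl * m%:R by rewrite addr_ge0// mulr_ge0.
rewrite ger0_norm// ler_pXn2r ?nnegrE// lerD2l ler_wpM2l// ler_nat.
by rewrite -ltnS.
Qed.

End Grid.

(** * The factorization through the homogeneous map *)

Section Forward.
Variables (K : realType) (n N : nat) (r R : K).
Local Notation C := (Cx K).
Local Notation V := 'cV[C]_n.
Variable F : V -> 'cV[C]_N.
Hypothesis HF : inner_ext r R F.

(** Two grid points have a real positive product [S]; scaled by r / sqrt S they satisfy the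
    condition of [inner_polar], and by homogeneity [A] preserves the product of their images under
    [Hmap]. These images span. *)
Lemma factor_isometry d (A : 'M[C]_(N, 'C(n + d - 1, d))) : R = r ^+ d ->
  (forall z, punct z -> F z = A *m Hmap d z) -> A^t* *m A = 1%:M.
Proof.
move=> Rd FA; have /andP[r0 r1] := ix_r HF.
have n0 : (0 < n)%N by apply: leq_trans (ix_n HF).
have nR : 0 < n%:R :> K by rewrite ltr0n.
(* With this mesh the grid points have nearly equal norms: after the scaling they have norm at most
   r (1 + dl d) < 1. *)
have [dl dlE] : exists dl : K, dl = (1 - r) / (d.+1)%:R by eexists.
have d1 : 0 < (d.+1)%:R :> K by rewrite ltr0n.
have dl0 : 0 < dl by rewrite dlE divr_gt0// subr_gt0.
have dld : dl * d%:R <= 1 - r.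
  rewrite dlE mulrAC ler_pdivrMr// ler_wpM2l ?ler_nat//.
  by rewrite subr_ge0 ltW.
have rdl : r * (1 + dl * d%:R) < 1.
  have : r * (1 + dl * d%:R) <= r * (1 + (1 - r)) by rewrite ler_pM2l// lerD2l.
  have : 0 < (1 - r) ^+ 2 by rewrite exprn_gt0// subr_gt0.
  rnra.
have key (f g : 'I_n -> 'I_d.+1) : ip (A *m Hmap d (grid (fun=> 1) dl f)) (A *m Hmap d (grid (fun=> 1) dl g)) =
    ip (Hmap d (grid (fun=> 1) dl f)) (Hmap d (grid (fun=> 1) dl g)).
  have [S [SE nS]] := ip_grid f g (ltW dl0).
  have S0 : 0 < S by apply: lt_le_trans nS.
  have [a aE] : exists a : K, a = r / Num.sqrt S by eexists.
  have sS : 0 < Num.sqrt S by rewrite sqrtr_gt0.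
  have a0 : 0 < a by rewrite aE divr_gt0.
  have aS : a ^+ 2 * S = r ^+ 2.
    by rewrite aE expr_div_n sqr_sqrtr ?ltW// divfK// gt_eqF.
  have ap (h : 'I_n -> 'I_d.+1) : ip (grid (fun=> 1) dl h) (grid (fun=> 1) dl h) != 0 -> punct (a%:C *: grid (fun=> 1) dl h).
    move=> hn; rewrite /punct /= enormZ nm_real gtr0_norm//.
    rewrite mulr_gt0 ?(ip_neq0 hn)//=.
    rewrite -(@ltr_pXn2r _ 2)// ?nnegrE ?mulr_ge0 ?enorm_ge0 ?ltW// expr1n exprMn.
    apply: (@le_lt_trans _ _ (a ^+ 2 * (S * (1 + dl * d%:R) ^+ 2))).
      rewrite ler_pM2l ?exprn_gt0//; apply: (le_trans (enorm_grid h (ltW dl0))).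
      by rewrite ler_wpM2r ?sqr_ge0.
    rewrite mulrA aS -exprMn expr_lt1// mulr_ge0 ?(ltW r0)//.
    by rewrite addr_ge0// mulr_ge0// ltW.
  have gn (h : 'I_n -> 'I_d.+1) : ip (grid (fun=> 1) dl h) (grid (fun=> 1) dl h) != 0.
    have [S' [-> nS']] := ip_grid h h (ltW dl0).
    by rewrite rC_eq0 gt_eqF// (lt_le_trans nR).
  have E1 := inner_polar HF (ap f (gn f)) (ap g (gn g)).
  rewrite ipZl ipZr conj_rC SE -!rCM mulrA -expr2 aS in E1.
  have {}E1 := E1 erefl.
  rewrite (FA _ (ap f (gn f))) (FA _ (ap g (gn g))) !HmapZ -!scalemxAr ipZl ipZr -rCX conj_rC in E1.
  have an : (a ^+ d)%:C != 0 :> C by rewrite rC_eq0 expf_neq0// gt_eqF.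
  apply: (mulfI an); apply: (mulfI an); rewrite E1 ip_Hmap SE -!rCX -!rCM; congr (_%:C).
  by rewrite Rd mulrA -!exprMn -expr2 aS -!exprM mulnC.
have Bg (g : 'I_n -> 'I_d.+1) : A^t* *m A *m Hmap d (grid (fun=> 1) dl g) = Hmap d (grid (fun=> 1) dl g).
  have H : forall i, ((A^t* *m A *m Hmap d (grid (fun=> 1) dl g) - Hmap d (grid (fun=> 1) dl g)) i 0)^* = 0.
    apply: (grid_span dl0 (fun=> ltr01)) => f.
    have := key f g; rewrite ip_adj mulmxA => /eqP; rewrite -subr_eq0 -ipBr => /eqP E.
    by rewrite -[RHS]E; apply: eq_bigr => i _; rewrite mulrC.
  apply/colP => i; have /eqP := H i; rewrite conjC_eq0 mxE [X in _ + X]mxE subr_eq0.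
  by move=> /eqP.
apply/matrixP => i k; apply/eqP; rewrite -subr_eq0.
have H : forall k, (A^t* *m A - 1%:M) i k = 0.
  apply: (grid_span dl0 (fun=> ltr01)) => f.
  have E : (A^t* *m A - 1%:M) *m Hmap d (grid (fun=> 1) dl f) = 0.
    by rewrite mulmxBl Bg mul1mx subrr.
  by have := congr1 (fun u : 'cV[C]__ => u i 0) E; rewrite [LHS]mxE [RHS]mxE.
by have := H k; rewrite mxE [X in _ + X]mxE => ->.
Qed.

(** The products with [N] independent vectors [F (ws i)] determine [F z] linearly from [Hmap d z].
    Injectivity of the isometry [A] bounds the binomial coefficient by [N]; the factorization of [N]
    independent values through [Hmap] gives the reverse bound. *)
Lemma forward (p : V) : enorm p = 1 -> good r F p ->
  exists (d : nat) (eN : 'C(n + d - 1, d) = N) (U : 'M[C]_N),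
    [/\ (1 <= d)%N, U \is unitarymx, R = r ^+ d
      & forall z, punct z -> F z = U *m castmx (eN, erefl 1%N) (Hmap d z)].
Proof.
move=> p1 gp.
have [u [zs [u1 zsp zsr zsd]]] := good_rotate HF p1 gp.
have q1 : enorm (u *: p) = 1 by rewrite enormZ u1 p1 mulr1.
have [d [_ [d1 Rd _]]] := line_power HF q1 zsp zsr zsd.
have [ws [wp wd wip]] := pairing HF p1 gp Rd.
pose W : 'M[C]_N := map_mx (fun x : C => x^* ) (Fm F ws).
pose Hc : 'M[C]_(N, 'C(n + d - 1, d)) := \matrix_(i, k) (Hmap d (ws i) k 0)^*.
have FU : Fm F ws \in unitmx by rewrite unitmxE unitfE.
have WU : W \in unitmx by rewrite map_unitmx.
pose A := invmx W *m Hc.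
have FA z : punct z -> F z = A *m Hmap d z.
  move=> pz; rewrite -[LHS](mulKmx WU) -mulmxA; congr (_ *m _).
  apply/colP => i; rewrite mxE [RHS]mxE.
  have := wip z i pz; rewrite -ip_Hmap => E.
  transitivity (ip (F z) (F (ws i))).
    by apply: eq_bigr => j _; rewrite !mxE mulrC.
  by rewrite E; apply: eq_bigr => j _; rewrite [in RHS]mxE mulrC.
have A1 := factor_isometry Rd FA.
have eN : 'C(n + d - 1, d) = N.
  apply/eqP; rewrite eqn_leq; apply/andP; split.
    rewrite -{1}(mxrank1 C 'C(n + d - 1, d)) -A1.
    by apply: (leq_trans (mxrankM_maxr _ _)); exact: rank_leq_row.
  have rN : \rank (Fm F ws) = N by exact (mxrank_unit FU).
  have E : Fm F ws = (\matrix_(i, k) Hmap d (ws i) k 0) *m A^T.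
    apply/matrixP => i j; rewrite mxE [RHS]mxE (FA _ (wp i)) mxE.
    by apply: eq_bigr => k _; rewrite mulrC; congr (_ * _); rewrite [RHS]mxE.
  rewrite E in rN; rewrite -{1}rN.
  by apply: (leq_trans (mxrankM_maxl _ _)); exact: rank_leq_col.
have [U UU UA] := castmx_unitary eN A1.
exists d, eN, U; split => //.
by move=> z pz; rewrite FA// UA.
Qed.

End Forward.

(** * Affine hulls of hyperplane sections *)

Section Affine.
Variable K : realType.
Local Notation C := (Cx K).

Definition perp n (b : 'cV[C]_n) : {vspace 'cV[C]_n} :=
  lker (linfun (mulmx (b^t* ) : 'cV[C]_n -> 'M[C]_1)).

Lemma mem_perp n (b y : 'cV[C]_n) : (y \in perp b) = (ip y b == 0).
Proof.
rewrite memv_ker lfunE /=; apply/eqP/eqP => [E|E].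
  have := congr1 (fun M : 'M[C]_1 => M 0 0) E; rewrite !mxE => h.
  by rewrite -[RHS]h; apply: eq_bigr => j _; rewrite !mxE mulrC.
apply/matrixP => i j; rewrite !ord1 [RHS]mxE -[RHS]E mxE.
by apply: eq_bigr => k _; rewrite !mxE mulrC.
Qed.

Lemma dim_full n : \dim {: 'cV[C]_n} = n.
Proof. by rewrite dimvf /dim /= muln1. Qed.

Lemma dim_perp n (b : 'cV[C]_n) : b != 0 -> (\dim (perp b)).+1 = n.
Proof.
move=> b0; have := limg_ker_dim (linfun (mulmx (b^t* ) : 'cV[C]_n -> 'M[C]_1)) fullv.
rewrite capfv -/(perp b) dim_full => E; rewrite -[RHS]E -addn1; congr (_ + _)%N.
apply/eqP; rewrite eq_sym eqn_leq; apply/andP; split.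
  by apply: (leq_trans (dimvS (subvf _))); rewrite dim_full.
rewrite lt0n dimv_eq0; apply/negP => /eqP E0.
have : linfun (mulmx (b^t* ) : 'cV[C]_n -> 'M[C]_1) b \in 0%VS by rewrite -E0 memv_img ?memvf.
have bb : (b \in perp b) = false.
  by rewrite mem_perp -enorm_sqr rC_eq0 expf_eq0 enorm_eq0 (negbTE b0).
by rewrite memv0 -memv_ker -/(perp b) bb.
Qed.

Lemma affine_rebase n k (A : set 'cV[C]_n) x0 : affine_of_dim k A -> A x0 ->
  exists V : {vspace 'cV[C]_n}, \dim V = k /\ A = [set z | z - x0 \in V].
Proof.
move=> [p [V [dV ->]]] /= x0V; exists V; split => //.
apply/seteqP; split => z /= zV.
  have -> : z - x0 = (z - p) - (x0 - p) by rewrite opprB addrA subrK.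
  exact: memvB.
have -> : z - p = (z - x0) + (x0 - p) by rewrite addrA subrK.
exact: memvD.
Qed.

Lemma affine_of_vspace n (x0 : 'cV[C]_n) (V : {vspace 'cV[C]_n}) :
  affine_of_dim (\dim V) [set z | z - x0 \in V].
Proof. by exists x0, V. Qed.

Lemma sub_aff n (S : set 'cV[C]_n) : S `<=` aff S.
Proof. exact: sub_smallest. Qed.

Lemma aff_sub n (S A : set 'cV[C]_n) : affine_subspace A -> S `<=` A -> aff S `<=` A.
Proof. by move=> hA SA; exact: smallest_sub. Qed.

(** The hull of the empty set is the intersection of all affine subspaces, which is empty for n > 0
    and so has no dimension. *)
Lemma aff_nonempty n k (S : set 'cV[C]_n) : (0 < n)%N -> affine_of_dim k (aff S) ->
  exists x, S x.
Proof.
move=> n0 [p [V [_ E]]]; apply: contrapT => h.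
have H (x : 'cV[C]_n) : p = x.
  have hx : aff S `<=` [set z | z - x \in 0%VS].
    apply: aff_sub; first by exists 0%N, x, 0%VS; rewrite dimv0.
    by move=> y Sy; exfalso; apply: h; exists y.
  have : aff S p by rewrite E /= subrr mem0v.
  by move=> /hx /=; rewrite memv0 subr_eq0 => /eqP.
have := H (p + const_mx 1) => /eqP; rewrite eq_sym -subr_eq0 addrAC subrr add0r => /eqP E1.
have := congr1 (fun v : 'cV[C]_n => v (Ordinal n0) 0) E1; rewrite !mxE.
by move=> /eqP; rewrite oner_eq0.
Qed.

(** While fewer than [k] differences are chosen, their span has dimension below [k], so some point
    of [S] lies outside its translate by x0. *)
Lemma aff_free n k (S : set 'cV[C]_n) x0 : affine_of_dim k (aff S) -> S x0 ->
  exists X : k.-tuple 'cV[C]_n, free X /\ forall i, S (x0 + tnth X i).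
Proof.
move=> hA Sx0; have [V [dV AE]] := affine_rebase hA (sub_aff Sx0).
have H m : (m <= k)%N -> exists X : m.-tuple 'cV[C]_n, free X /\ forall i, S (x0 + tnth X i).
  elim: m => [_|m IH mk]; first by exists [tuple]; split; [rewrite nil_free|case].
  have [X [fX SX]] := IH (ltnW mk).
  have [y [Sy yX]] : exists y, S y /\ y - x0 \notin <<X>>%VS.
    apply: contrapT => h.
    have hs : aff S `<=` [set z | z - x0 \in <<X>>%VS].
      apply: aff_sub; first by exists (\dim <<X>>); exact: affine_of_vspace.
      by move=> y Sy /=; apply/negPn/negP => yX; apply: h; exists y.
    have VX : (V <= <<X>>)%VS.
      apply/subvP => v vV; have : aff S (x0 + v) by rewrite AE /= addrAC subrr add0r.
      by move=> /hs /=; rewrite addrAC subrr add0r.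
    have := dimvS VX; rewrite dV => h2.
    have := leq_trans h2 (dim_span X); rewrite size_tuple => h3.
    by have := leq_trans mk h3; rewrite ltnn.
  exists [tuple of (y - x0) :: X]; split; first by rewrite free_cons yX fX.
  move=> i; case: (unliftP ord0 i) => [j ->|->]; first by rewrite tnthS; exact: SX.
  by rewrite tnth0 addrC subrK.
exact: H.
Qed.

Lemma hyperplane_eq n (H : set 'cV[C]_n) : affine_hyperplane H ->
  exists (u : 'cV[C]_n) (c : C), u != 0 /\ forall z, H z -> ip z u = c.
Proof.
move=> [k [kn [q [W [dW HE]]]]].
have kn' : (\dim W < n)%N by rewrite dW -kn.
have [u u0 Hu] := orth_rows (fun i => tnth (vbasis W) i) kn'.
exists u, (ip q u); split => // z; rewrite HE /= => zW.
rewrite -{1}(subrK q z) ipDl -[RHS]add0r; congr (_ + _).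
have : (W <= perp u)%VS.
  rewrite -(span_basis (vbasisP W)); apply/span_subvP => x /tnthP [i ->].
  by rewrite mem_perp Hu.
by move=> /subvP /(_ _ zW); rewrite mem_perp => /eqP.
Qed.

Lemma perp_hyperplane n (q b : 'cV[C]_n) : b != 0 -> affine_hyperplane [set z | z - q \in perp b].
Proof.
by move=> b0; exists (\dim (perp b)); split; [exact: dim_perp|exact: affine_of_vspace].
Qed.

End Affine.

Lemma bigmax_attained m (P : pred 'I_m) :
  (\max_(k < m | P k) k = 0)%N \/ exists2 k, P k & (\max_(k < m | P k) k = k)%N.
Proof.
apply: (big_ind (fun v : nat => v = 0%N \/ exists2 k, P k & v = k)).
- by left.
- by move=> x y hx hy; case: (leqP x y) => _.
by move=> k Pk; right; exists k.
Qed.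

Lemma annulus_ex (K : realType) n (r : K) : (0 < n)%N -> 0 < r < 1 ->
  exists z : 'cV[Cx K]_n, annulus n r z.
Proof.
case: n => // n _ /andP[r0 r1].
have e1 : enorm (delta_mx ord0 0 : 'cV[Cx K]_n.+1) = 1.
  apply: enorm_ip => //; rewrite /ip (bigD1 ord0)//= big1 => [|j j0].
    by rewrite !mxE !eqxx /= conjC1 mulr1 addr0 expr1n rC1.
  by rewrite mxE (negbTE j0) mul0r.
exists (((1 + r) / 2)%:C *: delta_mx ord0 0).
by rewrite /annulus /= enormZ e1 mulr1 nm_real gtr0_norm; [apply/andP; split; rlra|rlra].
Qed.

Section RankGood.
Variables (K : realType) (n : nat) (r R : K).
Local Notation C := (Cx K).
Local Notation V := 'cV[C]_n.

(** A right inverse of the matrix (1 | F) is the affine map for which [Ym] is the identity. A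
    unimodular factor on [u] makes the level of the hyperplane real and nonnegative, as [good_start]
    requires. *)
Lemma good_of_affine_indep N (F : V -> 'cV[C]_N) (zs : 'I_N -> V) (u : V) (c : C) :
  inner_ext r R F -> u != 0 -> (forall i, punct (zs i)) -> (forall i, ip (zs i) u = c) ->
  row_free (row_mx (const_mx 1 : 'M[C]_(N, 1)) (Fm F zs)) ->
  exists p : V, enorm p = 1 /\ good r F p.
Proof.
move=> HF u0 zp zc /row_freeP [B YB].
have un : 0 < enorm u by rewrite enorm_gt0.
have cV (x : C) : (x^-1)^* = (x^* )^-1 by rewrite fmorphV.
have cM (x y : C) : (x * y)^* = x^* * y^* by rewrite rmorphM.
have [om [om1 omc]] : exists om : C, nm om = 1 /\ om^* * c = (nm c)%:C.
  have [->|c0] := eqVneq c 0; first by exists 1; rewrite nm1 mulr0 nm0.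
  have cn : 0 < nm c by rewrite nm_gt0.
  have cn0 : (nm c)%:C != 0 :> C by rewrite rC_eq0 gt_eqF.
  exists (c / (nm c)%:C); split.
    by rewrite nmM nmV nm_real gtr0_norm// divff// gt_eqF.
  by rewrite cM cV conj_rC mulrAC [_ * c]mulrC -nmsqr rCX expr2 mulfK.
have ui : 0 < (enorm u)^-1 by rewrite invr_gt0.
pose p : V := (om * ((enorm u)^-1)%:C) *: u.
have p1 : enorm p = 1 by rewrite enormZ nmM om1 mul1r nm_real gtr0_norm// mulVf// gt_eqF.
exists p; split => //.
apply: (good_start HF (t0 := fun j => usubmx B 0 j) (T := dsubmx B) (zs := zs) p1
   (c0 := (enorm u)^-1 * nm c)) => //.
- by rewrite mulr_ge0 ?nm_ge0// ltW.
- by move=> i; rewrite /p ipZr cM conj_rC zc mulrAC omc -rCM mulrC.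
have -> : Ym F (fun j => usubmx B 0 j) (dsubmx B) zs = 1%:M.
  rewrite -YB -[in RHS](vsubmxK B) mul_row_col; apply/matrixP => i j.
  rewrite mxE [RHS]mxE; congr (_ + _).
    by rewrite [RHS]mxE big_ord1 [const_mx _ _ _]mxE mul1r.
  by rewrite [RHS]mxE; apply: eq_bigr => k _; congr (_ * _); rewrite [RHS]mxE.
by rewrite det1 oner_neq0.
Qed.

(** The column of ones forces the coefficients of a relation to have sum 0, which makes it a
    relation between the differences [X]. *)
Lemma affine_indep_rows k (F : V -> 'cV[C]_k.+1) (zs : 'I_k.+1 -> V) (X : k.-tuple 'cV[C]_k.+1) :
  free X -> (forall i, F (zs (lift ord0 i)) = F (zs ord0) + tnth X i) ->
  row_free (row_mx (const_mx 1 : 'M[C]_(k.+1, 1)) (Fm F zs)).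
Proof.
move=> fX FX; apply: inj_row_free => v; rewrite mul_mx_row => vY.
have v1 : v *m (const_mx 1 : 'M[C]_(k.+1, 1)) = 0 by rewrite -(row_mxKl (v *m _) (v *m Fm F zs)) vY linear0.
have v2 : v *m Fm F zs = 0 by rewrite -(row_mxKr (v *m (const_mx 1 : 'M[C]_(k.+1, 1))) (v *m Fm F zs)) vY linear0.
have s0 : v 0 ord0 + \sum_(i < k) v 0 (lift ord0 i) = 0.
  have := congr1 (fun M : 'M[C]_1 => M 0 0) v1; rewrite mxE big_ord_recl !mxE mulr1 => h.
  by rewrite -[RHS]h; congr (_ + _); apply: eq_bigr => i _; rewrite mxE mulr1.
have E : \sum_(i < k) v 0 (lift ord0 i) *: X`_i = 0.
  apply/colP => j; rewrite summxE [RHS]mxE.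
  have := congr1 (fun M : 'rV[C]_k.+1 => M 0 j) v2; rewrite mxE big_ord_recl !mxE => h.
  rewrite -[RHS]h.
  have -> : v 0 ord0 = - \sum_(i < k) v 0 (lift ord0 i) by apply/eqP; rewrite -addr_eq0 s0.
  rewrite mulNr mulr_suml addrC -sumrB; apply: eq_bigr => i _.
  rewrite !mxE FX -tnth_nth mxE.
  by ring.
have vi := (freeP fX) (fun i => v 0 (lift ord0 i)) E.
apply/rowP => i; rewrite [RHS]mxE; case: (unliftP ord0 i) => [j ->|->]; first exact: vi.
by move: s0; rewrite big1 ?addr0// => j _; exact: vi.
Qed.

Lemma rank_good N (f : V -> 'cV[C]_N) : (2 <= n)%N -> (1 <= N)%N -> 0 < r < 1 -> 0 < R < 1 ->
  holomorphic_on (annulus n r) f -> proper_map (annulus n r) (annulus N R) f ->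
  hyperplane_rank (annulus n r) f = (N - 1)%N ->
  exists p : V, enorm p = 1 /\ good r (Fext r f) p.
Proof.
move=> n2 N1 r01 R01 fh fp Hrk.
have HF := inner_extP n2 r01 R01 fh fp.
case: N N1 f fh fp Hrk HF => // k _ f fh fp; rewrite subn1 /= => Hrk HF.
have pz z : annulus n r z -> punct z.
  by case/andP: r01 => r0 _ /andP[z1 z2]; apply/andP; split => //; exact: lt_trans z1.
have [u [c [zs [X [u0 za zc fX FX]]]]] : exists (u : V) (c : C) (zs : 'I_k.+1 -> V)
    (X : k.-tuple 'cV[C]_k.+1), [/\ u != 0, forall i, annulus n r (zs i),
    forall i, ip (zs i) u = c, free X & forall i, f (zs (lift ord0 i)) = f (zs ord0) + tnth X i].
  have n0 : (0 < n)%N by apply: leq_trans n2.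
  have [z0 az0] := annulus_ex n0 r01.
  (* For N = 1 the rank 0 could also be a maximum over an empty family; there a single point of the
     annulus suffices. *)
  have [k0|k0] := posnP k.
    exists z0, (ip z0 z0), (fun=> z0); move: k0 f fh fp Hrk HF => -> f fh fp Hrk HF.
    exists [tuple]; split => //; last by case.
      by rewrite -enorm_gt0; case/andP: (pz _ az0).
    by rewrite nil_free.
  have [E|[k' Pk E]] := bigmax_attained (fun k : 'I_k.+2 => `[< exists H, affine_hyperplane H /\
                          affine_of_dim k (aff (f @` (H `&` annulus n r))) >]).
    exfalso; move/lt0n_neq0: k0 => /eqP; apply; rewrite -[LHS]Hrk.
    exact: E.
  have kk : k' = k :> nat by rewrite -[RHS]Hrk; exact: esym E.
  move/asboolP: Pk; rewrite kk => -[H [hH hA]].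
  have [_ [z1 [Hz1 az1] _]] := aff_nonempty (ltn0Sn k) hA.
  have Sz1 : (f @` (H `&` annulus n r)) (f z1) by exists z1.
  have [X [fX SX]] := aff_free hA Sz1.
  have [xs Hxs] := choice (fun i => let: ex_intro2 z Hz Ez := SX i in ex_intro (fun z => (H z /\ annulus n r z) /\ f z = f z1 + tnth X i) z (conj Hz Ez)).
  have [u [c [u0 Hu]]] := hyperplane_eq hH.
  exists u, c, (fun i => if unlift ord0 i is Some j then xs j else z1), X; split => //.
  - by move=> i; case: (unlift ord0 i) => // j; case: (Hxs j) => -[].
  - by move=> i; apply: Hu; case: (unlift ord0 i) => // j; case: (Hxs j) => -[].
  by move=> i; rewrite liftK unlift_none; case: (Hxs i).
apply: (@good_of_affine_indep k.+1 (Fext r f) zs u c HF) => //.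
  by move=> i; exact: pz.
apply: (affine_indep_rows fX) => i.
have Fa z : annulus n r z -> Fext r f z = f z by exact (Fext_annulus n2 r01 fh fp (z := z)).
by rewrite (Fa _ (za _)) (Fa _ (za _)); exact: FX.
Qed.

End RankGood.

Local Open Scope sesquilinear_scope.

(** * The hyperplane rank of the homogeneous map *)

Section Converse.
Variables (K : realType) (n N : nat) (r : K).
Local Notation C := (Cx K).
Local Notation V := 'cV[C]_n.
Hypotheses (n2 : (2 <= n)%N) (N1 : (1 <= N)%N) (r01 : 0 < r < 1).
Variables (d : nat) (f g : V -> 'cV[C]_N).
(* [g] is the map [U H_d], of which [f] is the restriction to the annulus. *)
Hypothesis fg : forall z, annulus n r z -> f z = g z.
Hypothesis g_ip : forall z w, ip (g z) (g w) = ip z w ^+ d.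
Hypothesis g_span : forall s (dl : K) y, 0 < dl -> (forall j, 0 < s j) ->
  (forall h : 'I_n -> 'I_d.+1, ip (g (grid s dl h)) y = 0) -> y = 0.
Hypothesis gZ : forall c z, g (c *: z) = c ^+ d *: g z.

Lemma g_neq0 u : u != 0 -> g u != 0.
Proof.
move=> u0; apply: contraNneq u0 => gu0; have := g_ip u u; rewrite gu0 ip0l => /esym/eqP.
by rewrite expf_eq0 -enorm_sqr rC_eq0 expf_eq0 enorm_eq0 => /andP[].
Qed.

Lemma rank_le H k : affine_hyperplane H -> affine_of_dim k (aff (f @` (H `&` annulus n r))) ->
  (k <= N - 1)%N.
Proof.
move=> hH hA; have [u [c [u0 Hu]]] := hyperplane_eq hH.
have [x0 Sx0] := aff_nonempty N1 hA.
have [W [dW AE]] := affine_rebase hA (sub_aff Sx0).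
have gip y : (f @` (H `&` annulus n r)) y -> ip y (g u) = c ^+ d.
  by move=> [z [Hz az] <-]; rewrite fg// g_ip Hu.
have sub : aff (f @` (H `&` annulus n r)) `<=` [set z | z - x0 \in perp (g u)].
  apply: aff_sub; first by exists (\dim (perp (g u))); exact: affine_of_vspace.
  by move=> y Sy; rewrite /= mem_perp ipBl !gip ?subrr.
have WP : (W <= perp (g u))%VS.
  apply/subvP => v vW; have : aff (f @` (H `&` annulus n r)) (x0 + v).
    by rewrite AE /= addrAC subrr add0r.
  by move=> /sub /=; rewrite addrAC subrr add0r.
have := dimvS WP; rewrite dW => kW; have := dim_perp (g_neq0 u0) => E.
by apply: (leq_trans kW); rewrite -[in X in (_ <= X)%N]E subn1.
Qed.

Lemma rank_ge : exists H, affine_hyperplane H /\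
  affine_of_dim (N - 1)%N (aff (f @` (H `&` annulus n r))).
Proof.
case/andP: r01 => r0 r1; have n0 : (0 < n)%N by apply: leq_trans n2.
pose j0 := Ordinal n0; pose e : V := delta_mx j0 0.
have ipe z : ip z e = z j0 0.
  rewrite /ip (bigD1 j0)//= big1 => [|j jj]; first by rewrite mxE !eqxx conjC1 mulr1 addr0.
  by rewrite mxE (negbTE jj) conjC0 mulr0.
have e1 : enorm e = 1 by apply: enorm_ip => //; rewrite ipe mxE !eqxx expr1n rC1.
have en : e != 0 by rewrite -enorm_gt0 e1.
have [c cE] : exists c : K, c = (1 + r) / 2 by eexists.
have [c0 c1 cr] : [/\ 0 < c, c < 1 & r < c] by rewrite cE; split; rlra.
pose H : set V := [set z | z - c%:C *: e \in perp e].
have HE z : H z -> ip z e = c%:C.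
  rewrite /H /= mem_perp ipBl ipZl -(enorm_sqr e) e1 expr1n rC1 mulr1 subr_eq0.
  by move=> /eqP.
have HI z : ip z e = c%:C -> H z.
  by move=> zE; rewrite /H /= mem_perp ipBl ipZl -(enorm_sqr e) e1 expr1n rC1 mulr1 zE subrr.
exists H; split; first exact: perp_hyperplane.
pose S := f @` (H `&` annulus n r); pose b := g e.
have b0 : b != 0 by exact: g_neq0.
have ce : annulus n r (c%:C *: e).
  by rewrite /annulus /= enormZ e1 mulr1 nm_real gtr0_norm// cr.
have Sx0 : S (f (c%:C *: e)).
  exists (c%:C *: e) => //; split => //; apply: HI.
  by rewrite ipZl -(enorm_sqr e) e1 expr1n rC1 mulr1.
set x0 := f (c%:C *: e) in Sx0.
have Sb y : S y -> ip y b = c%:C ^+ d.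
  by move=> [z [Hz az] <-]; rewrite fg// g_ip HE.
have dP : \dim (perp b) = (N - 1)%N by rewrite -[in RHS](dim_perp b0) subn1.
(* Since x0 = c^d b, such a [v] is orthogonal to [S] itself; by homogeneity it is orthogonal to the
   values of [g] on a whole grid, which span. *)
have key v : (forall y, S y -> ip (y - x0) v = 0) -> ip b v = 0 -> v = 0.
  move=> Hv bv.
  have x0v : ip x0 v = 0 by rewrite /x0 fg// gZ ipZl bv mulr0.
  have Sv y : S y -> ip y v = 0 by move=> /Hv; rewrite ipBl x0v subr0.
  have d1 : 0 < (1 + d)%:R :> K by rewrite ltr0n.
  have nR : 0 < n%:R :> K by rewrite ltr0n.
  (* The coordinates other than the first are scaled down to a total of at most (1 - c) / 2, so that
     the grid points, rescaled to first coordinate [c], stay in the ball. *)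
  have [eps epsE] : exists eps : K, eps = (1 - c) / 2 / (n%:R * (1 + d)%:R) by eexists.
  have eps0 : 0 < eps by rewrite epsE !divr_gt0 ?mulr_gt0// subr_gt0.
  have epsn : n%:R * (eps * (1 + d)%:R) = (1 - c) / 2.
    rewrite epsE; move: (n%:R : K) ((1 + d)%:R : K) nR d1 => x y xp yp.
    by field; rewrite !gt_eqF.
  pose s j := if j == j0 then 1 else eps.
  apply: (g_span (s := s) (dl := 1) ltr01) => [j|h].
    by rewrite /s; case: eqP.
  have [z zE] : exists z : V, z = grid s 1 h by eexists.
  have [a aE] : exists a : K, a = 1 + (h j0)%:R by eexists.
  have a1 : 1 <= a by rewrite aE lerDl.
  have a0 : 0 < a by apply: lt_le_trans a1.
  have za : z j0 0 = a%:C by rewrite zE mxE /s eqxx !mul1r aE.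
  have zn : enorm z <= a + (1 - c) / 2.
    apply: le_trans (enorm_le_sum _) _; rewrite (bigD1 j0)//= za nm_real gtr0_norm//.
    rewrite lerD2l -epsn mulr_natl.
    apply: (@le_trans _ _ (\sum_(j < n) eps * (1 + d)%:R)); last by rewrite sumr_const card_ord.
    rewrite [leRHS](bigD1 j0)//=.
    have p0 : 0 <= eps * (1 + d)%:R by rewrite mulr_ge0// ltW.
    apply: (@le_trans _ _ (\sum_(j < n | j != j0) eps * (1 + d)%:R)); last by rewrite lerDr.
    apply: ler_sum => j jj; rewrite zE mxE /s (negbTE jj) mul1r nm_real.
    rewrite ger0_norm; last by rewrite mulr_ge0 ?addr_ge0// ltW.
    by rewrite ler_pM2l// ?mul1r nat1r ler_nat add1n.
  have ac : 0 < c / a by rewrite divr_gt0.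
  have az : annulus n r ((c / a)%:C *: z).
    apply/andP; split.
      have := nm_coord ((c / a)%:C *: z) j0; rewrite mxE za -rCM divfK ?gt_eqF// nm_real gtr0_norm//.
      exact: lt_le_trans.
    rewrite enormZ nm_real gtr0_norm// mulrAC ltr_pdivrMr// mul1r.
    have : c * enorm z <= c * (a + (1 - c) / 2) by rewrite ler_pM2l.
    have h1 : 0 < 1 - c by rewrite subr_gt0.
    have : c * (1 - c) < 1 * (1 - c) by rewrite ltr_pM2r.
    have : 1 * (1 - c) <= a * (1 - c) by rewrite ler_pM2r.
    rlra.
  have Sz : S (g ((c / a)%:C *: z)).
    exists ((c / a)%:C *: z); last exact: fg.
    by split => //; apply: HI; rewrite ipe mxE za -rCM divfK// gt_eqF.
  have := Sv _ Sz; rewrite gZ ipZl => /eqP.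
  rewrite mulf_eq0 expf_eq0 rC_eq0 (gt_eqF ac) andbF /= => /eqP.
  by rewrite zE.
have AE : aff S = [set y | y - x0 \in perp b].
  apply/seteqP; split.
    apply: aff_sub; first by exists (\dim (perp b)); exact: affine_of_vspace.
    by move=> y Sy; rewrite /= mem_perp ipBl !Sb ?subrr.
  move=> y /= yb M [[k hM] SM].
  have [W [dW ME]] := affine_rebase hM (SM _ Sx0).
  (* If the direction [W] of an affine subspace containing [S] met [perp b] in a smaller space, a
     nonzero [v] would be orthogonal to [b] and to this intersection, against [key]. *)
  have dimW : (\dim (perp b) <= \dim (perp b :&: W))%N.
    rewrite leqNgt; apply/negP => lt1; rewrite dP in lt1.
    pose X := vbasis (perp b :&: W); pose m := \dim (perp b :&: W).
    have mN : (m.+1 < N)%N by move: lt1; rewrite ltn_subRL add1n.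
    have [v v0 Hv] := orth_rows (fun i : 'I_m.+1 => if unlift ord0 i is Some j then tnth X j else b) mN.
    have bv : ip b v = 0 by have := Hv ord0; rewrite unlift_none.
    have Xv : (perp b :&: W <= perp v)%VS.
      rewrite -(span_basis (vbasisP (perp b :&: W))); apply/span_subvP => x /tnthP [i ->].
      by rewrite mem_perp; have := Hv (lift ord0 i); rewrite liftK => ->.
    move/negP: v0; apply; apply/eqP; apply: key => // x Sx.
    have : x - x0 \in (perp b :&: W)%VS.
      rewrite memv_cap mem_perp ipBl !Sb// subrr eqxx /=.
      by have := SM _ Sx; rewrite ME.
    by move=> /(subvP Xv); rewrite mem_perp => /eqP.
  have /eqP EW : (perp b :&: W == perp b)%VS by rewrite eqEdim capvSl.
  have : y - x0 \in (perp b :&: W)%VS by rewrite EW.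
  by rewrite memv_cap ME /= => /andP[].
by rewrite AE -dP; exact: affine_of_vspace.
Qed.

Lemma converse_rank : hyperplane_rank (annulus n r) f = (N - 1)%N.
Proof.
apply/eqP; rewrite eqn_leq; apply/andP; split.
  by apply/bigmax_leqP => k /asboolP [H [hH hA]]; exact: rank_le hH hA.
have [H [hH hA]] := rank_ge.
have kN : (N - 1 < N.+1)%N by rewrite ltnS leq_subr.
have := @leq_bigmax_cond _ (fun k : 'I_N.+1 => `[< exists H, affine_hyperplane H /\
                          affine_of_dim k (aff (f @` (H `&` annulus n r))) >])
   (fun k => k : nat) (Ordinal kN); apply.
by apply/asboolP; exists H.
Qed.

End Converse.

Lemma unitary_Hmap_ip (K : realType) n N d (eN : 'C(n + d - 1, d) = N) (U : 'M[Cx K]_N) :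
  U \is unitarymx ->
  let g z := U *m castmx (eN, erefl 1%N) (Hmap d z : 'cV[Cx K]_('C(n + d - 1, d))) in
  [/\ forall z w : 'cV[Cx K]_n, ip (g z) (g w) = ip z w ^+ d,
      forall s (dl : K) y, 0 < dl -> (forall j, 0 < s j) ->
        (forall h : 'I_n -> 'I_d.+1, ip (g (grid s dl h)) y = 0) -> y = 0 &
      forall c (z : 'cV[Cx K]_n), g (c *: z) = c ^+ d *: g z].
Proof.
case: N / eN U => U /unitarymxP UU g; have {}gE z : g z = U *m Hmap d z by rewrite /g castmx_id.
have UU' := mulmx1C UU; split => [z w|s dl y dl0 s0 H|c z].
- by rewrite !gE ip_adj mulmxA UU' mul1mx ip_Hmap.
- have H2 : forall i, ((U^t* *m y) i 0)^* = 0.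
    apply: (grid_span dl0 s0) => h; have := H h; rewrite gE ip_adj => E.
    by rewrite -[RHS]E; apply: eq_bigr => i _; rewrite mulrC.
  have E : U^t* *m y = 0.
    by apply/colP => i; have /eqP := H2 i; rewrite conjC_eq0 => /eqP ->; rewrite mxE.
  by rewrite -[y]mul1mx -UU -mulmxA E mulmx0.
by rewrite !gE HmapZ scalemxAr.
Qed.

Theorem theorem1p2 (K : realType) (n N : nat) (r R : K)
    (f : 'cV[Cx K]_n -> 'cV[Cx K]_N)
    (hn : (2 <= n)%N) (hN : (1 <= N)%N)
    (hr : 0 < r < 1) (hR : 0 < R < 1)
    (f_holo : holomorphic_on (annulus n r) f)
    (f_proper : proper_map (annulus n r) (annulus N R) f) :
  hyperplane_rank (annulus n r) f = (N - 1)%N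
  <->
  exists (d : nat) (eN : 'C(n + d - 1, d) = N) (U : 'M[Cx K]_N),
    [/\ (1 <= d)%N, U \is unitarymx, R = r ^+ d
      & forall z, annulus n r z ->
          f z = U *m castmx (eN, erefl 1%N) (Hmap d z)].
Proof.
split=> [Hrk|[d [eN [U [d1 UU Rd fE]]]]]; last first.
  have [h1 h2 h3] := unitary_Hmap_ip eN UU.
  exact: (converse_rank hn hN hr fE h1 h2 h3).
have [p [p1 gp]] := rank_good hn hN hr hR f_holo f_proper Hrk.
have HF := inner_extP hn hr hR f_holo f_proper.
have [d [eN [U [d1 UU Rd HU]]]] := forward HF p1 gp.
exists d, eN, U; split => // z az.
rewrite -(Fext_annulus hn hr f_holo f_proper az); apply: HU.
case/andP: hr az => r0 _ /andP[z1 z2]; apply/andP; split => //.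
exact: lt_trans z1.
Qed.
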